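(* Let $p>1$, let $J:L^{2p}(\Omega,m)\to L^2(\Omega,m)$ satisfy $J(0)=0$ and $$\|J(u)-J(v)\|_{L^2(\Omega,m)}\le l(r)\|u-v\|_{L^{2p}(\Omega,m)}\quad\text{whenever }\|u\|_{L^{2p}(\Omega,m)}\le r,\ \|v\|_{L^{2p}(\Omega,m)}\le r,$$ where $l(r)$ denotes the Lipschitz constant of $J$ on the ball of radius $r$. Let $\lambda=\frac{2d}{d-N+2s}$, $a:=\frac\lambda4\big(1-\frac1p\big)$, and suppose there exists $0<\varrho<a$ such that $l(r)=\mathcal O\big(r^{\frac{1-a}\varrho}\big)$ as $r\to+\infty$. Let $\kappa>0$ be sufficiently small, $\phi\in L^2(\Omega,m)$ and $$\limsup_{t\to0^+}\|t^\varrho U(t,0)\phi\|_{L^{2p}(\Omega,m)}<\kappa.$$ Then there exist $\overline T>0$ and a unique mild solution $$u\in C([0,\overline T],L^2(\Omega,m))\cap C((0,\overline T],L^{2p}(\Omega,m)),$$ with $u(0)=\phi$ and $\|t^\varrho u(t)\|_{L^{2p}(\Omega,m)}<2\kappa$, satisfying, for every $t\in[0,\overline T]$, $$u(t)=U(t,0)\phi+\int_0^tU(t,\tau)J(u(\tau))\,d\tau,$$ with the integral being both an $L^2$-valued and an $L^{2p}$-valued Bochner integral.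
   Context: Setting. $\Omega\subset\mathbb R^N$ is a bounded $(\varepsilon,\delta)$ domain, i.e. $\Omega$ is open and connected and, with $d(x)=\inf_{y\notin\Omega}|x-y|$, whenever $x,y\in\Omega$ and $|x-y|<\delta$ there is a rectifiable arc $\gamma\subset\Omega$ joining $x$ to $y$ with length $\ell(\gamma)\le\frac1\varepsilon|x-y|$ and $d(z)\ge\frac{\varepsilon|x-z||y-z|}{|x-y|}$ for all $z\in\gamma$. The boundary $\partial\Omega$ is a $d$-set, $0<d\le N$: there are a Borel measure $\mu$ with $\operatorname{supp}\mu=\partial\Omega$ and constants $c_1,c_2>0$ with $c_1r^d\le\mu(B(x,r)\cap\partial\Omega)\le c_2r^d$ for every $x\in\partial\Omega$ and $0<r\le1$. Moreover $\Omega=\bigcup_n\Omega_n$ with $\Omega_n$ bounded Lipschitz domains and $\Omega_n\subseteq\Omega_{n+1}$. The number $s\in(0,1)$ satisfies $N-d<2s<N$, $\alpha:=s-\frac{N-d}2\in(0,1)$, and $T>0$ is fixed. $\mathfrak L(X)$ denotes the bounded linear operators on $X$. (One has $0<a<1$ when $N-2s\le\frac d2$ and $p>1$.) ''$\kappa$ sufficiently small'' means smaller than a threshold independent of $\phi$; $\overline T\le T$. $H^s(\Omega)$ has norm $\|u\|_{H^s(\Omega)}^2=\|u\|_{L^2(\Omega)}^2+\iint_{\Omega\times\Omega}\frac{(u(x)-u(y))^2}{|x-y|^{N+2s}}\,d\mathcal L_N(x)\,d\mathcal L_N(y)$ ($\mathcal L_N$ Lebesgue measure). The trace is $u|_{\partial\Omega}(x)=\lim_{r\to0}\frac1{|B(x,r)\cap\Omega|}\int_{B(x,r)\cap\Omega}u\,d\mathcal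 L_N$ ($\mu$-a.e.); it maps $H^s(\Omega)$ boundedly onto the Besov space $B^{2,2}_\alpha(\partial\Omega)$, whose norm is $\|u\|^2=\|u\|_{L^2(\partial\Omega,\mu)}^2+\iint_{|x-y|<1}\frac{|u(x)-u(y)|^2}{|x-y|^{d+2\alpha}}\,d\mu(x)\,d\mu(y)$. $m=\mathcal L_N+\mu$ (Lebesgue measure on $\Omega$ plus $\mu$ on $\partial\Omega$), $\|u\|_{L^q(\Omega,m)}^q=\|u\|_{L^q(\Omega)}^q+\|u|_{\partial\Omega}\|_{L^q(\partial\Omega)}^q$ for $q<\infty$; $H^s(\Omega)\subset L^2(\Omega,m)$ through traces. Data. $K:[0,T]\times\Omega\times\Omega\to\mathbb R$ and $\zeta:[0,T]\times\partial\Omega\times\partial\Omega\to\mathbb R$ are measurable, symmetric in the last two variables, with $k_1\le K\le k_2$ and $\zeta_1\le\zeta\le\zeta_2$ a.e. for constants $0<k_1<k_2$, $0<\zeta_1<\zeta_2$; $b\in L^\infty([0,T]\times\partial\Omega)$ with $\inf b>b_0>0$; and for a fixed exponent $\eta\in(\frac12,1)$ and constants $c,C$: $|b(t,P)-b(\tau,P)|\le c|t-\tau|^\eta$, $|K(t,x,y)-K(\tau,x,y)|\le C|t-\tau|^\eta$, $|\zeta(t,x,y)-\zeta(\tau,x,y)|\le C|t-\tau|^\eta$ for $t,\tau\in[0,T]$ and (almost) all points. $C_{N,s}=\frac{s2^{2s}\Gamma(\frac{N+2s}2)}{\pi^{N/2}\Gamma(1-s)}$. For $u,v\in H^s(\Omega)$,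 $$E(t,u,v)=\frac{C_{N,s}}2\iint_{\Omega\times\Omega}K(t,x,y)\frac{(u(x)-u(y))(v(x)-v(y))}{|x-y|^{N+2s}}\,d\mathcal L_N(x)\,d\mathcal L_N(y)+\int_{\partial\Omega}b(t,P)\,u|_{\partial\Omega}v|_{\partial\Omega}\,d\mu+\langle\Theta^t_\alpha(u|_{\partial\Omega}),v|_{\partial\Omega}\rangle,$$ where $\langle\Theta^t_\alpha(u),v\rangle=\iint_{\partial\Omega\times\partial\Omega}\zeta(t,x,y)\frac{(u(x)-u(y))(v(x)-v(y))}{|x-y|^{d+2\alpha}}\,d\mu(x)\,d\mu(y)$. This is a closed symmetric form on $L^2(\Omega,m)$, and $A(t)$ is the unique selfadjoint non-positive operator on $L^2(\Omega,m)$ with dense domain $D(A(t))\subset H^s(\Omega)$ such that $E(t,u,v)=(-A(t)u,v)_{L^2(\Omega,m)}$ for $u\in D(A(t))$, $v\in H^s(\Omega)$. Evolution family. $U(t,\tau)\in\mathfrak L(L^2(\Omega,m))$, $0\le\tau\le t\le T$, is the unique family with $U(\tau,\tau)=\mathrm{Id}$; $U(t,\tau)U(\tau,\sigma)=U(t,\sigma)$ for $\sigma\le\tau\le t$; $\|U(t,\tau)\|\le1$ and strong continuity; $t\mapsto U(t,\tau)$ differentiable on $(\tau,T]$ in $\mathfrak L(L^2(\Omega,m))$ with $\partial_tU(t,\tau)=A(t)U(t,\tau)$; $A(t)U(t,\tau)$ continuous in $\mathfrak L(L^2(\Omega,m))$ for $\tau<t$ with $\|A(t)U(t,\tau)\|\le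 C/(t-\tau)$. The integral equation is the mild form of $\partial_tu=A(t)u+J(u)$, $u(0)=\phi$.
   Formalization: The formal theorem also assumes a<1 (automatic when N−2s ≤ d/2). For a=1 the claim fails, since the integrand need not be L^{2p}-Bochner integrable (e.g. J(u)=(∫u dm)w with suitable w in L^2); for a>1 the growth condition forces J=0. *)

(* Defs.v *)
From HB Require Import structures.
From mathcomp Require Import all_boot all_order all_algebra.
From mathcomp Require Import all_classical all_reals all_analysis.
From mathcomp Require Import measurable_realfun ess_sup_inf.
Set Implicit Arguments.
Unset Strict Implicit.
Unset Printing Implicit Defensive.
Import Order.TTheory GRing.Theory Num.Theory.
Import numFieldNormedType.Exports.
Local Open Scope classical_set_scope.
Local Open Scope ring_scope.

(* R^N with its norm topology (the sup norm of 'rV) and its Borel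
   sigma-algebra; Euclidean distances go through [edist] below. *)
Definition RN (R : realType) (N : nat) := 'rV[R]_N.
HB.instance Definition _ (R : realType) (N : nat) :=
  NormedModule.copy (RN R N) 'rV[R]_N.
HB.instance Definition _ (R : realType) (N : nat) :=
  @isMeasurable.Build (sigma_display (@open 'rV[R]_N)) (RN R N)
    <<s (@open 'rV[R]_N) >> (@sigma_algebra0 _ setT _) (@sigma_algebraC _ _)
    (@sigma_algebra_bigcup _ setT _).

Section borel_RN.
Variables (R : realType) (N : nat).

Lemma open_measurable_RN (A : set (RN R N)) : open A -> measurable A.
Proof. by move=> oA; apply: sub_sigma_algebra. Qed.

Lemma closed_measurable_RN (A : set (RN R N)) : closed A -> measurable A.
Proof.
by rewrite -openC -[A in measurable A]setCK => /open_measurable_RN/measurableC.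
Qed.

Definition row_of_tuple (t : N.-tuple (measurableTypeR R)) : RN R N :=
  \row_j tnth t j.
Definition tuple_of_row (x : RN R N) : N.-tuple (measurableTypeR R) :=
  [tuple x ord0 j | j < N].

Lemma row_of_tupleK : cancel row_of_tuple tuple_of_row.
Proof. by move=> t; apply: eq_from_tnth => j; rewrite tnth_mktuple mxE. Qed.

Lemma tuple_of_rowK : cancel tuple_of_row row_of_tuple.
Proof. by move=> x; apply/rowP => j; rewrite mxE tnth_mktuple. Qed.

Lemma measurable_tuple_of_row : measurable_fun [set: RN R N] tuple_of_row.
Proof.
apply/measurable_fun_tnthP => j.
rewrite (_ : _ \o _ = fun x : RN R N => x ord0 j); last first.
  by apply/funext => x /=; rewrite tnth_mktuple.
apply: (measurability _ (RGenOpens.measurableE R)).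
move=> _ [_ [a [b ->]] <-]; rewrite setTI.
have oB : open `]a, b[%classic by exact: interval_open.
apply: open_measurable_RN.
apply: open_comp => // x _; exact: (@coord_continuous R 1 N ord0 j x).
Qed.

Lemma measurable_row_of_tuple :
  measurable_fun [set: N.-tuple (measurableTypeR R)] row_of_tuple.
Proof.
apply: (@measurability _ _ _ (RN R N) _ _ (@open 'rV[R]_N)) => //.
move=> _ [B oB <-]; rewrite setTI.
pose rbox (qe : 'rV[rat]_N * rat) : set (RN R N) :=
  [set y | forall j, `|ratr (qe.1 ord0 j) - y ord0 j| < ratr qe.2].
have -> : row_of_tuple @^-1` B =
    \bigcup_(qe in [set qe | rbox qe `<=` B]) (row_of_tuple @^-1` rbox qe).
  apply/seteqP; split => [t Bt|t [qe qeB] /qeB //].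
  have : nbhs (row_of_tuple t : 'rV[R]_N) B by exact: open_nbhs_nbhs.
  move=> /nbhs_ballP[e /= e0 eB].
  have e20 : (0 < e / 2)%R by rewrite divr_gt0.
  have [r] := rat_in_itvoo e20; rewrite in_itv/= => /andP[r0 re].
  have cq (j : 'I_N) : exists q : rat, `|ratr q - tnth t j| < ratr r.
    have tr : tnth t j - ratr r < tnth t j + ratr r.
      by rewrite ltrBlDr -addrA ltrDl addr_gt0.
    have [q] := rat_in_itvoo tr.
    by rewrite in_itv/= => qtr; exists q; rewrite ltr_distl.
  pose q := \row_j projT1 (cid (cq j)).
  exists (q, r) => /=; last first.
    by move=> j; rewrite !mxE; case: cid.
  move=> y /= qy; apply: eB; split => // i j.
  rewrite ord1 /ball/= !mxE.
  have := qy j; rewrite mxE; case: cid => /= p ptr pyr.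
  rewrite (le_lt_trans (ler_distD (ratr p) _ _))//.
  rewrite [ltRHS]splitr ltrD// ?(lt_trans _ re)//.
  by rewrite distrC.
rewrite bigcup_mkcond; apply: countable_bigcupT_measurable => // qe.
case: ifPn => // _.
pose rb j : set (N.-tuple (measurableTypeR R)) :=
  (@tnth _ _ ^~ j) @^-1` ball (ratr (qe.1 ord0 j) : R) (ratr qe.2).
rewrite (_ : _ @^-1` _ = \bigcap_(j in [set: 'I_N]) rb j).
  apply: fin_bigcap_measurable; first exact: finite_finset.
  move=> j _; rewrite -[X in measurable X]setTI; apply: measurable_tnth => //.
  by apply: open_measurable; exact: ball_open.
by apply/seteqP; split => [t /= h j _|t h j]; have := h j; rewrite /rb/= mxE; exact.
Qed.
End borel_RN.

(* The hypotheses are arguments of [pushforward_iso] so that its measure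
   instances can be inferred from the term. *)
Section sigma_finite_pushforward.
Context d1 d2 (T1 : measurableType d1) (T2 : measurableType d2) (R : realType).
Variables (m : {measure set T1 -> \bar R}) (f : T1 -> T2) (g : T2 -> T1).
Hypothesis m_sigma_finite : sigma_finite setT m.
Hypotheses (mf : measurable_fun [set: T1] f) (mg : measurable_fun [set: T2] g).
Hypothesis (fK : cancel f g).

Definition pushforward_iso (_ : sigma_finite setT m)
  (_ : measurable_fun [set: T1] f)
  (_ : measurable_fun [set: T2] g) (_ : cancel f g) : set T2 -> \bar R :=
  pushforward m f.

Let pf := pushforward_iso m_sigma_finite mf mg fK.

Let pf0 : pf set0 = 0%E.
Proof. by rewrite /pf /pushforward_iso /pushforward preimage_set0. Qed.

Let pf_ge0 A : (0 <= pf A)%E. Proof. exact: measure_ge0. Qed.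

Let pf_sigma_additive : semi_sigma_additive pf.
Proof.
exact: (@measure_semi_sigma_additive _ _ _
  (measure_function_pushforward__canonical__measure_function_Measure m mf)).
Qed.

HB.instance Definition _ := isMeasure.Build _ _ _
  (pushforward_iso m_sigma_finite mf mg fK) pf0 pf_ge0 pf_sigma_additive.

Let pf_sigma_finite : sigma_finite setT pf.
Proof.
have [F TF mF] := m_sigma_finite.
exists (fun n => g @^-1` F n).
  by rewrite -preimage_bigcup -TF preimage_setT.
move=> n; have [mFn Fny] := mF n; split.
  by rewrite -[X in measurable X]setTI; exact: mg.
rewrite /pf /pushforward_iso /pushforward (_ : f @^-1` _ = F n)//.
by apply/seteqP; split => x /=; rewrite fK.
Qed.

HB.instance Definition _ := Measure_isSigmaFinite.Build _ _ _
  (pushforward_iso m_sigma_finite mf mg fK) pf_sigma_finite.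
End sigma_finite_pushforward.

(* Not inferred: on [m1 \x m2] the instance for subprobabilities shadows the
   sigma-finite one. *)
Lemma sigma_finite_product d1 d2 (T1 : measurableType d1)
    (T2 : measurableType d2) (R : realType)
    (m1 : {sigma_finite_measure set T1 -> \bar R})
    (m2 : {sigma_finite_measure set T2 -> \bar R}) :
  sigma_finite setT (m1 \x m2)%E.
Proof.
have /sigma_finiteP[F [TF ndF Foo]] := sigma_finiteT m1.
have /sigma_finiteP[G [TG ndG Goo]] := sigma_finiteT m2.
exists (fun n => F n `*` G n).
  rewrite -setXTT TF TG; apply/seteqP; split => [[x y] [[i _ Fx] [j _ Gy]]|].
    exists (maxn i j) => //; split.
    - by move: (x) Fx; exact/subsetPset/ndF/leq_maxl.
    - by move: (y) Gy; exact/subsetPset/ndG/leq_maxr.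
  by move=> [x y] [n _ [/= Fx Gy]]; split; exists n.
move=> k; have [? ?] := Foo k; have [? ?] := Goo k.
split; first exact: measurableX.
by rewrite product_measure1E// lte_mul_pinfty// ge0_fin_numE.
Qed.

Section lebesgue_RN.
Variable R : realType.

Definition tuple_of_pair n (x : measurableTypeR R * n.-tuple (measurableTypeR R))
  : n.+1.-tuple (measurableTypeR R) := [tuple of x.1 :: x.2].
Definition pair_of_tuple n (t : n.+1.-tuple (measurableTypeR R)) :=
  (thead t, [tuple of behead t]).

Lemma measurable_tuple_of_pair n : measurable_fun setT (@tuple_of_pair n).
Proof. exact: measurable_cons. Qed.

Lemma measurable_pair_of_tuple n : measurable_fun setT (@pair_of_tuple n).
Proof.
apply/measurable_fun_pairP.
by split; [exact: measurable_tnth|exact: measurable_behead].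
Qed.

Lemma tuple_of_pairK n : cancel (@tuple_of_pair n) (@pair_of_tuple n).
Proof.
by move=> [x t]; rewrite /pair_of_tuple/= theadE; congr pair; exact: val_inj.
Qed.

Fixpoint lebesgue_tuple (n : nat) :
    {sigma_finite_measure set (n.-tuple (measurableTypeR R)) -> \bar R} :=
  match n with
  | 0%N => dirac [tuple]
  | n'.+1 => pushforward_iso
      (sigma_finite_product (@lebesgue_measure R) (lebesgue_tuple n'))
      (@measurable_tuple_of_pair n') (@measurable_pair_of_tuple n')
      (@tuple_of_pairK n')
  end.

Definition lebesgue_RN (N : nat) :
    {sigma_finite_measure set (RN R N) -> \bar R} :=
  pushforward_iso (sigma_finiteT (lebesgue_tuple N))
    (@measurable_row_of_tuple R N) (@measurable_tuple_of_row R N)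
    (@row_of_tupleK R N).
End lebesgue_RN.

Lemma lebesgue_RN_box (R : realType) (N : nat) (a b : RN R N) :
  (forall j, a ord0 j <= b ord0 j) ->
  lebesgue_RN R N [set x | forall j, a ord0 j <= x ord0 j <= b ord0 j] =
  (\prod_(j < N) (b ord0 j - a ord0 j))%:E.
Proof.
suff H n (A B : 'I_n -> R) : (forall j, A j <= B j) ->
    lebesgue_tuple R n [set t | forall j, A j <= tnth t j <= B j] =
    (\prod_(j < n) (B j - A j))%:E.
  move=> ab; rewrite -(H N (a ord0) (b ord0))//; congr (lebesgue_tuple R N _).
  by apply/seteqP; split => t /= tab j; have := tab j; rewrite mxE.
elim: n A B => [|n IH] A B AB.
  rewrite big_ord0 /= diracE mem_set//= => -[]//.
rewrite big_ord_recl.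
pose S := [set t : n.-tuple (measurableTypeR R) |
  forall j, A (lift ord0 j) <= tnth t j <= B (lift ord0 j)].
have mS : measurable S.
  rewrite (_ : S = \bigcap_(j in [set: 'I_n])
     ((@tnth _ _ ^~ j) @^-1` `[A (lift ord0 j), B (lift ord0 j)])).
    apply: fin_bigcap_measurable => // j _.
    by rewrite -[X in measurable X]setTI; apply: measurable_tnth.
  apply/seteqP; split => [t St j _|t St j].
    by rewrite /= in_itv/=; exact: St.
  by have := St j Logic.I; rewrite /= in_itv.
have -> : lebesgue_tuple R n.+1 [set t | forall j, A j <= tnth t j <= B j] =
    (@lebesgue_measure R \x lebesgue_tuple R n)%E
      (`[A ord0, B ord0]%classic `*` S).
  congr (product_measure1 _ _ _); apply/seteqP; split => -[x t] /=.
    move=> xt; split; first by rewrite in_itv; exact: (xt ord0).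
    by move=> j; have := xt (lift ord0 j); rewrite tnthS.
  rewrite in_itv/= => -[xAB tAB] j.
  by have [k ->|->//] := unliftP ord0 j; rewrite tnthS.
rewrite product_measure1E//= IH//.
rewrite EFinM lebesgue_measure_itv/= lte_fin.
have := AB ord0; rewrite le_eqVlt => /orP[/eqP ->|->]; last by rewrite EFinB.
by rewrite ltxx subrr mul0e.
Qed.

(* The quotient of [LfunType] by a.e. equality; unlike [LspaceType] it carries
   a normed space structure. *)
Section Lq.
Context d (T : measurableType d) (R : realType).
Variables (m : {measure set T -> \bar R}) (p : \bar R) (p1 : (1 <= p)%E).
Local Notation ty := (LfunType m p1).
Local Open Scope quotient_scope.

Definition Lq_eq (f g : ty) := `[< (f : T -> R) = g %[ae m] >].

Let Lq_eq_refl : reflexive Lq_eq.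
Proof. by move=> f; apply/asboolP; exact: aeW. Qed.
Let Lq_eq_sym : symmetric Lq_eq.
Proof. by move=> f g; apply/asboolP/asboolP => /ae_eq_sym. Qed.
Let Lq_eq_trans : transitive Lq_eq.
Proof. by move=> f g h /asboolP gf /asboolP fh; apply/asboolP/(ae_eq_trans gf fh). Qed.

Canonical Lq_eq_equiv := EquivRel Lq_eq Lq_eq_refl Lq_eq_sym Lq_eq_trans.

Definition Lq : Type := {eq_quot Lq_eq}.
HB.instance Definition _ := Choice.on Lq.
HB.instance Definition _ := EqQuotient.on Lq.

Definition Lq_fun (f : Lq) : T -> R := repr f.
Coercion Lq_fun : Lq >-> Funclass.

Definition Lq_of (f : ty) : Lq := \pi f.

Lemma Lq_ofP (f g : ty) : Lq_of f = Lq_of g <-> (f : T -> R) = g %[ae m].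
Proof. by split => [/eqquotP/asboolP|fg]; last by apply/eqquotP/asboolP. Qed.

Lemma Lq_funK (f : Lq) : Lq_of (repr f) = f.
Proof. exact: reprK. Qed.

Lemma Lq_ofK (f : ty) : (Lq_of f : T -> R) = f %[ae m].
Proof. by apply/Lq_ofP; exact: Lq_funK. Qed.

Let zero := Lq_of 0.
Let opp (f : Lq) := Lq_of (- repr f).
Let add (f g : Lq) := Lq_of (repr f + repr g).
Let scale (a : R) (f : Lq) := Lq_of (a *: repr f).

Let oppE f : opp (Lq_of f) = Lq_of (- f).
Proof.
by apply/Lq_ofP; have := Lq_ofK f; apply: filterS => x /(_ I) fE _; congr (- _).
Qed.
Let addE f g : add (Lq_of f) (Lq_of g) = Lq_of (f + g).
Proof.
apply/Lq_ofP; have := Lq_ofK g; have := Lq_ofK f; apply: filterS2.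
by move=> x /(_ I) fE /(_ I) gE _; congr (_ + _).
Qed.
Let scaleE a f : scale a (Lq_of f) = Lq_of (a *: f).
Proof.
by apply/Lq_ofP; have := Lq_ofK f; apply: filterS => x /(_ I) fE _; congr (_ * _).
Qed.

Let LqW (P : Lq -> Prop) : (forall f, P (Lq_of f)) -> forall f, P f.
Proof. by move=> Pf f; rewrite -(Lq_funK f). Qed.

Let addA : associative add.
Proof. by elim/LqW => f; elim/LqW => g; elim/LqW => h; rewrite !addE addrA. Qed.
Let addC : commutative add.
Proof. by elim/LqW => f; elim/LqW => g; rewrite !addE addrC. Qed.
Let add0 : left_id zero add.
Proof. by elim/LqW => f; rewrite addE add0r. Qed.
Let addN : left_inverse zero opp add.
Proof. by elim/LqW => f; rewrite oppE addE addNr. Qed.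

HB.instance Definition _ := GRing.isZmodule.Build Lq addA addC add0 addN.

Let scaleA a b f : scale a (scale b f) = scale (a * b) f.
Proof. by elim/LqW: f => f; rewrite !scaleE scalerA. Qed.
Let scale1 : left_id 1 scale.
Proof. by elim/LqW => f; rewrite scaleE scale1r. Qed.
Let scaleDr : right_distributive scale +%R.
Proof.
move=> a; elim/LqW => f; elim/LqW => g.
by rewrite -[_ + _]/(add _ _) -[RHS]/(add _ _) addE !scaleE addE scalerDr.
Qed.
Let scaleDl f : {morph scale^~ f : a b / a + b}.
Proof.
elim/LqW: f => f a b.
by rewrite -[RHS]/(add _ _) !scaleE addE scalerDl.
Qed.

HB.instance Definition _ :=
  GRing.Zmodule_isLmodule.Build R Lq scaleA scale1 scaleDr scaleDl.

Lemma Lq_ofD f g : Lq_of (f + g) = Lq_of f + Lq_of g.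
Proof. by rewrite -addE. Qed.
Lemma Lq_ofN f : Lq_of (- f) = - Lq_of f.
Proof. by rewrite -oppE. Qed.
Lemma Lq_ofZ a f : Lq_of (a *: f) = a *: Lq_of f.
Proof. by rewrite -scaleE. Qed.

Let norm (f : Lq) : R := fine 'N[m]_p[EFin \o f]%E.

Lemma ae_eq_Lnorm (f g : {mfun T >-> R}) : (f : T -> R) = g %[ae m] ->
  'N[m]_p[EFin \o f]%E = 'N[m]_p[EFin \o g]%E.
Proof.
move=> fg; rewrite unlock /Lnorm; case: p p1 => [r r1||//].
- have mN (h : {mfun T >-> R}) : measurable_fun [set: T]
      (fun x => `|(EFin \o h) x| `^ r)%E.
    apply: (measurableT_comp (measurable_poweR _)).
    by apply: measurableT_comp => //; exact/measurable_EFinP.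
  congr poweR; apply: ae_eq_integral => //.
  by apply: filterS fg => x /= /(_ I) -> _.
- move=> _; case: ifPn => // m0; apply: eq_ess_sup.
  by apply: filterS fg => x /= /(_ I) ->.
Qed.

Let normE f : (norm (Lq_of f))%:E = 'N[m]_p[EFin \o f]%E.
Proof.
rewrite [LHS](finite_norm_fine (repr (Lq_of f))).
exact: (ae_eq_Lnorm (Lq_ofK f)).
Qed.

Let ler_normD f g : norm (f + g) <= norm f + norm g.
Proof.
elim/LqW: f => f; elim/LqW: g => g; rewrite -Lq_ofD -lee_fin EFinD !normE.
exact: eminkowski.
Qed.
Let normZ (a : R) f : norm (a *: f) = `|a| * norm f.
Proof.
elim/LqW: f => f; apply/EFin_inj; rewrite -Lq_ofZ EFinM !normE; exact: LnormZ.
Qed.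
Let norm0_eq0 f : norm f = 0 -> f = 0.
Proof.
elim/LqW: f => f f0; apply/Lq_ofP/fine_Lnormr_eq0.
by rewrite -normE f0.
Qed.

HB.instance Definition _ :=
  @Lmodule_isNormed.Build R Lq norm ler_normD normZ norm0_eq0.

Lemma Lq_normE (f : Lq) : `|f|%:E = 'N[m]_p[EFin \o f]%E.
Proof. exact: (finite_norm_fine (repr f)). Qed.

End Lq.

Lemma lee12 (R : realType) : (1 <= (2%:R : R)%:E)%E.
Proof. by rewrite lee_fin ler1n. Qed.

Lemma lee1_2p (R : realType) (p : R) : 1 < p -> (1 <= (2 * p)%:E)%E.
Proof.
move=> p1; rewrite lee_fin (le_trans (ltW p1))// ler_peMl ?ler1n//.
exact: le_trans (ltW p1).
Qed.

Section geometry.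
Variables (R : realType) (N : nat).
Implicit Types (O F : set (RN R N)) (x y : RN R N).

Definition dot x y : R := \sum_(j < N) x ord0 j * y ord0 j.
Definition edist x y : R := Num.sqrt (\sum_(j < N) (x ord0 j - y ord0 j) ^+ 2).
Definition eball x (r : R) : set (RN R N) := [set y | edist x y < r].
Definition boundary O : set (RN R N) := closure O `\` interior O.
Definition dist_compl O x : R := inf [set edist x y | y in ~` O].

Definition arc_length (gamma : R -> RN R N) : \bar R :=
  ereal_sup [set (\sum_(i < size l)
                    edist (gamma (nth 0 (0 :: l) i)) (gamma (nth 0 l i)))%:E
            | l in [set l | itv_partition 0 1 l]].

Definition eps_delta_domain (eps delta : R) O : Prop :=
  [/\ open O, connected O, O !=set0 &
   forall x y, O x -> O y -> edist x y < delta ->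
   exists gamma : R -> RN R N,
   [/\ {within `[0, 1], continuous gamma}, gamma 0 = x, gamma 1 = y,
       (arc_length gamma <= (edist x y / eps)%:E)%E &
       forall t, 0 <= t <= 1 -> O (gamma t) /\
         eps * edist x (gamma t) * edist y (gamma t) / edist x y
           <= dist_compl O (gamma t)]].

(* Near each boundary point the domain is the strict epigraph, in some unit
   direction e, of a Lipschitz function of the coordinates orthogonal to e. *)
Definition lipschitz_domain O : Prop :=
  [/\ open O, connected O, O !=set0 &
   forall x0, boundary O x0 ->
   exists r, exists e : RN R N, exists phi : RN R N -> R, exists L,
   [/\ 0 < r, dot e e = 1,
       forall x y, `|phi x - phi y| <= L * edist x y,
       forall x t, phi (x + t *: e) = phi x &
       forall x, eball x0 r x -> (O x <-> phi x < dot x e)]].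

Definition msupport (mu : set (RN R N) -> \bar R) : set (RN R N) :=
  [set x | forall V : set (RN R N), open V -> V x -> (0 < mu V)%E].

Definition d_set (mu : set (RN R N) -> \bar R) F (d : R) : Prop :=
  msupport mu = F /\
  exists c1 c2, [/\ 0 < c1, 0 < c2 &
    forall x r, F x -> 0 < r <= 1 ->
      ((c1 * r `^ d)%:E <= mu (eball x r `&` F) <= (c2 * r `^ d)%:E)%E].

Lemma closed_boundary O : closed (boundary O).
Proof.
rewrite /boundary setDE; apply: closedI; first exact: closed_closure.
by rewrite closedC; exact: open_interior.
Qed.

Lemma measurable_boundary O : measurable (boundary O).
Proof. by apply: closed_measurable_RN; exact: closed_boundary. Qed.

End geometry.

Section fractional_spaces.
Variables (R : realType) (N : nat) (O : set (RN R N)).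
Implicit Types (u v : RN R N -> R) (s d t : R).
Local Notation LN := (lebesgue_RN R N).

(* Only the values of u on O are used; points where the limit does not exist
   get a default value. *)
Definition trace u (x : RN R N) : R :=
  lim ((fine (LN (eball x r `&` O)))^-1 * \int[LN]_(y in eball x r `&` O) u y
       @[r --> 0^'+]).

Definition Hs s u : Prop :=
  [/\ measurable_fun O u,
      (\int[LN]_(x in O) (u x ^+ 2)%:E < +oo)%E &
      (\int[(LN \x LN)%E]_(z in O `*` O)
         ((u z.1 - u z.2) ^+ 2 / edist z.1 z.2 `^ (N%:R + 2 * s))%:E < +oo)%E].

(* The representative of u : H^s(O) in L^2(O, m). *)
Definition Hs_embed u (x : RN R N) : R := if x \in O then u x else trace u x.

(* A is a family of symmetric kernels indexed by [0, T], for both K (with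
   Lebesgue measure on the domain) and zeta (with mu on the boundary). *)
Definition admissible_kernel (nu : {sigma_finite_measure set (RN R N) -> \bar R})
    (D : set (RN R N)) (T k1 k2 C eta : R) (A : R -> RN R N -> RN R N -> R) :=
  [/\ measurable_fun (`[0, T] `*` D `*` D)
        (fun z : measurableTypeR R * RN R N * RN R N => A z.1.1 z.1.2 z.2),
      forall t x y, 0 <= t <= T -> D x -> D y -> A t x y = A t y x,
      {ae ((@lebesgue_measure R \x nu) \x nu)%E, forall z,
        0 <= z.1.1 <= T -> D z.1.2 -> D z.2 -> k1 <= A z.1.1 z.1.2 z.2 <= k2} &
      forall t tau, 0 <= t <= T -> 0 <= tau <= T ->
        {ae (nu \x nu)%E, forall z, D z.1 -> D z.2 ->
          `|A t z.1 z.2 - A tau z.1 z.2| <= C * `|t - tau| `^ eta}].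

(* [inf b > b0] is expressed by a constant b1 > b0 below b almost everywhere. *)
Definition admissible_coefficient
    (nu : {sigma_finite_measure set (RN R N) -> \bar R})
    (D : set (RN R N)) (T b0 c eta : R) (b : R -> RN R N -> R) :=
  [/\ measurable_fun (`[0, T] `*` D)
        (fun z : measurableTypeR R * RN R N => b z.1 z.2),
      exists M, {ae (@lebesgue_measure R \x nu)%E, forall z,
        0 <= z.1 <= T -> D z.2 -> `|b z.1 z.2| <= M},
      exists b1, b0 < b1 /\ {ae (@lebesgue_measure R \x nu)%E, forall z,
        0 <= z.1 <= T -> D z.2 -> b1 <= b z.1 z.2} &
      forall t tau, 0 <= t <= T -> 0 <= tau <= T ->
        {ae nu, forall x, D x -> `|b t x - b tau x| <= c * `|t - tau| `^ eta}].

Definition Gamma (x : R) : R :=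
  \int[@lebesgue_measure R]_(t in `]0, +oo[) (t `^ (x - 1) * expR (- t)).

Definition C_Ns s : R :=
  s * 2 `^ (2 * s) * Gamma ((N%:R + 2 * s) / 2)
  / (pi `^ (N%:R / 2) * Gamma (1 - s)).

Definition alpha s d : R := s - (N%:R - d) / 2.

Definition Theta (mu : {finite_measure set (RN R N) -> \bar R}) s d
    (zeta : R -> RN R N -> RN R N -> R) t u v : R :=
  \int[(mu \x mu)%E]_(z in boundary O `*` boundary O)
    (zeta t z.1 z.2 * ((u z.1 - u z.2) * (v z.1 - v z.2))
     / edist z.1 z.2 `^ (d + 2 * alpha s d)).

Definition energy (mu : {finite_measure set (RN R N) -> \bar R}) s d
    (K : R -> RN R N -> RN R N -> R) (b : R -> RN R N -> R)
    (zeta : R -> RN R N -> RN R N -> R) t u v : R :=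
  C_Ns s / 2 *
    \int[(LN \x LN)%E]_(z in O `*` O)
      (K t z.1 z.2 * ((u z.1 - u z.2) * (v z.1 - v z.2))
       / edist z.1 z.2 `^ (N%:R + 2 * s))
  + \int[mu]_(x in boundary O) (b t x * trace u x * trace v x)
  + Theta mu s d zeta t (trace u) (trace v).

Definition lambda s d : R := 2 * d / (d - N%:R + 2 * s).
Definition a_exp s d p : R := lambda s d / 4 * (1 - 1 / p).

(* As O is open it is disjoint from its boundary. *)
Definition m_Omega (oO : open O) (mu : {measure set (RN R N) -> \bar R}) :
    {measure set (RN R N) -> \bar R} :=
  measure_add (mrestr LN (open_measurable_RN oO))
    (mrestr mu (measurable_boundary O)).

End fractional_spaces.

Notation L2 m := (Lq m (lee12 _)).
Notation L2p m p1 := (Lq m (lee1_2p p1)).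

Section operators.
Context dsp (X : measurableType dsp) (R : realType).
Variable m : {measure set X -> \bar R}.

Definition ip (f g : L2 m) : R := \int[m]_x (f x * g x).

(* An unbounded operator is a domain together with a function, of which only
   the values on the domain matter. *)
Definition linear_operator (D : set (L2 m)) (A : L2 m -> L2 m) : Prop :=
  D 0 /\ forall (c : R) f g, D f -> D g ->
    D (c *: f + g) /\ A (c *: f + g) = c *: A f + A g.

Definition selfadjoint (D : set (L2 m)) (A : L2 m -> L2 m) : Prop :=
  [/\ linear_operator D A, dense D &
   forall g h, (D g /\ A g = h) <-> (forall f, D f -> ip (A f) g = ip f h)].

Definition nonpositive (D : set (L2 m)) (A : L2 m -> L2 m) : Prop :=
  forall f, D f -> ip (A f) f <= 0.

End operators.

Section form_generator.
Variables (R : realType) (N : nat) (O : set (RN R N)) (s : R).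
Variable m : {measure set (RN R N) -> \bar R}.

Definition Hs_represents (u : RN R N -> R) (f : L2 m) : Prop :=
  Hs O s u /\ (f : RN R N -> R) = Hs_embed O u %[ae m].

Definition form_generator (E : (RN R N -> R) -> (RN R N -> R) -> R)
    (D : set (L2 m)) (A : L2 m -> L2 m) : Prop :=
  [/\ selfadjoint D A, nonpositive D A,
      forall f, D f -> exists u, Hs_represents u f &
      forall f g u v, D f -> Hs_represents u f -> Hs_represents v g ->
        E u v = ip (- A f) g].

End form_generator.

Section evolution.
Variables (R : realType) (X : normedModType R).

(* S i --> S0 in the operator norm of bounded operators on X. *)
Definition operator_cvg (I : Type) (F : set_system I) (S : I -> X -> X)
    (S0 : X -> X) : Prop :=
  forall e : R, 0 < e -> \forall i \near F, forall f, `|S i f - S0 f| <= e * `|f|.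

Record evolution_family (T : R) (D : R -> set X) (A : R -> X -> X)
    (U : R -> R -> X -> X) : Prop := EvolutionFamily {
  evo_linear : forall t tau, 0 <= tau -> tau <= t -> t <= T ->
    forall (c : R) f g, U t tau (c *: f + g) = c *: U t tau f + U t tau g ;
  evo_id : forall tau f, 0 <= tau <= T -> U tau tau f = f ;
  evo_comp : forall t tau sigma f, 0 <= sigma -> sigma <= tau -> tau <= t ->
    t <= T -> U t tau (U tau sigma f) = U t sigma f ;
  evo_contraction : forall t tau f, 0 <= tau -> tau <= t -> t <= T ->
    `|U t tau f| <= `|f| ;
  evo_strongly_continuous : forall f,
    {within [set z : R * R | 0 <= z.2 /\ z.2 <= z.1 /\ z.1 <= T],
      continuous (fun z => U z.1 z.2 f)} ;
  evo_domain : forall t tau f, 0 <= tau -> tau < t -> t <= T -> D t (U t tau f) ;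
  evo_derivative : forall t tau, 0 <= tau -> tau < t -> t <= T ->
    operator_cvg (within [set h | t + h <= T] 0^')
      (fun h f => h^-1 *: (U (t + h) tau f - U t tau f))
      (fun f => A t (U t tau f)) ;
  evo_generator_continuous : forall t tau, 0 <= tau -> tau < t -> t <= T ->
    operator_cvg
      (within [set z : R * R | 0 <= z.2 /\ z.2 < z.1 /\ z.1 <= T]
        (nbhs ((t, tau) : R * R)))
      (fun z f => A z.1 (U z.1 z.2 f)) (fun f => A t (U t tau f)) ;
  evo_generator_bounded : exists C : R, forall t tau f,
    0 <= tau -> tau < t -> t <= T ->
    `|A t (U t tau f)| <= C / (t - tau) * `|f|
}.

End evolution.

Section bochner.
Context dsp (T : measurableType dsp) (R : realType) (V : normedModType R).
Variable nu : {measure set T -> \bar R}.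

(* The list of pairs (B, c) encodes the function \sum \1_B *: c. *)
Definition simple_fun (l : seq (set T * V)) (x : T) : V :=
  \sum_(Bc <- l) (\1_(Bc.1) x : R) *: Bc.2.

Definition simple_integral (l : seq (set T * V)) : V :=
  \sum_(Bc <- l) fine (nu Bc.1) *: Bc.2.

Definition integrable_simple (D : set T) (l : seq (set T * V)) : Prop :=
  forall i, (i < size l)%N -> let B := (nth (set0, 0) l i).1 in
    [/\ measurable B, B `<=` D & (nu B < +oo)%E].

(* f is Bochner integrable on D, with integral w. The norm of f minus a simple
   function is a.e. equal to a measurable function, so its integral is the
   usual one even though measurability of f is not required separately. *)
Definition bochner_integral (D : set T) (f : T -> V) (w : V) : Prop :=
  exists l : nat -> seq (set T * V),
  [/\ forall k, integrable_simple D (l k),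
      {ae nu, forall x, D x -> simple_fun (l k) x @[k --> \oo] --> f x},
      (\int[nu]_(x in D) `|f x - simple_fun (l k) x|%:E)%E @[k --> \oo] --> 0%E &
      simple_integral (l k) @[k --> \oo] --> w].

End bochner.

Section mild.
Context dsp (X : measurableType dsp) (R : realType).
Variable m : {measure set X -> \bar R}.
Variables (p : R) (p1 : 1 < p).

(* v is u on ]0, Tb] seen as an L^{2p}-valued function. *)
Definition mild_solution (U : R -> R -> L2 m -> L2 m) (J : L2p m p1 -> L2 m)
    (rho kappa : R) (phi : L2 m) (Tb : R) (u : R -> L2 m) : Prop :=
  [/\ {within `[0, Tb], continuous u}, u 0 = phi &
   exists v : R -> L2p m p1,
   [/\ forall t, 0 < t <= Tb -> (v t : X -> R) = u t %[ae m],
       {within `]0, Tb], continuous v},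
       forall t, 0 < t <= Tb -> `|t `^ rho *: v t| < 2 * kappa &
       forall t, 0 <= t <= Tb ->
         bochner_integral (@lebesgue_measure R) `]0, t[
           (fun tau => U t tau (J (v tau))) (u t - U t 0 phi) /\
         exists (f : R -> L2p m p1) (w : L2p m p1),
         [/\ forall tau, 0 < tau < t ->
               (f tau : X -> R) = U t tau (J (v tau)) %[ae m],
             (w : X -> R) = (u t - U t 0 phi : L2 m) %[ae m] &
             bochner_integral (@lebesgue_measure R) `]0, t[ f w]]].

End mild.

(* Main.v *)
(* Comparing u with its averages over the balls of radius 2^-j r gives, by the
   corkscrew property of Omega, the Nash inequality
     int u^2 dm <= C h^(-lambda/2) (int |u| dm)^2 + C' h E(t,u,u)
   for small h > 0.
   Testing the evolution equation with truncated powers of the solution turns it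
   into a differential inequality that doubles the exponent of integrability, and
   finitely many doublings followed by interpolation give
     |U(t,tau) f|_(L^2p) <= M (t-tau)^(-a) |f|_(L^2).
   On the balls |v(tau)| <= 2 kappa tau^-rho the growth of l makes J Lipschitz with
   constant Lam tau^(a-1), where Lam tends to 0 with kappa; since
     int_0^t (t-tau)^(-a) tau^(a-1-rho) dtau <= beta t^-rho,
   the integral operator is a contraction for the norm sup t^rho |v(t)|_(L^2p). *)
Require Import Defs.
From HB Require Import structures.
From mathcomp Require Import all_boot all_order all_algebra.
From mathcomp Require Import all_classical all_reals all_analysis.
From mathcomp Require Import measurable_realfun.
From mathcomp Require Import ring lra.
Set Implicit Arguments.
Unset Strict Implicit.
Unset Printing Implicit Defensive.
Import Order.TTheory GRing.Theory Num.Theory.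
Import numFieldNormedType.Exports.
Local Open Scope classical_set_scope.
Local Open Scope ring_scope.
(* makes [edist] denote the Euclidean distance again, not the library's *)
Import Defs.

(** The trace is a pointwise limit of averages, and testing with truncated powers needs it to
    commute with a nonlinear map. Convergence of averages does not give that; the comparison of
    scales is therefore carried far enough to make the mean-square oscillation tend to 0, which
    Lipschitz maps preserve. The dyadic weights grow like 2^(alpha j): enough to control all smaller
    scales, yet summable against boundary energies that decay like 2^(-2 alpha j). The Nash
    inequality takes radius h^(1/(2s)) inside and h^(1/(2 alpha)) on the boundary, so that both
    energy terms have size h; as (N-d)(N-2s) >= 0, the boundary has the worse power, whence lambda.
    An orbit is a priori only in L^2, so powers are truncated at a level [n], with constants
    independent of [n]. As the target exponent 2p is finite, the constants may grow with the number
    of doublings. The threshold for [kappa] does not see [phi], which influences only the length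
    [Tb] of the time interval. *)

Section euclidean_distance.
Variables (R : realType) (N : nat).
Implicit Types x y z : RN R N.

Lemma edist_ge0 x y : 0 <= edist x y.
Proof. exact: sqrtr_ge0. Qed.

Lemma edistC x y : edist x y = edist y x.
Proof. by rewrite /edist; congr Num.sqrt; apply: eq_bigr => j _; rewrite -sqrrN opprB. Qed.

Lemma edistxx x : edist x x = 0.
Proof. by rewrite /edist big1 ?sqrtr0// => j _; rewrite subrr expr0n. Qed.

(** The sum of the squares (A b_j - P a_j)^2 equals A (A B - P^2). Dividing by A needs A > 0; when A
    = 0 all a_j vanish and both sides are 0. *)
Lemma cauchy_schwarz_sum (a b : 'I_N -> R) :
  (\sum_j a j * b j) ^+ 2 <= (\sum_j a j ^+ 2) * (\sum_j b j ^+ 2).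
Proof.
set A := \sum_j a j ^+ 2; set B := \sum_j b j ^+ 2; set P := \sum_j a j * b j.
have A0 : 0 <= A by apply: sumr_ge0 => j _; exact: sqr_ge0.
have : 0 <= \sum_j (A * b j - P * a j) ^+ 2 by apply: sumr_ge0 => j _; exact: sqr_ge0.
have -> : \sum_j (A * b j - P * a j) ^+ 2 = A * (A * B - P ^+ 2).
  under eq_bigr => j _.
    rewrite (_ : _ ^+ 2 = A ^+ 2 * b j ^+ 2 - 2 * A * P * (a j * b j) + P ^+ 2 * a j ^+ 2);
      last by ring.
    over.
  rewrite big_split sumrB/= -!mulr_sumr -/A -/B -/P; ring.
have [A1|A1] := ltP 0 A; first by rewrite pmulr_rge0// subr_ge0.
have A00 : A = 0 by apply/eqP; rewrite eq_le A1 A0.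
have a0 j : a j = 0.
  have /psumr_eq0P := A00 => /(_ (fun j _ => sqr_ge0 _)) /(_ j isT) /eqP.
  by rewrite sqrf_eq0 => /eqP.
by move=> _; rewrite /P A00 mul0r big1 ?expr0n// => j _; rewrite a0 mul0r.
Qed.

Lemma edist_triangle y x z : edist x z <= edist x y + edist y z.
Proof.
rewrite /edist -[leRHS]ger0_norm ?addr_ge0// -sqrtr_sqr ler_sqrt ?sqr_ge0//.
have s0 u v : 0 <= \sum_(j < N) (u ord0 j - v ord0 j) ^+ 2 :> R.
  by apply: sumr_ge0 => j _; exact: sqr_ge0.
rewrite sqrrD !sqr_sqrtr//.
under eq_bigr => j _.
  rewrite (_ : _ ^+ 2 = (x ord0 j - y ord0 j) ^+ 2 +
    2 * ((x ord0 j - y ord0 j) * (y ord0 j - z ord0 j)) +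
    (y ord0 j - z ord0 j) ^+ 2); last by ring.
  over.
rewrite !big_split/= -mulr_sumr lerD2r lerD2l -[leRHS]mulr_natl.
rewrite ler_pM2l// -sqrtrM// (le_trans (ler_norm _))// -sqrtr_sqr ler_wsqrtr//.
exact: cauchy_schwarz_sum.
Qed.

Lemma le_coord_edist x y j : `|x ord0 j - y ord0 j| <= edist x y.
Proof.
rewrite -sqrtr_sqr ler_wsqrtr// (bigD1 j)//= lerDl.
by apply: sumr_ge0 => i _; exact: sqr_ge0.
Qed.

Lemma edist_le_sum x y : edist x y <= \sum_j `|x ord0 j - y ord0 j|.
Proof.
rewrite -[leRHS]ger0_norm ?sumr_ge0// -sqrtr_sqr ler_wsqrtr//.
suff H (I : Type) (s : seq I) (a : I -> R) :
    \sum_(j <- s) a j ^+ 2 <= (\sum_(j <- s) `|a j|) ^+ 2.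
  exact: H.
elim: s => [|i s IH]; first by rewrite !big_nil expr0n.
rewrite !big_cons sqrrD -real_normK ?num_real// -addrA lerD2l (le_trans IH)// lerDr.
by rewrite mulrn_wge0// mulr_ge0// sumr_ge0.
Qed.

Lemma edist_gt0 x y : x != y -> 0 < edist x y.
Proof.
move=> xy; rewrite lt_neqAle edist_ge0 andbT eq_sym.
apply: contra xy => /eqP xy0; apply/eqP/rowP => j.
apply/eqP; rewrite -subr_eq0 -normr_eq0 eq_le normr_ge0 andbT.
by rewrite -xy0; exact: le_coord_edist.
Qed.

Lemma edist_continuous x : continuous (edist x : 'rV[R]_N -> R).
Proof.
move=> y; apply: (@continuous_comp _ _ _ _ Num.sqrt); last exact: sqrt_continuous.
have H (s : seq 'I_N) :
    {for y, continuous (fun z : 'rV[R]_N => \sum_(j <- s) (x ord0 j - z ord0 j) ^+ 2)}.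
  elim: s => [|j s IH].
    have -> : (fun z : 'rV[R]_N => \sum_(j <- [::]) (x ord0 j - z ord0 j) ^+ 2) = cst 0.
      by apply/funext => z; rewrite big_nil.
    exact: (@cst_continuous _ _ 0 y).
  have -> : (fun z : 'rV[R]_N => \sum_(i <- j :: s) (x ord0 i - z ord0 i) ^+ 2) =
      (fun z : 'rV[R]_N =>
      (x ord0 j - z ord0 j) * (x ord0 j - z ord0 j) + \sum_(j <- s) (x ord0 j - z ord0 j) ^+ 2).
    by apply/funext => z; rewrite big_cons expr2.
  have cj : {for y, continuous (fun z : 'rV[R]_N => x ord0 j - z ord0 j)}.
    by apply: continuousB; [exact: cst_continuous|exact: coord_continuous].
  by apply: continuousD; [exact: continuousM|exact: IH].
exact: H.
Qed.

Lemma open_eball x r : open (eball x r : set 'rV[R]_N).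
Proof.
apply: (@open_comp _ _ (edist x : 'rV[R]_N -> R) [set t | t < r]).
  by move=> y _; exact: edist_continuous.
exact: open_lt.
Qed.

Lemma measurable_eball x r : measurable (eball x r).
Proof. by apply: open_measurable_RN; exact: open_eball. Qed.

Lemma measurable_coord (j : 'I_N) : measurable_fun setT (fun x : RN R N => x ord0 j).
Proof.
rewrite (_ : (fun _ => _) = (@tnth _ _ ^~ j) \o @tuple_of_row R N).
  by apply: measurableT_comp; [exact: measurable_tnth|exact: measurable_tuple_of_row].
by apply/funext => x /=; rewrite tnth_mktuple.
Qed.

Lemma measurable_edist :
  measurable_fun setT (fun z : RN R N * RN R N => edist z.1 z.2).
Proof.
rewrite /edist.
have -> : (fun z : RN R N * RN R N => Num.sqrt (\sum_j (z.1 ord0 j - z.2 ord0 j) ^+ 2)) =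
  (fun z : RN R N * RN R N => (\sum_j (z.1 ord0 j - z.2 ord0 j) ^+ 2) `^ 2^-1).
  by apply/funext => z; rewrite powR12_sqrt// sumr_ge0// => j _; exact: sqr_ge0.
apply: (measurableT_comp (measurable_powR 2^-1)).
apply: measurable_sum => j; apply: measurable_funX; apply: measurable_funB.
  by apply: (measurableT_comp (measurable_coord j)); exact: measurable_fst.
by apply: (measurableT_comp (measurable_coord j)); exact: measurable_snd.
Qed.

Lemma measurable_box (a b : RN R N) :
  measurable [set x : RN R N | forall j, a ord0 j <= x ord0 j <= b ord0 j].
Proof.
rewrite (_ : [set _ : RN R N | _] = \bigcap_(j in [set: 'I_N])
    ((fun x : RN R N => x ord0 j) @^-1` `[a ord0 j, b ord0 j])).
  apply: fin_bigcap_measurable => // j _.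
  by rewrite -[X in measurable X]setTI; apply: measurable_coord.
apply/seteqP; split => [y By j _|y By j].
  by rewrite /= in_itv/=; exact: By.
by have := By j Logic.I; rewrite /= in_itv.
Qed.

(** The cube of half-side r/(2(N+1)) about x lies in the ball, because the Euclidean distance is at
    most the sum of the N coordinate distances. The divisor N+1 stays positive when N = 0. *)
Lemma lebesgue_eball_ge x r : 0 < r ->
  (((2 * (r / (2 * N.+1%:R))) ^+ N)%:E <= lebesgue_RN R N (eball x r))%E.
Proof.
move=> r0; set e := r / (2 * N.+1%:R).
have e0 : 0 < e by rewrite divr_gt0// mulr_gt0.
pose a : RN R N := \row_j (x ord0 j - e); pose b : RN R N := \row_j (x ord0 j + e).
have ab j : a ord0 j <= b ord0 j by rewrite !mxE; lra.
have := lebesgue_RN_box ab.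
rewrite (_ : \prod_(j < N) _ = (2 * e) ^+ N); last first.
  rewrite -[in RHS](card_ord N) -prodr_const; apply: eq_bigr => j _.
  by rewrite !mxE; ring.
move=> <-; apply: le_measure; rewrite ?inE.
- exact: measurable_box.
- exact: measurable_eball.
- move=> y By; rewrite /eball/= (le_lt_trans (edist_le_sum _ _))//.
  apply: (@le_lt_trans _ _ (\sum_(j < N) e)).
    apply: ler_sum => j _; rewrite distrC ler_distl.
    by have := By j; rewrite !mxE.
  rewrite sumr_const card_ord -mulr_natl /e mulrA ltr_pdivrMr ?mulr_gt0//.
  rewrite mulrC ltr_pM2l//; rewrite -natrM ltr_nat.
  by rewrite mul2n -addnn addSn ltnS leq_addr.
Qed.

Lemma lebesgue_eball_fin x r : (lebesgue_RN R N (eball x r) < +oo)%E.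
Proof.
have [r0|r0] := leP r 0.
  rewrite (_ : eball x r = set0) ?measure0//.
  apply/seteqP; split => // y; rewrite /eball/= => xy.
  by have := edist_ge0 x y; rewrite leNgt (lt_le_trans xy).
pose a : RN R N := \row_j (x ord0 j - r); pose b : RN R N := \row_j (x ord0 j + r).
have ab j : a ord0 j <= b ord0 j by rewrite !mxE; lra.
apply: (@le_lt_trans _ _ (lebesgue_RN R N [set y | forall j, a ord0 j <= y ord0 j <= b ord0 j])).
  apply: le_measure; rewrite ?inE.
  - exact: measurable_eball.
  - exact: measurable_box.
  - move=> y xy j; rewrite !mxE -ler_distl distrC.
    exact: le_trans (le_coord_edist _ _ _) (ltW xy).
by rewrite lebesgue_RN_box// ltry.
Qed.

End euclidean_distance.

(** * Geometry of (eps, delta) domains and of d-sets *)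

Section regularity.
Variables (R : realType) (N : nat).
Implicit Types (x y z : RN R N) (O F : set (RN R N)).

Lemma open_two_points O : (0 < N)%N -> open O -> O !=set0 ->
  exists p q, [/\ O p, O q & 0 < edist p q].
Proof.
move=> N0 oO [p Op].
have : nbhs (p : 'rV[R]_N) O by exact: open_nbhs_nbhs.
move=> /nbhs_ballP[e /= e0 eB].
pose q : 'rV[R]_N := p + const_mx (e / 2).
exists p, q; split => //.
  apply: eB; split => // i j; rewrite /ball/= !mxE opprD addrA subrr add0r normrN.
  by rewrite gtr0_norm ?divr_gt0// ltr_pdivrMr// ltr_pMr// ltr1n.
apply: edist_gt0; apply/eqP => /rowP /(_ (Ordinal N0)).
rewrite /q mxE mxE; lra.
Qed.

Lemma closureP O x r : closure O x -> 0 < r -> exists2 y, O y & edist x y < r.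
Proof.
move=> cl r0; have : nbhs (x : 'rV[R]_N) (eball x r).
  apply: open_nbhs_nbhs; split; first exact: open_eball.
  by rewrite /eball/= edistxx.
by move=> /cl[y [Oy xy]]; exists y.
Qed.

(* A point of the arc from x to y half way (in distance) to x is the center of
   a ball inside the domain, of radius comparable to |x - y|. *)
Lemma eps_delta_corkscrew (eps delta : R) O : (0 < N)%N -> 0 < eps -> 0 < delta ->
  eps_delta_domain eps delta O ->
  exists2 r0, 0 < r0 & forall x r, closure O x -> 0 < r <= r0 ->
    exists z, eball z (Num.min 1 eps / 8 * r) `<=` eball x r `&` O.
Proof.
move=> N0 eps0 delta0 [oO cO O0 arc].
have [p [q [Op Oq pq]]] := open_two_points N0 oO O0.
(* Of the two points [p] and [q], one is at distance at least |p-q|/2 from any given point; so the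
   domain contains points far enough from [x']. *)
exists (Num.min delta (edist p q / 2)).
  by rewrite lt_min delta0 divr_gt0.
move=> x r clx /andP[r0]; rewrite le_min => /andP[rdelta rpq].
have r20 : 0 < r / 2 by rewrite divr_gt0.
have [x' Ox' xx'] := closureP clx r20.
have [y Oy xy] : exists2 y, O y & edist x' y = r / 2.
  have [p' Op' xp'] : exists2 p', O p' & r / 2 <= edist x' p'.
    have [h|h] := leP (r / 2) (edist x' p); first by exists p.
    exists q => //; have := edist_triangle x' p q; rewrite (edistC p x'); lra.
  (* The distances from [x'] to points of the connected set [O] form an interval, so the value r/2
     is attained exactly. *)
  have : connected [set edist x' y | y in O].
    apply: connected_continuous_connected => //.
    apply: continuous_subspaceT => y; exact: edist_continuous.
  move=> /connected_intervalP /(_ (edist x' x') (edist x' p')) h.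
  have [|||y Oy yE] := h _ _ (r / 2); [by exists x'|by exists p'| |by exists y].
  by rewrite edistxx xp' ltW.
have [|gam [cgam gam0 gam1 _ gamP]] := arc _ _ Ox' Oy.
  by rewrite xy (lt_le_trans _ rdelta)// ltr_pdivrMr// ltr_pMr// ltr1n.
have cg : {within `[0, 1], continuous (fun t => edist x' (gam t))}.
  by move=> t; exact: (cvg_comp _ _ (cgam t) (@edist_continuous _ _ x' (gam t))).
(* The arc point at distance r/4 from [x'] is at distance at least r/4 from [y], so its depth is at
   least eps (r/4)(r/4)/(r/2) = eps r/8. Replacing eps by its minimum with 1 keeps the new ball
   inside the ball about [x], as r/2 + r/4 + r/8 < r. *)
have [|t /[1!in_itv]/= t01 tE] := @IVT R _ 0 1 (r / 4) ler01 cg.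
  rewrite gam0 gam1 edistxx xy min_l ?max_r; [|lra|lra].
  apply/andP; split; lra.
have [_ dz] := gamP _ t01.
exists (gam t) => w zw.
have yz : r / 4 <= edist y (gam t).
  by have := edist_triangle (gam t) x' y; rewrite (edistC (gam t)) xy tE; lra.
have m0 : 0 < Num.min 1 eps by rewrite lt_min ltr01.
have m1 : Num.min 1 eps <= 1 by rewrite ge_min lexx.
have m2 : Num.min 1 eps <= eps by rewrite ge_min lexx orbT.
move: zw; rewrite /eball/= => zw.
split; rewrite /=.
  have := edist_triangle x' x w; have := edist_triangle (gam t) x' w.
  rewrite tE => h1 h2.
  have : Num.min 1 eps / 8 * r <= r / 8.
    by rewrite mulrAC ler_pM2r// ler_piMl// ltW.
  lra.
apply: contrapT => Ow; move: zw; apply/negP; rewrite -leNgt.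
apply: (@le_trans _ _ (dist_compl O (gam t))).
  apply: le_trans dz; rewrite tE xy ler_pdivlMr//.
  apply: (@le_trans _ _ (eps * (r / 4) * (r / 4))).
    rewrite [leLHS](_ : _ = Num.min 1 eps * (r / 4) * (r / 4)); last by field.
    by rewrite ler_pM2r ?divr_gt0// ler_pM2r ?divr_gt0.
  by rewrite ler_pM2l// mulr_gt0// divr_gt0.
apply: ge_inf; last by exists w.
by exists 0 => _ [v _ <-]; exact: edist_ge0.
Qed.

(** The corkscrew ball contains a cube of comparable size. This density bound, valid up to the
    boundary, is the only consequence of the (eps, delta) condition used afterwards. *)
Lemma eps_delta_measure_density (eps delta : R) O :
  (0 < N)%N -> 0 < eps -> 0 < delta -> eps_delta_domain eps delta O ->
  exists c r0, [/\ 0 < c, 0 < r0 & forall x r, closure O x -> 0 < r <= r0 ->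
    ((c * r ^+ N)%:E <= lebesgue_RN R N (eball x r `&` O))%E].
Proof.
move=> N0 eps0 delta0 ed.
have [oO _ _ _] := ed.
have [r0 r00 H] := eps_delta_corkscrew N0 eps0 delta0 ed.
have m0 : 0 < Num.min 1 eps / 8 by rewrite divr_gt0// lt_min ltr01.
exists ((Num.min 1 eps / 8 / N.+1%:R) ^+ N), r0; split => //.
  by rewrite exprn_gt0// divr_gt0.
move=> x r clx rr; have [z zB] := H x r clx rr.
have /andP[r_gt0 _] := rr.
apply: (@le_trans _ _ (lebesgue_RN R N (eball z (Num.min 1 eps / 8 * r)))).
  apply: le_trans (lebesgue_eball_ge _ _); last by rewrite mulr_gt0.
  rewrite lee_fin -exprMn le_eqVlt; apply/orP; left; apply/eqP; congr (_ ^+ _).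
  have : N.+1%:R != 0 :> R by rewrite pnatr_eq0.
  by move: (N.+1%:R) => n n0; field.
apply: le_measure; rewrite ?inE//; first exact: measurable_eball.
by apply: measurableI; [exact: measurable_eball|exact: open_measurable_RN].
Qed.

Lemma closure_boundary O x : boundary O x -> closure O x.
Proof. by case. Qed.

(** A ball with arbitrary centre that meets [F] lies in the ball of twice its radius about a point
    of [F]. Centres off [F] occur when Tonelli's theorem moves the integration to points of the
    domain. *)
Lemma d_set_measure_upper (mu : {measure set (RN R N) -> \bar R}) F (d c2 : R) :
  measurable F -> 0 < c2 ->
  (forall x r, F x -> 0 < r <= 1 -> (mu (eball x r `&` F) <= (c2 * r `^ d)%:E)%E) ->
  forall z r, 0 < r <= 2^-1 -> (mu (eball z r `&` F) <= (c2 * (2 * r) `^ d)%:E)%E.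
Proof.
move=> mF c20 H z r /andP[r0 r1].
have [[x [zx Fx]]|no] := pselect (eball z r `&` F !=set0); last first.
  move: no => /set0P/negP; rewrite negbK => /eqP ->.
  by rewrite measure0 lee_fin mulr_ge0 ?powR_ge0// ltW.
apply: le_trans (H x (2 * r) Fx _); last first.
  by rewrite mulr_gt0//= -ler_pdivlMl// mulr1.
apply: le_measure; rewrite ?inE; [| |apply: setSI].
- by apply: measurableI => //; exact: measurable_eball.
- by apply: measurableI => //; exact: measurable_eball.
- move=> w zw; move: zx zw; rewrite /eball/= => zx zw.
  have := edist_triangle z x w; rewrite (edistC x z); lra.
Qed.

End regularity.

(** * Monotonicity and Jensen's inequality *)

Section integral_aux.
Context dsp (X : measurableType dsp) (R : realType).
Variable m : {measure set X -> \bar R}.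
Local Open Scope ereal_scope.

(** The integral of a nonnegative function is a supremum over simple functions below it, so
    monotonicity holds without measurability. *)
Lemma ge0_le_integral_nm (D : set X) (f g : X -> \bar R) :
  (forall x, D x -> 0 <= f x) -> (forall x, D x -> f x <= g x) ->
  \int[m]_(x in D) f x <= \int[m]_(x in D) g x.
Proof.
move=> f0 fg; rewrite !ge0_integralE//; last first.
  by move=> x Dx; exact: le_trans (f0 _ Dx) (fg _ Dx).
rewrite /= ge_ereal_sup// => _ [h/= hf <-]; apply: ereal_sup_ubound.
exists h => //= x; apply: le_trans (hf x) _; rewrite /patch.
by case: ifPn => // /set_mem /fg.
Qed.

Lemma integral_indic_mul (D : set X) (f : X -> \bar R) :
  \int[m]_(x in D) f x = \int[m]_x ((\1_D x)%:E * f x).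
Proof.
rewrite integral_mkcond; apply: eq_integral => x _.
by rewrite /patch indicE; case: ifPn => _; rewrite ?mul1e ?mul0e.
Qed.

(** With a = average - c, integrate (f - c)^2 >= 2 a (f - c) - a^2 over [P]: the right side has
    integral a^2 m(P). *)
Lemma jensen_sqr (P : set X) (f : X -> R) (c : R) :
  measurable P -> 0 < m P < +oo -> m.-integrable P (EFin \o f) ->
  (((fine (m P))^-1 * \int[m]_(x in P) f x - c) ^+ 2)%:E * m P <=
  \int[m]_(x in P) ((f x - c) ^+ 2)%:E.
Proof.
move=> mP /andP[P0 Py] intf.
have fP : m P \is a fin_num by rewrite ge0_fin_numE ?measure_ge0.
have v0 : (0 < fine (m P))%R by rewrite fine_gt0// P0.
set v := fine (m P) in v0 *; set I := (\int[m]_(x in P) f x)%R.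
set a := (v^-1 * I - c)%R.
have mf : measurable_fun P f by exact/measurable_EFinP/(measurable_int _ intf).
have intc k : m.-integrable P (EFin \o cst k).
  apply/integrableP; split; first exact/measurable_EFinP.
  by rewrite /= integral_cst//= lte_mul_pinfty// ?abse_ge0.
have intl k : m.-integrable P (EFin \o (fun x => k * (f x - c)))%R.
  rewrite (_ : _ \o _ = (fun x => k%:E * ((EFin \o f) x - (EFin \o cst c) x))).
    by apply: integrableZl => //; apply: integrableB => //; exact: intc.
  by apply/funext => x /=; rewrite EFinM EFinB.
have [oo|fin] := eqVneq (\int[m]_(x in P) ((f x - c) ^+ 2)%:E) +oo.
  by rewrite oo leey.
have m2 : measurable_fun P (fun x => (f x - c) ^+ 2)%R.
  by apply: measurable_funX; apply: measurable_funB.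
have int2 : m.-integrable P (fun x => ((f x - c) ^+ 2)%:E).
  apply/integrableP; split; first exact/measurable_EFinP.
  under eq_integral do rewrite abse_EFin ger0_norm ?sqr_ge0//.
  by rewrite ltey.
have -> : (a ^+ 2)%:E * m P = \int[m]_(x in P) (2 * a * (f x - c) - a ^+ 2)%:E.
  under eq_integral do rewrite EFinB.
  rewrite integralB_EFin//; last exact: intc.
  rewrite integral_cst// -(fineK fP) -/v.
  under eq_integral do rewrite EFinM EFinB.
  rewrite integralZl//; last by apply: integrableB => //; exact: intc.
  rewrite integralB//; last exact: intc.
  rewrite integral_cst// -(fineK fP) -/v.
  have -> : \int[m]_(x in P) (f x)%:E = I%:E.
    by rewrite /I /Rintegral fineK//; exact: integrable_fin_num.
  rewrite -!(EFinM, EFinB); congr EFin.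
  by rewrite /a; field; rewrite gt_eqF.
apply: le_integral => //.
  by under eq_fun do rewrite EFinB; apply: integrableB => //; [exact: intl|exact: intc].
move=> x _; rewrite lee_fin -subr_ge0.
rewrite (_ : _ - _ = (f x - c - a) ^+ 2)%R ?sqr_ge0//; ring.
Qed.

End integral_aux.

(** * Averages against the Gagliardo energy *)

Section averages.
Variables (R : realType) (N : nat).
Local Notation LN := (lebesgue_RN R N).
Local Notation X := (RN R N).
Variables (O : set X) (e : R) (u : X -> R).
Hypotheses (mO : measurable O) (e0 : 0 <= e) (mu : measurable_fun setT u).
Local Open Scope ereal_scope.

Definition gkernel (z : X * X) : R := ((u z.1 - u z.2) ^+ 2 / edist z.1 z.2 `^ e)%R.

(** The share of the point [z] in the Gagliardo energy when e = N + 2s, kept as a function of [z] so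
    that the energy can be localised in balls. *)
Definition gdensity (z : X) : \bar R := \int[LN]_(w in O) (gkernel (z, w))%:E.

Definition average (P : set X) : R := ((fine (LN P))^-1 * \int[LN]_(y in P) u y)%R.

Lemma gkernel_ge0 z : (0 <= gkernel z)%R.
Proof. by rewrite /gkernel divr_ge0 ?sqr_ge0// powR_ge0. Qed.

Lemma measurable_gkernel : measurable_fun setT gkernel.
Proof.
apply: measurable_funM.
  apply: measurable_funX; apply: measurable_funB.
    exact: measurableT_comp mu measurable_fst.
  exact: measurableT_comp mu measurable_snd.
under eq_fun do rewrite -powRN.
exact: measurableT_comp (measurable_powR (- e)) (@measurable_edist R N).
Qed.

Lemma gdensity_ge0 z : 0 <= gdensity z.
Proof. by apply: integral_ge0 => w _; rewrite lee_fin gkernel_ge0. Qed.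

Lemma measurable_gdensity : measurable_fun setT gdensity.
Proof.
pose f (z : X * X) := ((\1_O z.2)%:E * (gkernel z)%:E).
have -> : gdensity = fubini_F LN f.
  by apply/funext => z; rewrite /gdensity integral_indic_mul.
apply: measurable_fun_fubini_tonelli_F => /=.
  apply: emeasurable_funM; apply/measurable_EFinP; last exact: measurable_gkernel.
  rewrite (_ : (fun _ => _) = \1_(snd @^-1` O))//; apply: measurable_indic.
  by rewrite -[X in measurable X]setTI; exact: measurable_snd.
by move=> z; rewrite mule_ge0// ?lee_fin ?gkernel_ge0.
Qed.

Lemma sqr_le_gkernel z w delta : (edist z w <= delta)%R ->
  ((u w - u z) ^+ 2 <= delta `^ e * gkernel (z, w))%R.
Proof.
move=> zw; rewrite /gkernel/=.
have [->|zw0] := eqVneq z w.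
  by rewrite subrr expr0n/= mul0r mulr0.
have d0 : (0 < edist z w)%R by exact: edist_gt0.
rewrite mulrCA -sqrrN opprB ler_peMr ?sqr_ge0// ler_pdivlMr ?powR_gt0// mul1r.
by rewrite ge0_ler_powR// nnegrE ?edist_ge0// (le_trans _ zw)// edist_ge0.
Qed.

(** Jensen's inequality in the second variable replaces the average over [Q] by a mean of squared
    differences; for pairs at distance at most [delta] these are at most delta^e times the
    kernel. *)
Lemma sqr_sub_average_le (P Q : set X) (v delta : R) :
  measurable P -> measurable Q -> Q `<=` O -> (0 < v)%R ->
  v%:E <= LN Q -> LN Q < +oo -> LN.-integrable Q (EFin \o u) ->
  (forall z w, P z -> Q w -> (edist z w <= delta)%R) ->
  v%:E * \int[LN]_(z in P) ((u z - average Q) ^+ 2)%:E <=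
  (delta `^ e)%:E * \int[LN]_(z in P) gdensity z.
Proof.
move=> mP mQ QO v0 vQ Qy intQ PQ.
have mPd : measurable_fun P gdensity.
  exact: measurable_funS (measurableT) (@subsetT _ _) measurable_gdensity.
rewrite -[leRHS]ge0_integralZl_EFin ?powR_ge0//; last by move=> z _; exact: gdensity_ge0.
rewrite -[leLHS]ge0_integralZl_EFin ?(ltW v0)//; last 2 first.
- by move=> z _; rewrite lee_fin sqr_ge0.
- apply/measurable_EFinP; apply: measurable_funX; apply: measurable_funB => //.
  exact: measurable_funS (measurableT) (@subsetT _ _) mu.
apply: ge0_le_integral_nm => z Pz.
  by rewrite mule_ge0// lee_fin ?sqr_ge0// ltW.
rewrite /gdensity -ge0_integralZl_EFin ?powR_ge0//; last 2 first.
- by move=> w _; rewrite lee_fin gkernel_ge0.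
- apply: (measurable_funS measurableT) => //.
  apply/measurable_EFinP; apply: (measurableT_comp measurable_gkernel).
  exact: measurable_pair1.
apply: (@le_trans _ _ (LN Q * ((u z - average Q) ^+ 2)%:E)).
  by rewrite lee_wpmul2r// lee_fin sqr_ge0.
rewrite muleC -sqrrN opprB.
apply: le_trans (jensen_sqr (u z) mQ _ intQ) _; first by rewrite (lt_le_trans _ vQ).
apply: (@le_trans _ _ (\int[LN]_(w in Q) ((delta `^ e)%:E * (gkernel (z, w))%:E))).
  apply: ge0_le_integral_nm => w Qw; first by rewrite lee_fin sqr_ge0.
  by rewrite -EFinM lee_fin sqr_le_gkernel// PQ.
rewrite [leLHS]integral_mkcond [leRHS]integral_mkcond.
apply: ge0_le_integral_nm => w _.
  by rewrite /patch; case: ifPn => // _; rewrite mule_ge0// lee_fin ?gkernel_ge0 ?powR_ge0.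
rewrite /patch; case: ifPn => [/set_mem/QO Ow|_]; first by rewrite mem_set.
by case: ifPn => // _; rewrite mule_ge0// lee_fin ?gkernel_ge0 ?powR_ge0.
Qed.

(** Jensen's inequality once more, on [P], at the cost of a second factor 1/v. *)
Lemma sqr_sub_averages_le (P Q : set X) (v delta : R) :
  measurable P -> measurable Q -> Q `<=` O -> (0 < v)%R ->
  v%:E <= LN P -> LN P < +oo -> LN.-integrable P (EFin \o u) ->
  v%:E <= LN Q -> LN Q < +oo -> LN.-integrable Q (EFin \o u) ->
  (forall z w, P z -> Q w -> (edist z w <= delta)%R) ->
  ((average P - average Q) ^+ 2)%:E <=
  (delta `^ e / v ^+ 2)%:E * \int[LN]_(z in P) gdensity z.
Proof.
move=> mP mQ QO v0 vP Py intP vQ Qy intQ PQ.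
have := sqr_sub_average_le mP mQ QO v0 vQ Qy intQ PQ.
set G := \int[LN]_(z in P) gdensity z => h.
have v20 : (0 < v ^+ 2)%R by rewrite exprn_gt0.
have -> : (delta `^ e / v ^+ 2)%:E * G = ((v ^+ 2)^-1)%:E * ((delta `^ e)%:E * G).
  by rewrite muleA -EFinM mulrC.
rewrite lee_pdivlMl//.
apply: le_trans h; rewrite expr2 EFinM -muleA.
rewrite lee_pmul2l// muleC.
apply: le_trans (jensen_sqr (average Q) mP _ intP); last by rewrite (lt_le_trans _ vP).
by rewrite lee_wpmul2l// lee_fin sqr_ge0.
Qed.

End averages.

Lemma lipschitz_measurable (R : realType) (M : R) (theta : R -> R) :
  (forall a b, `|theta a - theta b| <= M * `|a - b|) -> measurable_fun setT theta.
Proof.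
move=> thM; apply: continuous_measurable_fun => a.
apply/cvgrPdist_lt => eps eps0.
have M1 : 0 < `|M| + 1 by rewrite ltr_pwDr.
near=> b; apply: (le_lt_trans (thM _ _)).
apply: (@le_lt_trans _ _ ((`|M| + 1) * `|a - b|)).
  by rewrite ler_wpM2r// (le_trans (ler_norm _))// lerDl.
rewrite mulrC -ltr_pdivlMr//; near: b.
by apply: cvgr_dist_lt; [exact: cvg_id|rewrite divr_gt0].
Unshelve. all: by end_near.
Qed.

Section telescoping.
Variable R : realType.
Local Open Scope ereal_scope.

(* (x + y)^2 <= beta/(beta-1) x^2 + beta y^2 keeps the constant independent of
   the number of steps. *)
Lemma telescope_sqr_le (beta : R) (a : nat -> R) (A : nat -> \bar R) n :
  (1 < beta)%R -> (forall j, ((a j.+1 - a j) ^+ 2)%:E <= A j) ->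
  ((a n - a 0%N) ^+ 2)%:E <=
  (beta / (beta - 1))%:E * \sum_(0 <= j < n) (beta ^+ j)%:E * A j.
Proof.
move=> beta1.
have b0 : (0 < beta)%R by rewrite (lt_trans _ beta1).
have b1 : (0 < beta - 1)%R by rewrite subr_gt0.
have c0 : (0 <= beta / (beta - 1))%R by rewrite divr_ge0 ?ltW.
elim: n a A => [|n IH] a A aA.
  by rewrite big_geq// mule0 subrr expr0n.
have A0 j : 0 <= A j by apply: le_trans (aA j); rewrite lee_fin sqr_ge0.
have {}IH := IH (a \o S) (A \o S) (fun j => aA j.+1).
rewrite big_nat_recl// expr0 mul1e ge0_muleDr//; last first.
  by apply: sume_ge0 => j _; rewrite mule_ge0// lee_fin exprn_ge0// ltW.
have -> : \sum_(0 <= i < n) (beta ^+ i.+1)%:E * A i.+1 =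
    beta%:E * \sum_(0 <= i < n) (beta ^+ i)%:E * A i.+1.
  rewrite ge0_sume_distrr//; last first.
    by move=> j _; rewrite mule_ge0// lee_fin exprn_ge0// ltW.
  by apply: eq_bigr => i _; rewrite exprS EFinM muleA.
rewrite muleCA.
apply: (@le_trans _ _ ((beta / (beta - 1))%:E * ((a 1%N - a 0%N) ^+ 2)%:E +
    beta%:E * ((a n.+1 - a 1%N) ^+ 2)%:E)).
  rewrite -!EFinM -EFinD lee_fin.
  set x := (a 1%N - a 0%N)%R; set y := (a n.+1 - a 1%N)%R.
  have -> : (a n.+1 - a 0%N = x + y)%R by rewrite /x /y; ring.
  rewrite -subr_ge0.
  have -> : (beta / (beta - 1) * x ^+ 2 + beta * y ^+ 2 - (x + y) ^+ 2 =
    (x - (beta - 1) * y) ^+ 2 / (beta - 1))%R by field; rewrite gt_eqF.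
  by rewrite divr_ge0 ?sqr_ge0 ?ltW.
by apply: leeD; rewrite lee_wpmul2l// lee_fin ltW.
Qed.

End telescoping.

(** * Dyadic averages and the trace at one point *)

Section scales.
Variables (R : realType) (N : nat).
Local Notation LN := (lebesgue_RN R N).
Local Notation X := (RN R N).
Variables (O : set X) (s c r0 : R) (u : X -> R).
Hypotheses (mO : measurable O) (s0 : 0 < s) (c0 : 0 < c) (r00 : 0 < r0).
Hypothesis density : forall x r, closure O x -> 0 < r <= r0 ->
  ((c * r ^+ N)%:E <= LN (eball x r `&` O))%E.
Hypotheses (mu : measurable_fun setT u)
  (u2 : (\int[LN]_(x in O) (u x ^+ 2)%:E < +oo)%E).
Local Open Scope ereal_scope.

Implicit Types (x y z : X) (r rho : R).

Let e : R := (N%:R + 2 * s)%R.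
Let e0 : (0 <= e)%R. Proof. by rewrite addr_ge0// mulr_ge0// ltW. Qed.

Definition ballO x r : set X := eball x r `&` O.

Lemma measurable_ballO x r : measurable (ballO x r).
Proof. by apply: measurableI => //; exact: measurable_eball. Qed.

Lemma ballO_fin x r : LN (ballO x r) < +oo.
Proof.
apply: le_lt_trans (lebesgue_eball_fin x r).
by apply: le_measure; rewrite ?inE; [exact: measurable_ballO|exact: measurable_eball|move=> z []].
Qed.

(** On a set of finite measure |v| <= 1 + v^2 suffices. *)
Lemma ballO_integrable x r (v : X -> R) : measurable_fun setT v ->
  \int[LN]_(x in O) (v x ^+ 2)%:E < +oo ->
  LN.-integrable (ballO x r) (EFin \o v).
Proof.
move=> mv v2; have mB := measurable_ballO x r.
have mvB : measurable_fun (ballO x r) v by exact: measurable_funS (measurableT) (@subsetT _ _) mv.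
apply/integrableP; split; first exact/measurable_EFinP.
apply: (@le_lt_trans _ _ (\int[LN]_(y in ballO x r) (1 + (v y ^+ 2)%:E))).
  apply: ge0_le_integral_nm => y _; first exact: abse_ge0.
  rewrite /= -EFinD lee_fin -(ger0_norm (sqr_ge0 (v y))) normrX.
  have := sqr_ge0 (`|v y| - 1)%R; have := normr_ge0 (v y); rewrite sqrrB expr1n; nra.
rewrite ge0_integralD//; last 2 first.
- by move=> y _; rewrite lee_fin sqr_ge0.
- by apply/measurable_EFinP; exact: measurable_funX.
rewrite lte_add_pinfty//.
  by rewrite integral_cst// mul1e ballO_fin.
apply: le_lt_trans v2; apply: ge0_subset_integral => //.
- apply/measurable_EFinP; apply: measurable_funX.
  exact: measurable_funS (measurableT) (@subsetT _ _) mv.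
- by move=> y _; rewrite lee_fin sqr_ge0.
- by move=> y [].
Qed.

Let dens := gdensity O e u.

(** The power 2s - N is the normalisation for which this bounds, up to a constant, the squared
    difference of two averages at scale [r]. *)
Definition local_energy x r : \bar R :=
  (r `^ (2 * s - N%:R))%:E * \int[LN]_(z in ballO x r) dens z.

Lemma local_energy_ge0 x r : 0 <= local_energy x r.
Proof.
by rewrite mule_ge0// ?lee_fin ?powR_ge0//; apply: integral_ge0 => z _; exact: gdensity_ge0.
Qed.

(** With delta = 3r and v = c (r/2)^N, the factor delta^e / v^2 of [sqr_sub_averages_le] is this
    constant times r^(2s - N). *)
Definition scale_cst : R := (3 `^ e * (4 ^+ N / c ^+ 2))%R.

Lemma scale_cst_gt0 : (0 < scale_cst)%R.
Proof. by rewrite mulr_gt0 ?powR_gt0// divr_gt0// exprn_gt0. Qed.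

Lemma scale_cstE r : (0 < r)%R ->
  ((3 * r) `^ e / (c * (r / 2) ^+ N) ^+ 2 = scale_cst * r `^ (2 * s - N%:R))%R.
Proof.
move=> r_gt0; rewrite powRM ?ltW// /scale_cst.
set t := (3 `^ e)%R; set q := (r `^ (2 * s))%R.
have -> : (r `^ e = r ^+ N * q)%R.
  by rewrite /e powRD ?(gt_eqF r_gt0) ?implybT// powR_mulrn ?ltW.
have -> : (r `^ (2 * s - N%:R) = q / r ^+ N)%R.
  by rewrite powRB ?(gt_eqF r_gt0) ?implybT// powR_mulrn ?ltW.
rewrite !exprMn exprVn.
rewrite (_ : (4 : R) = 2 ^+ 2)%R; last by rewrite expr2 -natrM.
have r1 : (r ^+ N != 0)%R by rewrite expf_neq0// gt_eqF.
have c1 : c != 0%R by rewrite gt_eqF.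
have t2 : (2 ^+ N != 0 :> R)%R by rewrite expf_neq0// pnatr_eq0.
rewrite [(2 ^+ 2 ^+ N)%R]exprAC.
move: (r ^+ N)%R (2 ^+ N)%R r1 t2 => y z y0 z0.
by field; rewrite y0 c1 z0.
Qed.

Let ball_ge x r rho : closure O x -> (0 < r <= r0)%R -> (r / 2 <= rho <= r)%R ->
  (c * (r / 2) ^+ N)%:E <= LN (ballO x rho).
Proof.
move=> clx /andP[r_gt0 rr0] /andP[rho1 rho2].
have rho0 : (0 < rho)%R by rewrite (lt_le_trans _ rho1)// divr_gt0.
apply: le_trans (density clx _); last by rewrite rho0 (le_trans rho2).
by rewrite lee_fin ler_pM2l// lerXn2r// nnegrE ?divr_ge0 ?ltW.
Qed.

Let v_gt0 r : (0 < r)%R -> (0 < c * (r / 2) ^+ N)%R.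
Proof. by move=> r_gt0; rewrite mulr_gt0// exprn_gt0// divr_gt0. Qed.

Let energy_sub x r rho : (rho <= r)%R ->
  \int[LN]_(z in ballO x rho) dens z <= \int[LN]_(z in ballO x r) dens z.
Proof.
move=> h; apply: ge0_subset_integral.
- exact: measurable_ballO.
- exact: measurable_ballO.
- by apply: (measurable_funS measurableT) => //; exact: measurable_gdensity.
- by move=> z _; exact: gdensity_ge0.
- by apply: setSI => z; rewrite /eball/= => /lt_le_trans; exact.
Qed.

(** Points of the two balls are less than 3r apart, and both balls meet [O] in measure at least c
    (r/2)^N. *)
Lemma average_close x y r rho rho' : closure O x -> closure O y ->
  (0 < r <= r0)%R -> (r / 2 <= rho <= r)%R -> (r / 2 <= rho' <= r)%R ->
  (edist x y <= r)%R ->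
  ((average u (ballO x rho) - average u (ballO y rho')) ^+ 2)%:E <=
  scale_cst%:E * local_energy x r.
Proof.
move=> clx cly rr h h' xy; have /andP[r_gt0 _] := rr.
have /andP[_ h2] := h; have /andP[_ h2'] := h'.
have := @sqr_sub_averages_le R N O e u mO e0 mu (ballO x rho) (ballO y rho')
  (c * (r / 2) ^+ N) (3 * r) (measurable_ballO _ _) (measurable_ballO _ _).
move=> /(_ _ (v_gt0 r_gt0) (ball_ge clx rr h) (ballO_fin _ _) (ballO_integrable _ _ mu u2)
  (ball_ge cly rr h') (ballO_fin _ _) (ballO_integrable _ _ mu u2)) H.
apply: le_trans (H _ _) _; [by move=> z []| |].
  move=> z w [/= xz _] [/= yw _]; move: xz yw; rewrite /eball/= => xz yw.
  have := edist_triangle x z w; have := edist_triangle y x w; rewrite (edistC z x); lra.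
rewrite scale_cstE// EFinM -muleA lee_wpmul2l//.
  by rewrite lee_fin ltW// scale_cst_gt0.
by rewrite /local_energy lee_wpmul2l ?lee_fin ?powR_ge0//; exact: energy_sub.
Qed.

Lemma mean_square_scale x r rho : closure O x ->
  (0 < r <= r0)%R -> (r / 2 <= rho <= r)%R ->
  \int[LN]_(z in ballO x rho) ((u z - average u (ballO x r)) ^+ 2)%:E <=
  scale_cst%:E * local_energy x r * LN (ballO x rho).
Proof.
move=> clx rr h; have /andP[r_gt0 _] := rr; have /andP[_ h2] := h.
have r2 : (r / 2 <= r <= r)%R by apply/andP; split; lra.
have := @sqr_sub_average_le R N O e u mO e0 mu (ballO x rho) (ballO x r)
  (c * (r / 2) ^+ N) (3 * r) (measurable_ballO _ _) (measurable_ballO _ _).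
move=> /(_ _ (v_gt0 r_gt0) (ball_ge clx rr r2) (ballO_fin _ _) (ballO_integrable _ _ mu u2)) H.
rewrite -(@lee_pmul2l _ (c * (r / 2) ^+ N)%:E) ?lte_fin ?v_gt0//.
apply: le_trans (H _ _) _; [by move=> z []| |].
  move=> z w [/= xz _] [/= yw _]; move: xz yw; rewrite /eball/= => xz yw.
  have := edist_triangle x z w; rewrite (edistC z x); lra.
set v := (c * _)%R; have v0 : (0 < v)%R by exact: v_gt0.
rewrite /local_energy [scale_cst%:E * _]muleA -EFinM -scale_cstE// -/v.
set G := \int[LN]_(z in ballO x r) dens z.
have G0 : 0 <= G by apply: integral_ge0 => z _; exact: gdensity_ge0.
apply: (@le_trans _ _ (((3 * r) `^ e)%:E * G)).
  by rewrite lee_wpmul2l ?lee_fin ?powR_ge0//; exact: energy_sub.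
apply: (@le_trans _ _ (v%:E * (((3 * r) `^ e / v ^+ 2)%:E * G * v%:E))).
  rewrite (muleC _ v%:E) !muleA -!EFinM le_eqVlt; apply/orP; left.
  by apply/eqP; congr (_%:E * _); field; rewrite gt_eqF.
apply: lee_wpmul2l; first by rewrite lee_fin ltW.
apply: lee_wpmul2l; last exact: ball_ge.
by rewrite mule_ge0// lee_fin divr_ge0 ?powR_ge0// exprn_ge0// ltW.
Qed.

Variable be : R.
Hypothesis be1 : (1 < be)%R.

Let be0 : (0 < be)%R. Proof. by rewrite (lt_trans _ be1). Qed.

(** Geometrically growing weights let a single number control the averages at all scales below [r],
    with a rate of convergence. *)
Definition scale_sum x r : \bar R :=
  \sum_(0 <= j <oo) (be ^+ j)%:E * local_energy x (r / 2 ^+ j).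

Let term_ge0 x r j : 0 <= (be ^+ j)%:E * local_energy x (r / 2 ^+ j).
Proof. by rewrite mule_ge0 ?local_energy_ge0// lee_fin exprn_ge0// ltW. Qed.

Lemma scale_sum_ge0 x r : 0 <= scale_sum x r.
Proof. by apply: nneseries_ge0 => j _ _; exact: term_ge0. Qed.

Lemma scale_sum_partial x r n :
  \sum_(0 <= j < n) (be ^+ j)%:E * local_energy x (r / 2 ^+ j) <= scale_sum x r.
Proof. by apply: nneseries_lim_ge => j _ _; exact: term_ge0. Qed.

(** Starting j scales lower drops the first j terms and divides the remaining weights by be^j; this
    is the source of every factor be^-j below. *)
Lemma scale_sum_shift x r j : (be ^+ j)%:E * scale_sum x (r / 2 ^+ j) <= scale_sum x r.
Proof.
rewrite /scale_sum -nneseriesZl; last by move=> i _; exact: term_ge0.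
apply: lime_le.
  by apply: is_cvg_nneseries => i _ _; rewrite mule_ge0 ?term_ge0// lee_fin exprn_ge0// ltW.
apply: nearW => n; apply: le_trans (scale_sum_partial x r (j + n)).
rewrite (big_cat_nat (leq0n j) (leq_addr n j))/= -[leLHS]add0e.
apply: leeD; first by apply: sume_ge0 => i _; exact: term_ge0.
rewrite [leRHS](_ : _ = \sum_(0 <= i < n) (be ^+ (i + j))%:E * local_energy x (r / 2 ^+ (i + j)));
  last by rewrite [(j + n)%N]addnC -{1}(add0n j) big_addn addnK.
rewrite le_eqVlt; apply/orP; left; apply/eqP; apply: eq_bigr => i _.
rewrite muleA -EFinM -exprD addnC; congr (_ * local_energy _ _).
by rewrite -mulrA -invfM -exprD addnC.
Qed.

Definition tail_cst : R := (be / (be - 1) * scale_cst)%R.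

Lemma tail_cst_gt0 : (0 < tail_cst)%R.
Proof. by rewrite mulr_gt0 ?scale_cst_gt0// divr_gt0// subr_gt0. Qed.

Let half_gt0 r j : (0 < r)%R -> (0 < r / 2 ^+ j)%R.
Proof. by move=> r_gt0; rewrite divr_gt0// exprn_gt0. Qed.

Let half_le r j : (0 < r)%R -> (r / 2 ^+ j <= r)%R.
Proof.
by move=> r_gt0; rewrite ler_pdivrMr ?exprn_gt0// ler_peMr ?(ltW r_gt0)// exprn_ege1// ler1n.
Qed.

Let dyadic_range r j : (0 < r <= r0)%R -> (0 < r / 2 ^+ j <= r0)%R.
Proof.
by move=> /andP[r_gt0 rr0]; rewrite half_gt0//= (le_trans (half_le _ r_gt0)).
Qed.

Lemma average_tail x r n : closure O x -> (0 < r <= r0)%R ->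
  ((average u (ballO x (r / 2 ^+ n)) - average u (ballO x r)) ^+ 2)%:E <=
  tail_cst%:E * scale_sum x r.
Proof.
move=> clx rr.
have [K0 r_gt0] : (0 < scale_cst)%R /\ (0 < r)%R.
  by split; [exact: scale_cst_gt0|case/andP: rr].
have H j : ((average u (ballO x (r / 2 ^+ j.+1)) - average u (ballO x (r / 2 ^+ j))) ^+ 2)%:E
    <= scale_cst%:E * local_energy x (r / 2 ^+ j).
  have d0 := half_gt0 j r_gt0.
  apply: average_close => //; [exact: dyadic_range| | |by rewrite edistxx ltW].
  - by rewrite exprS invfM mulrCA mulrC; apply/andP; split; lra.
  - by apply/andP; split; lra.
have := telescope_sqr_le n be1 H; rewrite expr0 divr1 => /le_trans; apply.
apply: (@le_trans _ _ ((be / (be - 1))%:E * (scale_cst%:E * scale_sum x r))); last first.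
  by rewrite muleA -EFinM.
apply: lee_wpmul2l.
  by rewrite lee_fin divr_ge0 ?ltW// subr_gt0.
apply: le_trans (lee_wpmul2l _ (scale_sum_partial x r n)); last by rewrite lee_fin ltW.
rewrite ge0_sume_distrr; last by move=> j _; exact: term_ge0.
by rewrite le_eqVlt; apply/orP; left; apply/eqP; apply: eq_bigr => j _; rewrite muleCA.
Qed.

(** Places an arbitrary radius in a dyadic shell, since the limit that defines the trace runs over
    all radii. *)
Lemma dyadic_scale r rho j : (0 < rho)%R -> (rho <= r / 2 ^+ j)%R ->
  exists2 i, (j <= i)%N & (r / 2 ^+ i / 2 <= rho <= r / 2 ^+ i)%R.
Proof.
move=> rho0 rhoj.
have r_gt0 : (0 < r)%R.
  by have := lt_le_trans rho0 rhoj; rewrite pmulr_lgt0// invr_gt0 exprn_gt0.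
have ex : exists i, (r / 2 ^+ i / 2 < rho)%R.
  have [i ri] : exists i : nat, (r / rho < i%:R)%R.
    by exists (Num.truncn (r / rho)).+1; rewrite truncnS_gt.
  exists i; rewrite ltr_pdivrMr// ltr_pdivrMr ?exprn_gt0//.
  rewrite ltr_pdivrMr// in ri; apply: (lt_le_trans ri).
  rewrite mulrC -mulrA ler_pM2l// -natrX -natrM ler_nat.
  by rewrite (leq_trans (ltnW (ltn_expl i (ltnSn 1))))// leq_pmull.
have [i Pi imin] := find_ex_minn ex.
have ri : (rho <= r / 2 ^+ i)%R.
  case: i Pi imin => [|i] Pi imin.
    by rewrite expr0 divr1 (le_trans rhoj)// half_le.
  rewrite leNgt; apply/negP => h; have := imin i.
  by rewrite exprSr invfM mulrA in h => /(_ h); rewrite ltnn.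
exists i; last by rewrite (ltW Pi) ri.
rewrite leqNgt; apply/negP => ij.
move: rhoj; apply/negP; rewrite -ltNge; apply: le_lt_trans Pi.
rewrite -mulrA -invfM -exprSr ler_pM2l// lef_pV2 ?posrE ?exprn_gt0//.
by rewrite ler_eXn2l// ltr1n.
Qed.

(** The dyadic averages form a Cauchy sequence by the decay be^-j, and the bound survives when the
    finer scale tends to 0. *)
Lemma average_limit x r : closure O x -> (0 < r <= r0)%R -> scale_sum x r < +oo ->
  exists L, forall j, ((average u (ballO x (r / 2 ^+ j)) - L) ^+ 2 <=
    tail_cst * be ^- j * fine (scale_sum x r))%R.
Proof.
move=> clx rr Soo.
have Sfin : scale_sum x r \is a fin_num by rewrite ge0_fin_numE// scale_sum_ge0.
set S := fine _; have SE : scale_sum x r = S%:E by rewrite fineK.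
pose a j := average u (ballO x (r / 2 ^+ j)).
have H j n : ((a (n + j)%N - a j) ^+ 2 <= tail_cst * be ^- j * S)%R.
  have := average_tail n clx (dyadic_range j rr).
  rewrite -mulrA -invfM -exprD addnC -/(a _) -/(a _) => h.
  rewrite -lee_fin; apply: (le_trans h).
  apply: (@le_trans _ _ (tail_cst%:E * (be ^- j * S)%:E)); last by rewrite -EFinM mulrA.
  apply: lee_wpmul2l; first by rewrite lee_fin ltW// tail_cst_gt0.
  have := scale_sum_shift x r j; rewrite SE muleC -lee_pdivlMr ?exprn_gt0//.
  by move=> /le_trans; apply; rewrite -EFinM mulrC.
have B0 : (tail_cst * be ^- j * S)%R @[j --> \oo] --> (0 : R)%R.
  rewrite (_ : 0%R = tail_cst * 0 * S)%R; last by rewrite mulr0 mul0r.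
  apply: cvgMl; apply: cvgMr.
  under eq_fun do rewrite -exprVn.
  by apply: cvg_expr; rewrite gtr0_norm ?invr_gt0// invf_lt1.
have ca : cvgn a.
  apply/cauchy_cvgP; apply: cauchy_exP => eps eps0.
  move/cvgrPdist_lt : B0 => /(_ (eps ^+ 2)%R).
  rewrite exprn_gt0// => /(_ isT) [j _ /(_ j (leqnn j))].
  rewrite sub0r normrN => hj; exists (a j); exists j => //= i ji.
  rewrite /ball/= distrC -(@ltr_pXn2r _ 2)// ?nnegrE ?normr_ge0 ?(ltW eps0)//.
  rewrite real_normK ?num_real//; apply: le_lt_trans (le_lt_trans (ler_norm _) hj).
  by have := H j (i - j)%N; rewrite subnK.
exists (limn a) => j; rewrite -sqrrN opprB.
have cv : ((a (n + j)%N - a j) ^+ 2)%R @[n --> \oo] --> ((limn a - a j) ^+ 2)%R.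
  rewrite expr2; under eq_fun do rewrite expr2.
  have cva : a (n + j)%N @[n --> \oo] --> limn a by rewrite cvg_shiftn.
  by apply: cvgM; (apply: cvgB => //; exact: cvg_cst).
rewrite -(cvg_lim _ cv)//; apply: limr_le; first by apply/cvg_ex; exists ((limn a - a j) ^+ 2)%R.
by apply: nearW => n; exact: H.
Qed.

(** [L] is a Lebesgue value in the mean-square sense, not merely the limit of the averages; this is
    the property that survives composition with a Lipschitz map. *)
Lemma mean_square_limit x r : closure O x -> (0 < r <= r0)%R -> scale_sum x r < +oo ->
  exists L, (((average u (ballO x r) - L) ^+ 2)%:E <= tail_cst%:E * scale_sum x r) /\
  forall j rho, (0 < rho)%R -> (rho <= r / 2 ^+ j)%R ->
  \int[LN]_(z in ballO x rho) ((u z - L) ^+ 2)%:E <=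
  (2 * (scale_cst + tail_cst) * fine (scale_sum x r) * be ^- j)%:E * LN (ballO x rho).
Proof.
move=> clx rr Soo; have [L HL] := average_limit clx rr Soo.
have Sfin : scale_sum x r \is a fin_num by rewrite ge0_fin_numE// scale_sum_ge0.
set S := fine _ in HL *; have SE : scale_sum x r = S%:E by rewrite fineK.
have S0 : (0 <= S)%R by rewrite -lee_fin -SE scale_sum_ge0.
exists L; split.
  by have := HL 0%N; rewrite expr0 divr1 invr1 mulr1 SE -EFinM lee_fin.
move=> j rho rho0 rhoj; have [i ji ri] := dyadic_scale rho0 rhoj.
have := mean_square_scale clx (dyadic_range i rr) ri.
set a := average u _; set B := ballO x rho => h.
have bji : (be ^- i <= be ^- j)%R.
  by rewrite lef_pV2 ?posrE ?exprn_gt0// ler_eXn2l.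
have K0 := scale_cst_gt0; have T0 := tail_cst_gt0.
have aL : ((a - L) ^+ 2 <= tail_cst * S * be ^- j)%R.
  apply: (le_trans (HL i)); rewrite mulrAC; apply: ler_wpM2l => //.
  by rewrite mulr_ge0// ltW.
have le1 : scale_cst%:E * local_energy x (r / 2 ^+ i) <= (scale_cst * S * be ^- j)%:E.
  apply: (@le_trans _ _ (scale_cst%:E * (S * be ^- j)%:E)); last by rewrite -EFinM mulrA.
  apply: lee_wpmul2l; first by rewrite lee_fin ltW.
  apply: (@le_trans _ _ (S * be ^- i)%:E); last by rewrite lee_fin ler_wpM2l.
  rewrite EFinM lee_pdivlMr ?exprn_gt0// muleC -SE.
  apply: le_trans (scale_sum_partial x r i.+1).
  rewrite big_nat_recr//= -[leLHS]add0e; apply: leeD => //.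
  by apply: sume_ge0 => k _; exact: term_ge0.
have mB : measurable B by exact: measurable_ballO.
have muB : measurable_fun B u by exact: measurable_funS (measurableT) (@subsetT _ _) mu.
have msq k : measurable_fun B (fun z => ((u z - k) ^+ 2)%:E).
  by apply/measurable_EFinP; apply: measurable_funX; apply: measurable_funB.
(* [a] is the average over the dyadic ball that contains [B]: the first term is the oscillation at
   that scale, the second the distance of its average to the limit. *)
apply: (@le_trans _ _ (\int[LN]_(z in B) (2%:E * ((u z - a) ^+ 2)%:E + 2%:E * ((a - L) ^+ 2)%:E))).
  apply: ge0_le_integral_nm => z _; first by rewrite lee_fin sqr_ge0.
  rewrite -!EFinM -EFinD lee_fin -subr_ge0.
  have -> : (2 * (u z - a) ^+ 2 + 2 * (a - L) ^+ 2 - (u z - L) ^+ 2 =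
    ((u z - a) - (a - L)) ^+ 2)%R by ring.
  exact: sqr_ge0.
rewrite ge0_integralD//; last 3 first.
- by move=> z _; rewrite -EFinM lee_fin mulr_ge0 ?sqr_ge0.
- by apply: emeasurable_funM.
- by move=> z _; rewrite -EFinM lee_fin mulr_ge0 ?sqr_ge0.
rewrite ge0_integralZl_EFin//; last by move=> z _; rewrite lee_fin sqr_ge0.
rewrite integral_cst//.
rewrite [X in _ <= X%:E * LN B](_ : _ = 2 * (scale_cst * S * be ^- j) + 2 * (tail_cst * S * be ^- j))%R;
  last by ring.
have P0 (k : R) : (0 <= k)%R -> (0 <= 2 * (k * S * be ^- j))%R.
  by move=> k0; rewrite mulr_ge0// mulr_ge0 ?mulr_ge0// invr_ge0 exprn_ge0// ltW.
rewrite [X in _ <= X * _]EFinD ge0_muleDl ?lee_fin; [|exact: P0 (ltW K0)|exact: P0 (ltW T0)].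
apply: leeD.
  rewrite EFinM -muleA; apply: lee_wpmul2l => //; apply: (le_trans h).
  by apply: lee_wpmul2r.
by apply: lee_wpmul2r => //; rewrite lee_fin ler_pM2l.
Qed.

(** By Jensen's inequality the average of theta(u) differs from theta(L) by at most M times the root
    mean square of u - L, which tends to 0 with the radius. *)
Lemma lipschitz_average_limit x r (L K M : R) (theta : R -> R) : closure O x ->
  (0 < r <= r0)%R -> theta 0%R = 0%R -> (0 <= M)%R ->
  (forall a b, `|theta a - theta b| <= M * `|a - b|)%R ->
  (forall j rho, (0 < rho)%R -> (rho <= r / 2 ^+ j)%R ->
    \int[LN]_(z in ballO x rho) ((u z - L) ^+ 2)%:E <= (K * be ^- j)%:E * LN (ballO x rho)) ->
  average (theta \o u) (ballO x rho) @[rho --> 0^'+] --> theta L.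
Proof.
move=> clx rr th0 M0 thM H; have /andP[r_gt0 _] := rr.
have mth : measurable_fun setT (theta \o u).
  by apply: measurableT_comp mu; exact: lipschitz_measurable thM.
have sqth a b : ((theta a - theta b) ^+ 2 <= M ^+ 2 * (a - b) ^+ 2)%R.
  rewrite -exprMn -(real_normK (num_real (_ - _))) -(real_normK (num_real (M * _))).
  rewrite lerXn2r// ?nnegrE ?normr_ge0//.
  by rewrite normrM (ger0_norm M0).
have th2 : \int[LN]_(z in O) ((theta \o u) z ^+ 2)%:E < +oo.
  apply: (@le_lt_trans _ _ (\int[LN]_(z in O) ((M ^+ 2)%:E * (u z ^+ 2)%:E))).
    apply: ge0_le_integral_nm => z _; first by rewrite lee_fin sqr_ge0.
    by rewrite -EFinM lee_fin; have := sqth (u z) 0%R; rewrite th0 !subr0.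
  rewrite ge0_integralZl_EFin ?sqr_ge0//; last 2 first.
  - by move=> z _; rewrite lee_fin sqr_ge0.
  - apply/measurable_EFinP; apply: measurable_funX.
    exact: measurable_funS (measurableT) (@subsetT _ _) mu.
  by rewrite lte_mul_pinfty// lee_fin sqr_ge0.
have key j rho : (0 < rho)%R -> (rho <= r / 2 ^+ j)%R ->
    ((average (theta \o u) (ballO x rho) - theta L) ^+ 2 <= M ^+ 2 * (K * be ^- j))%R.
  move=> rho0 rhoj; have := H j rho rho0 rhoj.
  set B := ballO x rho => HB.
  have mB : measurable B by exact: measurable_ballO.
  have B0 : 0 < LN B.
    apply: lt_le_trans (density clx (r := rho) _).
      by rewrite lte_fin mulr_gt0// exprn_gt0.
    by rewrite rho0 (le_trans rhoj)//; have /andP[] := dyadic_range j rr.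
  have Bfin : LN B \is a fin_num by rewrite ge0_fin_numE ?measure_ge0// ballO_fin.
  have b0 : (0 < fine (LN B))%R by rewrite fine_gt0// B0 ballO_fin.
  have := jensen_sqr (theta L) mB _ (ballO_integrable x rho mth th2).
  rewrite -/B B0 ballO_fin => /(_ isT) J.
  rewrite -lee_fin -(@lee_pmul2r _ (LN B))//; apply: (le_trans J).
  apply: (@le_trans _ _ (\int[LN]_(z in B) ((M ^+ 2)%:E * ((u z - L) ^+ 2)%:E))).
    apply: ge0_le_integral_nm => z _; first by rewrite lee_fin sqr_ge0.
    by rewrite -EFinM lee_fin sqth.
  rewrite ge0_integralZl_EFin ?sqr_ge0//; last 2 first.
  - by move=> z _; rewrite lee_fin sqr_ge0.
  - apply/measurable_EFinP; apply: measurable_funX; apply: measurable_funB => //.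
    exact: measurable_funS (measurableT) (@subsetT _ _) mu.
  rewrite [leRHS](_ : _ = (M ^+ 2)%:E * ((K * be ^- j)%:E * LN B)); last by rewrite muleA -EFinM.
  by apply: lee_wpmul2l; rewrite ?lee_fin ?sqr_ge0.
have B0 : (M ^+ 2 * (K * be ^- j))%R @[j --> \oo] --> (0 : R)%R.
  rewrite (_ : 0%R = M ^+ 2 * (K * 0))%R; last by rewrite !mulr0.
  apply: cvgMr; apply: cvgMr.
  under eq_fun do rewrite -exprVn.
  by apply: cvg_expr; rewrite gtr0_norm ?invr_gt0// invf_lt1.
apply/cvgrPdist_lt => eps eps0.
move/cvgrPdist_lt : B0 => /(_ (eps ^+ 2)%R).
rewrite exprn_gt0// => /(_ isT) [j _ /(_ j (leqnn j))].
rewrite sub0r normrN => hj.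
near=> rho.
rewrite distrC -(@ltr_pXn2r _ 2)// ?nnegrE ?normr_ge0 ?(ltW eps0)//.
rewrite real_normK ?num_real//; apply: le_lt_trans (le_lt_trans (ler_norm _) hj).
apply: key; first by near: rho; exact: nbhs_right_gt.
by near: rho; apply: nbhs_right_le; exact: half_gt0.
Unshelve. all: by end_near.
Qed.

Lemma trace_lipschitz x r M theta : closure O x -> (0 < r <= r0)%R ->
  scale_sum x r < +oo -> theta 0%R = 0%R -> (0 <= M)%R ->
  (forall a b, `|theta a - theta b| <= M * `|a - b|)%R ->
  trace O (theta \o u) x = theta (trace O u x).
Proof.
move=> clx rr Soo th0 M0 thM.
have [L [_ H]] := mean_square_limit clx rr Soo.
have H1 : trace O u x = L.
  apply: cvg_lim => //.
  (* The case of the identity map identifies [L] with the trace of [u]. *)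
  apply: (@lipschitz_average_limit x r L _ 1 id clx rr) => // [a b|]; last exact: H.
  by rewrite mul1r.
by rewrite H1; apply: cvg_lim => //; apply: (lipschitz_average_limit clx rr th0 M0 thM H).
Qed.

Lemma trace_average x r : closure O x -> (0 < r <= r0)%R ->
  ((trace O u x - average u (ballO x r)) ^+ 2)%:E <= tail_cst%:E * scale_sum x r.
Proof.
(* Where the sum is infinite the bound holds trivially, whatever default value the trace takes
   there. *)
move=> clx rr; have [->|Soo] := eqVneq (scale_sum x r) +oo.
  by rewrite gt0_muley ?leey// lte_fin tail_cst_gt0.
have [L [H0 H]] := mean_square_limit clx rr (ltac:(by rewrite ltey)).
have -> : trace O u x = L; last by rewrite -sqrrN opprB.
apply: cvg_lim => //.
apply: (@lipschitz_average_limit x r L _ 1 id clx rr) => // [a b|]; last exact: H.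
by rewrite mul1r.
Qed.


End scales.

(** * The Nash argument for a measure with a lower bound on balls *)

Section nash.
Variables (R : realType) (N : nat).
Local Notation X := (RN R N).
Implicit Types (x y z : X) (r : R).
Local Open Scope ereal_scope.

(** As a set of pairs it turns integrals over balls with a moving centre into sections of one
    function on the product, to which Tonelli's theorem applies. *)
Definition near_pairs r : set (X * X) := [set p | (edist p.1 p.2 < r)%R].

Lemma measurable_near_pairs r : measurable (near_pairs r).
Proof.
rewrite -[near_pairs r]setTI.
rewrite (_ : near_pairs r = (fun p : X * X => edist p.1 p.2) @^-1` `]-oo, r[); last first.
  by apply/seteqP; split => p; rewrite /near_pairs /= in_itv.
by apply: measurable_edist.
Qed.

Lemma measurable_near_indic r : measurable_fun setT (fun p : X * X => (\1_(near_pairs r) p : R)%:E).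
Proof. by apply/measurable_EFinP; apply: measurable_indic; exact: measurable_near_pairs. Qed.

Lemma near_pairsC r x y : (\1_(near_pairs r) (x, y) : R) = \1_(near_pairs r) (y, x).
Proof.
rewrite !indicE; congr (_%:R); congr (nat_of_bool _).
by apply/idP/idP => /set_mem h; apply/mem_set; move: h; rewrite /near_pairs/= edistC.
Qed.

Lemma measurable_near1 r x : measurable_fun setT (fun y => (\1_(near_pairs r) (x, y) : R)%:E).
Proof. exact: measurableT_comp (measurable_near_indic r) (measurable_pair1 x). Qed.

Lemma measurable_near2 r y : measurable_fun setT (fun x => (\1_(near_pairs r) (x, y) : R)%:E).
Proof. exact: measurableT_comp (measurable_near_indic r) (measurable_pair2 y). Qed.

Variables (nu : {sigma_finite_measure set X -> \bar R}) (F : set X).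
Hypothesis mF : measurable F.

Let mFsnd : measurable_fun setT (fun p : X * X => (\1_F p.2 : R)%:E).
Proof.
apply/measurable_EFinP.
rewrite (_ : (fun _ => _) = \1_(snd @^-1` F))//; apply: measurable_indic.
by rewrite -[X in measurable X]setTI; exact: measurable_snd.
Qed.

Let mFfst : measurable_fun setT (fun p : X * X => (\1_F p.1 : R)%:E).
Proof.
apply/measurable_EFinP.
rewrite (_ : (fun _ => _) = \1_(fst @^-1` F))//; apply: measurable_indic.
by rewrite -[X in measurable X]setTI; exact: measurable_fst.
Qed.

Lemma ball_integralE x r (f : X -> \bar R) :
  \int[nu]_(y in eball x r `&` F) f y =
  \int[nu]_y ((\1_F y)%:E * (\1_(near_pairs r) (x, y))%:E * f y).
Proof.
rewrite integral_indic_mul; apply: eq_integral => y _.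
rewrite indicI /= -EFinM mulrC; congr (_%:E * _).
Qed.

Lemma measurable_ball_integral r (f : X -> \bar R) :
  measurable_fun setT f -> (forall y, 0 <= f y) ->
  measurable_fun setT (fun x => \int[nu]_(y in eball x r `&` F) f y).
Proof.
move=> mf f0.
pose g (p : X * X) := (\1_F p.2)%:E * (\1_(near_pairs r) p)%:E * f p.2.
have -> : (fun x => \int[nu]_(y in eball x r `&` F) f y) = fubini_F nu g.
  by apply/funext => x; rewrite ball_integralE.
apply: measurable_fun_fubini_tonelli_F => [|p]; last by rewrite !mule_ge0.
apply: emeasurable_funM; first by apply: emeasurable_funM => //; exact: measurable_near_indic.
exact: measurableT_comp mf measurable_snd.
Qed.

Let mFE : measurable_fun setT (fun y => (\1_F y : R)%:E).
Proof. by apply/measurable_EFinP; exact: measurable_indic. Qed.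

(** Tonelli's theorem, as |x - y| < r is symmetric. Each point [y] is counted with the measure of
    the part of [F'] that lies within [r] of it. *)
Lemma ball_integral_swap (nu' : {sigma_finite_measure set X -> \bar R})
    (F' : set X) r (f : X -> \bar R) : measurable F' ->
  measurable_fun setT f -> (forall y, 0 <= f y) ->
  \int[nu']_(x in F') \int[nu]_(y in eball x r `&` F) f y =
  \int[nu]_(y in F) (f y * nu' (eball y r `&` F')).
Proof.
move=> mF' mf f0.
pose g (p : X * X) := (\1_F' p.1)%:E * ((\1_F p.2)%:E * (\1_(near_pairs r) p)%:E * f p.2).
have mg : measurable_fun setT g.
  apply: emeasurable_funM.
    apply/measurable_EFinP.
    rewrite (_ : (fun _ => _) = \1_(fst @^-1` F'))//; apply: measurable_indic.
    by rewrite -[X in measurable X]setTI; exact: measurable_fst.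
  apply: emeasurable_funM; first by apply: emeasurable_funM => //; exact: measurable_near_indic.
  exact: measurableT_comp mf measurable_snd.
have g0 p : 0 <= g p by rewrite !mule_ge0.
transitivity (\int[nu']_x \int[nu]_y g (x, y)).
  rewrite integral_indic_mul; apply: eq_integral => x _.
  rewrite ball_integralE -ge0_integralZl//.
  - by apply: emeasurable_funM => //; apply: emeasurable_funM => //; exact: measurable_near1.
  - by move=> y _; rewrite !mule_ge0.
rewrite (@fubini_tonelli _ _ _ _ _ nu' nu g mg g0) [RHS]integral_indic_mul.
apply: eq_integral => y _; rewrite /g/=.
transitivity (\int[nu']_x (((\1_F y)%:E * f y) *
    ((\1_F' x)%:E * (\1_(near_pairs r) (x, y))%:E))).
  by apply: eq_integral => x _; rewrite [X in _ * X = _]muleAC muleCA.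
rewrite ge0_integralZl ?mule_ge0//; last first.
  apply: emeasurable_funM; last exact: measurable_near2.
  by apply/measurable_EFinP; exact: measurable_indic.
rewrite -muleA; congr (_ * (_ * _)).
have mB : measurable (eball y r `&` F') by apply: measurableI => //; exact: measurable_eball.
rewrite -[RHS]mul1e -integral_cst// [RHS]integral_mkcond.
apply: eq_integral => x _; rewrite /patch.
rewrite near_pairsC !indicE.
have -> : (y, x) \in near_pairs r = (x \in eball y r).
  by apply/idP/idP => /set_mem h; apply/mem_set.
rewrite in_setI; case: (x \in F'); case: (x \in eball y r) => /=;
  by rewrite ?mul1e ?mul0e.
Qed.

(** Integrate f(x)^2 <= 2 |f(x)| |f(y)| + (f(x) - f(y))^2 over y in the ball about x, of measure at
    least [v], and then over x. No Sobolev embedding is involved. *)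
Lemma nash_core (f : X -> R) r (v : R) : measurable_fun setT f -> (0 <= v)%R ->
  (forall x, F x -> v%:E <= nu (eball x r `&` F)) ->
  v%:E * \int[nu]_(x in F) (f x ^+ 2)%:E <=
  2%:E * (\int[nu]_(x in F) `|f x|%:E) ^+ 2 +
  \int[nu]_(x in F) \int[nu]_(y in eball x r `&` F) ((f x - f y) ^+ 2)%:E.
Proof.
move=> mf v0 vF.
have mfF : measurable_fun F f by exact: measurable_funS (measurableT) (@subsetT _ _) mf.
have mnf : measurable_fun F (fun x => `|f x|%:E).
  by apply/measurable_EFinP; apply: measurableT_comp mfF.
set I := \int[nu]_(x in F) `|f x|%:E.
have I0 : 0 <= I by apply: integral_ge0 => x _; rewrite lee_fin.
pose g (p : X * X) := (\1_F p.2)%:E * (\1_(near_pairs r) p)%:E * ((f p.1 - f p.2) ^+ 2)%:E.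
have mg : measurable_fun setT g.
  apply: emeasurable_funM; first by apply: emeasurable_funM => //; exact: measurable_near_indic.
  apply/measurable_EFinP; apply: measurable_funX; apply: measurable_funB.
    exact: measurableT_comp mf measurable_fst.
  exact: measurableT_comp mf measurable_snd.
have g0 p : 0 <= g p by rewrite !mule_ge0// lee_fin sqr_ge0.
have gE x : \int[nu]_(y in eball x r `&` F) ((f x - f y) ^+ 2)%:E = fubini_F nu g x.
  by rewrite ball_integralE.
have mG : measurable_fun F (fubini_F nu g).
  apply: (measurable_funS measurableT) => //.
  exact: measurable_fun_fubini_tonelli_F.
rewrite -ge0_integralZl_EFin//; last 2 first.
- by move=> x _; rewrite lee_fin sqr_ge0.
- by apply/measurable_EFinP; exact: measurable_funX.
under [X in _ <= _ + X]eq_integral do rewrite gE.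
apply: (@le_trans _ _ (\int[nu]_(x in F) ((2%:E * I) * `|f x|%:E + fubini_F nu g x))).
  apply: ge0_le_integral_nm => x Fx; first by rewrite mule_ge0// lee_fin sqr_ge0.
  apply: (@le_trans _ _ (nu (eball x r `&` F) * (f x ^+ 2)%:E)).
    by rewrite lee_wpmul2r ?vF// lee_fin sqr_ge0.
  have mB : measurable (eball x r `&` F) by apply: measurableI => //; exact: measurable_eball.
  rewrite muleC -integral_cst//.
  have mfB : measurable_fun (eball x r `&` F) f.
    exact: measurable_funS (measurableT) (@subsetT _ _) mf.
  apply: (@le_trans _ _ (\int[nu]_(y in eball x r `&` F)
     ((2 * `|f x|)%:E * `|f y|%:E + ((f x - f y) ^+ 2)%:E))).
    apply: ge0_le_integral_nm => y _; first by rewrite lee_fin sqr_ge0.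
    rewrite -EFinM -EFinD lee_fin.
    have : (f x * f y <= `|f x| * `|f y|)%R by rewrite -normrM ler_norm.
    have := sqr_ge0 (f y); nra.
  rewrite ge0_integralD//; last 3 first.
  - apply: emeasurable_funM => //; apply/measurable_EFinP.
    exact: measurableT_comp mfB.
  - by move=> y _; rewrite lee_fin sqr_ge0.
  - by apply/measurable_EFinP; apply: measurable_funX; apply: measurable_funB.
  rewrite gE; apply: leeD => //.
  rewrite ge0_integralZl_EFin ?mulr_ge0//; last first.
    by apply/measurable_EFinP; exact: measurableT_comp mfB.
  rewrite EFinM -muleA [leRHS]muleAC -muleA; apply: lee_wpmul2l => //.
  by apply: lee_wpmul2l => //; apply: ge0_subset_integral => // y [].
rewrite ge0_integralD//; last 2 first.
- by apply: emeasurable_funM.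
- by move=> x _; apply: integral_ge0.
rewrite ge0_integralZl//; last by rewrite mule_ge0.
  by rewrite -muleA.
by move=> x _; rewrite !mule_ge0.
Qed.

End nash.

Lemma inv_exp2_powR (R : realType) (a : R) (j : nat) :
  (2 ^+ j)^-1 `^ (2 * a) = ((2 `^ a) ^+ j)^-1 ^+ 2.
Proof.
have t0 : 0 <= 2 ^+ j :> R by rewrite exprn_ge0.
have E : (2 ^+ j) `^ (2 * a) = ((2 `^ a) ^+ j) ^+ 2.
  have -> : 2 ^+ j = 2 `^ j%:R :> R by rewrite powR_mulrn.
  have -> : (2 `^ a) ^+ j = 2 `^ (a * j%:R) by rewrite powRrM powR_mulrn// powR_ge0.
  rewrite -powRrM expr2 -powRD ?pnatr_eq0 ?implybT//.
  by congr (_ `^ _); ring.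
by rewrite -[X in X `^ _ = _]powR_inv1// -powRrM mulN1r powRN E exprVn.
Qed.

(** The sums [Sx] and [Sy] may be infinite; the infinite cases are separated from the linear
    arithmetic of the finite one. *)
Lemma three_terms_le (R : realType) (T K : R) (A B D Sx Sy : \bar R) :
  0 < T -> 0 < K -> (0 <= Sx)%E -> (0 <= Sy)%E ->
  (A <= T%:E * Sx)%E -> (B <= K%:E * Sx)%E -> (D <= T%:E * Sy)%E ->
  (3%:E * (A + B + D) <= (3 * (2 * T + K))%:E * (Sx + Sy))%E.
Proof.
move=> T0 K0 Sx0 Sy0 hA hB hD.
have M0 : 0 < 3 * (2 * T + K) by rewrite mulr_gt0// addr_gt0// mulr_gt0.
apply: (@le_trans _ _ (3%:E * (T%:E * Sx + K%:E * Sx + T%:E * Sy))%E).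
  by apply: lee_wpmul2l => //; exact: leeD (leeD hA hB) hD.
case: Sx Sx0 {hA hB} => [x x0| _|//]; last by rewrite addye ?gt0_muley ?leey// -ltNye (lt_le_trans _ Sy0).
case: Sy Sy0 {hD} => [y y0| _|//]; last first.
  by rewrite [X in (_ <= _ * X)%E]addey// [leRHS]gt0_muley ?leey.
rewrite !lee_fin in x0 y0; rewrite -!(EFinM, EFinD) lee_fin; nra.
Qed.

Lemma ge0_integral_addl dsp (Y : measurableType dsp) (R : realType)
    (m : {measure set Y -> \bar R}) (B : set Y) (k : \bar R) (g : Y -> \bar R) :
  measurable B -> (0 <= k)%E -> measurable_fun B g -> (forall y, (0 <= g y)%E) ->
  (\int[m]_(y in B) (k + g y) = k * m B + \int[m]_(y in B) g y)%E.
Proof. by move=> mB k0 mg g0; rewrite ge0_integralD// integral_cst. Qed.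

(** * Nash inequalities in the domain and for traces on its boundary *)

Section nash_domain.
Variables (R : realType) (N : nat).
Local Notation X := (RN R N).
Local Notation LN := (lebesgue_RN R N).
Variables (O F : set X) (s d c r0 c1 c2 : R).
Variable nu : {finite_measure set X -> \bar R}.
Hypotheses (mO : measurable O) (mF : measurable F) (FO : F `<=` closure O).
Hypotheses (s0 : 0 < s) (c0 : 0 < c) (r00 : 0 < r0) (r01 : r0 <= 2^-1).
Hypotheses (c10 : 0 < c1) (c20 : 0 < c2) (d0 : 0 < d).
Let al : R := alpha N s d.
Hypothesis al0 : 0 < al.
Hypothesis density : forall x r, closure O x -> 0 < r <= r0 ->
  ((c * r ^+ N)%:E <= LN (eball x r `&` O))%E.
Hypothesis nu_lower : forall x r, F x -> 0 < r <= r0 ->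
  ((c1 * r `^ d)%:E <= nu (eball x r `&` F))%E.
Hypothesis nu_upper : forall x r, 0 < r <= r0 ->
  (nu (eball x r `&` F) <= (c2 * r `^ d)%:E)%E.
Variable u : X -> R.
Hypotheses (mu : measurable_fun setT u)
  (u2 : (\int[LN]_(x in O) (u x ^+ 2)%:E < +oo)%E).
Local Open Scope ereal_scope.
Implicit Types (x y z : X) (r : R).

Let e : R := (N%:R + 2 * s)%R.
Let dens := gdensity O e u.
Let G := \int[LN]_(z in O) dens z.
(** A ratio between 1 and 2^(2 alpha): above 1 for the telescoping of averages, below 2^(2 alpha)
    for the sum of the boundary integrals of the local energies. *)
Let be : R := (2 `^ al)%R.
Let be1 : (1 < be)%R.
Proof. by rewrite /be /powR pnatr_eq0/= expR_gt1 mulr_gt0// ln_gt0// ltr1n. Qed.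

Let S := scale_sum O s u be.

Let mdens : measurable_fun setT dens.
Proof. exact: measurable_gdensity. Qed.

Lemma measurable_local_energy r : measurable_fun setT (fun x => local_energy O s u x r).
Proof.
apply: emeasurable_funM => //.
by apply: measurable_ball_integral => // z; exact: gdensity_ge0.
Qed.

Lemma measurable_scale_sum r : measurable_fun setT (fun x => S x r).
Proof.
apply: ge0_emeasurable_sum => [k x _ _|k _].
  by rewrite mule_ge0 ?local_energy_ge0// lee_fin exprn_ge0// powR_ge0.
by apply: emeasurable_funM => //; exact: measurable_local_energy.
Qed.

(** After exchanging the integrations each point z of [O] carries the weight nu(B(z,r) cap F) <= c2
    r^d, and (2s - N) + d = 2 alpha. *)
Lemma integral_local_energy r : (0 < r <= r0)%R ->
  \int[nu]_(x in F) local_energy O s u x r <= (c2 * r `^ (2 * al))%:E * G.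
Proof.
move=> rr; have /andP[r_gt0 _] := rr.
rewrite /local_energy ge0_integralZl_EFin ?powR_ge0//; last 2 first.
- by move=> x _; apply: integral_ge0 => z _; exact: gdensity_ge0.
- apply: (measurable_funS measurableT) => //.
  by apply: measurable_ball_integral => // z; exact: gdensity_ge0.
rewrite (@ball_integral_swap _ _ LN O mO nu F r dens mF mdens); last by move=> z; exact: gdensity_ge0.
apply: (@le_trans _ _ ((r `^ (2 * s - N%:R))%:E * ((c2 * r `^ d)%:E * G))).
  apply: lee_wpmul2l; first by rewrite lee_fin powR_ge0.
  rewrite /G -ge0_integralZl_EFin//; last 3 first.
  - by move=> z _; exact: gdensity_ge0.
  - exact: measurable_funS (measurableT) (@subsetT _ _) mdens.
  - by rewrite mulr_ge0 ?powR_ge0// ltW.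
  apply: ge0_le_integral_nm => z _; first by rewrite mule_ge0// gdensity_ge0.
  by rewrite muleC; apply: lee_wpmul2r; [exact: gdensity_ge0|exact: nu_upper].
rewrite muleA -EFinM mulrCA -powRD ?(gt_eqF r_gt0) ?implybT//.
rewrite le_eqVlt; apply/orP; left; apply/eqP; congr ((_ * _ `^ _)%:E * _).
by rewrite /al /alpha; field.
Qed.

(** Sum of a geometric series of ratio 1/be: the weight be^j meets (2^-j)^(2 alpha) = be^(-2j). *)
Definition sum_cst : R := (c2 / (1 - be^-1))%R.

Lemma integral_scale_sum r : (0 < r <= r0)%R ->
  \int[nu]_(x in F) S x r <= (sum_cst * r `^ (2 * al))%:E * G.
Proof.
move=> rr; have /andP[r_gt0 rr0] := rr.
have b0 : (0 < be)%R by rewrite powR_gt0.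
have b1 : (0 < 1 - be^-1)%R by rewrite subr_gt0 invf_lt1 ?be1.
have G0 : 0 <= G by apply: integral_ge0 => z _; exact: gdensity_ge0.
rewrite integral_nneseries//; last 2 first.
- move=> n; apply: emeasurable_funM => //.
  by apply: (measurable_funS measurableT) => //; exact: measurable_local_energy.
- by move=> n x _; rewrite mule_ge0 ?local_energy_ge0// lee_fin exprn_ge0// ltW.
apply: lime_le.
  apply: is_cvg_nneseries => n _ _; apply: integral_ge0 => x _.
  by rewrite mule_ge0 ?local_energy_ge0// lee_fin exprn_ge0// ltW.
apply: nearW => n.
apply: (@le_trans _ _ (\sum_(0 <= j < n) (c2 * r `^ (2 * al) * be^-1 ^+ j)%:E * G)).
  apply: lee_sum => j _.
  have t0 : (0 < 2 ^+ j :> R)%R by rewrite exprn_gt0.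
  have rj : (0 < r / 2 ^+ j <= r0)%R.
    rewrite divr_gt0//= (le_trans _ rr0)// ler_pdivrMr// ler_peMr ?(ltW r_gt0)//.
    by rewrite exprn_ege1// ler1n.
  rewrite ge0_integralZl_EFin ?exprn_ge0 ?(ltW b0)//; last 2 first.
  - by move=> x _; exact: local_energy_ge0.
  - by apply: (measurable_funS measurableT) => //; exact: measurable_local_energy.
  apply: (@le_trans _ _ ((be ^+ j)%:E * ((c2 * (r / 2 ^+ j) `^ (2 * al))%:E * G))).
    by apply: lee_wpmul2l; [rewrite lee_fin exprn_ge0// ltW|exact: integral_local_energy].
  rewrite muleA -EFinM le_eqVlt; apply/orP; left; apply/eqP; congr (_%:E * _).
  rewrite powRM ?invr_ge0 ?(ltW t0) ?(ltW r_gt0)//.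
  rewrite inv_exp2_powR -/be.
  have : (be ^+ j != 0)%R by rewrite expf_neq0// gt_eqF.
  by rewrite [(be^-1 ^+ j)%R]exprVn; move: (be ^+ j)%R => q q0; field.
rewrite -ge0_sume_distrl; last first.
  by move=> j _; rewrite lee_fin !mulr_ge0 ?powR_ge0 ?exprn_ge0 ?invr_ge0// ltW.
apply: lee_wpmul2r => //; rewrite sumEFin lee_fin -mulr_sumr /sum_cst.
rewrite [leRHS]mulrAC; apply: ler_wpM2l; first by rewrite mulr_ge0 ?powR_ge0// ltW.
rewrite -[leRHS]mul1r ler_pdivlMr//.
have -> : (\sum_(0 <= i < n) be^-1 ^+ i = (1 - be^-1 ^+ n) / (1 - be^-1))%R.
  rewrite big_mkord; apply: (mulfI (lt0r_neq0 b1)); rewrite mulrCA divff ?gt_eqF// mulr1.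
  by rewrite -[LHS]opprK -mulNr opprB -subrX1 opprB.
by rewrite mulfVK ?gt_eqF// gerBl exprn_ge0// invr_ge0 ltW.
Qed.

Let finG : forall x, 0 <= dens x. Proof. by move=> x; exact: gdensity_ge0. Qed.

(** Inside the domain the squared difference of a pair at distance less than [r] is directly at most
    r^e times the Gagliardo kernel. *)
Lemma nash_interior r : (0 < r <= r0)%R ->
  (c * r ^+ N)%:E * \int[LN]_(x in O) (u x ^+ 2)%:E <=
  2%:E * (\int[LN]_(x in O) `|u x|%:E) ^+ 2 + (r `^ e)%:E * G.
Proof.
move=> rr; have /andP[r_gt0 rr0] := rr.
have e0 : (0 <= e)%R by rewrite addr_ge0// mulr_ge0// ltW.
apply: le_trans (nash_core mO (r := r) mu _ _) _.
- by rewrite mulr_ge0 ?exprn_ge0 ?ltW.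
- by move=> x Ox; apply: density => //; exact: subset_closure.
apply: leeD => //; rewrite /G -ge0_integralZl_EFin ?powR_ge0//; last first.
  exact: measurable_funS (measurableT) (@subsetT _ _) mdens.
apply: ge0_le_integral_nm => x _; first by apply: integral_ge0 => y _; rewrite lee_fin sqr_ge0.
rewrite /dens /gdensity -ge0_integralZl_EFin ?powR_ge0//; last 2 first.
- by move=> y _; rewrite lee_fin gkernel_ge0.
- apply: (measurable_funS measurableT) => //.
  by apply/measurable_EFinP; apply: measurableT_comp (measurable_pair1 x); exact: measurable_gkernel.
apply: (@le_trans _ _ (\int[LN]_(y in eball x r `&` O) ((r `^ e)%:E * (gkernel e u (x, y))%:E))).
  apply: ge0_le_integral_nm => y [xy _]; first by rewrite lee_fin sqr_ge0.
  by rewrite -EFinM lee_fin -sqrrN opprB; apply: sqr_le_gkernel => //; exact: ltW xy.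
apply: ge0_subset_integral => //.
- by apply: measurableI => //; exact: measurable_eball.
- apply: (measurable_funS measurableT) => //; apply: emeasurable_funM => //.
  by apply/measurable_EFinP; apply: measurableT_comp (measurable_pair1 x); exact: measurable_gkernel.
- by move=> y _; rewrite mule_ge0// lee_fin ?powR_ge0 ?gkernel_ge0.
Qed.

(** Three steps lead from the trace at x to the average about x, to the average about y, to the
    trace at y: two tails, one comparison, and the factor 3 for the square of a sum of three
    terms. *)
Definition bd_cst : R := (3 * (2 * tail_cst N s c be + scale_cst N s c))%R.

Lemma trace_pair_le x y r : closure O x -> closure O y -> (0 < r <= r0)%R ->
  (edist x y < r)%R ->
  ((trace O u x - trace O u y) ^+ 2)%:E <= bd_cst%:E * (S x r + S y r).
Proof.
move=> clx cly rr xy; have /andP[r_gt0 _] := rr.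
have T0 := tail_cst_gt0 N s c0 be1; have K0 := scale_cst_gt0 N s c0.
have r2 : (r / 2 <= r <= r)%R by apply/andP; split; lra.
have b0 : (0 < be)%R by rewrite powR_gt0.
have Sx0 : 0 <= S x r by exact: scale_sum_ge0.
have Sy0 : 0 <= S y r by exact: scale_sum_ge0.
have hx := trace_average mO s0 c0 density mu u2 be1 clx rr.
have hy := trace_average mO s0 c0 density mu u2 be1 cly rr.
have hxy := average_close mO s0 c0 density mu u2 clx cly rr r2 r2 (ltW xy).
have hS : local_energy O s u x r <= S x r.
  have := scale_sum_partial O s u be1 x r 1; rewrite big_nat1 expr0 mul1e.
  by rewrite expr0 divr1.
set ax := average _ _ in hx hxy; set ay := average _ _ in hy hxy.
apply: (@le_trans _ _ (3%:E * (((trace O u x - ax) ^+ 2)%:E + ((ax - ay) ^+ 2)%:E +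
    ((trace O u y - ay) ^+ 2)%:E))).
  rewrite -!EFinD -EFinM lee_fin.
  move: (trace O u x) (trace O u y) => tx ty.
  have := sqr_ge0 ((tx - ax) - (ax - ay)); have := sqr_ge0 ((ax - ay) - (ay - ty)).
  have := sqr_ge0 ((tx - ax) - (ay - ty)); nra.
have h2 : ((ax - ay) ^+ 2)%:E <= (scale_cst N s c)%:E * S x r.
  by apply: (le_trans hxy); apply: lee_wpmul2l => //; rewrite lee_fin ltW.
rewrite /bd_cst; exact: three_terms_le T0 K0 Sx0 Sy0 hx h2 hy.
Qed.

(** [f] is a measurable function that equals the trace almost everywhere; the trace itself, a limit
    over real radii with default values, is never shown to be measurable. *)
Lemma nash_boundary (f : X -> R) r : measurable_fun setT f ->
  {ae nu, forall x, F x -> f x = trace O u x} -> (0 < r <= r0)%R ->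
  (c1 * r `^ d)%:E * \int[nu]_(x in F) (f x ^+ 2)%:E <=
  2%:E * (\int[nu]_(x in F) `|f x|%:E) ^+ 2 +
  (2 * bd_cst * c2 * sum_cst * r `^ d * r `^ (2 * al))%:E * G.
Proof.
move=> mf ftr rr; have /andP[r_gt0 rr0] := rr.
have b0 : (0 < be)%R by rewrite powR_gt0.
have T0 := tail_cst_gt0 N s c0 be1; have K0 := scale_cst_gt0 N s c0.
have M0 : (0 <= bd_cst)%R.
  apply: mulr_ge0 => //; apply: addr_ge0; last exact: ltW.
  by apply: mulr_ge0 => //; exact: ltW.
(* Hides the series behind the four properties on which the rest of the argument relies. *)
have [S' [S0 mS SG Spair]] : exists S' : X -> \bar R, [/\ forall x, 0 <= S' x,
    measurable_fun setT S',
    \int[nu]_(x in F) S' x <= (sum_cst * r `^ (2 * al))%:E * G &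
    forall x y, F x -> F y -> (edist x y < r)%R ->
      ((trace O u x - trace O u y) ^+ 2)%:E <= bd_cst%:E * (S' x + S' y)].
  exists (fun x => S x r); split.
  - by move=> x; exact: scale_sum_ge0.
  - exact: measurable_scale_sum.
  - exact: integral_scale_sum.
  - by move=> x y Fx Fy xy; apply: trace_pair_le => //; exact: FO.
have msq x : measurable_fun setT (fun y => ((f x - f y) ^+ 2)%:E).
  by apply/measurable_EFinP; apply: measurable_funX; apply: measurable_funB.
have mBx x : measurable (eball x r `&` F).
  by apply: measurableI => //; exact: measurable_eball.
apply: le_trans (nash_core mF (r := r) mf _ _) _.
- by rewrite mulr_ge0 ?powR_ge0 ?ltW.
- by move=> x Fx; exact: nu_lower.
apply: leeD => //.
have mnuB : measurable_fun setT (fun x => nu (eball x r `&` F)).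
  have -> : (fun x => nu (eball x r `&` F)) = fun x => \int[nu]_(y in eball x r `&` F) (cst 1 y).
    by apply/funext => x; rewrite integral_cst// mul1e.
  by apply: measurable_ball_integral.
have mIS : measurable_fun setT (fun x => \int[nu]_(y in eball x r `&` F) S' y).
  exact: measurable_ball_integral.
have mFS (g : X -> \bar R) : measurable_fun setT g -> measurable_fun F g.
  exact: measurable_funS.
have IS0 x : 0 <= \int[nu]_(y in eball x r `&` F) S' y by exact: integral_ge0.
apply: (@le_trans _ _ (\int[nu]_(x in F) (bd_cst%:E * (S' x * nu (eball x r `&` F) +
    \int[nu]_(y in eball x r `&` F) S' y)))).
  apply: ae_ge0_le_integral => //.
  - by move=> x _; apply: integral_ge0 => y _; rewrite lee_fin sqr_ge0.
  - apply: mFS.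
    pose g (p : X * X) := (\1_F p.2)%:E * (\1_(near_pairs r) p)%:E * ((f p.1 - f p.2) ^+ 2)%:E.
    rewrite (_ : (fun x => _) = fubini_F nu g); last first.
      by apply/funext => x; rewrite ball_integralE.
    apply: measurable_fun_fubini_tonelli_F; last by move=> p; rewrite !mule_ge0// lee_fin sqr_ge0.
    apply: emeasurable_funM.
      apply: emeasurable_funM; last exact: measurable_near_indic.
      apply/measurable_EFinP.
      rewrite (_ : (fun _ => _) = \1_(snd @^-1` F))//; apply: measurable_indic.
      by rewrite -[X in measurable X]setTI; exact: measurable_snd.
    apply/measurable_EFinP; apply: measurable_funX; apply: measurable_funB.
      exact: measurableT_comp mf measurable_fst.
    exact: measurableT_comp mf measurable_snd.
  - by move=> x _; rewrite !mule_ge0// adde_ge0// mule_ge0.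
  - by apply: mFS; apply: emeasurable_funM => //; apply: emeasurable_funD => //; apply: emeasurable_funM.
  apply: filterS (ftr) => x fx Fx.
  have mSB : measurable_fun (eball x r `&` F) S' by exact: measurable_funS (measurableT) (@subsetT _ _) mS.
  rewrite -(ge0_integral_addl nu (mBx x) (S0 x) mSB S0).
  rewrite -ge0_integralZl_EFin//; last 2 first.
  - by move=> y _; rewrite adde_ge0.
  - by apply: emeasurable_funD.
  apply: ae_ge0_le_integral => //.
  - by move=> y _; rewrite lee_fin sqr_ge0.
  - exact: measurable_funS (measurableT) (@subsetT _ _) (msq x).
  - by move=> y _; rewrite mule_ge0// adde_ge0.
  - by apply: emeasurable_funM => //; apply: emeasurable_funD.
  apply: filterS (ftr) => y fy [/= xy Fy].
  by rewrite (fx Fx) (fy Fy); exact: Spair.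
rewrite ge0_integralZl_EFin//; last 2 first.
- by move=> x _; rewrite adde_ge0// mule_ge0.
- by apply: mFS; apply: emeasurable_funD => //; apply: emeasurable_funM.
rewrite ge0_integralD//; last 3 first.
- by move=> x _; rewrite mule_ge0.
- by apply: mFS; apply: emeasurable_funM.
- by apply: mFS.
rewrite (@ball_integral_swap _ _ nu F mF nu F r S' mF mS S0).
set W := \int[nu]_(x in F) (S' x * nu (eball x r `&` F)).
have WG : W <= (c2 * r `^ d * (sum_cst * r `^ (2 * al)))%:E * G.
  apply: (@le_trans _ _ ((c2 * r `^ d)%:E * \int[nu]_(x in F) S' x)).
    rewrite -ge0_integralZl_EFin//; last 2 first.
    - exact: mFS.
    - by rewrite mulr_ge0 ?powR_ge0// ltW.
    apply: ge0_le_integral_nm => x _; first by rewrite mule_ge0.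
    by rewrite muleC; apply: lee_wpmul2r => //; exact: nu_upper.
  rewrite [leRHS](_ : _ = (c2 * r `^ d)%:E * ((sum_cst * r `^ (2 * al))%:E * G)).
    by apply: lee_wpmul2l => //; rewrite lee_fin mulr_ge0 ?powR_ge0// ltW.
  by rewrite muleA -EFinM.
(* The contributions of the two points of a pair agree after the swap of integrations, whence the
   factor 2 in the constant. *)
have -> : W + W = 2%:E * W by rewrite -mule2n -mule_natl.
rewrite muleA -EFinM.
rewrite [leRHS](_ : _ = (bd_cst * 2)%:E * ((c2 * r `^ d * (sum_cst * r `^ (2 * al)))%:E * G)).
  by apply: lee_wpmul2l => //; rewrite lee_fin mulr_ge0.
by rewrite muleA -EFinM; congr (_%:E * _); ring.
Qed.

(** Finite Gagliardo energy bounds the boundary integral of the scale sum, so the limit of averages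
    exists at almost every boundary point. *)
Lemma scale_sum_ae_fin : G < +oo -> {ae nu, forall x, F x -> S x r0 < +oo}.
Proof.
move=> Goo; have r00' : (0 < r0 <= r0)%R by rewrite r00 lexx.
have b0 : (0 < be)%R by rewrite powR_gt0.
have S0 x : 0 <= S x r0 by exact: scale_sum_ge0.
have iS : nu.-integrable F (fun x => S x r0).
  apply/integrableP; split.
    exact: measurable_funS (measurableT) (@subsetT _ _) (measurable_scale_sum r0).
  under eq_integral do rewrite gee0_abs//.
  apply: (le_lt_trans (integral_scale_sum r00')); rewrite lte_mul_pinfty// lee_fin.
  rewrite mulr_ge0 ?powR_ge0// /sum_cst divr_ge0// ?(ltW c20)// subr_ge0.
  by rewrite invf_le1// ltW.
have := integrable_ae mF iS; apply: filterS => x h Fx.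
by have := h Fx; rewrite ge0_fin_numE.
Qed.

Lemma trace_lipschitz_ae M theta : G < +oo -> theta 0%R = 0%R -> (0 <= M)%R ->
  (forall a b, `|theta a - theta b| <= M * `|a - b|)%R ->
  {ae nu, forall x, F x -> trace O (theta \o u) x = theta (trace O u x)}.
Proof.
move=> Goo th0 M0 thM; have := scale_sum_ae_fin Goo; apply: filterS => x h Fx.
have r00' : (0 < r0 <= r0)%R by rewrite r00 lexx.
exact: (trace_lipschitz mO s0 c0 density mu u2 be1 (FO Fx) r00' (h Fx) th0 M0 thM).
Qed.

End nash_domain.

Lemma integral_mrestr dsp (Y : measurableType dsp) (R : realType)
    (nu : {measure set Y -> \bar R}) (D : set Y) (mD : measurable D) (g : Y -> \bar R) :
  measurable_fun setT g -> (forall y, 0 <= g y)%E ->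
  (\int[mrestr nu mD]_y g y = \int[nu]_(y in D) g y)%E.
Proof.
move=> mg g0; rewrite (@ge0_negligible_integral _ _ _ _ setT (~` D))//; last 2 first.
- exact: measurableC.
- by rewrite /= /mrestr setICl measure0.
rewrite setTD setCK; apply: eq_measure_integral => A mA AD.
by rewrite /mrestr/=; congr (nu _); exact/setIidl.
Qed.

(** * The measure m, the space H^s and the global Nash inequality *)

Section domain.
Variables (R : realType) (N : nat).
Local Notation X := (RN R N).
Local Notation LN := (lebesgue_RN R N).
Variables (O : set X) (oO : open O) (mu : {finite_measure set X -> \bar R}).
Local Open Scope ereal_scope.
Local Notation F := (boundary O).
Local Notation m := (m_Omega oO mu).

Let mO : measurable O. Proof. exact: open_measurable_RN. Qed.
Let mF : measurable F. Proof. exact: measurable_boundary. Qed.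

Lemma boundary_notin x : F x -> ~ O x.
Proof. by move=> [_ nOx] Ox; apply: nOx; rewrite interiorT_id// || rewrite (interior_id _).1. Qed.

Lemma m_OmegaE A : m A = LN (A `&` O) + mu (A `&` F).
Proof. exact: measure_addE. Qed.

Lemma integral_m_Omega (g : X -> \bar R) : measurable_fun setT g -> (forall x, 0 <= g x) ->
  \int[m]_x g x = \int[LN]_(x in O) g x + \int[mu]_(x in F) g x.
Proof.
by move=> mg g0; rewrite /m_Omega ge0_integral_measure_add// !integral_mrestr.
Qed.

Lemma ae_m_Omega (P : X -> Prop) : {ae m, forall x, P x} <->
  {ae LN, forall x, O x -> P x} /\ {ae mu, forall x, F x -> P x}.
Proof.
split.
  move=> [B [mB mB0 PB]].
  have [B1 B2] : LN (B `&` O) = 0 /\ mu (B `&` F) = 0.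
    move: mB0; rewrite m_OmegaE => /eqP.
    by rewrite padde_eq0// => /andP[/eqP ? /eqP ?].
  split.
    exists (B `&` O); split => //; first exact: measurableI.
    move=> x /= /not_implyP[Ox nP]; split => //; exact: PB.
  exists (B `&` F); split => //; first exact: measurableI.
  move=> x /= /not_implyP[Ox nP]; split => //; exact: PB.
move=> [[B [mB B0 PB]] [B' [mB' B'0 PB']]].
have mC : measurable ((B `|` ~` O) `&` (B' `|` ~` F)).
  by apply: measurableI; apply: measurableU => //; exact: measurableC.
(* Points outside both pieces are left in the exceptional set, since [m] does not charge them. *)
exists ((B `|` ~` O) `&` (B' `|` ~` F)); split => //.
  rewrite m_OmegaE.
  rewrite (_ : _ `&` O = B `&` ((B' `|` ~` F) `&` O)); last first.
    by rewrite predeqE => y; split; rewrite /=; tauto.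
  rewrite (_ : _ `&` F = B' `&` ((B `|` ~` O) `&` F)); last first.
    by rewrite predeqE => y; split; rewrite /=; tauto.
  have -> : LN (B `&` ((B' `|` ~` F) `&` O)) = 0.
    apply/eqP; rewrite -measure_le0 -B0; apply: le_measure; rewrite ?inE//.
    by apply: measurableI => //; apply: measurableI => //; apply: measurableU => //; exact: measurableC.
  rewrite add0e; apply/eqP; rewrite -measure_le0 -B'0; apply: le_measure; rewrite ?inE//.
  by apply: measurableI => //; apply: measurableI => //; apply: measurableU => //; exact: measurableC.
move=> x nP; split.
  by have [Ox|] := pselect (O x); [left; apply: PB => /(_ Ox)|right].
by have [Ox|] := pselect (F x); [left; apply: PB' => /(_ Ox)|right].
Qed.

(** The averages run over subsets of [O]. Extension by 0 makes a function of H^s measurable on the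
    whole space, as the preceding lemmas require. *)
Lemma trace_patch (w : X -> R) : trace O (w \_ O) = trace O w.
Proof.
apply/funext => x; rewrite /trace.
pose A (v : X -> R) (r : R) :=
  ((fine (LN (eball x r `&` O)))^-1 * \int[LN]_(y in eball x r `&` O) v y)%R.
rewrite -/(A (w \_ O)) -/(A w); suff -> : A (w \_ O) = A w by [].
apply/funext => r; congr (_ * _)%R; apply: eq_Rintegral => y.
by rewrite inE => -[_ Oy]; rewrite patchE mem_set.
Qed.

Variables (s d : R).
Local Notation e := (N%:R + 2 * s)%R.

Definition gagliardo (w : X -> R) : \bar R :=
  \int[(LN \x LN)%E]_(z in O `*` O)
     ((w z.1 - w z.2) ^+ 2 / edist z.1 z.2 `^ (N%:R + 2 * s))%:E.

Lemma gagliardo_ge0 w : 0 <= gagliardo w.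
Proof. by apply: integral_ge0 => z _; rewrite lee_fin divr_ge0 ?sqr_ge0// powR_ge0. Qed.

Lemma integral_product_set (g : X * X -> \bar R) : measurable_fun setT g ->
  (forall z, 0 <= g z) ->
  \int[(LN \x LN)%E]_(z in O `*` O) g z = \int[LN]_(x in O) \int[LN]_(y in O) g (x, y).
Proof.
move=> mg g0.
pose k (z : X * X) := (\1_O z.1)%:E * ((\1_O z.2)%:E * g z).
have mk : measurable_fun setT k.
  apply: emeasurable_funM.
    apply/measurable_EFinP.
    rewrite (_ : (fun _ => _) = \1_(fst @^-1` O))//; apply: measurable_indic.
    by rewrite -[X in measurable X]setTI; exact: measurable_fst.
  apply: emeasurable_funM => //; apply/measurable_EFinP.
  rewrite (_ : (fun _ => _) = \1_(snd @^-1` O))//; apply: measurable_indic.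
  by rewrite -[X in measurable X]setTI; exact: measurable_snd.
have k0 z : 0 <= k z by rewrite !mule_ge0.
transitivity (\int[(LN \x LN)%E]_z k z).
  rewrite integral_indic_mul; apply: eq_integral => z _.
  rewrite /k muleA -EFinM; congr (_%:E * _).
  by rewrite !indicE -natrM mulnb -in_setX; case: z.
rewrite (@fubini_tonelli1 _ _ _ _ _ LN LN k mk k0) [RHS]integral_indic_mul.
apply: eq_integral => x _; rewrite /fubini_F /k/=.
rewrite ge0_integralZl//; last 2 first.
- apply: emeasurable_funM; first by apply/measurable_EFinP; exact: measurable_indic.
  exact: measurableT_comp mg (measurable_pair1 x).
- by move=> y _; rewrite mule_ge0.
by rewrite -integral_indic_mul.
Qed.

Lemma gagliardo_patch (w : X -> R) : measurable_fun O w ->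
  gagliardo w = \int[LN]_(z in O) gdensity O e (w \_ O) z.
Proof.
move=> /(measurable_restrictT _ mO).1 mw.
have -> : gagliardo w = \int[(LN \x LN)%E]_(z in O `*` O) (gkernel e (w \_ O) z)%:E.
  apply: eq_integral => z; rewrite inE => -[Oz1 Oz2].
  by rewrite /gkernel !patchE !mem_set.
rewrite integral_product_set//.
- by apply/measurable_EFinP; exact: measurable_gkernel.
- by move=> z; rewrite lee_fin gkernel_ge0.
Qed.

Variables (eps delta : R).
Hypotheses (N0 : (0 < N)%N) (eps0 : (0 < eps)%R) (delta0 : (0 < delta)%R).
Hypothesis ed : eps_delta_domain eps delta O.
Hypothesis ds : d_set mu F d.
Hypotheses (s0 : (0 < s)%R) (d0 : (0 < d)%R) (dN : (d <= N%:R)%R).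
Hypotheses (sN : (2 * s <= N%:R)%R) (dsN : (N%:R - d < 2 * s)%R).

Let al0 : (0 < alpha N s d)%R.
Proof. by rewrite /alpha subr_gt0 ltr_pdivrMr// mulrC. Qed.

Lemma domain_constants : exists c r0 c1 c2, [/\ (0 < c)%R, (0 < r0)%R, (r0 <= 2^-1)%R,
  (0 < c1)%R & (0 < c2)%R] /\ [/\ 
  forall x r, closure O x -> (0 < r <= r0)%R -> (c * r ^+ N)%:E <= LN (eball x r `&` O),
  forall x r, F x -> (0 < r <= r0)%R -> (c1 * r `^ d)%:E <= mu (eball x r `&` F) &
  forall x r, (0 < r <= r0)%R -> mu (eball x r `&` F) <= (c2 * r `^ d)%:E].
Proof.
have [c [r0 [c0 r00 H]]] := eps_delta_measure_density N0 eps0 delta0 ed.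
have [_ [c1 [c2 [c10 c20 H2]]]] := ds.
(* One radius at most 1/2 serves all three bounds; the factor 2^d pays for balls whose centre is off
   the boundary. *)
exists c, (Num.min r0 2^-1)%R, c1, (c2 * 2 `^ d)%R; split.
  split => //.
  - by rewrite lt_min r00/= invr_gt0.
  - by rewrite ge_min lexx orbT.
  - by rewrite mulr_gt0// powR_gt0.
split.
- by move=> x r clx /andP[r_gt0]; rewrite le_min => /andP[rr0 _]; apply: H => //; rewrite r_gt0.
- move=> x r Fx /andP[r_gt0]; rewrite le_min => /andP[_ r2].
  have /(H2 x r Fx)/andP[] // : (0 < r <= 1)%R.
  by rewrite r_gt0 (le_trans r2)// invf_le1// ler1n.
- move=> x r /andP[r_gt0]; rewrite le_min => /andP[_ r2].
  rewrite -mulrA -powRM ?(ltW r_gt0)//.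
  apply: (@d_set_measure_upper _ _ mu F d c2 mF c20) => //; last by rewrite r_gt0.
  by move=> y t Fy t1; have /andP[] := H2 y t Fy t1.
Qed.

(** The factor M^2 dominates both integrals of the norm; the statement on traces is the pointwise
    one at the boundary points where the scale sum is finite. *)
Lemma Hs_trace_lipschitz (w : X -> R) M theta : Hs O s w ->
  theta 0%R = 0%R -> (0 <= M)%R -> (forall a b, `|theta a - theta b| <= M * `|a - b|)%R ->
  Hs O s (theta \o w) /\ {ae mu, forall x, F x -> trace O (theta \o w) x = theta (trace O w x)}.
Proof.
move=> [mw w2 wG] th0 M0 thM.
have mth := lipschitz_measurable thM.
have sqth a b : ((theta a - theta b) ^+ 2 <= M ^+ 2 * (a - b) ^+ 2)%R.
  rewrite -exprMn -(real_normK (num_real (_ - _))) -(real_normK (num_real (M * _))).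
  rewrite lerXn2r// ?nnegrE ?normr_ge0//.
  by rewrite normrM (ger0_norm M0).
have mwp := (measurable_restrictT _ mO).1 mw.
split.
  split.
  - exact: measurableT_comp mth mw.
  - apply: (@le_lt_trans _ _ (\int[LN]_(x in O) ((M ^+ 2)%:E * (w x ^+ 2)%:E))).
      apply: ge0_le_integral_nm => x _; first by rewrite lee_fin sqr_ge0.
      by rewrite -EFinM lee_fin; have := sqth (w x) 0%R; rewrite th0 !subr0.
    rewrite ge0_integralZl_EFin ?sqr_ge0//; last 2 first.
    + by move=> x _; rewrite lee_fin sqr_ge0.
    + by apply/measurable_EFinP; exact: measurable_funX.
    by rewrite lte_mul_pinfty// lee_fin sqr_ge0.
  - have mk : measurable_fun setT (gkernel e (w \_ O)) by exact: measurable_gkernel.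
    apply: (@le_lt_trans _ _ (\int[(LN \x LN)%E]_(z in O `*` O)
        ((M ^+ 2)%:E * (gkernel e (w \_ O) z)%:E))).
      apply: ge0_le_integral_nm => z [Oz1 Oz2].
        by rewrite lee_fin divr_ge0 ?sqr_ge0// powR_ge0.
      rewrite -EFinM lee_fin /gkernel !patchE !mem_set// mulrA.
      by rewrite ler_wpM2r ?invr_ge0 ?powR_ge0// sqth.
    rewrite ge0_integralZl_EFin ?sqr_ge0//; last 3 first.
    + exact: measurableX.
    + by move=> z _; rewrite lee_fin gkernel_ge0.
    + exact: measurable_funS (measurableT) (@subsetT _ _) (measurableT_comp _ mk).
    rewrite lte_mul_pinfty// ?lee_fin ?sqr_ge0//.
    apply: le_lt_trans wG; apply: ge0_le_integral_nm => z [Oz1 Oz2].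
      by rewrite lee_fin gkernel_ge0.
    by rewrite /gkernel !patchE !mem_set.
have [c [r0 [c1 [c2 [[c0 r00 r01 c10 c20] [H1 H2 H3]]]]]] := domain_constants.
have w2p : \int[LN]_(x in O) ((w \_ O) x ^+ 2)%:E < +oo.
  apply: le_lt_trans w2; apply: ge0_le_integral_nm => x Ox; first by rewrite lee_fin sqr_ge0.
  by rewrite patchE mem_set.
have GG : \int[LN]_(z in O) gdensity O e (w \_ O) z < +oo by rewrite -gagliardo_patch.
have := @trace_lipschitz_ae R N O F s d c r0 c2 mu mO mF (@closure_boundary R N O)
  s0 c0 r00 c20 al0 H1 H3 (w \_ O) mwp w2p M theta GG th0 M0 thM.
apply: filterS => x h Fx; rewrite -(trace_patch w) -(h Fx).
rewrite -(trace_patch (theta \o w)); congr (trace O _ x).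
by apply/funext => y; rewrite /= !patchE; case: ifP.
Qed.

Lemma Hs_represents_lipschitz (w : X -> R) (f : X -> R) M theta : Hs O s w ->
  f = Hs_embed O w %[ae m] ->
  theta 0%R = 0%R -> (0 <= M)%R -> (forall a b, `|theta a - theta b| <= M * `|a - b|)%R ->
  Hs O s (theta \o w) /\ theta \o f = Hs_embed O (theta \o w) %[ae m].
Proof.
move=> Hw fw th0 M0 thM.
have [Hth tr] := Hs_trace_lipschitz Hw th0 M0 thM.
move/ae_m_Omega : fw => [f1 f2]; split; [exact: Hth|apply/ae_m_Omega; split].
  apply: filterS f1 => x fx Ox _; have := fx Ox Logic.I.
  by rewrite /Hs_embed !mem_set//= => ->.
apply: filterS2 f2 tr => x fx tx Fx _; have := fx Fx Logic.I.
by rewrite /Hs_embed !memNset/=; [move=> ->; rewrite tx|exact: boundary_notin..].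
Qed.

Lemma nash_rescale (v t : R) (Y A B : \bar R) : (0 < v)%R -> (0 <= t)%R ->
  v%:E * Y <= 2%:E * A + t%:E * B -> 0 <= A -> 0 <= B ->
  Y <= (2 / v)%:E * A + (t / v)%:E * B.
Proof.
move=> v0 t0 h A0 B0.
rewrite [leRHS](_ : _ = (v^-1)%:E * (2%:E * A + t%:E * B)) ?lee_pdivlMl//.
by rewrite ge0_muleDr ?mule_ge0// !muleA -!EFinM mulrC [(t / v)%R]mulrC.
Qed.

Lemma nash_combine (a1 a2 a3 b1 b2 b3 : R) (A B I G : \bar R) :
  (0 <= a1)%R -> (0 <= a2)%R -> (0 <= b1)%R -> (0 <= b2)%R ->
  (a1 + a2 <= a3)%R -> (b1 + b2 <= b3)%R -> 0 <= I -> 0 <= G -> A <= I -> B <= I ->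
  a1%:E * A + b1%:E * G + (a2%:E * B + b2%:E * G) <= a3%:E * I + b3%:E * G.
Proof.
move=> a10 a20 b10 b20 ha hb I0 G0 AI BI.
apply: (@le_trans _ _ (a1%:E * I + b1%:E * G + (a2%:E * I + b2%:E * G))).
  by apply: leeD; apply: leeD => //; apply: lee_wpmul2l.
rewrite addeACA -!ge0_muleDl ?lee_fin// -!EFinD.
by apply: leeD; apply: lee_wpmul2r; rewrite ?lee_fin.
Qed.

Lemma nash_inequality : exists C h0, [/\ (0 < C)%R, (0 < h0)%R &
  forall w f, Hs O s w -> measurable_fun setT f -> f = Hs_embed O w %[ae m] ->
  forall h, (0 < h <= h0)%R ->
  \int[m]_x (f x ^+ 2)%:E <=
  (C * h `^ (- (lambda N s d / 2)))%:E * (\int[m]_x `|f x|%:E) ^+ 2 +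
  (C * h)%:E * gagliardo w].
Proof.
have [c [r0 [c1 [c2 [[c0 r00 r01 c10 c20] [H1 H2 H3]]]]]] := domain_constants.
have al0' := al0; set al := alpha N s d in al0'.
have al20 : (0 < 2 * al)%R by rewrite mulr_gt0.
have s20 : (0 < 2 * s)%R by rewrite mulr_gt0.
pose K := (2 * bd_cst N s d c * c2 * sum_cst N s d c2)%R.
have be1 : (1 < 2 `^ al)%R by rewrite /powR pnatr_eq0/= expR_gt1 mulr_gt0// ln_gt0// ltr1n.
have K0 : (0 <= K)%R.
  have bd0 : (0 <= bd_cst N s d c)%R.
    apply: mulr_ge0 => //; apply: addr_ge0; last exact/ltW/scale_cst_gt0.
    by apply: mulr_ge0 => //; exact/ltW/tail_cst_gt0.
  have sc0 : (0 <= sum_cst N s d c2)%R.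
    by rewrite /sum_cst divr_ge0 ?(ltW c20)// subr_ge0 invf_le1 ?(ltW be1)// powR_gt0.
  by apply: mulr_ge0 => //; apply: mulr_ge0 (ltW c20); exact: mulr_ge0.
exists (2 / c + 2 / c1 + 1 / c + K / c1)%R.
(* The last two bounds make the radii h^(1/(2 alpha)) and h^(1/(2s)) at most [r0]; h <= 1 makes
   powers of h comparable by their exponents. *)
exists (Num.min 1 (Num.min (r0 `^ (2 * al)) (r0 `^ (2 * s))))%R; split.
- by rewrite ltr_wpDr ?divr_ge0 ?(ltW c10)// !addr_gt0// divr_gt0.
- by rewrite !lt_min ltr01 !powR_gt0.
move=> w f [mw w2 wG] mf fw h /andP[h_gt0]; rewrite !le_min => /andP[h1 /andP[hal hs]].
move/ae_m_Omega : fw => [f1 f2].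
have powh t : (h `^ t > 0)%R by rewrite powR_gt0.
have mwp := (measurable_restrictT _ mO).1 mw.
have w2p : \int[LN]_(x in O) ((w \_ O) x ^+ 2)%:E < +oo.
  apply: le_lt_trans w2; apply: ge0_le_integral_nm => x Ox; first by rewrite lee_fin sqr_ge0.
  by rewrite patchE mem_set.
have rootle t : (0 < t)%R -> (h <= r0 `^ t)%R -> (0 < h `^ t^-1 <= r0)%R.
  move=> t0 ht; rewrite powh/=.
  have -> : (r0 = (r0 `^ t) `^ t^-1)%R by rewrite -powRrM mulfV ?gt_eqF// powRr1 ?ltW.
  by rewrite ge0_ler_powR ?nnegrE ?invr_ge0 ?powR_ge0 ?(ltW t0) ?(ltW h_gt0).
rewrite gagliardo_patch//; set G := \int[LN]_(z in O) _.
have G0 : 0 <= G by apply: integral_ge0 => z _; exact: gdensity_ge0.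
have mf2 : measurable_fun setT (fun x => (f x ^+ 2)%:E).
  by apply/measurable_EFinP; exact: measurable_funX.
have mfn : measurable_fun setT (fun x => `|f x|%:E).
  by apply/measurable_EFinP; exact: measurableT_comp mf.
set I := \int[m]_x `|f x|%:E.
have IE : I = \int[LN]_(x in O) `|f x|%:E + \int[mu]_(x in F) `|f x|%:E.
  by rewrite /I integral_m_Omega.
set A := \int[LN]_(x in O) `|f x|%:E in IE; set B := \int[mu]_(x in F) `|f x|%:E in IE.
have A0 : 0 <= A by exact: integral_ge0.
have B0 : 0 <= B by exact: integral_ge0.
have A2I : A ^+ 2 <= I ^+ 2 by rewrite !expe2; apply: lee_pmul => //; rewrite IE leeDl.
have B2I : B ^+ 2 <= I ^+ 2 by rewrite !expe2; apply: lee_pmul => //; rewrite IE leeDr.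
rewrite integral_m_Omega//; last by move=> x; rewrite lee_fin sqr_ge0.
have mfD (D : set X) (k : R -> R) : measurable_fun setT k ->
    measurable_fun D (fun x => (k (f x))%:E).
  move=> mk; apply: (measurable_funS measurableT) => //.
  by apply/measurable_EFinP; exact: measurableT_comp mf.
have mwD (D : set X) (k : R -> R) : measurable_fun setT k ->
    measurable_fun D (fun x => (k ((w \_ O) x))%:E).
  move=> mk; apply: (measurable_funS measurableT) => //.
  by apply/measurable_EFinP; exact: measurableT_comp mwp.
have msqr : measurable_fun setT (fun x : R => x ^+ 2)%R by exact: measurable_funX.
have mabs : measurable_fun setT (fun x : R => `|x|)%R by exact: normr_measurable.
have fwO x : O x -> (O x -> [set: X] x -> f x = Hs_embed O w x) -> f x = (w \_ O) x.
  by move=> Ox /(_ Ox Logic.I) ->; rewrite /Hs_embed patchE mem_set.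
have EO2 : \int[LN]_(x in O) (f x ^+ 2)%:E = \int[LN]_(x in O) ((w \_ O) x ^+ 2)%:E.
  apply: ge0_ae_eq_integral => //; [exact: (mfD _ _ msqr)|exact: (mwD _ _ msqr)| | |].
  - by move=> x _; rewrite lee_fin sqr_ge0.
  - by move=> x _; rewrite lee_fin sqr_ge0.
  - by apply: filterS f1 => x fx Ox; rewrite (fwO x Ox fx).
have EO1 : A = \int[LN]_(x in O) `|(w \_ O) x|%:E.
  apply: ge0_ae_eq_integral => //; [exact: (mfD _ _ mabs)|exact: (mwD _ _ mabs)|].
  by apply: filterS f1 => x fx Ox; rewrite (fwO x Ox fx).
have ftr : {ae mu, forall x, F x -> f x = trace O (w \_ O) x}.
  apply: filterS f2 => x fx Fx; rewrite (fx Fx Logic.I) /Hs_embed memNset//.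
    by rewrite trace_patch.
  exact: boundary_notin.
(* Different radii inside and on the boundary, chosen so that both energy terms come with the
   coefficient h. *)
have ss : (0 < h `^ (2 * s)^-1 <= r0)%R by exact: rootle.
have aa : (0 < h `^ (2 * al)^-1 <= r0)%R by exact: rootle.
have NI := @nash_interior R N O s c r0 mO s0 c0 H1 (w \_ O) mwp _ ss.
have NB := @nash_boundary R N O F s d c r0 c1 c2 mu mO mF (@closure_boundary R N O)
  s0 c0 c10 c20 al0 H1 H2 H3 (w \_ O) mwp w2p f _ mf ftr aa.
rewrite -EO2 -EO1 -/G in NI; rewrite -/B -/G -/al -/K in NB.
have I20 : 0 <= I ^+ 2 by rewrite expe2 mule_ge0// IE adde_ge0.
have A20 : 0 <= A ^+ 2 by rewrite expe2 mule_ge0.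
have B20 : 0 <= B ^+ 2 by rewrite expe2 mule_ge0.
set P := (h `^ (- (lambda N s d / 2)))%R.
have P0 : (0 < P)%R by exact: powh.
set r1 := (h `^ _)%R in NI; set r2 := (h `^ _)%R in NB.
have r10 : (0 < r1)%R by exact: powh.
have r20 : (0 < r2)%R by exact: powh.
have r1s : (r1 `^ (2 * s) = h)%R.
  by rewrite /r1 -powRrM mulVf ?gt_eqF// powRr1// ltW.
have r2a : (r2 `^ (2 * al) = h)%R.
  by rewrite /r2 -powRrM mulVf ?gt_eqF// powRr1// ltW.
have PE : ((r2 `^ d)^-1 = P)%R.
  rewrite /r2 -powRrM -powRN; congr (_ `^ (- _))%R.
  rewrite /lambda (_ : d - N%:R + 2 * s = 2 * al)%R; last by rewrite /al /alpha; field.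
  by field; rewrite gt_eqF.
(* The interior power h^(-N/(2s)) is at most the boundary power h^(-d/(2 alpha)) = h^(-lambda/2),
   because d 2s - N 2 alpha = (N-d)(N-2s) >= 0. Here d <= N and 2s <= N enter. *)
have P1 : ((r1 ^+ N)^-1 <= P)%R.
  rewrite -powR_mulrn ?(ltW r10)// /r1 -powRrM -powRN.
  apply: ger_powR; first by rewrite h_gt0.
  rewrite lerN2 /lambda (_ : d - N%:R + 2 * s = 2 * al)%R; last by rewrite /al /alpha; field.
  rewrite (_ : 2 * d / (2 * al) / 2 = d / (2 * al))%R; last by field; rewrite gt_eqF.
  rewrite ler_pdivlMr// -mulrA ler_pdivrMl// /al /alpha -subr_ge0.
  rewrite (_ : _ - _ = (N%:R - d) * (N%:R - 2 * s))%R; last by field.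
  by rewrite mulr_ge0// subr_ge0.
have r1N : (0 < r1 ^+ N)%R by rewrite exprn_gt0.
have r2d : (0 < r2 `^ d)%R by rewrite powR_gt0.
have r1e : (r1 `^ e = r1 ^+ N * h)%R.
  by rewrite powRD ?(gt_eqF r10) ?implybT// powR_mulrn ?ltW// r1s.
have RI := nash_rescale (mulr_gt0 c0 r1N) (powR_ge0 r1 e) NI A20 G0.
have t20 : (0 <= K * r2 `^ d * r2 `^ (2 * al))%R by exact: mulr_ge0 (mulr_ge0 K0 (powR_ge0 _ _)) (powR_ge0 _ _).
have RB := nash_rescale (mulr_gt0 c10 r2d) t20 NB B20 G0.
apply: (le_trans (leeD RI RB)); apply: nash_combine => //.
- by rewrite divr_ge0// mulr_ge0 ?ltW.
- by rewrite divr_ge0// mulr_ge0 ?ltW.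
- by rewrite divr_ge0 ?powR_ge0// mulr_ge0 ?ltW.
- by rewrite divr_ge0// mulr_ge0 ?ltW.
- apply: (@le_trans _ _ ((2 / c + 2 / c1) * P)%R).
    rewrite [leRHS]mulrDl; apply: lerD.
      by rewrite invfM mulrA; apply: ler_wpM2l => //; rewrite divr_ge0// ltW.
    by rewrite invfM mulrA PE.
  apply: ler_wpM2r; first exact: ltW.
  by rewrite -addrA lerDl addr_ge0// divr_ge0// ltW.
- rewrite r1e r2a.
  have -> : (r1 ^+ N * h / (c * r1 ^+ N) = 1 / c * h)%R.
    by move: (r1 ^+ N)%R r1N => q q0; field; rewrite !gt_eqF.
  have -> : (K * r2 `^ d * h / (c1 * r2 `^ d) = K / c1 * h)%R.
    by move: (r2 `^ d)%R r2d => q q0; field; rewrite !gt_eqF.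
  rewrite -mulrDl; apply: ler_wpM2r; first exact: ltW.
  by rewrite -addrA lerDr addr_ge0// divr_ge0// ltW.
Qed.

End domain.

(** * Truncated powers and their primitive *)

Section truncated_powers.
Variables (R : realType) (k : nat) (n : R).
Hypothesis n0 : 0 < n.
Implicit Types x y : R.

(* Truncation keeps [tpow n j f] in [L2] for [f] in [L2]; [tprim] is the primitive
   of [tpow n k.*2] vanishing at 0. *)
Definition clip x : R := Num.min `|x| n.
Definition tpow j x : R := x * clip x ^+ j.
Definition tprim x : R :=
  clip x ^+ k.*2.+2 / k.*2.+2%:R + clip x ^+ k.*2 * (x ^+ 2 - clip x ^+ 2) / 2.

Lemma clip_ge0 x : 0 <= clip x.
Proof. by rewrite /clip le_min normr_ge0 ltW. Qed.

Lemma clip_le x : clip x <= n. Proof. by rewrite /clip ge_min lexx orbT. Qed.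

Lemma clip_le_norm x : clip x <= `|x|. Proof. by rewrite /clip ge_min lexx. Qed.

Lemma clipN x : clip (- x) = clip x. Proof. by rewrite /clip normrN. Qed.

Lemma clip_small x : 0 <= x -> x <= n -> clip x = x.
Proof. by move=> x0 xn; rewrite /clip ger0_norm// min_l. Qed.

Lemma clip_large x : n <= x -> clip x = n.
Proof. by move=> nx; rewrite /clip ger0_norm ?min_r// (le_trans (ltW n0)). Qed.

Lemma le_clip x y : 0 <= y -> y <= x -> clip y <= clip x.
Proof.
move=> y0 yx; rewrite /clip !ger0_norm ?(le_trans y0)//.
by rewrite le_min !ge_min yx lexx orbT.
Qed.

Lemma tpowN j x : tpow j (- x) = - tpow j x.
Proof. by rewrite /tpow clipN mulNr. Qed.

Lemma tpow0 j : tpow j 0 = 0. Proof. by rewrite /tpow mul0r. Qed.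

Lemma tpow_ge0 j x : 0 <= x -> 0 <= tpow j x.
Proof. by move=> x0; rewrite mulr_ge0// exprn_ge0// clip_ge0. Qed.

(** [clip] is concave on the half-line and vanishes at 0, so its slope between y and x is at most
    clip(y)/y. *)
Lemma mul_clip_sub x y : 0 <= y -> y <= x -> y * (clip x - clip y) <= clip x * (x - y).
Proof.
move=> y0 yx; have c0 := clip_ge0 x.
have [ny|yn] := leP n y.
  rewrite !clip_large// ?(le_trans ny)// subrr mulr0 mulr_ge0 ?subr_ge0//.
  by rewrite ltW.
have cy : clip y = y by rewrite clip_small// ltW.
have := le_clip y0 yx; rewrite cy => ycx.
have : clip x <= x by rewrite (le_trans (clip_le_norm x))// ger0_norm// (le_trans y0).
nra.
Qed.

(** Induction on the exponent with the product rule for differences. *)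
Lemma mul_expclip_sub j x y : 0 <= y -> y <= x ->
  y * (clip x ^+ j - clip y ^+ j) <= j%:R * clip x ^+ j * (x - y).
Proof.
move=> y0 yx; elim: j => [|j IH]; first by rewrite !expr0 subrr mulr0 !mul0r.
have cx0 := clip_ge0 x; have cy0 := clip_ge0 y.
have cc := le_clip y0 yx; have h := mul_clip_sub y0 yx.
have X0 : 0 <= clip x ^+ j by rewrite exprn_ge0.
rewrite !exprS -natr1.
have -> : y * (clip x * clip x ^+ j - clip y * clip y ^+ j) =
  clip x ^+ j * (y * (clip x - clip y)) + clip y * (y * (clip x ^+ j - clip y ^+ j)) by ring.
have -> : (j%:R + 1) * (clip x * clip x ^+ j) * (x - y) =
  clip x ^+ j * (clip x * (x - y)) + clip x * (j%:R * clip x ^+ j * (x - y)) by ring.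
apply: lerD; first exact: ler_wpM2l.
apply: (le_trans (ler_wpM2l cy0 IH)); apply: ler_wpM2r => //.
by rewrite !mulr_ge0// subr_ge0.
Qed.

Lemma tpow_sub_le j x y : 0 <= y -> y <= x ->
  0 <= tpow j x - tpow j y <= j.+1%:R * clip x ^+ j * (x - y).
Proof.
move=> y0 yx; have h := mul_expclip_sub j y0 yx.
have cx0 := clip_ge0 x; have cy0 := clip_ge0 y; have cc := le_clip y0 yx.
apply/andP; split.
  rewrite subr_ge0 /tpow ler_pM// ?exprn_ge0//.
  by rewrite lerXn2r// nnegrE.
rewrite -natr1 /tpow.
have -> : x * clip x ^+ j - y * clip y ^+ j =
  y * (clip x ^+ j - clip y ^+ j) + clip x ^+ j * (x - y) by ring.
have -> : (j%:R + 1) * clip x ^+ j * (x - y) =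
  j%:R * clip x ^+ j * (x - y) + clip x ^+ j * (x - y) by ring.
by rewrite lerD2r.
Qed.

(* Odd functions: a bound for pairs of the same sign and one for pairs of
   opposite signs suffice. *)
Lemma sign_ind (P : R -> R -> Prop) : (forall x y, P x y -> P y x) ->
  (forall x y, P x y -> P (- x) (- y)) ->
  (forall x y, 0 <= y -> y <= x -> P x y) ->
  (forall x y, 0 <= x -> 0 <= y -> P x (- y)) -> forall x y, P x y.
Proof.
move=> sym opp same diff.
have pos x y : 0 <= x -> P x y.
  move=> x0; have [y0|y0] := leP 0 y.
    by have [xy|/ltW xy] := leP y x; [exact: same|apply: sym; exact: same].
  by rewrite -(opprK y); apply: diff => //; rewrite oppr_ge0 ltW.
move=> x y; have [/pos //|x0] := leP 0 x.
by rewrite -(opprK x) -(opprK y); apply: opp; apply: pos; rewrite oppr_ge0 ltW.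
Qed.

Lemma tpow_lipschitz j x y :
  `|tpow j x - tpow j y| <= j.+1%:R * n ^+ j * `|x - y|.
Proof.
move: x y; apply: sign_ind => [x y|x y|x y y0 yx|x y x0 y0].
- by rewrite distrC [`|y - x|]distrC.
- by rewrite !tpowN -!opprD !normrN.
- have /andP[h0 h1] := tpow_sub_le j y0 yx.
  rewrite ger0_norm// (ger0_norm (x := x - y)) ?subr_ge0//.
  apply: (le_trans h1); apply: ler_wpM2r; first by rewrite subr_ge0.
  by apply: ler_wpM2l => //; rewrite lerXn2r ?nnegrE ?clip_ge0 ?clip_le// ltW.
- rewrite tpowN !opprK !ger0_norm ?addr_ge0 ?tpow_ge0//.
  have X z : 0 <= z -> tpow j z <= n ^+ j * z.
    move=> z0; rewrite /tpow mulrC; apply: ler_wpM2r => //.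
    by rewrite lerXn2r ?nnegrE ?clip_ge0 ?clip_le// ltW.
  apply: (@le_trans _ _ (n ^+ j * (x + y))); first by rewrite mulrDr lerD// X.
  apply: ler_wpM2r; first by rewrite addr_ge0.
  by rewrite ler_peMl ?exprn_ge0 ?(ltW n0)// ler1n.
Qed.

(** The Stroock-Varopoulos inequality for truncated powers: the form tested with the power 2k+1
    controls the energy of the power k+1, with a constant free of the level [n]. *)
Lemma tpow_strong_monotone x y :
  (tpow k x - tpow k y) ^+ 2 <= k.+1%:R * ((tpow k.*2 x - tpow k.*2 y) * (x - y)).
Proof.
move: x y; apply: sign_ind => [x y|x y|x y y0 yx|x y x0 y0].
- rewrite -sqrrN opprB => h; apply: (le_trans h).
  by rewrite le_eqVlt; apply/orP; left; apply/eqP; ring.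
- by rewrite !tpowN -!opprD sqrrN mulrNN.
- have /andP[h0 h1] := tpow_sub_le k y0 yx.
  have cx0 := clip_ge0 x; have cy0 := clip_ge0 y; have cc := le_clip y0 yx.
  have gh : clip y ^+ k <= clip x ^+ k by rewrite lerXn2r.
  have g0 : 0 <= clip y ^+ k by rewrite exprn_ge0.
  have xy0 : 0 <= x - y by rewrite subr_ge0.
  rewrite expr2.
  apply: (@le_trans _ _ (k.+1%:R * clip x ^+ k * (x - y) * (tpow k x - tpow k y))).
    exact: ler_wpM2r.
  rewrite -!mulrA; apply: ler_wpM2l => //.
  rewrite [leLHS]mulrCA [leRHS]mulrC; apply: ler_wpM2l => //.
  rewrite /tpow -addnn !exprD.
  move: (clip x ^+ k) (clip y ^+ k) gh g0 => g h gh g0.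
  rewrite -subr_ge0 (_ : _ - _ = y * h * (g - h)); last by ring.
  by rewrite !mulr_ge0// subr_ge0.
- rewrite !tpowN !opprK.
  apply: (@le_trans _ _ ((tpow k.*2 x + tpow k.*2 y) * (x + y))).
    rewrite /tpow -addnn !exprD; move: (clip x ^+ k) (clip y ^+ k) => g h.
    rewrite -subr_ge0 (_ : _ - _ = x * y * (g - h) ^+ 2); last by ring.
    by rewrite mulr_ge0 ?sqr_ge0// mulr_ge0.
  rewrite ler_peMl ?ler1n// mulr_ge0 ?addr_ge0 ?tpow_ge0//.
Qed.

(** The graph of t^(j+1) lies above its tangent at x. *)
Lemma pow_tangent j x y : 0 <= x -> 0 <= y ->
  x ^+ j * (j.+1%:R * y - j%:R * x) <= y ^+ j.+1.
Proof.
move=> x0 y0; elim: j => [|j IH]; first by rewrite expr0 !mul1r mul0r subr0 expr1.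
have X0 : 0 <= x ^+ j by rewrite exprn_ge0.
rewrite [leRHS]exprS; apply: le_trans (ler_wpM2l y0 IH).
rewrite -subr_ge0 exprS -!natr1.
rewrite (_ : _ - _ = x ^+ j * ((j%:R + 1) * (y - x) ^+ 2)); last by ring.
by rewrite mulr_ge0// mulr_ge0 ?sqr_ge0// addr_ge0.
Qed.

Let tprim_small x : 0 <= x -> x <= n -> tprim x = x ^+ k.*2.+2 / k.*2.+2%:R.
Proof. by move=> x0 xn; rewrite /tprim clip_small// subrr mulr0 mul0r addr0. Qed.

Let tprim_large x : n <= x ->
  tprim x = n ^+ k.*2.+2 / k.*2.+2%:R + n ^+ k.*2 * (x ^+ 2 - n ^+ 2) / 2.
Proof. by move=> nx; rewrite /tprim clip_large. Qed.

Let tpow_small x : 0 <= x -> x <= n -> tpow k.*2 x = x ^+ k.*2.+1.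
Proof. by move=> x0 xn; rewrite /tpow clip_small// exprS. Qed.

Let tpow_large x : n <= x -> tpow k.*2 x = n ^+ k.*2 * x.
Proof. by move=> nx; rewrite /tpow clip_large// mulrC. Qed.

Let convex_small x y : 0 <= x -> x <= n -> 0 <= y -> y <= n ->
  tpow k.*2 x * (y - x) <= tprim y - tprim x.
Proof.
move=> x0 xn y0 yn; rewrite !tprim_small// tpow_small//.
have h := pow_tangent k.*2.+1 x0 y0.
have K0 : 0 < k.*2.+2%:R :> R by [].
rewrite -mulrBl ler_pdivlMr//.
have -> : x ^+ k.*2.+1 * (y - x) * k.*2.+2%:R =
  x ^+ k.*2.+1 * (k.*2.+2%:R * y - k.*2.+1%:R * x) - x ^+ k.*2.+2.
  by rewrite [x ^+ k.*2.+2]exprS -[in k.*2.+2%:R]natr1; ring.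
by rewrite lerD2r.
Qed.

Let convex_large x y : n <= x -> n <= y -> tpow k.*2 x * (y - x) <= tprim y - tprim x.
Proof.
move=> nx ny; rewrite !tprim_large// tpow_large//.
have X0 : 0 <= n ^+ k.*2 by rewrite exprn_ge0// ltW.
rewrite -subr_ge0 (_ : _ - _ = n ^+ k.*2 * (y - x) ^+ 2 / 2); last by field.
by rewrite divr_ge0// mulr_ge0// sqr_ge0.
Qed.

Lemma tprimN x : tprim (- x) = tprim x.
Proof. by rewrite /tprim clipN sqrrN. Qed.

(** [tprim] is convex with derivative [tpow k.*2]. The inequality holds on each side of the level
    [n]; for points on different sides it is added up through [n], the slope at [n] being compared
    with the slope at x. *)
Lemma tprim_convex x y : tpow k.*2 x * (y - x) <= tprim y - tprim x.
Proof.
have pos u v : 0 <= u -> 0 <= v -> tpow k.*2 u * (v - u) <= tprim v - tprim u.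
  move=> u0 v0; have n0' := ltW n0.
  have [nu|/ltW un] := leP n u; have [nv|/ltW vn] := leP n v.
  - exact: convex_large.
  - have h1 := convex_small n0' (lexx n) v0 vn.
    have h2 := convex_large nu (lexx n).
    have : tpow k.*2 n <= tpow k.*2 u.
      by have /andP[] := tpow_sub_le k.*2 n0' nu; rewrite subr_ge0.
    nra.
  - have h1 := convex_small u0 un n0' (lexx n).
    have h2 := convex_large (lexx n) nv.
    have : tpow k.*2 u <= tpow k.*2 n.
      by have /andP[] := tpow_sub_le k.*2 u0 un; rewrite subr_ge0.
    nra.
  - exact: convex_small.
have abs u v : 0 <= u -> tpow k.*2 u * (v - u) <= tprim v - tprim u.
  move=> u0; have : tprim `|v| = tprim v.
    by have [?|?] := leP 0 v; [rewrite ger0_norm|rewrite ltr0_norm// tprimN].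
  move=> <-; apply: le_trans (pos _ _ u0 (normr_ge0 v)).
  by apply: ler_wpM2l; [exact: tpow_ge0|rewrite lerD2r ler_norm].
have [x0|x0] := leP 0 x; first exact: abs.
have := abs (- x) (- y); rewrite oppr_ge0 ltW// => /(_ isT).
by rewrite tpowN !tprimN -opprD mulrNN.
Qed.

Lemma tprim_ge0 x : 0 <= tprim x.
Proof.
have cx := clip_ge0 x.
apply: addr_ge0; first by rewrite divr_ge0// exprn_ge0.
rewrite divr_ge0// mulr_ge0 ?exprn_ge0// subr_ge0.
rewrite -(real_normK (num_real x)) lerXn2r ?nnegrE//.
exact: clip_le_norm.
Qed.

(** Links the quantity differentiated in time with the square bounded by the Nash inequality. *)
Lemma tprim_le x : tprim x <= tpow k x ^+ 2 / 2.
Proof.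
have -> : tprim x = (clip x ^+ k) ^+ 2 * (clip x ^+ 2 / k.*2.+2%:R + (x ^+ 2 - clip x ^+ 2) / 2).
  have -> : (clip x ^+ k) ^+ 2 = clip x ^+ k.*2 by rewrite -exprM muln2.
  have e1 : clip x ^+ k.*2.+2 = clip x ^+ k.*2 * clip x ^+ 2 by rewrite -exprD addn2.
  by rewrite /tprim e1; ring.
rewrite /tpow exprMn [leRHS]mulrAC mulrC; apply: ler_wpM2r; first exact: sqr_ge0.
have K2 : k.*2.+2%:R^-1 <= 2^-1 :> R by rewrite lef_pV2 ?posrE// ler_nat.
have := ler_wpM2l (sqr_ge0 (clip x)) K2; move: (_%:R^-1) => q; lra.
Qed.

Lemma tpow_abs_le x : `|tpow k x| <= `|x| ^+ k.+1.
Proof.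
rewrite /tpow normrM exprS ler_wpM2l// ger0_norm ?exprn_ge0 ?clip_ge0//.
by rewrite lerXn2r ?nnegrE ?clip_ge0// clip_le_norm.
Qed.

Lemma tprim_norm_small x : `|x| <= n -> tprim x = `|x| ^+ k.*2.+2 / k.*2.+2%:R.
Proof.
move=> xn; rewrite -tprim_small//; have [?|?] := leP 0 x.
  by rewrite ger0_norm.
by rewrite ltr0_norm// tprimN.
Qed.

End truncated_powers.

(** * Integrals of powers singular at the endpoints *)

Section primitive_bound.
Variable R : realType.
Notation mu := (@lebesgue_measure R).

(** The fundamental theorem on compact subintervals followed by monotone convergence: the integrand
    may blow up at both ends, and only increments of the primitive need a bound. *)
Lemma integral_le_primitive (f F : R -> R) (a b M : R) : a < b ->
  (forall x, a < x < b -> is_derive x 1 F (f x)) ->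
  (forall x, a < x < b -> {for x, continuous f}) ->
  (forall x, a < x < b -> 0 <= f x) ->
  (forall x y, a < x -> x <= y -> y < b -> F y - F x <= M) ->
  (\int[mu]_(x in `]a, b[) (f x)%:E <= M%:E)%E.
Proof.
move=> ab dF cf f0 FM.
pose del n : R := (b - a) / n.+2%:R.
have del0 n : 0 < del n by rewrite divr_gt0// subr_gt0.
pose A n : set R := `[a + del n, b - del n]%classic.
have ndel : {homo del : n k / (n <= k)%N >-> k <= n}.
  move=> n k nk; rewrite /del ler_pM2l ?subr_gt0//.
  by rewrite lef_pV2 ?posrE// ler_nat.
have Aab n x : A n x -> a < x < b.
  rewrite /A /= in_itv/= => /andP[h1 h2]; have := del0 n; move=> h; apply/andP; split; lra.
have mf : measurable_fun `]a, b[ f.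
  apply: open_continuous_measurable_fun; first exact: interval_open.
  by move=> x; rewrite inE/= in_itv/= => /cf.
have AE : `]a, b[%classic = \bigcup_n A n.
  apply/seteqP; split => [x|x [n _ /Aab]]; last by rewrite /= in_itv.
  rewrite /= in_itv/= => /andP[ax xb].
  pose e := Num.min (x - a) (b - x).
  have e0 : 0 < e by rewrite lt_min !subr_gt0 ax.
  have [n hn] : exists n : nat, (b - a) / e < n%:R.
    by exists (Num.truncn ((b - a) / e)).+1; rewrite truncnS_gt.
  have dn : del n <= e.
    rewrite /del ler_pdivrMr// mulrC -ler_pdivrMr// ltW// (lt_trans hn)// ltr_nat.
    by rewrite ltnS leqnSn.
  have e1 : e <= x - a by rewrite /e ge_min lexx.
  have e2 : e <= b - x by rewrite /e ge_min lexx orbT.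
  by exists n => //; rewrite /A /= in_itv/=; apply/andP; split; lra.
have ndA : nondecreasing_seq A.
  move=> n k nk; apply/subsetPset => x; rewrite /A /= !in_itv/= => /andP[h1 h2].
  by have := ndel _ _ nk; move=> h; apply/andP; split; lra.
have cvgA : (\int[mu]_(x in A n) (f x)%:E)%E @[n --> \oo] -->
    (\int[mu]_(x in `]a, b[) (f x)%:E)%E.
  rewrite AE; apply: ge0_nondecreasing_set_cvg_integral => //.
  - by move=> n; exact: measurable_itv.
  - move=> n; apply/measurable_EFinP; apply: measurable_funS mf; first exact: measurable_itv.
    by move=> x /Aab; rewrite /= in_itv.
  - by move=> n x /Aab xab; rewrite lee_fin f0.
rewrite -(cvg_lim _ cvgA)//; apply: lime_le; first by apply/cvg_ex; eexists; exact: cvgA.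
apply: nearW => n.
have [le_ab|lt_ba] := leP (b - del n) (a + del n).
  apply: (@le_trans _ _ 0%E).
    rewrite (@integral_Sset1 _ _ _ (a + del n))// => x; rewrite /A /= in_itv/= => /andP[h1 h2].
    by apply/eqP; rewrite eq_le; apply/andP; split => /=; lra.
  have := FM ((a + b) / 2) ((a + b) / 2); rewrite subrr lee_fin; apply; lra.
have sub x : a + del n <= x <= b - del n -> a < x < b.
  by move=> h; apply: (Aab n); rewrite /A /= in_itv.
have cF x : a < x < b -> {for x, continuous F}.
  move=> xab; have [dFx _] := dF x xab.
  by apply: differentiable_continuous; apply/derivable1_diffP.
have da := del0 n.
rewrite /A (@continuous_FTC2 _ f F _ _ lt_ba).
- by rewrite -EFinB lee_fin; apply: FM; lra.
- apply: continuous_in_subspaceT => x; rewrite inE/= in_itv/= => /sub; exact: cf.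
- split.
  + move=> x; rewrite in_itv/= => /andP[h1 h2].
    by have [] := dF x (ltac:(apply/andP; split; lra)).
  + by apply: cvg_at_right_filter; apply: cF; apply/andP; split; lra.
  + by apply: cvg_at_left_filter; apply: cF; apply/andP; split; lra.
- move=> x; rewrite in_itv/= => /andP[h1 h2]; rewrite derive1E.
  by have [_ ->] := dF x (ltac:(apply/andP; split; lra)).
Qed.

Lemma powR_continuous (a x : R) : 0 < x -> {for x, continuous (fun t : R => t `^ a)}.
Proof.
move=> x0; apply: differentiable_continuous; apply/derivable1_diffP.
by apply: derivable_powR; rewrite in_itv/= x0.
Qed.

Lemma integral_powR_le (ga x : R) : 0 < ga -> 0 < x ->
  (\int[mu]_(t in `]0%R, x[) (t `^ (ga - 1))%:E <= (x `^ ga / ga)%:E)%E.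
Proof.
move=> g0 x0; apply: (@integral_le_primitive _ (fun t => ga^-1 *: (t `^ ga))).
- exact: x0.
- move=> t /andP[t0 _]; have h := is_derive1_powR ga t0.
  have := is_deriveZ ga^-1 h.
  by rewrite /GRing.scale/= mulrA mulVf ?gt_eqF// mul1r.
- by move=> t /andP[t0 _]; exact: powR_continuous.
- by move=> t _; exact: powR_ge0.
- move=> u v u0 uv vx; rewrite /GRing.scale/= -mulrBr mulrC ler_wpM2r ?invr_ge0 ?(ltW g0)//.
  apply: (@le_trans _ _ (v `^ ga)); first by rewrite gerBl powR_ge0.
  by rewrite ge0_ler_powR ?nnegrE ?(ltW g0) ?(ltW vx) ?(ltW x0)// ltW// (lt_le_trans u0).
Qed.

Lemma integral_powR_sub_le (a s t : R) : a < 1 -> s < t ->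
  (\int[mu]_(x in `]s, t[) ((t - x) `^ (- a))%:E <= ((t - s) `^ (1 - a) / (1 - a))%:E)%E.
Proof.
move=> a1 st; have b0 : 0 < 1 - a by rewrite subr_gt0.
pose F (x : R) := - (1 - a)^-1 *: ((t - x) `^ (1 - a)).
apply: (@integral_le_primitive (fun x => (t - x) `^ (- a)) F s t _ st).
- move=> x /andP[_ xt]; have tx0 : 0 < t - x by rewrite subr_gt0.
  have h := is_derive1_powR (1 - a) tx0.
  have h1 : is_derive x 1 (fun y : R => t - y) (-1).
    by have := is_deriveB (is_derive_cst t x 1) (is_derive_id x 1); rewrite sub0r.
  have := is_deriveZ (- (1 - a)^-1) (@is_derive1_comp R (fun y : R => y `^ (1 - a)) (fun y : R => t - y) x _ _ h h1).
  rewrite (_ : _ *: _ = (t - x) `^ (- a)) //.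
  rewrite /GRing.scale/= (_ : 1 - a - 1 = - a); last by ring.
  by move: (_ `^ _) => q; field; rewrite gt_eqF.
- move=> x /andP[_ xt]; have tx0 : 0 < t - x by rewrite subr_gt0.
  apply: (@continuous_comp _ _ _ (fun y : R => t - y) (fun y => y `^ (- a))).
    by apply: continuousB; [exact: cst_continuous|exact: cvg_id].
  exact: powR_continuous.
- by move=> x _; exact: powR_ge0.
- move=> u v su uv vt; rewrite /F /GRing.scale/= !mulNr opprK addrC -mulrBr mulrC.
  rewrite ler_wpM2r ?invr_ge0 ?(ltW b0)//.
  apply: (@le_trans _ _ ((t - u) `^ (1 - a))); first by rewrite gerBl powR_ge0.
  by rewrite ge0_ler_powR ?nnegrE ?(ltW b0)//; lra.
Qed.

(** Upper bound for the Beta function B(1-a, ga), obtained by splitting the integral at the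
    midpoint. *)
Definition beta_cst (a ga : R) : R := 2 `^ a / ga + 2 `^ (1 - ga) / (1 - a).

Lemma integral_beta_le (a ga t : R) : 0 <= a -> a < 1 -> 0 < ga -> ga <= 1 -> 0 < t ->
  (\int[mu]_(x in `]0%R, t[) ((t - x) `^ (- a) * x `^ (ga - 1))%:E <=
  (beta_cst a ga * t `^ (ga - a))%:E)%E.
Proof.
move=> a0 a1 g0 g1 t0; have b0 : 0 < 1 - a by rewrite subr_gt0.
have t20 : 0 < t / 2 by rewrite divr_gt0.
(* On each half of the interval the factor that is regular there is at most its value at the
   midpoint, both exponents being nonpositive. *)
have dec (p x : R) : p <= 0 -> t / 2 <= x -> x `^ p <= (t / 2) `^ p.
  move=> p0 tx; have E z : z `^ p = (z `^ (- p))^-1 by rewrite -powRN opprK.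
  rewrite !E.
  rewrite lef_pV2 ?posrE ?powR_gt0// ?(lt_le_trans t20 tx)//.
  by rewrite ge0_ler_powR ?nnegrE ?oppr_ge0// ?(ltW t20)// (le_trans (ltW t20)).
have mp (p : R) : measurable_fun `]0, t[ (fun x : R => x `^ p).
  exact: measurable_funS (measurableT) (@subsetT _ _) (measurable_powR p).
have mq (p : R) : measurable_fun `]0, t[ (fun x : R => (t - x) `^ p).
  apply: (measurableT_comp (measurable_powR p)); exact: measurable_funB.
apply: (@le_trans _ _ (\int[mu]_(x in `]0%R, t[)
   (((t / 2) `^ (- a))%:E * (x `^ (ga - 1))%:E +
    ((t / 2) `^ (ga - 1))%:E * ((t - x) `^ (- a))%:E))%E).
  apply: ge0_le_integral => //.
  - by move=> x _; rewrite lee_fin mulr_ge0 ?powR_ge0.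
  - by apply/measurable_EFinP; apply: measurable_funM; [exact: mq|exact: mp].
  - by apply: emeasurable_funD; apply: emeasurable_funM => //; apply/measurable_EFinP; [exact: mp|exact: mq].
  move=> x; rewrite /= in_itv/= => /andP[x0 xt].
  rewrite -!EFinM -EFinD lee_fin.
  have [h|/ltW h] := leP x (t / 2).
    rewrite -[leLHS]addr0 lerD ?mulr_ge0 ?powR_ge0//.
    by rewrite ler_wpM2r ?powR_ge0//; apply: dec; [rewrite oppr_le0|lra].
  rewrite -[leLHS]add0r lerD ?mulr_ge0 ?powR_ge0//.
  by rewrite mulrC ler_wpM2r ?powR_ge0//; apply: dec; [rewrite subr_le0|].
rewrite ge0_integralD//; last 4 first.
- by move=> x _; rewrite mule_ge0 ?lee_fin ?powR_ge0.
- by apply: emeasurable_funM => //; apply/measurable_EFinP; exact: mp.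
- by move=> x _; rewrite mule_ge0 ?lee_fin ?powR_ge0.
- by apply: emeasurable_funM => //; apply/measurable_EFinP; exact: mq.
rewrite !ge0_integralZl_EFin ?powR_ge0//; last 4 first.
- by move=> x _; rewrite lee_fin powR_ge0.
- by apply/measurable_EFinP; exact: mq.
- by move=> x _; rewrite lee_fin powR_ge0.
- by apply/measurable_EFinP; exact: mp.
apply: (@le_trans _ _ (((t / 2) `^ (- a))%:E * (t `^ ga / ga)%:E +
   ((t / 2) `^ (ga - 1))%:E * ((t - 0) `^ (1 - a) / (1 - a))%:E)%E).
  apply: leeD; (apply: lee_wpmul2l; first by rewrite lee_fin powR_ge0).
    exact: integral_powR_le.
  exact: integral_powR_sub_le.
rewrite subr0 -!EFinM -EFinD lee_fin le_eqVlt; apply/orP; left; apply/eqP.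
have E (p q : R) : (t / 2) `^ p * t `^ q = 2 `^ (- p) * t `^ (p + q).
  rewrite powRM ?invr_ge0 ?ltW// powRD ?(gt_eqF t0) ?implybT//.
  rewrite (_ : 2^-1 `^ p = 2 `^ (- p)); first by ring.
  by rewrite -powR_inv1// -powRrM mulN1r.
rewrite !mulrA !E opprK opprB /beta_cst mulrDl.
have -> : ga - 1 + (1 - a) = ga - a by ring.
have -> : - a + ga = ga - a by ring.
by move: (t `^ (ga - a)) (2 `^ a) (2 `^ (1 - ga)) => q q1 q2; ring.
Qed.

End primitive_bound.

(** * Positivity of the normalising constant of the form *)

Section gamma.
Variable R : realType.
Notation mu := (@lebesgue_measure R).

(** From ln u < u at u = t / (2 (|y| + 1)). *)
Lemma powR_le_expR (y t : R) : 1 <= t ->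
  t `^ y <= expR (`|y| * ln (2 * (`|y| + 1))) * expR (t / 2).
Proof.
move=> t1; have t0 : 0 < t by rewrite (lt_le_trans _ t1).
have y0 : 0 <= `|y| by [].
have [z z0 zE] : exists2 z : R, 0 < z & `|y| + 1 = z by exists (`|y| + 1); rewrite ?ltr_wpDl.
rewrite zE.
rewrite /powR gt_eqF// -expRD ler_expR.
have lt0 : 0 <= ln t by rewrite ln_ge0.
apply: (@le_trans _ _ (`|y| * ln t)); first by rewrite ler_wpM2r// ler_norm.
have tz : 0 < t / (2 * z) by rewrite divr_gt0// mulr_gt0.
have -> : ln t = ln (t / (2 * z)) + ln (2 * z).
  have {1}-> : t = t / (2 * z) * (2 * z) by field; rewrite gt_eqF.
  by rewrite lnM ?posrE// mulr_gt0.
rewrite mulrDr addrC lerD2l.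
apply: (@le_trans _ _ (`|y| * (t / (2 * z)))).
  by rewrite ler_wpM2l// ltW// ln_sublinear.
rewrite mulrCA ler_wpM2l ?(ltW t0)// invfM mulrCA ler_piMr ?invr_ge0//.
by rewrite ler_pdivrMr// mul1r -zE lerDl.
Qed.

(** A real-valued integral is 0 when the integral is infinite, so positivity needs finiteness
    besides a positive lower bound. *)
Lemma Gamma_gt0 (x : R) : 0 < x -> 0 < Gamma x.
Proof.
move=> x0; rewrite /Gamma.
set f := fun t : R => t `^ (x - 1) * expR (- t).
have f0 t : 0 <= f t by rewrite mulr_ge0 ?powR_ge0 ?expR_ge0.
have mf D : measurable_fun D f.
  apply: (measurable_funS measurableT) => //; apply: measurable_funM.
    exact: measurable_powR.
  by apply: measurableT_comp; [exact: measurable_expR|exact: oppr_measurable].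
have mfE D : measurable_fun D (EFin \o f) by exact/measurable_EFinP.
set C := expR (`|x - 1| * ln (2 * (`|x - 1| + 1))).
have fin : (\int[mu]_(t in `]0%R, +oo[) (f t)%:E < +oo)%E.
  have -> : `]0%R, +oo[%classic = `]0%R, 1%R[%classic `|` `[1%R, +oo[%classic :> set R.
    apply/seteqP; split => t /=; rewrite !in_itv/= !andbT.
      by move=> t0; have [h|h] := ltP t 1; [left; rewrite t0|right].
    by move=> [/andP[]//|]; exact: lt_le_trans.
  rewrite ge0_integral_setU//; last 3 first.
  - exact: mfE.
  - by move=> t _; rewrite lee_fin.
  - apply/disj_setPS => t [] /=; rewrite !in_itv/= andbT => /andP[_ h] h'.
    by move: h; rewrite ltNge h'.
  apply: lte_add_pinfty.
    apply: (@le_lt_trans _ _ (\int[mu]_(t in `]0%R, 1%R[) (t `^ (x - 1))%:E)%E).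
      apply: ge0_le_integral => //; first by move=> t _; rewrite lee_fin.
      - exact: mfE.
      - by apply/measurable_EFinP; apply: (measurable_funS measurableT) => //; exact: measurable_powR.
      - move=> t; rewrite /= in_itv/= => /andP[t0 _]; rewrite lee_fin /f ler_piMr ?powR_ge0//.
        by rewrite expR_le1 oppr_le0 ltW.
    by apply: le_lt_trans (integral_powR_le x0 ltr01) _; rewrite ltry.
  (* For t >= 1 the integrand is at most C exp(-t/2), which is 2C times the exponential density of
     rate 1/2. *)
  apply: (@le_lt_trans _ _ (\int[mu]_t ((2 * C)%:E * (exponential_pdf 2^-1 t)%:E))%E).
    rewrite integral_mkcond; apply: ge0_le_integral => //.
    - by move=> t _; rewrite patchE; case: ifP => // _; rewrite lee_fin.
    - by apply: (measurable_restrictT _ _).1; [exact: measurable_itv|exact: mfE].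
    - by apply: emeasurable_funM => //; apply/measurable_EFinP; exact: measurable_exponential_pdf.
    move=> t _; rewrite patchE; case: ifPn; rewrite ?inE/= ?in_itv/=.
      rewrite andbT => t1; rewrite lee_fin /exponential_pdf patchE mem_set; last first.
        by rewrite /= in_itv/= andbT (le_trans _ t1).
      rewrite (_ : 2 * C * _ = C * expR (t / 2) * expR (- t)); last first.
        rewrite -[RHS]mulrA -expRD (_ : t / 2 - t = - 2^-1 * t); last by field.
        by field.
      by rewrite /f ler_wpM2r ?expR_ge0// powR_le_expR.
    by move=> _; rewrite mule_ge0// lee_fin ?mulr_ge0 ?expR_ge0// exponential_pdf_ge0.
  rewrite ge0_integralZl_EFin//; last 3 first.
  - by move=> t _; rewrite lee_fin exponential_pdf_ge0.
  - by apply/measurable_EFinP; exact: measurable_exponential_pdf.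
  - by rewrite mulr_ge0// expR_ge0.
  by rewrite integral_exponential_pdf// mule1 ltry.
have lower : (0 < \int[mu]_(t in `]0%R, +oo[) (f t)%:E)%E.
  (* On the interval from 1 to 2 the monotone function t^(x-1) is at least the smaller of its end
     values. *)
  pose k := Num.min 1 (2 `^ (x - 1)) * expR (- 2).
  have k0 : 0 < k by rewrite mulr_gt0 ?expR_gt0// lt_min ltr01 powR_gt0.
  apply: (@lt_le_trans _ _ (\int[mu]_(t in `]1%R, 2%R[) (cst k%:E t))%E).
    rewrite integral_cst; last exact: measurable_itv.
    rewrite [X in (_ * X)%E](_ : _ = 1%E); last first.
      apply: etrans (lebesgue_measure_itv _) _.
      by rewrite /= lte_fin ltr1n -EFinD; congr EFin; ring.
    by rewrite mule1 lte_fin.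
  apply: (@le_trans _ _ (\int[mu]_(t in `]1%R, 2%R[) (f t)%:E)%E).
    apply: ge0_le_integral => //; first by move=> t _; rewrite lee_fin ltW.
      exact: mfE.
    move=> t; rewrite /= in_itv/= => /andP[t1 t2]; rewrite lee_fin /k /f.
    apply: ler_pM; rewrite ?expR_ge0//; last by rewrite ler_expR lerN2 ltW.
    rewrite ge_min; have [h|h] := leP 0 (x - 1).
      by rewrite -{1}(powRr0 t) ler_powR ?(ltW t1).
    have t0 : 0 < (t : R) := lt_trans ltr01 t1.
    apply/orP; right; rewrite -(opprK (x - 1)) !(powRN _ (- (x - 1))) lef_pV2 ?posrE ?powR_gt0//.
    by rewrite ge0_ler_powR ?nnegrE ?oppr_ge0 ?(ltW h) ?(ltW t2) ?(ltW t0).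
  apply: ge0_subset_integral => //; [exact: mfE|by move=> t _; rewrite lee_fin|].
  move=> t; rewrite /= !in_itv/= andbT => /andP[t1 _]; exact: lt_trans ltr01 t1.
by rewrite /Rintegral fine_gt0// lower.
Qed.

Lemma C_Ns_gt0 (N : nat) (s : R) : 0 < s < 1 -> 0 < C_Ns N s.
Proof.
move=> /andP[s0 s1]; rewrite /C_Ns divr_gt0//.
  rewrite mulr_gt0 ?mulr_gt0 ?powR_gt0// Gamma_gt0// divr_gt0//.
  by rewrite ltr_wpDl// mulr_gt0.
by rewrite mulr_gt0 ?powR_gt0 ?pi_gt0// Gamma_gt0// subr_gt0.
Qed.

End gamma.

(** * Almost everywhere statements on products and at fixed times *)

Section product_null.
Context d1 d2 (T1 : measurableType d1) (T2 : measurableType d2) (R : realType).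
Variables (m1 : {sigma_finite_measure set T1 -> \bar R})
  (m2 : {sigma_finite_measure set T2 -> \bar R}).

Lemma ae_product_section (P : T1 * T2 -> Prop) :
  {ae (m1 \x m2)%E, forall z, P z} -> {ae m1, forall x, {ae m2, forall y, P (x, y)}}.
Proof.
move=> [A [mA A0 PA]].
have mf := measurable_fun_xsection m2 mA.
have : (\int[m1]_x `|m2 (xsection A x)| = 0)%E.
  by rewrite -[RHS]A0; apply: eq_integral => x _; rewrite gee0_abs.
move/(ae_eq_integral_abs _ measurableT mf); apply: filterS => x /(_ Logic.I) xA0.
exists (xsection A x); split => //; first exact: measurable_xsection.
by move=> y nP; rewrite /xsection/= inE; exact: PA.
Qed.

(** The kernels are bounded almost everywhere in (t, x, y); this extracts a bound for almost every
    pair at almost every time. *)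
Lemma ae_product_section3 (P : T1 * T2 * T2 -> Prop) :
  {ae ((m1 \x m2) \x m2)%E, forall z, P z} ->
  {ae m1, forall t, {ae (m2 \x m2)%E, forall z, P (t, z.1, z.2)}}.
Proof.
move=> [A [mA A0 PA]].
have mf := measurable_fun_xsection m2 mA.
have f0 z : (0 <= m2 (xsection A z))%E by [].
have mF : measurable_fun setT (@fubini_F _ _ T1 T2 R m2 (fun z => m2 (xsection A z))).
  exact: measurable_fun_fubini_tonelli_F.
have : (\int[m1]_t `|@fubini_F _ _ T1 T2 R m2 (fun z => m2 (xsection A z)) t| = 0)%E.
  rewrite -[RHS]A0 [RHS](@fubini_tonelli1 _ _ _ _ _ m1 m2 _ mf f0).
  by apply: eq_integral => x _; rewrite gee0_abs//; exact: integral_ge0.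
move/(ae_eq_integral_abs _ measurableT mF); apply: filterS => t /(_ Logic.I) tA0.
exists [set z | A (t, z.1, z.2)]; split.
- rewrite -[X in measurable X]setTI.
  have mp : measurable_fun setT (fun z : T2 * T2 => (t, z.1, z.2)).
    by apply: measurable_fun_pair => //; apply: measurable_fun_pair.
  exact: mp.
- rewrite -[RHS]tA0; apply: eq_integral => x _; congr (m2 _).
- by move=> z nP; exact: PA.
Qed.

End product_null.

Section product_ae.
Context d1 (X : measurableType d1) (R : realType).
Variable m : {finite_measure set X -> \bar R}.

Lemma ae_product_fst_snd (P : X -> Prop) : {ae m, forall x, P x} ->
  {ae (m \x m)%E, forall z, P z.1 /\ P z.2}.
Proof.
move=> [A [mA A0 PA]]; exists ((A `*` setT) `|` (setT `*` A)); split.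
- by apply: measurableU; exact: measurableX.
- apply/eqP; rewrite -measure_le0.
  apply: (@le_trans _ _ ((m \x m)%E (A `*` setT) + (m \x m)%E (setT `*` A))%E).
    by apply: measureU2; exact: measurableX.
  by rewrite !product_measure1E//= A0 mul0e mule0 adde0.
- move=> z nP; have [Az|nAz] := pselect (A z.1); first by left.
  right; split => //; apply: (PA) => Pz2; apply: nP; split => //.
  by apply: contrapT => nP1; apply: nAz; exact: (PA z.1).
Qed.

End product_ae.

Section nonmeasurable.
Context d1 (X : measurableType d1) (R : realType).
Variable m : {measure set X -> \bar R}.

(** The negative part vanishes off a null set, so it lies below the function equal to +oo on that
    set, whose integral is 0. No measurability of [f] enters, as the boundary integrands contain
    traces. *)
Lemma Rintegral_ae_ge0 (D : set X) (f : X -> R) :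
  {ae m, forall x, D x -> 0 <= f x} -> 0 <= \int[m]_(x in D) f x.
Proof.
move=> [A [mA A0 PA]]; rewrite /Rintegral fine_ge0// integralE.
suff -> : (\int[m]_(x in D) (EFin \o f)^\- x = 0)%E.
  by rewrite sube0; exact: integral_ge0.
apply/eqP; rewrite eq_le; apply/andP; split; last exact: integral_ge0.
apply: (@le_trans _ _ (\int[m]_(x in setT) (cst +oo%E \_ A) x)%E); last first.
  by rewrite -integral_mkcond integral_cst// A0 mule0.
rewrite integral_mkcond; apply: ge0_le_integral_nm => x _.
  by rewrite patchE; case: ifP.
rewrite !patchE; case: ifPn => xD; last by case: ifP; rewrite ?leey.
case: ifPn => [_|/negP xA]; first by rewrite leey.
rewrite funenegE -EFinN -EFin_max lee_fin ge_max lexx andbT oppr_le0.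
apply: contrapT => nf; apply: xA; rewrite inE; apply: PA => /=; move=> h; apply: nf.
by apply: h; rewrite inE in xD.
Qed.

End nonmeasurable.

Section time_section.
Context d1 (Z : measurableType d1) (R : realType).
Variable nu : {measure set Z -> \bar R}.
Notation leb := (@lebesgue_measure R).

(** A null set contains no interval of positive length. *)
Lemma ae_good_time (T t e : R) (Q : R -> Prop) : 0 < T -> 0 <= t <= T -> 0 < e ->
  {ae leb, forall t, Q t} -> exists2 tau, 0 <= tau <= T /\ `|t - tau| <= e & Q tau.
Proof.
move=> T0 /andP[t0 tT] e0 [A [mA A0 QA]]; apply: contrapT => h.
pose e' := Num.min e (T / 2).
have e'0 : 0 < e' by rewrite lt_min e0 divr_gt0.
have [e'e e'T] : e' <= e /\ e' <= T / 2 by rewrite /e' !ge_min !lexx orbT.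
(* The interval of length [e'] is laid on the side of [t] that stays within [0, T]. *)
have [x [x0 xT] xt] : exists2 x, 0 <= x /\ x + e' <= T & x <= t /\ t <= x + e'.
  have [ht|ht] := leP t (T / 2).
    by exists t; split; lra.
  by exists (t - e'); split; lra.
have sub : `[x, x + e']%classic `<=` A.
  move=> y; rewrite /= in_itv/= => /andP[y1 y2]; apply: QA => Qy; apply: h; exists y => //.
  by split; [apply/andP; split; lra|rewrite ler_norml; apply/andP; split; lra].
have : leb `[x, x + e']%classic = 0%E.
  by apply: (subset_measure0 _ mA sub A0); exact: measurable_itv.
rewrite lebesgue_measure_itv/= lte_fin ltrDl e'0 -EFinB => -[]; lra.
Qed.

(** Hoelder continuity in time carries the bounds from good times near [t] to [t] itself up to an
    error 1/(n+1); the null sets for all n together are still null. *)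
Lemma ae_time_section (Dm : set Z) (g : R -> Z -> R) (T l u C eta : R) :
  0 < T -> 0 < eta ->
  {ae leb, forall t, 0 <= t <= T -> {ae nu, forall z, Dm z -> l <= g t z <= u}} ->
  (forall t tau, 0 <= t <= T -> 0 <= tau <= T ->
     {ae nu, forall z, Dm z -> `|g t z - g tau z| <= C * `|t - tau| `^ eta}) ->
  forall t, 0 <= t <= T -> {ae nu, forall z, Dm z -> l <= g t z <= u}.
Proof.
move=> T0 eta0 aeg hg t tT.
have eps n : exists2 e : R, 0 < e & `|C| * e `^ eta <= n.+1%:R^-1.
  exists (((`|C| + 1) * n.+1%:R)^-1 `^ eta^-1).
    by rewrite powR_gt0 // invr_gt0 mulr_gt0 // ltr_wpDl.
  rewrite -powRrM mulVf ?gt_eqF// powRr1; last by rewrite invr_ge0 mulr_ge0.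
  rewrite invfM mulrA ler_piMl ?invr_ge0// ler_pdivrMr ?mul1r ?lerDl//.
have good n : exists tau, [/\ 0 <= tau <= T,
    {ae nu, forall z, Dm z -> `|g t z - g tau z| <= n.+1%:R^-1} &
    {ae nu, forall z, Dm z -> l <= g tau z <= u}].
  have [e e0 eC] := eps n.
  have [tau [tauT te] Q] := ae_good_time T0 tT e0 aeg.
  exists tau; split => //; last exact: Q.
  apply: filterS (hg t tau tT tauT) => z h Dz; apply: le_trans (h Dz) _.
  apply: le_trans eC; apply: (@le_trans _ _ (`|C| * `|t - tau| `^ eta)).
    by rewrite ler_wpM2r ?powR_ge0 ?ler_norm.
  by rewrite ler_wpM2l// ge0_ler_powR ?nnegrE// ltW.
have : {ae nu, forall z, forall n, Dm z -> l - n.+1%:R^-1 <= g t z <= u + n.+1%:R^-1}.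
  apply/ae_foralln => n; have [tau [_ h1 h2]] := good n.
  apply: filterS2 h1 h2 => z h3 h4 Dz; have /andP[h5 h6] := h4 Dz.
  have := h3 Dz; move: (n.+1%:R^-1 : R) => e; rewrite ler_norml => /andP[h7 h8].
  by apply/andP; split; lra.
apply: filterS => z h Dz; apply/andP; split; apply/ler_addgt0Pl => e e0;
  have [n] := ltr_add_invr e0; rewrite add0r => ne; have := h n Dz;
  move: (n.+1%:R^-1 : R) ne => x xe /andP[].
- lra.
- lra.
Qed.

End time_section.


(** * Lower bound for the form on truncated powers *)

Section energy_bound.
Variables (R : realType) (N : nat).
Local Notation X := (RN R N).
Local Notation LN := (lebesgue_RN R N).
Variables (O : set X) (oO : open O) (mu : {finite_measure set X -> \bar R}).
Local Notation F := (boundary O).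
Variables (s d eps delta : R).
Hypotheses (N0 : (0 < N)%N) (eps0 : (0 < eps)%R) (delta0 : (0 < delta)%R).
Hypothesis ed : eps_delta_domain eps delta O.
Hypothesis ds : d_set mu F d.
Hypotheses (s01 : 0 < s < 1) (d0 : 0 < d) (dN : d <= N%:R).
Hypotheses (sN : 2 * s <= N%:R) (dsN : N%:R - d < 2 * s).
Variables (T eta k1 k2 zeta1 zeta2 b0 c C : R).
Variables (K zeta : R -> X -> X -> R) (b : R -> X -> R).
Hypotheses (T0 : 0 < T) (eta0 : 0 < eta) (k10 : 0 < k1) (z10 : 0 < zeta1) (b00 : 0 < b0).
Hypotheses (K_adm : admissible_kernel LN O T k1 k2 C eta K)
  (zeta_adm : admissible_kernel mu F T zeta1 zeta2 C eta zeta)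
  (b_adm : admissible_coefficient mu F T b0 c eta b).

Let mO : measurable O. Proof. exact: open_measurable_RN. Qed.

Lemma kernel_ae_bounds (nu : {sigma_finite_measure set X -> \bar R}) (Dm : set X)
    (l u : R) (A : R -> X -> X -> R) :
  admissible_kernel nu Dm T l u C eta A -> forall t, 0 <= t <= T ->
  {ae (nu \x nu)%E, forall z, (Dm `*` Dm) z -> l <= A t z.1 z.2 <= u}.
Proof.
move=> [_ _ /ae_product_section3 h1 h2].
apply: (@ae_time_section _ _ _ _ (Dm `*` Dm) (fun t z => A t z.1 z.2) T l u C eta) => //.
  apply: filterS h1 => t h tT; apply: filterS h => z /= h [Dz1 Dz2]; exact: h.
move=> t tau tT tauT; apply: filterS (h2 t tau tT tauT) => z h [Dz1 Dz2]; exact: h.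
Qed.

Lemma coefficient_ae_ge0 t : 0 <= t <= T -> {ae mu, forall x, F x -> 0 <= b t x}.
Proof.
have [_ [M h1] [b1 [b01 h2]] h3] := b_adm; move=> tT.
have h : {ae mu, forall x, F x -> b1 <= b t x <= M}.
  apply: (@ae_time_section _ _ _ _ F b T b1 M c eta) => //.
  apply: filterS2 (ae_product_section h1) (ae_product_section h2) => u h4 h5 uT.
  apply: filterS2 h4 h5 => x /= h4 h5 Fx; rewrite h5//=.
  exact: le_trans (ler_norm _) (h4 uT Fx).
apply: filterS h => x h Fx; have /andP[h4 _] := h Fx.
by apply: le_trans h4; rewrite ltW// (lt_trans b00).
Qed.

Lemma tpow_mono_ge0 j (n x y : R) : 0 < n -> 0 <= (tpow n j.*2 x - tpow n j.*2 y) * (x - y).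
Proof.
move=> n0; have := tpow_strong_monotone j n0 x y.
by move/(le_trans (sqr_ge0 _)); rewrite pmulr_rge0.
Qed.

Lemma tpow_sign_ge0 j (n x : R) : 0 < n -> 0 <= x * tpow n j.*2 x.
Proof.
by move=> n0; have := tpow_mono_ge0 j x 0 n0; rewrite tpow0 !subr0 mulrC.
Qed.

(** The trace commutes with [tpow], which is monotone, so both boundary terms are nonnegative;
    strong monotonicity and K >= k1 bound the interior term from below. *)
Lemma energy_tpow_ge k n (w : X -> R) t : 0 < n -> Hs O s w -> 0 <= t <= T ->
  C_Ns N s / 2 * (k1 / k.+1%:R) * fine (gagliardo O s (tpow n k \o w)) <=
  energy O mu s d K b zeta t w (tpow n k.*2 \o w).
Proof.
move=> n0 Hw tT; have /andP[s0 s1] := s01.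
have C0 := C_Ns_gt0 N s01.
have [Hv trv] := Hs_trace_lipschitz oO N0 eps0 delta0 ed ds s0 dsN Hw
  (tpow0 n k.*2) (mulr_ge0 (ler0n _ _) (exprn_ge0 _ (ltW n0))) (tpow_lipschitz n0 k.*2).
have [[mpsi _ psiG] _] := Hs_trace_lipschitz oO N0 eps0 delta0 ed ds s0 dsN Hw
  (tpow0 n k) (mulr_ge0 (ler0n _ _) (exprn_ge0 _ (ltW n0))) (tpow_lipschitz n0 k).
have [mw _ wG] := Hw; have [mv _ _] := Hv.
rewrite /energy -[leLHS]addr0 -[leLHS]addr0; apply: lerD; last first.
  rewrite /Theta; apply: Rintegral_ae_ge0.
  have := ae_product_fst_snd trv; apply: filterS2 (kernel_ae_bounds zeta_adm tT).
  move=> z h [t1 t2] [Fz1 Fz2]; have /andP[h1 _] := h (conj Fz1 Fz2).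
  rewrite t1// t2// divr_ge0 ?powR_ge0// mulr_ge0//.
    exact: le_trans (ltW z10) h1.
  by rewrite mulrC tpow_mono_ge0.
apply: lerD; last first.
  apply: Rintegral_ae_ge0; apply: filterS2 trv (coefficient_ae_ge0 tT) => x t1 bx Fx.
  by rewrite t1// -mulrA mulr_ge0 ?bx// tpow_sign_ge0.
rewrite -mulrA; apply: ler_wpM2l; first exact: ltW (divr_gt0 C0 _).
(* [K] cut to [k1, k2] satisfies its bounds everywhere instead of almost everywhere and gives the
   same integral. *)
pose Kc (z : X * X) := Num.max k1 (Num.min k2 (K t z.1 z.2)).
pose e (z : X * X) := edist z.1 z.2 `^ (N%:R + 2 * s).
pose h (z : X * X) := (w z.1 - w z.2) * (tpow n k.*2 (w z.1) - tpow n k.*2 (w z.2)).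
have Kb := kernel_ae_bounds K_adm tT.
have mD : measurable (O `*` O) by exact: measurableX.
have mfst (f : X -> R) : measurable_fun O f -> measurable_fun (O `*` O) (fun z : X * X => f z.1).
  by move=> mf; apply: (measurable_comp mO _ mf (measurable_funS measurableT (@subsetT _ _) measurable_fst)) => // y [z [? ?] <-].
have msnd (f : X -> R) : measurable_fun O f -> measurable_fun (O `*` O) (fun z : X * X => f z.2).
  by move=> mf; apply: (measurable_comp mO _ mf (measurable_funS measurableT (@subsetT _ _) measurable_snd)) => // y [z [? ?] <-].
have mh : measurable_fun (O `*` O) h.
  apply: measurable_funM; apply: measurable_funB.
  - exact: mfst.
  - exact: msnd.
  - exact: (mfst (tpow n k.*2 \o w)).
  - exact: (msnd (tpow n k.*2 \o w)).
have me : measurable_fun (O `*` O) (fun z => (e z)^-1).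
  rewrite (_ : (fun z => _) = fun z => edist z.1 z.2 `^ (- (N%:R + 2 * s))); last first.
    by apply/funext => z; rewrite powRN.
  apply: (measurable_funS measurableT) => //.
  exact: (measurableT_comp (measurable_powR _) (@measurable_edist R N)).
have mK : measurable_fun (O `*` O) (fun z => K t z.1 z.2).
  have [mK _ _ _] := K_adm.
  have mDD : measurable (`[0%R, T]%classic `*` O `*` O : set (measurableTypeR R * X * X)).
    by apply: measurableX => //; apply: measurableX => //; exact: measurable_itv.
  apply: (measurable_comp mDD _ mK (g := fun z : X * X => (t, z.1, z.2))).
    by move=> _ [z [? ?] <-]; split => //; split => //=; rewrite in_itv.
  apply: (measurable_funS measurableT) => //.
  by apply: measurable_fun_pair => //; apply: measurable_fun_pair.
have mKc : measurable_fun (O `*` O) Kc.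
  by apply: measurable_maxr; [exact: measurable_cst|apply: measurable_minr].
have h0 z : 0 <= h z by rewrite /h mulrC tpow_mono_ge0.
have e0 z : 0 <= (e z)^-1 by rewrite invr_ge0 powR_ge0.
have Kc1 z : k1 <= Kc z by rewrite /Kc le_max lexx.
have Kc0 z : 0 <= Kc z := le_trans (ltW k10) (Kc1 z).
have -> : \int[(LN \x LN)%E]_(z in O `*` O)
      (K t z.1 z.2 * ((w z.1 - w z.2) * ((tpow n k.*2 \o w) z.1 - (tpow n k.*2 \o w) z.2))
       / edist z.1 z.2 `^ (N%:R + 2 * s)) =
   \int[(LN \x LN)%E]_(z in O `*` O) (Kc z * h z / e z).
  rewrite /Rintegral; congr fine; apply: ae_eq_integral => //.
  - by apply/measurable_EFinP; apply: measurable_funM => //; exact: measurable_funM.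
  - by apply/measurable_EFinP; apply: measurable_funM => //; exact: measurable_funM.
  apply: filterS Kb => z Kb Oz; rewrite /= /Kc.
  by have /andP[h1 h2] := Kb Oz; rewrite min_r// max_r.
have k120 : 0 <= k1 / k.+1%:R by rewrite divr_ge0// ltW.
have lo : ((k1 / k.+1%:R)%:E * gagliardo O s (tpow n k \o w) <=
    \int[(LN \x LN)%E]_(z in O `*` O) (Kc z * h z / e z)%:E)%E.
  rewrite /gagliardo -ge0_integralZl_EFin//; last 2 first.
  - by move=> z _; rewrite lee_fin divr_ge0 ?sqr_ge0 ?powR_ge0.
  - apply/measurable_EFinP; apply: measurable_funM => //; apply: measurable_funX.
    by apply: measurable_funB; [exact: (mfst (tpow n k \o w))|exact: (msnd (tpow n k \o w))].
  apply: ge0_le_integral_nm => z _.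
    by rewrite -EFinM lee_fin mulr_ge0// divr_ge0 ?sqr_ge0 ?powR_ge0.
  rewrite -EFinM lee_fin mulrA; apply: ler_wpM2r; first exact: e0.
  have H : (tpow n k (w z.1) - tpow n k (w z.2)) ^+ 2 <= k.+1%:R * h z.
    by rewrite /h [X in _ * X]mulrC; exact: tpow_strong_monotone.
  apply: (@le_trans _ _ (k1 * h z)); last exact: (ler_wpM2r (h0 z) (Kc1 z)).
  rewrite -mulrA; apply: ler_wpM2l; first exact: ltW.
  by rewrite ler_pdivrMl.
(* The form is a real-valued integral, which would read an infinite value as 0. Finiteness comes
   from the Lipschitz constant (2k+1) n^(2k) of the truncated power. *)
have hi : (\int[(LN \x LN)%E]_(z in O `*` O) (Kc z * h z / e z)%:E < +oo)%E.
  pose M := Num.max k1 k2 * (k.*2.+1%:R * n ^+ k.*2).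
  have M0 : 0 <= M by rewrite mulr_ge0 ?le_max ?(ltW k10)// mulr_ge0 ?exprn_ge0 ?(ltW n0).
  apply: (@le_lt_trans _ _ (M%:E * \int[(LN \x LN)%E]_(z in O `*` O)
         ((w z.1 - w z.2) ^+ 2 / edist z.1 z.2 `^ (N%:R + 2 * s))%:E)%E); last first.
    by rewrite lte_mul_pinfty.
  rewrite -ge0_integralZl_EFin//; last 2 first.
  - by move=> z _; rewrite lee_fin divr_ge0 ?sqr_ge0 ?powR_ge0.
  - apply/measurable_EFinP; apply: measurable_funM => //; apply: measurable_funX.
    by apply: measurable_funB; [exact: mfst|exact: msnd].
  apply: ge0_le_integral_nm => z _.
    by rewrite lee_fin mulr_ge0// mulr_ge0.
  rewrite -EFinM lee_fin [leRHS]mulrA; apply: ler_wpM2r; first exact: e0.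
  rewrite /M -mulrA; apply: ler_pM => //.
    rewrite /Kc ge_max !le_max lexx/=; apply/orP; right.
    by rewrite ge_min lexx.
  apply: le_trans (ler_norm _) _; rewrite /h normrM -(real_normK (num_real (w _ - _))) expr2.
  rewrite [leRHS]mulrA [leRHS]mulrC; apply: ler_wpM2l => //; exact: tpow_lipschitz.
rewrite /Rintegral -lee_fin fineK; last first.
  by rewrite ge0_fin_numE//; apply: integral_ge0 => z _; rewrite lee_fin mulr_ge0// mulr_ge0.
rewrite EFinM fineK//; rewrite ge0_fin_numE//; exact: gagliardo_ge0.
Qed.

End energy_bound.

(** * Calculus in L^q and the inner product of L^2 *)

Section Lq_facts.
Context dsp (X : measurableType dsp) (R : realType).
Variable m : {measure set X -> \bar R}.
Variables (p : R) (p1 : (1 <= p%:E)%E).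
Local Notation V := (Lq m p1).
Implicit Types f g : V.

Let p0 : 0 < p. Proof. by have := p1; rewrite lee_fin; exact: lt_le_trans. Qed.

Lemma Lq_measurable f : measurable_fun [set: X] f.
Proof. by have := LfunP (repr f); rewrite inE => /andP[+ _]; rewrite inE. Qed.

Lemma Lq_powE f : ((`|f| `^ p)%:E = \int[m]_x (`|f x| `^ p)%:E)%E.
Proof.
by rewrite -poweR_EFin Lq_normE powR_Lnorm ?gt_eqF.
Qed.

Lemma Lq_eqP f g : (f : X -> R) = g %[ae m] <-> f = g.
Proof. split=> [fg|-> //]; last exact: aeW.
by rewrite -(Lq_funK f) -(Lq_funK g); apply/Lq_ofP. Qed.

Lemma Lq_exists (h : X -> R) : measurable_fun [set: X] h ->
  (\int[m]_x (`|h x| `^ p)%:E < +oo)%E -> exists f, (f : X -> R) = h %[ae m].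
Proof.
move=> mh hp.
have hL : h \in Lfun m p%:E.
  rewrite inE; apply/andP; split; rewrite inE//=.
  rewrite /finite_norm; apply: (@lty_poweRy _ _ p); first by rewrite gt_eqF.
  by rewrite powR_Lnorm ?gt_eqF.
by exists (Lq_of (Lfun_Sub p1 hL)); apply: ae_eq_trans (Lq_ofK _) _; exact: aeW.
Qed.

Lemma Lq_add f g : {ae m, forall x, (f + g : V) x = f x + g x}.
Proof.
have := Lq_ofK (repr f + repr g : LfunType m p1); rewrite Lq_ofD !Lq_funK.
by apply: filterS => x; exact.
Qed.

Lemma Lq_scale (a : R) f : {ae m, forall x, (a *: f : V) x = a * f x}.
Proof.
have := Lq_ofK (a *: repr f : LfunType m p1); rewrite Lq_ofZ Lq_funK.
by apply: filterS => x; exact.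
Qed.

Lemma Lq_opp f : {ae m, forall x, (- f : V) x = - f x}.
Proof.
have := Lq_ofK (- repr f : LfunType m p1); rewrite Lq_ofN Lq_funK.
by apply: filterS => x; exact.
Qed.

Lemma Lq_sub f g : {ae m, forall x, (f - g : V) x = f x - g x}.
Proof.
by have := Lq_add f (- g); have := Lq_opp g; apply: filterS2 => x h1; rewrite h1.
Qed.

Let measurable_pow f : measurable_fun [set: X] (fun x => (`|f x| `^ p)%:E).
Proof.
apply/measurable_EFinP; apply: (measurableT_comp (measurable_powR _)).
by apply: measurableT_comp => //; exact: Lq_measurable.
Qed.

Lemma Lq_norm_le f g (c : R) : 0 <= c ->
  {ae m, forall x, `|f x| <= c * `|g x|} -> `|f| <= c * `|g|.
Proof.
move=> c0 fg; rewrite -(@ler_pXn2r _ 1) ?nnegrE ?mulr_ge0//.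
have H : `|f| `^ p <= (c * `|g|) `^ p.
  rewrite -lee_fin powRM// EFinM !Lq_powE.
  rewrite -ge0_integralZl_EFin//; last exact: powR_ge0.
  apply: ae_ge0_le_integral => //.
  - by move=> x _; rewrite mule_ge0// lee_fin powR_ge0.
  - exact: emeasurable_funM.
  apply: filterS fg => x fg _; rewrite -EFinM lee_fin -powRM// ge0_ler_powR// ?nnegrE ?(ltW p0)//.
  by rewrite mulr_ge0.
rewrite !expr1 leNgt; apply/negP => h; move: H; rewrite leNgt => /negP; apply.
by rewrite gt0_ltr_powR ?nnegrE ?mulr_ge0.
Qed.

End Lq_facts.

Section L2_facts.
Context dsp (X : measurableType dsp) (R : realType).
Variable m : {measure set X -> \bar R}.
Implicit Types f g h : L2 m.

Lemma L2_sqrE f : ((`|f| ^+ 2)%:E = \int[m]_x (f x ^+ 2)%:E)%E.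
Proof.
rewrite -powR_mulrn// Lq_powE; apply: eq_integral => x _.
by rewrite powR_mulrn// real_normK ?num_real.
Qed.

Lemma ip_integrable f g : m.-integrable [set: X] (EFin \o (fun x => f x * g x)).
Proof.
by apply/Lfun1_integrable; apply: (Lfun2_mul_Lfun1 (LfunP (repr f)) (LfunP (repr g))).
Qed.

Lemma ipC f g : ip f g = ip g f.
Proof. by apply: eq_Rintegral => x _; rewrite mulrC. Qed.

Lemma ip_comb (a : R) f g h : ip (a *: f + g) h = a * ip f h + ip g h.
Proof.
rewrite /ip -RintegralZl//; last exact: ip_integrable.
rewrite -RintegralD//; last 2 first.
- have := integrableZl measurableT a (ip_integrable f h); apply: eq_integrable => //.
- exact: ip_integrable.
congr fine; apply: ae_eq_integral => //.
- by apply/measurable_EFinP; apply: measurable_funM; exact: Lq_measurable.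
- apply/measurable_EFinP; apply: measurable_funD.
    by apply: measurable_funM => //; apply: measurable_funM; exact: Lq_measurable.
  by apply: measurable_funM; exact: Lq_measurable.
have := Lq_scale a f; have := Lq_add (a *: f) g; apply: filterS2 => x h1 h2 _.
by rewrite /= h1 h2 mulrDl mulrA.
Qed.

Lemma ipDl f g h : ip (f + g) h = ip f h + ip g h.
Proof. by have := ip_comb 1 f g h; rewrite scale1r mul1r. Qed.

Lemma ipZl (a : R) f h : ip (a *: f) h = a * ip f h.
Proof.
have := ip_comb a f 0 h; rewrite addr0 => ->.
by have := ipDl 0 0 h; rewrite addr0; lra.
Qed.

Lemma ipNl f h : ip (- f) h = - ip f h.
Proof. by rewrite -scaleN1r ipZl mulN1r. Qed.

Lemma ipBl f g h : ip (f - g) h = ip f h - ip g h.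
Proof. by rewrite ipDl ipNl. Qed.

Lemma ip_le_norm f g : `|ip f g| <= `|f| * `|g|.
Proof.
rewrite -lee_fin EFinM !Lq_normE.
apply: (@le_trans _ _ ('N[m]_1[EFin \o (f \* g)%R])%E); last first.
  by apply: hoelder => //; [exact: Lq_measurable..|rewrite [RHS]splitr !div1r].
have fi := ip_integrable f g.
rewrite Lnorm1 /ip -abse_EFin /Rintegral fineK; last exact: integrable_fin_num.
by apply: le_abse_integral => //; apply/measurable_EFinP; apply: measurable_funM; exact: Lq_measurable.
Qed.

End L2_facts.

Lemma within_continuous_dist (R : realType) (V W : normedModType R) (A : set V) (f : V -> W) :
  {within A, continuous f} <->
  (forall x, A x -> forall e : R, 0 < e ->
     exists2 d : R, 0 < d & forall y, A y -> `|x - y| < d -> `|f x - f y| < e).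
Proof.
rewrite subspace_continuousP; split=> h x Ax.
  move=> e e0; have /cvgrPdist_lt/(_ e e0) := h x Ax.
  rewrite near_withinE => /nbhs_ballP[d /= d0 dP]; exists d => // y Ay xy.
  by apply: (dP y) => //; rewrite -ball_normE.
apply/cvgrPdist_lt => e e0; have [d d0 dP] := h x Ax e e0.
rewrite near_withinE; apply/nbhs_ballP; exists d => //= y; rewrite -ball_normE => xy Ay; exact: dP.
Qed.

(** * A differential inequality that forgets its initial value *)

Section smoothing_ode.
Variable R : realType.

(** As the inequality holds for every small h, h may depend on t. With h = sg (t - t0) it says that
    (t - t0)^(k+1) Y has derivative at most C M (t - t0)^(k-a). The weight removes the value of Y at
    t0, and the mean value theorem concludes. *)
Lemma smoothing_ode (T a c K h0 : R) : 0 < T -> 0 <= a -> 0 < c -> 0 <= K -> 0 < h0 ->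
  exists C, 0 < C /\ forall (Y dY : R -> R) t0 t1 M, t0 < t1 -> t1 - t0 <= T -> 0 <= M ->
  (forall t, t0 < t < t1 -> 0 <= Y t) ->
  (forall t, t0 < t < t1 -> is_derive t 1 Y (dY t)) ->
  {within `[t0, t1], continuous Y} ->
  (forall t h, t0 < t < t1 -> 0 < h <= h0 -> h * dY t <= - (c * Y t) + K * h `^ (- a) * M) ->
  Y t1 <= C * (t1 - t0) `^ (- a) * M.
Proof.
move=> T0 a0 c0 K0 h00.
(* k >= a makes (t - t0)^(k-a) nondecreasing, so its value at the intermediate point is at most the
   one at t1. *)
have [k ak] : exists k : nat, a <= k%:R.
  by exists (Num.truncn a).+1; rewrite ltW// truncnS_gt.
(* sg T <= h0 makes h = sg (t - t0) admissible; sg (k+1) <= c absorbs the derivative of the weight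
   into the term -c Y. *)
have [sg [sg0 sgT sgk]] : exists sg : R, [/\ 0 < sg, sg * T <= h0 & sg * k.+1%:R <= c].
  exists (Num.min (h0 / T) (c / k.+1%:R)); split.
  - by rewrite lt_min !divr_gt0.
  - by rewrite -ler_pdivlMr// ge_min lexx.
  - by rewrite -ler_pdivlMr// ge_min lexx orbT.
pose C := K * sg^-1 * sg `^ (- a); have C0 : 0 <= C.
  by rewrite !mulr_ge0 ?invr_ge0 ?powR_ge0 ?(ltW sg0).
exists (C + 1); split; first by rewrite ltr_wpDl.
move=> Y dY t0 t1 M t01 tT M0 Y0 hd cY hY.
have t010 : 0 < t1 - t0 by rewrite subr_gt0.
pose Z (t : R) := (t - t0) ^+ k.+1 * Y t.
pose dZ (t : R) := (t - t0) ^+ k.+1 * dY t + (k.+1%:R * (t - t0) ^+ k) * Y t.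
have dZP (x : R) : x \in `]t0, t1[%R -> is_derive x 1 Z (dZ x).
  rewrite in_itv/= => /hd hx.
  have h1 : is_derive x 1 (fun y : R => y - t0) 1.
    by have := is_deriveB (is_derive_id x 1) (is_derive_cst t0 x 1); rewrite subr0.
  have h2 : is_derive x 1 (fun y : R => (y - t0) ^+ k.+1) (k.+1%:R * (x - t0) ^+ k).
    have := is_deriveX k.+1 h1; rewrite /GRing.scale/= mulr1.
    by rewrite (_ : _ ^+ k.+1 = fun y : R => (y - t0) ^+ k.+1)// exprfctE.
  have := is_deriveM h2 hx; rewrite (_ : _ + _ = dZ x)// /dZ /GRing.scale/=; congr (_ + _).
  exact: mulrC.
have cZ : {within `[t0, t1], continuous Z}.
  have c1 : {within `[t0, t1], continuous (fun y : R => (y - t0) ^+ k.+1)}.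
    apply: continuous_subspaceT => {}x.
    apply: (@continuous_comp _ _ _ (fun y : R => y - t0) (fun y => y ^+ k.+1)).
      by apply: continuousB; [exact: cvg_id|exact: cst_continuous].
    exact: exprn_continuous.
  by move=> x; exact: (@continuousM _ (subspace `[t0, t1]) _ _ x (c1 x) (cY x)).
have [x] := MVT t01 dZP cZ; rewrite in_itv/= => /andP[x0 x1].
rewrite {2}/Z subrr expr0n mul0r subr0 => Zt1.
have xx : 0 < x - t0 by rewrite subr_gt0.
have dZle : dZ x <= C * M * (t1 - t0) `^ (k%:R - a).
  have : dZ x <= (x - t0) ^+ k * (C * (x - t0) `^ (- a) * M).
    have -> : dZ x = (x - t0) ^+ k * ((x - t0) * dY x + k.+1%:R * Y x).
      by rewrite /dZ exprS; ring.
    rewrite ler_wpM2l ?exprn_ge0 ?(ltW xx)//.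
    have sx : 0 < sg * (x - t0) by rewrite mulr_gt0.
    have := hY x (sg * (x - t0)).
    rewrite x0 x1 sx /= => /(_ isT) /(_ _)/wrap[].
      apply: le_trans sgT; rewrite ler_wpM2l ?(ltW sg0)//; lra.
    have Yx := Y0 x (ltac:(apply/andP; split => //)).
    rewrite powRM ?(ltW sg0) ?(ltW xx)// /C.
    move: (_ `^ _) (_ `^ _) => q1 q2 h.
    have h1 : sg * ((x - t0) * dY x + k.+1%:R * Y x) <= K * (q1 * q2) * M.
      have : sg * k.+1%:R * Y x <= c * Y x by rewrite ler_wpM2r.
      move: h; lra.
    rewrite -(ler_pM2l sg0); apply: le_trans h1 _; rewrite le_eqVlt; apply/orP; left; apply/eqP.
    by field; rewrite gt_eqF.
  move/le_trans; apply.
  rewrite -powR_mulrn ?(ltW xx)// (_ : _ * (_ * M) = C * M * ((x - t0) `^ k%:R * (x - t0) `^ (- a))); last by ring.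
  rewrite -powRD; last by rewrite (gt_eqF xx) implybT.
  apply: ler_wpM2l; first exact: mulr_ge0.
  rewrite ge0_ler_powR ?nnegrE ?subr_ge0// ?(ltW x0) ?(ltW t01)//.
  by rewrite lerB// ltW.
have tk : 0 < (t1 - t0) ^+ k.+1 by rewrite exprn_gt0.
rewrite -(ler_pM2l tk) -/(Z t1) Zt1.
apply: (@le_trans _ _ (C * M * (t1 - t0) `^ (k%:R - a) * (t1 - t0))).
  by rewrite ler_wpM2r// ltW.
rewrite powRD; last by rewrite (gt_eqF t010) implybT.
rewrite powR_mulrn ?(ltW t010)// exprS.
have P0 : 0 <= (t1 - t0) ^+ k * (t1 - t0) * (t1 - t0) `^ (- a) * M.
  by rewrite !mulr_ge0 ?powR_ge0 ?exprn_ge0 ?(ltW t010).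
move: P0; move: (_ `^ _) (_ ^+ _) => q1 q2; move: (t1 - t0) => q3 P0; nra.
Qed.

End smoothing_ode.

(** * The primitive energy and its derivative along orbits *)

Section orbit.
Context dsp (X : measurableType dsp) (R : realType).
Variable m : {measure set X -> \bar R}.
Implicit Types f g : L2 m.

Lemma L2_lipschitz_exists (theta : R -> R) (M : R) f : theta 0 = 0 -> 0 <= M ->
  (forall a b, `|theta a - theta b| <= M * `|a - b|) ->
  exists g, {ae m, forall x, g x = theta (f x)}.
Proof.
move=> th0 M0 thM.
have mth : measurable_fun setT (theta \o f).
  by apply: measurableT_comp; [exact: lipschitz_measurable thM|exact: Lq_measurable].
have [|g gE] := @Lq_exists _ _ _ m 2 (lee12 R) _ mth; last first.
  by exists g; apply: filterS gE => x; exact.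
have fin : ((M ^+ 2 * `|f| ^+ 2)%:E < +oo)%E by rewrite ltry.
apply: le_lt_trans fin; rewrite EFinM L2_sqrE -ge0_integralZl_EFin//; last 3 first.
- by move=> x _; rewrite lee_fin sqr_ge0.
- by apply/measurable_EFinP; apply: measurable_funX; exact: Lq_measurable.
- exact: sqr_ge0.
apply: ge0_le_integral_nm => x _; first by rewrite lee_fin powR_ge0.
rewrite -EFinM lee_fin powR_mulrn// -exprMn real_normK ?num_real//.
rewrite -(real_normK (num_real (theta _))) -(real_normK (num_real (M * _))).
have := thM (f x) 0; rewrite th0 !subr0 => h.
by rewrite lerXn2r ?nnegrE// normrM (ger0_norm M0).
Qed.

Variables (k : nat) (n : R).
Hypothesis n0 : 0 < n.

Let measurable_clip : measurable_fun setT (clip n).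
Proof. by apply: measurable_minr => //; exact: normr_measurable. Qed.

Lemma measurable_tpow j : measurable_fun setT (tpow n j).
Proof. by apply: measurable_funM => //; apply: measurable_funX. Qed.

Lemma measurable_tprim : measurable_fun setT (tprim k n).
Proof.
apply: measurable_funD.
  by apply: measurable_funM => //; apply: measurable_funX.
apply: measurable_funM => //; apply: measurable_funM; first exact: measurable_funX.
by apply: measurable_funB; apply: measurable_funX.
Qed.

Lemma tprim_le_sqr x : tprim k n x <= n ^+ k.*2 / 2 * x ^+ 2.
Proof.
apply: le_trans (tprim_le k n x) _.
rewrite [leRHS]mulrAC; apply: ler_wpM2r => //; rewrite /tpow exprMn mulrC; apply: ler_wpM2r; rewrite ?sqr_ge0//.
by rewrite -exprM muln2 lerXn2r ?nnegrE ?clip_ge0 ?(ltW n0)// clip_le.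
Qed.

Lemma tprim_integrable f : m.-integrable setT (EFin \o (tprim k n \o f)).
Proof.
have i2 := integrableZl measurableT (n ^+ k.*2 / 2) (ip_integrable f f).
apply: le_integrable i2 => //.
  by apply/measurable_EFinP; apply: measurableT_comp; [exact: measurable_tprim|exact: Lq_measurable].
move=> x _; rewrite /= !lee_fin ger0_norm ?tprim_ge0// (le_trans (tprim_le_sqr _))//.
by rewrite expr2 ler_norm.
Qed.

Variable G : L2 m -> L2 m.
Hypothesis GE : forall f, {ae m, forall x, G f x = tpow n k.*2 (f x)}.

Definition primitive_energy f : R := \int[m]_x tprim k n (f x).

Local Notation P := primitive_energy.

Lemma primitive_energy_ge0 f : 0 <= P f.
Proof. by apply: Rintegral_ge0 => x _; exact: tprim_ge0. Qed.

Lemma primitive_energy_convex f g : ip (G f) (g - f) <= P g - P f.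
Proof.
have iB := integrableB measurableT (tprim_integrable g) (tprim_integrable f).
rewrite /P -RintegralB//; [|exact: tprim_integrable..].
rewrite -subr_ge0 -RintegralB//; last exact: ip_integrable.
apply: Rintegral_ae_ge0; have := Lq_sub g f; have := GE f; apply: filterS2 => x h1 h2 _.
by rewrite h1 h2 subr_ge0; exact: tprim_convex.
Qed.

Let L := k.*2.+1%:R * n ^+ k.*2.

Let L0 : 0 <= L. Proof. by rewrite mulr_ge0// exprn_ge0// ltW. Qed.

Lemma truncation_lipschitz f g : `|G g - G f| <= L * `|g - f|.
Proof.
apply: Lq_norm_le => //; have h : {ae m, forall x, G g x - G f x = tpow n k.*2 (g x) - tpow n k.*2 (f x)}.
  by apply: filterS2 (GE g) (GE f) => x -> ->.
apply: filterS3 (Lq_sub g f) (Lq_sub (G g) (G f)) h => x h1 h2 h3.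
by rewrite h1 h2 h3; exact: tpow_lipschitz.
Qed.

(** Convexity at [f] and at [g] traps the remainder between 0 and the pairing of G g - G f with g -
    f, which is quadratic because [G] is Lipschitz. So the energy is Frechet differentiable with
    gradient [G]. *)
Lemma primitive_energy_expansion f g :
  `|P g - P f - ip (G f) (g - f)| <= L * `|g - f| ^+ 2.
Proof.
have h1 := primitive_energy_convex f g; have h2 := primitive_energy_convex g f.
have h3 : ip (G g) (g - f) <= ip (G f) (g - f) + L * `|g - f| ^+ 2.
  rewrite -lerBlDl -ipBl; apply: le_trans (ler_norm _) _; apply: le_trans (ip_le_norm _ _) _.
  by rewrite expr2 mulrA ler_wpM2r// truncation_lipschitz.
have h4 : ip (G g) (f - g) = - ip (G g) (g - f) by rewrite -opprB ipC ipNl ipC.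
rewrite ler_norml; apply/andP; split; last by lra.
by apply: (@le_trans _ _ 0); [rewrite oppr_le0 mulr_ge0// sqr_ge0|lra].
Qed.

End orbit.

Section evolution_facts.
Variables (R : realType) (V : normedModType R) (T : R) (D : R -> set V)
  (A : R -> V -> V) (U : R -> R -> V -> V).
Hypothesis evo : evolution_family T D A U.

Lemma evo_within_continuous tau f : 0 <= tau ->
  {within `[tau, T], continuous (fun t => U t tau f)}.
Proof.
move=> tau0; apply/within_continuous_dist => x; rewrite /= in_itv/= => /andP[x0 x1] e e0.
have /within_continuous_dist h := @evo_strongly_continuous _ _ _ _ _ _ evo f.
have [|d d0 dP] := h (x, tau) _ e e0; first by [].
exists d => // y; rewrite /= in_itv/= => /andP[y0 y1] xy.
apply: (dP (y, tau)) => //=.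
by rewrite prod_normE/= subrr normr0 max_l.
Qed.

Lemma evo_sub tau t f g : 0 <= tau -> tau <= t -> t <= T ->
  U t tau (f - g) = U t tau f - U t tau g.
Proof.
move=> t0 t1 t2; have := evo_linear evo t0 t1 t2 (-1) g f.
by rewrite !scaleN1r addrC => ->; rewrite addrC.
Qed.

End evolution_facts.

Section orbit_energy.
Context dsp (X : measurableType dsp) (R : realType).
Variable m : {measure set X -> \bar R}.
Implicit Types f g : L2 m.
Variables (T : R) (D : R -> set (L2 m)) (A : R -> L2 m -> L2 m) (U : R -> R -> L2 m -> L2 m).
Hypothesis evo : evolution_family T D A U.
Variables (k : nat) (n : R).
Hypothesis n0 : 0 < n.
Variable G : L2 m -> L2 m.
Hypothesis GE : forall f, {ae m, forall x, G f x = tpow n k.*2 (f x)}.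
Local Notation P := (primitive_energy k n).
Let L := k.*2.+1%:R * n ^+ k.*2.
Let L0 : 0 <= L. Proof. by rewrite mulr_ge0// exprn_ge0// ltW. Qed.

Lemma primitive_energy_dist f g : `|P f - P g| <= (`|G f| + L * `|f - g|) * `|f - g|.
Proof.
have h := primitive_energy_expansion n0 GE f g; have h2 := ip_le_norm (G f) (g - f).
rewrite distrC [`|f - g|]distrC mulrDl -mulrA -expr2.
rewrite -(subrK (ip (G f) (g - f)) (P g - P f)) addrC.
by apply: le_trans (ler_normD _ _) _; exact: lerD.
Qed.

Lemma orbit_energy_continuous tau t0 t1 f : 0 <= tau -> tau <= t0 -> t1 <= T ->
  {within `[t0, t1], continuous (fun t => P (U t tau f))}.
Proof.
move=> tau0 t0tau t1T; have /within_continuous_dist c := @evo_within_continuous _ _ _ _ _ _ evo tau f tau0.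
apply/within_continuous_dist => x; rewrite /= in_itv/= => /andP[x0 x1] e e0.
have sub y : t0 <= y -> y <= t1 -> `[tau, T]%classic y.
  by move=> h1 h2; rewrite /= in_itv/=; apply/andP; split; [exact: le_trans h1|exact: le_trans t1T].
set g := U x tau f; have G0 : 0 < `|G g| + L + 1 by rewrite ltr_wpDl ?addr_ge0.
pose e' := Num.min 1 (e / (`|G g| + L + 1)).
have e'0 : 0 < e' by rewrite lt_min ltr01 divr_gt0.
have [d d0 dP] := c x (sub x x0 x1) e' e'0.
exists d => // y; rewrite /= in_itv/= => /andP[y0 y1] xy.
have := dP y (sub y y0 y1) xy; rewrite lt_min => /andP[/ltW h1 h2].
apply: le_lt_trans (primitive_energy_dist _ _) _.
apply: (@le_lt_trans _ _ ((`|G g| + L + 1) * `|g - U y tau f|)); last by rewrite mulrC -ltr_pdivlMr.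
rewrite ler_wpM2r// -addrA lerD2l; apply: (@le_trans _ _ L); first by rewrite ler_piMr.
by rewrite lerDl.
Qed.

(** Chain rule. One half of the error pays for the difference quotient of the orbit, differentiable
    in operator norm, the other for the quadratic remainder of the energy. *)
Lemma orbit_energy_derive tau t f : 0 <= tau -> tau < t -> t < T ->
  is_derive t 1 (fun t => P (U t tau f)) (ip (G (U t tau f)) (A t (U t tau f))).
Proof.
move=> tau0 taut tT.
set u := U t tau f; set w := A t u; set Y := fun t => P (U t tau f).
suff H : (fun h : R => h^-1 *: ((Y \o shift t) (h *: 1) - Y t)) @ 0^' --> ip (G u) w.
  apply: DeriveDef; first by apply/cvg_ex; exists (ip (G u) w).
  exact: cvg_lim H.
apply/cvgrPdist_le => e e0.
pose e1 := e / (2 * (`|G u| * `|f| + 1)).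
have B0 : 0 < `|G u| * `|f| + 1 by rewrite ltr_wpDl// mulr_ge0.
have e10 : 0 < e1 by rewrite divr_gt0// mulr_gt0.
(* The increment of the orbit is at most |h| (|w| + e1 |f|), so the remainder divided by h is at
   most |h| q. *)
pose q := L * (`|w| + e1 * `|f|) ^+ 2.
have q0 : 0 <= q by rewrite mulr_ge0// sqr_ge0.
have := evo_derivative evo tau0 taut (ltW tT) e10; rewrite near_withinE => H1.
near=> h.
have h0 : h != 0 by near: h; exact: nbhs_dnbhs_neq.
have hq : `|h| <= e / (2 * (q + 1)).
  near: h; apply: dnbhs0_le; rewrite divr_gt0// mulr_gt0// ltr_wpDl//.
have hT : `|h| <= T - t by near: h; apply: dnbhs0_le; rewrite subr_gt0.
have htT : t + h <= T by have := ler_norm h; lra.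
have Hh : `|h^-1 *: (U (t + h) tau f - u) - w| <= e1 * `|f|.
  have H2 : [set h | t + h <= T] h -> forall f, `|h^-1 *: (U (t + h) tau f - U t tau f) - A t (U t tau f)| <= e1 * `|f|.
    by near: h; exact: H1.
  exact: H2.
rewrite /Y /= /shift/= [h *: 1]mulr1 (addrC h).
set v := U (t + h) tau f in Hh *; set De := v - u in Hh *.
have E1 : h^-1 *: (P v - P u) = ip (G u) (h^-1 *: De) + h^-1 * (P v - P u - ip (G u) De).
  by rewrite [ip (G u) (_ *: _)]ipC ipZl [ip De _]ipC /GRing.scale/=; ring.
rewrite E1 opprD addrA; apply: le_trans (ler_normB _ _) _.
rewrite [e]splitr; apply: lerD.
  rewrite ipC [ip (G u) _]ipC -ipBl; apply: le_trans (ip_le_norm _ _) _.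
  rewrite distrC; apply: (@le_trans _ _ (e1 * `|f| * `|G u|)); first by rewrite ler_wpM2r.
  rewrite /e1 -mulrA (mulrC `|f|) mulrAC ler_pdivrMr ?mulr_gt0//.
  rewrite (_ : e / 2 * _ = e * (`|G u| * `|f| + 1)); last by field.
  by rewrite ler_wpM2l ?(ltW e0)// lerDl.
have De_le : `|De| <= `|h| * (`|w| + e1 * `|f|).
  rewrite -ler_pdivrMl ?normr_gt0// -normfV -normrZ.
  rewrite -[X in `|X|](subrK w) addrC; apply: le_trans (ler_normD _ _) _.
  by rewrite lerD2l.
rewrite normrM normfV ler_pdivrMl ?normr_gt0//.
apply: le_trans (primitive_energy_expansion n0 GE u v) _.
apply: (@le_trans _ _ (L * (`|h| * (`|w| + e1 * `|f|)) ^+ 2)).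
  have B : 0 <= `|h| * (`|w| + e1 * `|f|) := le_trans (normr_ge0 _) De_le.
  apply: (ler_wpM2l L0); apply: lerXn2r; rewrite ?nnegrE; [exact: normr_ge0|exact: B|exact: De_le].
rewrite exprMn mulrCA -/q expr2 -mulrA ler_wpM2l//.
apply: (@le_trans _ _ (e / (2 * (q + 1)) * q)); first by rewrite ler_wpM2r.
rewrite mulrAC ler_pdivrMr ?mulr_gt0// ?ltr_wpDl//.
rewrite (_ : e / 2 * _ = e * (q + 1)); last by field.
by rewrite ler_wpM2l ?(ltW e0)// lerDl.
Unshelve. all: by end_near. Qed.

End orbit_energy.

(** * Smoothing from L^2 to L^2p by doubling exponents *)

Section smoothing_step.
Context dsp (X : measurableType dsp) (R : realType).
Variable m : {measure set X -> \bar R}.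
Implicit Types f g : L2 m.
Variables (T : R) (D : R -> set (L2 m)) (A : R -> L2 m -> L2 m) (U : R -> R -> L2 m -> L2 m).
Hypotheses (T0 : 0 < T) (evo : evolution_family T D A U).
Variables (a h0 : R).
Hypotheses (a0 : 0 <= a) (h00 : 0 < h0).

(* The Nash inequality for [tpow n k f] at the length scale [h], with the form
   tested against [tpow n k.*2 f]. *)
Definition dissipative_at (k : nat) (K K' : R) :=
  forall n t f g h, 0 < n -> 0 <= t <= T -> D t f ->
  {ae m, forall x, g x = tpow n k.*2 (f x)} -> 0 < h <= h0 ->
  (\int[m]_x (tpow n k (f x) ^+ 2)%:E <=
   (K * h `^ (- a))%:E * (\int[m]_x `|tpow n k (f x)|%:E) ^+ 2
   + (K' * h * ip (- A t f) g)%:E)%E.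

(** Let Y be the primitive energy along the orbit. Its derivative is the form tested with
    [tpow n k.*2], up to sign, and 2 Y is at most the integral of the square of [tpow n k]; so the
    Nash inequality divided by [K'] is the hypothesis of [smoothing_ode]. The constant does not
    depend on [n]. *)
Lemma primitive_energy_ub (k : nat) (K K' : R) : 0 <= K -> 0 < K' -> dissipative_at k K K' ->
  exists C, 0 < C /\ forall n tau t0 t1 f M, 0 < n -> 0 <= tau -> tau <= t0 -> t0 < t1 ->
  t1 <= T -> 0 <= M ->
  (forall t, t0 < t <= t1 -> (\int[m]_x (`|U t tau f x| ^+ k.+1)%:E <= M%:E)%E) ->
  primitive_energy k n (U t1 tau f) <= C * (t1 - t0) `^ (- a) * M ^+ 2.
Proof.
move=> K0 K'0 diss.
have [C [C0 HC]] := @smoothing_ode R T a (2 / K') (K / K') h0 T0 a0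
  (divr_gt0 (ltr0n _ 2) K'0) (divr_ge0 K0 (ltW K'0)) h00.
exists C; split => // n tau t0 t1 f M n0 tau0 tau_t0 t01 t1T M0 HM.
have /choice[G GE] : forall f, exists g, {ae m, forall x, g x = tpow n k.*2 (f x)}.
  move=> g; apply: (@L2_lipschitz_exists _ _ _ m (tpow n k.*2) (k.*2.+1%:R * n ^+ k.*2)).
  - exact: tpow0.
  - by rewrite mulr_ge0// exprn_ge0// ltW.
  - exact: tpow_lipschitz.
apply: (HC (fun t => primitive_energy k n (U t tau f))
  (fun t => ip (G (U t tau f)) (A t (U t tau f)))) => //.
- by rewrite lerBlDr (le_trans t1T)// lerDl (le_trans tau0).
- exact: sqr_ge0.
- by move=> t _; exact: primitive_energy_ge0.
- move=> t /andP[h1 h2]; apply: (orbit_energy_derive evo n0 GE) => //.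
    exact: le_lt_trans tau_t0 h1.
  exact: lt_le_trans h2 t1T.
- exact: (orbit_energy_continuous evo n0 GE).
move=> t h /andP[ht0 ht1] /andP[h1 h2].
set u := U t tau f.
have tT : t <= T by rewrite (le_trans (ltW ht1)).
have taut : tau < t by exact: le_lt_trans tau_t0 ht0.
have Du : D t u by exact: evo_domain evo _ _ _ tau0 taut tT.
have t0' : 0 <= t <= T by rewrite tT andbT (le_trans tau0)// ltW.
have := diss n t u (G u) h n0 t0' Du (GE u) (ltac:(apply/andP; split => //)).
have I1 : (\int[m]_x `|tpow n k (u x)|%:E <= M%:E)%E.
  apply: le_trans (HM t (ltac:(apply/andP; split; [exact: ht0|exact: ltW]))).
  by apply: ge0_le_integral_nm => x _; rewrite lee_fin//; exact: tpow_abs_le.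
have I0 : (0 <= \int[m]_x `|tpow n k (u x)|%:E)%E by apply: integral_ge0 => x _; rewrite lee_fin.
have I2 : ((K * h `^ (- a))%:E * (\int[m]_x `|tpow n k (u x)|%:E) ^+ 2 <=
    (K * h `^ (- a) * M ^+ 2)%:E)%E.
  rewrite [leRHS]EFinM; apply: lee_wpmul2l; first by rewrite lee_fin mulr_ge0// powR_ge0.
  by rewrite !expe2 EFin_expe expe2; apply: lee_pmul.
have P2 : ((2 * primitive_energy k n u)%:E <= \int[m]_x (tpow n k (u x) ^+ 2)%:E)%E.
  rewrite EFinM /primitive_energy fineK; last first.
    by apply: integrable_fin_num => //; exact: tprim_integrable.
  rewrite -ge0_integralZl_EFin//; last 2 first.
  - by move=> x _; rewrite lee_fin tprim_ge0.
  - by apply: measurable_int; exact: tprim_integrable.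
  apply: ge0_le_integral_nm => x _; first by rewrite mule_ge0// lee_fin tprim_ge0.
  by rewrite -EFinM lee_fin mulrC -ler_pdivlMr//; exact: tprim_le.
move=> H; have {H} := le_trans P2 (le_trans H (leeD2r _ I2)).
rewrite -EFinD lee_fin ipNl [ip (A t u) _]ipC.
set Y := primitive_energy k n u; set dY := ip _ _; move: (h `^ (- a)) => q H.
rewrite -(ler_pM2l K'0); rewrite (_ : K' * (- (2 / K' * Y) + _) = - (2 * Y) + K * q * M ^+ 2).
  lra.
by field; rewrite gt_eqF.
Qed.

(** The truncation level tends to infinity. At each point (2k+2) times [tprim] is eventually
    |u|^(2k+2), and Fatou's lemma keeps a bound that is uniform in the level. *)
Lemma smoothing_step (k : nat) (K K' : R) : 0 <= K -> 0 < K' -> dissipative_at k K K' ->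
  exists C, 0 < C /\ forall tau t0 t1 f M, 0 <= tau -> tau <= t0 -> t0 < t1 ->
  t1 <= T -> 0 <= M ->
  (forall t, t0 < t <= t1 -> (\int[m]_x (`|U t tau f x| ^+ k.+1)%:E <= M%:E)%E) ->
  (\int[m]_x (`|U t1 tau f x| ^+ k.*2.+2)%:E <= (C * (t1 - t0) `^ (- a) * M ^+ 2)%:E)%E.
Proof.
move=> K0 K'0 diss; have [C [C0 HC]] := primitive_energy_ub K0 K'0 diss.
exists (k.*2.+2%:R * C); split; first by rewrite mulr_gt0.
move=> tau t0 t1 f M tau0 tau_t0 t01 t1T M0 HM; set u := U t1 tau f.
pose F j x := (k.*2.+2%:R * tprim k j.+1%:R (u x))%:E.
have F0 j x : setT x -> (0 <= F j x)%E by rewrite lee_fin mulr_ge0// tprim_ge0.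
have mF j : measurable_fun setT (F j).
  apply/measurable_EFinP; apply: measurable_funM => //.
  by apply: measurableT_comp; [exact: measurable_tprim|exact: Lq_measurable].
have := fatou m measurableT mF F0.
have -> : (\int[m]_x limn_einf (F^~ x) = \int[m]_x (`|u x| ^+ k.*2.+2)%:E)%E.
  apply: eq_integral => x _; have H : F ^~ x @ \oo --> (`|u x| ^+ k.*2.+2)%:E.
    apply: cvg_near_cst; near=> j; rewrite /F tprim_norm_small.
      by rewrite mulrCA mulfV ?pnatr_eq0// mulr1.
    near: j; exists (Num.truncn `|u x|) => // j /= jx.
    by rewrite (le_trans (ltW (truncnS_gt _)))// ler_nat.
  by rewrite (is_cvg_limn_einfE _); [exact: cvg_lim H|apply/cvg_ex; eexists; exact: H].
move=> H; apply: le_trans H _; rewrite limn_einf_lim.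
apply: lime_le; first exact: is_cvg_einfs.
near=> j; apply: (@le_trans _ _ (\int[m]_x F j x)%E).
  by apply: ereal_inf_lbound; exists j => //=.
rewrite (eq_integral (fun x => (k.*2.+2%:R)%:E * (tprim k j.+1%:R (u x))%:E)%E)//.
rewrite ge0_integralZl_EFin//; last 2 first.
- by move=> x _; rewrite lee_fin tprim_ge0.
- by apply: measurable_int; exact: tprim_integrable.
rewrite -(fineK (integrable_fin_num _ (tprim_integrable _ _ _)))//.
rewrite -!mulrA [leRHS]EFinM; apply: lee_wpmul2l => //.
by rewrite lee_fin mulrA; apply: HC.
Unshelve. all: by end_near. Qed.

Hypothesis dissipative : forall k, exists K K', [/\ 0 <= K, 0 < K' & dissipative_at k K K'].

(** Each doubling runs on the second half of the time interval, where the previous bound is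
    available. The time exponents obey g_(j+1) = a + 2 g_j from g_0 = 0, so g_j = a (2^j - 1). *)
Lemma orbit_moment_bound (j : nat) : exists C, 0 < C /\
  forall tau t f, 0 <= tau -> tau < t -> t <= T ->
  (\int[m]_x (`|U t tau f x| ^+ (2 ^ j.+1))%:E <=
   (C * (t - tau) `^ (- (a * (2 ^+ j - 1))) * `|f| ^+ (2 ^ j.+1))%:E)%E.
Proof.
elim: j => [|j [Cj [Cj0 IH]]].
  exists 1; split => // tau t f tau0 taut tT.
  rewrite expr0 subrr mulr0 oppr0 powRr0 !mul1r expn1.
  rewrite (eq_integral (fun x => (U t tau f x ^+ 2)%:E)); last first.
    by move=> x _; rewrite real_normK ?num_real.
  rewrite -L2_sqrE lee_fin lerXn2r ?nnegrE//.
  by apply: (evo_contraction evo) => //; exact: ltW.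
have [k kE] : exists k, k.+1 = (2 ^ j.+1)%N by exists (2 ^ j.+1).-1; rewrite prednK// expn_gt0.
have [K [K' [K0 K'0 diss]]] := dissipative k.
have [C [C0 HC]] := smoothing_step K0 K'0 diss.
pose ga := a * (2 ^+ j - 1).
have ga0 : 0 <= ga by rewrite mulr_ge0// subr_ge0 exprn_ege1// ler1n.
exists (C * Cj ^+ 2 * 2 `^ (a + 2 * ga)); split.
  by rewrite !mulr_gt0 ?powR_gt0 ?exprn_gt0.
move=> tau t f tau0 taut tT.
pose t0 := (tau + t) / 2.
have [t0tau t0t] : tau < t0 /\ t0 < t by split; rewrite /t0; lra.
have tt : 0 < t - tau by rewrite subr_gt0.
pose M := Cj * (t - t0) `^ (- ga) * `|f| ^+ (2 ^ j.+1).
have M0 : 0 <= M by rewrite !mulr_ge0 ?powR_ge0 ?(ltW Cj0).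
have := HC tau t0 t f M tau0 (ltW t0tau) t0t tT M0.
have -> : k.*2.+2 = (2 ^ j.+2)%N by rewrite -doubleS kE -mul2n -expnS.
rewrite kE => /(_ _)/le_trans; apply.
  move=> t' /andP[h1 h2].
  have taut' : tau < t' by exact: lt_trans h1.
  apply: le_trans (IH tau t' f tau0 taut' (le_trans h2 tT)) _.
  rewrite lee_fin /M -/ga; apply: ler_wpM2r => //; apply: ler_wpM2l; first exact: ltW.
  rewrite !powRN lef_pV2 ?posrE ?powR_gt0 ?subr_gt0//.
  by rewrite ge0_ler_powR// ?nnegrE; rewrite /t0 in h1 *; lra.
rewrite lee_fin le_eqVlt; apply/orP; left; apply/eqP.
have -> : t - t0 = (t - tau) / 2 by rewrite /t0; field.
have E : - (a * (2 ^+ j.+1 - 1)) = - (a + 2 * ga) by rewrite /ga exprS; ring.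
have E2 : ((t - tau) / 2) `^ (- a) * ((t - tau) / 2) `^ (- ga) ^+ 2 =
    2 `^ (a + 2 * ga) * (t - tau) `^ (- (a + 2 * ga)).
  have tt2 : 0 < (t - tau) / 2 by rewrite divr_gt0.
  rewrite expr2 -!powRD ?(gt_eqF tt2) ?implybT//.
  have -> : - a + (- ga - ga) = - (a + 2 * ga) by ring.
  rewrite powRM ?invr_ge0 ?(ltW tt)// mulrC; congr (_ * _).
  by rewrite -powR_inv1// -powRrM mulN1r opprK.
rewrite E /M; have -> : t - t0 = (t - tau) / 2 by rewrite /t0; field.
rewrite (_ : `|f| ^+ (2 ^ j.+2) = (`|f| ^+ (2 ^ j.+1)) ^+ 2); last by rewrite -exprM mulnC -expnS.
move: E2; move: (_ `^ (- a)) (_ `^ (- ga)) (_ `^ (- (a + _))) (`|f| ^+ _) (2 `^ _) => q1 q2 q3 q4 q5 E2.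
by transitivity (C * Cj ^+ 2 * (q1 * q2 ^+ 2) * q4 ^+ 2); [ring|rewrite E2; ring].
Qed.

(** The first term suffices where x <= B, the second where x >= B. *)
Lemma powR_interpolation (r B x : R) (Q : nat) : 2 <= r -> r <= Q%:R -> 0 < B -> 0 <= x ->
  x `^ r <= B `^ (r - 2) * x ^+ 2 + B `^ (r - Q%:R) * x ^+ Q.
Proof.
move=> r2 rQ B0; rewrite le_eqVlt => /predU1P[<-|x0].
  rewrite powR0 ?gt_eqF ?(lt_le_trans _ r2)//.
  by rewrite addr_ge0// mulr_ge0 ?powR_ge0// exprn_ge0.
have xE j : x `^ r = x `^ (r - j%:R) * x ^+ j.
  by rewrite -powR_mulrn ?(ltW x0)// -powRD ?subrK// (gt_eqF x0) implybT.
have [xB|/ltW Bx] := leP x B.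
  rewrite -[leLHS]addr0; apply: lerD; last by rewrite mulr_ge0 ?powR_ge0// exprn_ge0// ltW.
  rewrite (xE 2%N); apply: ler_wpM2r; first exact: sqr_ge0.
  by rewrite ge0_ler_powR ?nnegrE ?subr_ge0 ?(ltW x0) ?(ltW B0).
rewrite -[leLHS]add0r; apply: lerD; first by rewrite mulr_ge0 ?powR_ge0// exprn_ge0// ltW.
rewrite (xE Q); apply: ler_wpM2r; first by rewrite exprn_ge0// ltW.
rewrite -(opprB Q%:R r) !powRN lef_pV2 ?posrE ?powR_gt0//.
by rewrite ge0_ler_powR ?nnegrE ?subr_ge0 ?(ltW x0) ?(ltW B0).
Qed.

Lemma moment_interpolation (r B : R) (Q : nat) (w : X -> R) : 2 <= r -> r <= Q%:R -> 0 < B ->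
  measurable_fun setT w ->
  (\int[m]_x (`|w x| `^ r)%:E <= (B `^ (r - 2))%:E * \int[m]_x (w x ^+ 2)%:E
     + (B `^ (r - Q%:R))%:E * \int[m]_x (`|w x| ^+ Q)%:E)%E.
Proof.
move=> r2 rQ B0 mw.
have m2 : measurable_fun setT (fun x => (w x ^+ 2)%:E).
  by apply/measurable_EFinP; exact: measurable_funX.
have mQ : measurable_fun setT (fun x => (`|w x| ^+ Q)%:E).
  by apply/measurable_EFinP; apply: measurable_funX; exact: measurableT_comp.
have w2 x : setT x -> (0 <= (w x ^+ 2)%:E)%E by rewrite lee_fin sqr_ge0.
have wQ x : setT x -> (0 <= (`|w x| ^+ Q)%:E)%E by rewrite lee_fin exprn_ge0.
rewrite -(ge0_integralZl_EFin m measurableT w2 m2 (powR_ge0 B (r - 2))).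
rewrite -(ge0_integralZl_EFin m measurableT wQ mQ (powR_ge0 B (r - Q%:R))).
rewrite -ge0_integralD//; last 4 first.
- by move=> x _; rewrite mule_ge0 ?lee_fin ?powR_ge0 ?sqr_ge0.
- exact: emeasurable_funM.
- by move=> x _; rewrite mule_ge0 ?lee_fin ?powR_ge0 ?exprn_ge0.
- exact: emeasurable_funM.
apply: ge0_le_integral_nm => x _; first by rewrite lee_fin powR_ge0.
rewrite -!EFinM -EFinD lee_fin; apply: le_trans (powR_interpolation r2 rQ B0 (normr_ge0 _)) _.
by rewrite real_normK ?num_real.
Qed.

Lemma pow2_unbounded (r : R) : exists j, r < (2 ^ j.+1)%:R.
Proof.
exists (Num.truncn r).+1; apply: lt_trans (truncnS_gt r) _.
by rewrite ltr_nat; apply: (@ltn_trans (2 ^ (Num.truncn r).+1)); [exact: ltn_expl|rewrite ltn_exp2l].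
Qed.

Lemma orbit_powR_bound (r : R) : 2 <= r -> exists C, 0 < C /\
  forall tau t f, 0 <= tau -> tau < t -> t <= T ->
  (\int[m]_x (`|U t tau f x| `^ r)%:E <=
   (C * (t - tau) `^ (- (a * (r / 2 - 1))) * `|f| `^ r)%:E)%E.
Proof.
move=> r2; have [j rj] := pow2_unbounded r.
have [C [C0 HC]] := orbit_moment_bound j.
exists (1 + C); split; first exact: addr_gt0.
move=> tau t f tau0 taut tT; set u := U t tau f.
have tt : 0 < t - tau by rewrite subr_gt0.
have uf : `|u| <= `|f| by apply: (evo_contraction evo) => //; exact: ltW.
(* The cut [B] below would be 0 for f = 0; that case is done with the cut 1. *)
have [f0|f0] := eqVneq f 0.
  have u0 : u = 0 by apply/normr0_eq0/le_anti; rewrite normr_ge0 andbT (le_trans uf)// f0 normr0.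
  have := moment_interpolation r2 (ltW rj) ltr01 (Lq_measurable u).
  move/le_trans; apply; rewrite !powR1 !mul1e -L2_sqrE u0 normr0 expr0n add0e.
  rewrite -u0; apply: le_trans (HC tau t f tau0 taut tT) _.
  by rewrite f0 normr0 expr0n expn_eq0/= powR0 ?mulr0// gt_eqF// (lt_le_trans _ r2).
have f0' : 0 < `|f| by rewrite normr_gt0.
(* This cut balances the two terms: both become multiples of (t - tau)^(-a(r/2 - 1)) |f|^r. *)
pose B := (t - tau) `^ (- (a / 2)) * `|f|.
have B0 : 0 < B by rewrite mulr_gt0// powR_gt0.
have := moment_interpolation r2 (ltW rj) B0 (Lq_measurable u).
move/le_trans; apply; rewrite -L2_sqrE.
apply: (@le_trans _ _ ((B `^ (r - 2))%:E * (`|f| ^+ 2)%:E +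
  (B `^ (r - (2 ^ j.+1)%:R))%:E * (C * (t - tau) `^ (- (a * (2 ^+ j - 1))) * `|f| ^+ (2 ^ j.+1))%:E)%E).
  apply: leeD; (apply: lee_wpmul2l; first by rewrite lee_fin powR_ge0).
    by rewrite lee_fin lerXn2r ?nnegrE.
  exact: HC.
rewrite -!EFinM -EFinD lee_fin le_eqVlt; apply/orP; left; apply/eqP.
have fE i : `|f| ^+ i = `|f| `^ i%:R by rewrite powR_mulrn.
have BE s : B `^ s = (t - tau) `^ (- (a / 2) * s) * `|f| `^ s.
  by rewrite /B powRM ?powR_ge0// powRrM.
rewrite !BE !fE.
have fD s q : `|f| `^ s * `|f| `^ q = `|f| `^ (s + q).
  by rewrite powRD// (gt_eqF f0') implybT.
have tD s q : (t - tau) `^ s * (t - tau) `^ q = (t - tau) `^ (s + q).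
  by rewrite powRD// (gt_eqF tt) implybT.
have -> : (2 ^ j.+1)%:R = 2 * 2 ^+ j :> R by rewrite expnS natrM natrX.
have E1 : (t - tau) `^ (- (a / 2) * (r - 2)) * `|f| `^ (r - 2) * `|f| `^ 2 =
    (t - tau) `^ (- (a * (r / 2 - 1))) * `|f| `^ r.
  by rewrite -mulrA fD subrK; congr (_ `^ _ * _); field.
have AC (z1 z2 z3 z4 z5 : R) : z1 * z2 * (z3 * z4 * z5) = z3 * ((z1 * z4) * (z2 * z5)) by ring.
have E2 : (t - tau) `^ (- (a / 2) * (r - 2 * 2 ^+ j)) * `|f| `^ (r - 2 * 2 ^+ j) *
    (C * (t - tau) `^ (- (a * (2 ^+ j - 1))) * `|f| `^ (2 * 2 ^+ j)) =
    C * ((t - tau) `^ (- (a * (r / 2 - 1))) * `|f| `^ r).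
  rewrite AC.
  by rewrite fD tD subrK; congr (_ * (_ `^ _ * _)); field.
by rewrite E1 E2; ring.
Qed.

Variables (p : R) (p1 : 1 < p).

Let p2 : 2 <= 2 * p. Proof. by rewrite ler_peMr// ltW. Qed.
Let p20 : 0 < 2 * p. Proof. exact: lt_le_trans p2. Qed.

(** The root of order 2p turns the exponent a (p - 1) into (a/2)(1 - 1/p). *)
Lemma ultracontractive : exists M, 0 < M /\
  forall tau t f, 0 <= tau -> tau < t -> t <= T ->
  exists w : L2p m p1, {ae m, forall x, w x = U t tau f x} /\
    `|w| <= M * (t - tau) `^ (- (a / 2 * (1 - 1 / p))) * `|f|.
Proof.
have [C [C0 HC]] := orbit_powR_bound p2.
exists (C `^ (2 * p)^-1); split; first exact: powR_gt0.
move=> tau t f tau0 taut tT; have H := HC tau t f tau0 taut tT.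
have tt : 0 < t - tau by rewrite subr_gt0.
have [|w wE] := @Lq_exists _ _ _ m _ (lee1_2p p1) _ (Lq_measurable (U t tau f)).
  by apply: le_lt_trans H _; rewrite ltry.
have wE' : {ae m, forall x, w x = U t tau f x} by apply: filterS wE => x; exact.
exists w; split => //.
have H2 : `|w| `^ (2 * p) <= C * (t - tau) `^ (- (a * (2 * p / 2 - 1))) * `|f| `^ (2 * p).
  rewrite -lee_fin Lq_powE; apply: le_trans H.
  rewrite le_eqVlt; apply/orP; left; apply/eqP; apply: ge0_ae_eq_integral => //.
  - apply/measurable_EFinP; apply: (measurableT_comp (measurable_powR _)).
    by apply: measurableT_comp => //; exact: Lq_measurable.
  - apply/measurable_EFinP; apply: (measurableT_comp (measurable_powR _)).
    by apply: measurableT_comp => //; exact: Lq_measurable.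
  - by apply: filterS wE' => x -> _.
have ip : (2 * p) * (2 * p)^-1 = 1 by rewrite mulfV// gt_eqF.
have -> : `|w| = (`|w| `^ (2 * p)) `^ (2 * p)^-1 by rewrite -powRrM ip powRr1.
apply: le_trans (_ : (C * (t - tau) `^ (- (a * (2 * p / 2 - 1))) * `|f| `^ (2 * p)) `^ (2 * p)^-1 <= _).
  by rewrite ge0_ler_powR ?nnegrE ?invr_ge0 ?(ltW p20) ?powR_ge0// !mulr_ge0 ?powR_ge0 ?(ltW C0).
rewrite !powRM ?powR_ge0 ?mulr_ge0 ?powR_ge0 ?(ltW C0)//.
rewrite -!powRrM ip powRr1// (_ : - (a * (2 * p / 2 - 1)) / (2 * p) = - (a / 2 * (1 - 1 / p)))//.
by field; rewrite gt_eqF// (lt_trans ltr01).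
Qed.

(** Interpolates between L^2, where orbits are continuous, and a moment Q > 2p that is bounded for
    times near t: a large cut [B] makes the moment term small, and then closeness in L^2 makes the
    other term small. *)
Lemma orbit_L2p_continuous tau t g (e : R) : 0 <= tau -> tau < t -> t <= T -> 0 < e ->
  exists2 d, 0 < d & forall t', tau < t' -> t' <= T -> `|t - t'| < d ->
  forall w w' : L2p m p1, {ae m, forall x, w x = U t tau g x} ->
    {ae m, forall x, w' x = U t' tau g x} -> `|w - w'| < e.
Proof.
move=> tau0 taut tT e0.
have [j rj] := pow2_unbounded (2 * p).
have [C [C0 HC]] := orbit_moment_bound j.
set Q := (2 ^ j.+1)%N in rj HC.
pose ga := a * (2 ^+ j - 1).
have ga0 : 0 <= ga by rewrite mulr_ge0// subr_ge0 exprn_ege1// ler1n.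
pose S := C * ((t - tau) / 2) `^ (- ga) * `|g| ^+ Q.
have tt : 0 < t - tau by rewrite subr_gt0.
have S0 : 0 <= S by rewrite !mulr_ge0 ?powR_ge0 ?exprn_ge0 ?(ltW C0).
(* Bound for the moment of a difference, from |y1 - y2| <= 2 max(|y1|, |y2|); [S] serves all times
   at least (t - tau)/2 after [tau]. *)
pose S' := 2 ^+ Q * (S + S).
have S'0 : 0 <= S' by rewrite mulr_ge0 ?exprn_ge0// addr_ge0.
pose E := e `^ (2 * p); have E0 : 0 < E by rewrite powR_gt0.
have [B B0 BS] : exists2 B, 0 < B & B `^ (2 * p - Q%:R) * S' <= E / 2.
  have q0 : 0 < Q%:R - 2 * p by rewrite subr_gt0.
  pose z := 2 * (S' + 1) / E; have z0 : 0 < z by rewrite divr_gt0// mulr_gt0// ltr_wpDl.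
  exists (z `^ (Q%:R - 2 * p)^-1); first by rewrite powR_gt0.
  rewrite -powRrM (_ : _^-1 * _ = -1); last by rewrite -(opprB Q%:R) mulrN mulVf// gt_eqF.
  rewrite powR_inv1 ?(ltW z0)// /z invf_div mulrAC ler_pdivrMr ?mulr_gt0 ?ltr_wpDl//.
  rewrite (_ : E / 2 * _ = E * (S' + 1)); last by field.
  by rewrite ler_wpM2l ?(ltW E0)// lerDl.
pose e2 := Num.sqrt (E / 2 / B `^ (2 * p - 2)).
have e20 : 0 < e2 by rewrite sqrtr_gt0 !divr_gt0 ?powR_gt0.
have /within_continuous_dist c := @evo_within_continuous _ _ _ _ _ _ evo tau g tau0.
have inT (x : R) : tau <= x -> x <= T -> `[tau, T]%classic x by move=> h1 h2; rewrite /= in_itv/= h1.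
have [d d0 dP] := c t (inT t (ltW taut) tT) e2 e20.
exists (Num.min d ((t - tau) / 2)); first by rewrite lt_min d0 divr_gt0.
move=> t' taut' t'T; rewrite lt_min => /andP[h1 h2] w w' wE w'E.
have := dP t' (inT t' (ltW taut') t'T) h1.
set De : L2 m := U t tau g - U t' tau g => DeE.
have bnd x : tau < x -> x <= T -> (t - tau) / 2 <= x - tau ->
    (\int[m]_y (`|U x tau g y| ^+ Q)%:E <= S%:E)%E.
  move=> x1 x2 x3; apply: le_trans (HC tau x g tau0 x1 x2) _.
  rewrite lee_fin /S -/ga; apply: ler_wpM2r; first exact: exprn_ge0.
  apply: ler_wpM2l; first exact: ltW.
  rewrite !powRN lef_pV2 ?posrE ?powR_gt0 ?subr_gt0//; last by rewrite divr_gt0.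
  by rewrite ge0_ler_powR// ?nnegrE; lra.
have Q1 : (\int[m]_y (`|De y| ^+ Q)%:E <= S'%:E)%E.
  have mP x : measurable_fun setT (fun y => (`|U x tau g y| ^+ Q)%:E).
    apply/measurable_EFinP; apply: measurable_funX; apply: measurableT_comp => //; exact: Lq_measurable.
  apply: (@le_trans _ _ (\int[m]_y ((2 ^+ Q)%:E * ((`|U t tau g y| ^+ Q)%:E + (`|U t' tau g y| ^+ Q)%:E)))%E).
    apply: ae_ge0_le_integral => //.
    - apply/measurable_EFinP; apply: measurable_funX; apply: measurableT_comp => //; exact: Lq_measurable.
    - by move=> x _; rewrite mule_ge0 ?adde_ge0 ?lee_fin ?exprn_ge0.
    - by apply: emeasurable_funM => //; exact: emeasurable_funD.
    apply: filterS (Lq_sub (U t tau g) (U t' tau g)) => x -> _.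
    rewrite -EFinD -EFinM lee_fin.
    set y1 := U t tau g x; set y2 := U t' tau g x.
    apply: (@le_trans _ _ ((2 * Num.max `|y1| `|y2|) ^+ Q)).
      rewrite lerXn2r ?nnegrE// ?mulr_ge0// ?le_max ?normr_ge0//.
      apply: le_trans (ler_normB _ _) _; rewrite mulr2n mulrDl !mul1r.
      by apply: lerD; rewrite le_max lexx ?orbT.
    rewrite exprMn ler_wpM2l ?exprn_ge0// maxEle; case: ifP => _.
      by rewrite lerDr exprn_ge0.
    by rewrite lerDl exprn_ge0.
  rewrite ge0_integralZl_EFin ?exprn_ge0//; last 2 first.
  - by move=> x _; rewrite adde_ge0 ?lee_fin ?exprn_ge0.
  - exact: emeasurable_funD.
  rewrite ge0_integralD//.
  rewrite /S' EFinM; apply: lee_wpmul2l; first by rewrite lee_fin exprn_ge0.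
  rewrite [leRHS]EFinD; apply: leeD; apply: bnd => //; first by lra.
  by move: h2; rewrite ltr_norml => /andP[]; lra.
have H : `|w - w'| `^ (2 * p) < E.
  rewrite -lte_fin Lq_powE.
  have -> : (\int[m]_x (`|(w - w' : L2p m p1) x| `^ (2 * p))%:E = \int[m]_x (`|De x| `^ (2 * p))%:E)%E.
    apply: ge0_ae_eq_integral => //.
    - apply/measurable_EFinP; apply: (measurableT_comp (measurable_powR _)).
      by apply: measurableT_comp => //; exact: Lq_measurable.
    - apply/measurable_EFinP; apply: (measurableT_comp (measurable_powR _)).
      by apply: measurableT_comp => //; exact: Lq_measurable.
    have h : {ae m, forall x, w x - w' x = U t tau g x - U t' tau g x}.
      by apply: filterS2 wE w'E => x -> ->.
    by apply: filterS3 h (Lq_sub w w') (Lq_sub (U t tau g) (U t' tau g)) => x hx -> -> _; rewrite hx.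
  apply: le_lt_trans (moment_interpolation p2 (ltW rj) B0 (Lq_measurable De)) _.
  rewrite -L2_sqrE.
  apply: (@le_lt_trans _ _ ((B `^ (2 * p - 2))%:E * (`|De| ^+ 2)%:E + (E / 2)%:E)%E).
    apply: leeD2l; apply: (@le_trans _ _ (B `^ (2 * p - Q%:R) * S')%:E); last by rewrite lee_fin.
    by rewrite EFinM; apply: lee_wpmul2l => //; rewrite lee_fin powR_ge0.
  rewrite -EFinM -EFinD lte_fin {2}[E]splitr ltrD2r mulrC -ltr_pdivlMr ?powR_gt0//.
  rewrite -(@sqr_sqrtr _ (E / 2 / _)); last by rewrite !divr_ge0 ?powR_ge0 ?(ltW E0).
  by rewrite ltrXn2r ?nnegrE ?sqrtr_ge0.
rewrite ltNge; apply/negP => h; move: H; rewrite ltNge => /negP; apply.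
by rewrite ge0_ler_powR ?nnegrE ?(ltW p20) ?(ltW e0).
Qed.

End smoothing_step.

(** * The generator satisfies the dissipativity condition *)

Section form_smoothing.
Variables (R : realType) (N : nat).
Local Notation X := (RN R N).
Local Notation LN := (lebesgue_RN R N).
Variables (O : set X) (oO : open O) (mu : {finite_measure set X -> \bar R}).
Local Notation F := (boundary O).
Local Notation m := (m_Omega oO mu).
Variables (s d eps delta : R).
Hypotheses (N0 : (0 < N)%N) (eps0 : 0 < eps) (delta0 : 0 < delta).
Hypothesis ed : eps_delta_domain eps delta O.
Hypothesis ds : d_set mu F d.
Hypotheses (s01 : 0 < s < 1) (d0 : 0 < d) (dN : d <= N%:R).
Hypotheses (sN : 2 * s <= N%:R) (dsN : N%:R - d < 2 * s).
Variables (T eta k1 k2 zeta1 zeta2 b0 c C : R).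
Variables (K zeta : R -> X -> X -> R) (b : R -> X -> R).
Hypotheses (T0 : 0 < T) (eta0 : 0 < eta) (k10 : 0 < k1) (z10 : 0 < zeta1) (b00 : 0 < b0).
Hypotheses (K_adm : admissible_kernel LN O T k1 k2 C eta K)
  (zeta_adm : admissible_kernel mu F T zeta1 zeta2 C eta zeta)
  (b_adm : admissible_coefficient mu F T b0 c eta b).
Variables (D : R -> set (L2 m)) (A : R -> L2 m -> L2 m).
Hypothesis A_generator : forall t, 0 <= t <= T ->
  form_generator O s (energy O mu s d K b zeta t) (D t) (A t).

(** The Nash inequality is applied to [tpow n k] of the H^s representative, and [energy_tpow_ge]
    exchanges its Gagliardo term for the form at the cost of 1/kap. The range of h is the same for
    all k. *)
Lemma form_dissipative : exists h0, 0 < h0 /\ forall k, exists C1 C2,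
  [/\ 0 <= C1, 0 < C2 & dissipative_at T D A (lambda N s d / 2) h0 k C1 C2].
Proof.
have /andP[s0 s1] := s01.
have [Cn [h0 [Cn0 h00 Hn]]] := nash_inequality oO N0 eps0 delta0 ed ds s0 dN sN dsN.
exists h0; split => // k.
pose kap := C_Ns N s / 2 * (k1 / k.+1%:R).
have kap0 : 0 < kap by rewrite mulr_gt0// divr_gt0// C_Ns_gt0.
exists Cn, (Cn / kap); split; [exact: ltW|exact: divr_gt0|].
move=> n t f g h n0 tT Df gE hh0.
have [_ _ repr formE] := A_generator tT.
have [u ufr] := repr f Df; have [Hu fu] := ufr.
have M0 j : 0 <= j.+1%:R * n ^+ j by rewrite mulr_ge0// exprn_ge0// ltW.
have [Hpsi psif] := Hs_represents_lipschitz N0 eps0 delta0 ed ds s0 dsN Hu fu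
  (tpow0 n k) (M0 k) (tpow_lipschitz n0 k).
have [Hv vf] := Hs_represents_lipschitz N0 eps0 delta0 ed ds s0 dsN Hu fu
  (tpow0 n k.*2) (M0 k.*2) (tpow_lipschitz n0 k.*2).
have vg : Hs_represents O s (tpow n k.*2 \o u) g.
  split; first exact: Hv.
  by apply: filterS2 vf gE => x vf gE _; rewrite gE; exact: vf.
have mpsi : measurable_fun setT (tpow n k \o (f : X -> R)).
  by apply: measurableT_comp; [exact: measurable_tpow|exact: Lq_measurable].
have := Hn _ _ Hpsi mpsi psif h hh0.
have /andP[hp _] := hh0.
have gfin : gagliardo O s (tpow n k \o u) \is a fin_num.
  by rewrite ge0_fin_numE ?gagliardo_ge0//; have [_ _] := Hpsi.
move/le_trans; apply; apply: leeD2l.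
rewrite -(fineK gfin) -EFinM lee_fin -(formE _ _ _ _ Df ufr vg).
have := energy_tpow_ge oO N0 eps0 delta0 ed ds s01 dsN T0 eta0 k10 z10 b00 K_adm zeta_adm b_adm k n0 Hu tT.
rewrite -/kap; set G := fine _; set E := energy _ _ _ _ _ _ _ _ _ _ => H.
rewrite (_ : Cn / kap * h * E = Cn * h * (E / kap)); last by ring.
by rewrite ler_wpM2l ?mulr_ge0 ?(ltW Cn0) ?(ltW hp)// ler_pdivlMr// mulrC.
Qed.

End form_smoothing.

(** Continuity of the power at positive points does not cover the limit 0, which gets a direct
    estimate. *)
Lemma cvg_powR_ge0 (R : realType) (p L : R) (u : nat -> R) : 0 < p ->
  (forall n, 0 <= u n) -> u @ \oo --> L -> (fun n => u n `^ p) @ \oo --> L `^ p.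
Proof.
move=> p0 u0 uL; have L0 : 0 <= L.
  by rewrite -(cvg_lim (@Rhausdorff R) uL); apply: limr_ge; [apply/cvg_ex; exists L|exact: nearW].
move: L0; rewrite le_eqVlt => /predU1P[L0|L0]; last exact: (cvg_comp _ _ uL (powR_continuous L0)).
rewrite -L0 powR0 ?gt_eqF//; apply/cvgrPdist_lt => e e0.
have d0 : 0 < e `^ p^-1 by rewrite powR_gt0.
move: uL; rewrite -L0 => /cvgrPdist_lt/(_ _ d0); apply: filterS => n.
rewrite !sub0r !normrN !ger0_norm ?powR_ge0// => h.
rewrite -[ltRHS](powRr1 (ltW e0)) -(mulVf (lt0r_neq0 p0)) powRrM.
by rewrite gt0_ltr_powR ?nnegrE ?powR_ge0.
Qed.

(** * Completeness of L^q *)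

Section riesz_fischer.
Context dsp (X : measurableType dsp) (R : realType).
Variable m : {measure set X -> \bar R}.
Variables (p : R) (p1 : (1 <= p%:E)%E).
Local Notation V := (Lq m p1).

Let p0 : 0 < p. Proof. by have := p1; rewrite lee_fin; exact: lt_le_trans. Qed.

Lemma Lq_norm_pow_le (f : V) (c : R) : 0 <= c ->
  (\int[m]_x (`|f x| `^ p)%:E <= (c `^ p)%:E)%E -> `|f| <= c.
Proof.
move=> c0; rewrite -Lq_powE lee_fin leNgt => h; rewrite leNgt; apply/negP => cf.
by move/negP: h; apply; rewrite gt0_ltr_powR ?nnegrE.
Qed.

Lemma Lq_abs_exists (f : V) : exists g : V, {ae m, forall x, g x = `|f x|} /\ `|g| = `|f|.
Proof.
have mf : measurable_fun setT (fun x => `|f x|).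
  by apply: measurableT_comp => //; exact: Lq_measurable.
have fin : (\int[m]_x (`| `|f x| | `^ p)%:E < +oo)%E.
  rewrite (eq_integral (fun x => (`|f x| `^ p)%:E)); last by move=> x _; rewrite normr_id.
  by rewrite -Lq_powE ltry.
have [g gE] := Lq_exists p1 mf fin.
have gE' : {ae m, forall x, g x = `|f x|} by apply: filterS gE => x; exact.
exists g; split => //; apply/eqP; rewrite eq_le; apply/andP; split.
  rewrite -[leRHS]mul1r; apply: Lq_norm_le => //.
  by apply: filterS gE' => x ->; rewrite mul1r normr_id.
rewrite -[leRHS]mul1r; apply: Lq_norm_le => //.
by apply: filterS gE' => x ->; rewrite mul1r normr_id.
Qed.

Let measurable_pow (h : X -> R) : measurable_fun setT h ->
  measurable_fun setT (fun x => (`|h x| `^ p)%:E).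
Proof.
move=> mh; apply/measurable_EFinP; apply: (measurableT_comp (measurable_powR _)).
exact: measurableT_comp.
Qed.

Lemma Lq_pow_ae (f : V) (h : X -> R) : measurable_fun setT h -> {ae m, forall x, f x = h x} ->
  ((`|f| `^ p)%:E = \int[m]_x (`|h x| `^ p)%:E)%E.
Proof.
move=> mh fh; rewrite Lq_powE; apply: ge0_ae_eq_integral => //.
- by apply: measurable_pow; exact: Lq_measurable.
- exact: measurable_pow.
- by apply: filterS fh => x -> _.
Qed.

Section fast.
Variable f : nat -> V.
Hypothesis ff : forall n, `|f n.+1 - f n| <= 2^-1 ^+ n.

Let g n x : R := \sum_(i < n) `|f i.+1 x - f i x|.

Let mf i : measurable_fun setT (f i). Proof. exact: Lq_measurable. Qed.

Let mg n : measurable_fun setT (g n).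
Proof. by apply: measurable_sum => i; apply: measurableT_comp => //; apply: measurable_funB. Qed.

Let g_ge0 n x : 0 <= g n x. Proof. exact: sumr_ge0. Qed.

Let geo n : \sum_(i < n) (2^-1 : R) ^+ i <= 2.
Proof.
suff -> : \sum_(i < n) (2^-1 : R) ^+ i = 2 - 2 * 2^-1 ^+ n.
  by rewrite gerBl mulr_ge0// exprn_ge0.
elim: n => [|n IH]; first by rewrite big_ord0 expr0 mulr1 subrr.
by rewrite big_ord_recr/= IH exprS; field.
Qed.

(** The partial sums are realised as elements of the space, so that the triangle inequality of its
    norm applies. *)
Let gint n : (\int[m]_x (g n x `^ p)%:E <= (2 `^ p)%:E)%E.
Proof.
suff [G [GE Gn]] : exists G : V, {ae m, forall x, G x = g n x} /\ `|G| <= \sum_(i < n) 2^-1 ^+ i.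
  rewrite (eq_integral (fun x => (`|g n x| `^ p)%:E)); last by move=> x _; rewrite ger0_norm.
  rewrite -(Lq_pow_ae (mg n) GE) lee_fin ge0_ler_powR ?nnegrE ?(ltW p0)//.
  exact: le_trans Gn (geo n).
elim: n => [|n [G [GE Gn]]].
  exists 0; rewrite normr0 big_ord0; split => //.
  have := Lq_scale 0 (0 : V); rewrite scale0r; apply: filterS => x ->.
  by rewrite mul0r /g big_ord0.
have [H [HE Hn]] := Lq_abs_exists (f n.+1 - f n).
exists (G + H); split; last first.
  by rewrite big_ord_recr/=; apply: le_trans (ler_normD _ _) _; rewrite lerD// Hn.
have h1 : {ae m, forall x, H x = `|f n.+1 x - f n x|}.
  by apply: filterS2 HE (Lq_sub (f n.+1) (f n)) => x ->; move=> ->.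
apply: filterS3 (Lq_add G H) GE h1 => x -> -> ->.
by rewrite /g big_ord_recr.
Qed.

Let g_nd n k x : (n <= k)%N -> g n x <= g k x.
Proof.
elim: k => [|k IH]; first by rewrite leqn0 => /eqP ->.
rewrite leq_eqVlt => /predU1P[->//|]; rewrite ltnS => /IH h; apply: le_trans h _.
by rewrite /g big_ord_recr/= lerDl.
Qed.

(** The integrals of the p-th powers of the partial sums stay bounded, so these sums are bounded at
    almost every point and the telescoping series converges absolutely there. *)
Let f_ae_cvg : {ae m, forall x, cvgn (fun n => f n x)}.
Proof.
have mge n : measurable_fun setT (fun x => (g n x `^ p)%:E).
  by apply/measurable_EFinP; apply: (measurableT_comp (measurable_powR _)).
have ge0 n x : setT x -> (0 <= (g n x `^ p)%:E)%E by rewrite lee_fin powR_ge0.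
have gnd x : setT x -> {homo (fun n => (g n x `^ p)%:E) : n k / (n <= k)%N >-> (n <= k)%E}.
  move=> _ n k nk; rewrite lee_fin ge0_ler_powR ?nnegrE ?(ltW p0)//; exact: g_nd.
have := monotone_convergence m measurableT mge ge0 gnd.
set h := fun x => limn _ => hE.
have h0 x : (0 <= h x)%E.
  apply: lime_ge; last by apply: nearW => n; rewrite lee_fin powR_ge0.
  by apply: ereal_nondecreasing_is_cvgn => n k nk; apply: gnd.
have mh : measurable_fun setT h.
  apply: (emeasurable_fun_cvg (fun n x => (g n x `^ p)%:E)) => // x _.
  by apply: ereal_nondecreasing_is_cvgn => n k nk; apply: gnd.
have ih : m.-integrable setT h.
  apply/integrableP; split => //.
  rewrite (eq_integral h); last by move=> x _; rewrite gee0_abs.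
  rewrite hE; apply: (@le_lt_trans _ _ (2 `^ p)%:E); last by rewrite ltry.
  apply: lime_le; last exact: nearW.
  apply: ereal_nondecreasing_is_cvgn => n k nk; apply: ge0_le_integral => //.
  - by move=> x _; exact: ge0.
  - by move=> x _; exact: gnd.
have := integrable_ae measurableT ih; apply: filterS => x /(_ Logic.I) hx.
have gle n : (g n x `^ p) <= fine (h x).
  rewrite -lee_fin fineK//; apply: lime_gt_ || idtac.
  have := @ereal_nondecreasing_cvgn R (fun n => (g n x `^ p)%:E) (gnd x Logic.I).
  move/cvg_lim => /(_ (@ereal_hausdorff _)); rewrite /h => ->.
  by apply: ereal_sup_ubound; exists n.
have gub : has_ubound (range (fun n => g n x)).
  exists (fine (h x) `^ p^-1) => _ [n _ <-].
  rewrite -(powRr1 (g_ge0 n x)) -(mulfV (lt0r_neq0 p0)) powRrM.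
  by rewrite ge0_ler_powR ?nnegrE ?invr_ge0 ?(ltW p0) ?powR_ge0 ?(le_trans _ (gle n))// powR_ge0.
have gc : cvgn (fun n => g n x).
  by apply: nondecreasing_is_cvgn => // n k nk; exact: g_nd.
pose u i := f i.+1 x - f i x.
have cu : cvgn (series u).
  apply: normed_cvg; rewrite (_ : [normed series u] = fun n => g n x)//.
  by apply/funext => n; rewrite /g /= -(big_mkord xpredT (fun i => `|f i.+1 x - f i x|)).
have -> : (fun n => f n x) = (fun n => f 0%N x + series u n).
  by apply/funext => n; rewrite /series/= telescope_sumr// addrC subrK.
apply: is_cvgD => //; exact: is_cvg_cst.
Qed.

Lemma Lq_fast_cvg : exists F : V, forall n, `|F - f n| <= 2 * 2^-1 ^+ n.
Proof.
(* The upper limit is measurable and agrees with the limit wherever that exists. *)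
pose F x := fine (limn_esup (fun n => (f n x)%:E)).
have mF : measurable_fun setT F.
  apply: (measurableT_comp (fine_measurable (@measurableT _ _))) => //.
  apply: measurable_fun_limn_esup => n; apply/measurable_EFinP; exact: mf.
have Fcvg : {ae m, forall x, (fun n => f n x) @ \oo --> F x}.
  apply: filterS f_ae_cvg => x /cvg_ex[l fl].
  have fl' : (fun n => (f n x)%:E) @ \oo --> l%:E by apply: cvg_EFin => //; exact: nearW.
  by rewrite /F (cvg_limn_einf_sup fl').2.
have dist n k : (n <= k)%N -> `|f k - f n| <= 2 * 2^-1 ^+ n - 2 * 2^-1 ^+ k.
  elim: k => [|k IH]; first by rewrite leqn0 => /eqP ->; rewrite !subrr normr0.
  rewrite leq_eqVlt => /predU1P[->|]; first by rewrite !subrr normr0.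
  rewrite ltnS => /IH h; rewrite -(subrK (f k) (f k.+1)) -addrA.
  apply: le_trans (ler_normD _ _) _; have := ff k; rewrite exprS; lra.
have key n : (\int[m]_x (`|F x - f n x| `^ p)%:E <= ((2 * 2^-1 ^+ n) `^ p)%:E)%E.
  pose h k x := (`|f k x - f n x| `^ p)%:E.
  have mh k : measurable_fun setT (h k) by apply: measurable_pow; apply: measurable_funB.
  have h0 k x : setT x -> (0 <= h k x)%E by rewrite lee_fin powR_ge0.
  have := fatou m measurableT mh h0.
  have -> : (\int[m]_x limn_einf (h^~ x) = \int[m]_x (`|F x - f n x| `^ p)%:E)%E.
    apply: ge0_ae_eq_integral => //.
    - apply: measurableT_comp => //; apply: measurable_fun_limn_esup => k.
      exact: measurableT_comp.
    - by apply: measurable_pow; apply: measurable_funB.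
    - move=> x _; rewrite limn_einf_lim; apply: lime_ge; first exact: is_cvg_einfs.
      by apply: nearW => k; apply: le_ereal_inf_tmp => _ [j _ <-]; exact: h0.
    - apply: filterS Fcvg => x fx _.
      suff H : h^~ x @ \oo --> (`|F x - f n x| `^ p)%:E by rewrite (cvg_limn_einf_sup H).1.
      apply: cvg_EFin; first exact: nearW.
      have c1 : (fun k => `|f k x - f n x|) @ \oo --> `|F x - f n x|.
        by apply: cvg_norm; apply: cvgB => //; exact: cvg_cst.
      exact: cvg_powR_ge0.
  move=> H; apply: le_trans H _; rewrite limn_einf_lim.
  apply: lime_le; first exact: is_cvg_einfs.
  apply: nearW => j; apply: (@le_trans _ _ (\int[m]_x h (maxn j n) x)%E).
    by apply: ereal_inf_lbound; exists (maxn j n) => //=; rewrite leq_maxl.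
  have e1 : {ae m, forall x, (f (maxn j n) - f n : V) x = f (maxn j n) x - f n x}.
    exact: Lq_sub.
  rewrite -(Lq_pow_ae _ e1); last by apply: measurable_funB.
  rewrite lee_fin ge0_ler_powR ?nnegrE ?(ltW p0) ?mulr_ge0 ?exprn_ge0//.
  apply: le_trans (dist _ _ (leq_maxr _ _)) _.
  by rewrite gerBl mulr_ge0// exprn_ge0.
have mF0 : measurable_fun setT (fun x => F x - f 0%N x) by apply: measurable_funB.
have [H HE] := Lq_exists p1 mF0 (le_lt_trans (key 0%N) (ltry _)).
have HE' : {ae m, forall x, H x = F x - f 0%N x} by apply: filterS HE => x; exact.
exists (H + f 0%N) => n; apply: Lq_norm_pow_le; first by rewrite mulr_ge0// exprn_ge0.
rewrite -Lq_powE (@Lq_pow_ae _ (fun x => F x - f n x)); first exact: key.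
  by apply: measurable_funB.
apply: filterS3 HE' (Lq_add H (f 0%N)) (Lq_sub (H + f 0%N) (f n)) => x h1 h2 ->.
by rewrite h2 h1 subrK.
Qed.

End fast.

Definition seq_complete (W : normedModType R) := forall u : nat -> W,
  (forall e : R, 0 < e -> exists N, forall i j, (N <= i)%N -> (N <= j)%N -> `|u i - u j| < e) ->
  exists l : W, u @ \oo --> l.

Lemma Lq_complete : seq_complete V.
Proof.
move=> u cu.
have half n : 0 < (2^-1 : R) ^+ n by rewrite exprn_gt0.
have /choice[N NP] : forall n, exists N, forall i j, (N <= i)%N -> (N <= j)%N ->
  `|u i - u j| < 2^-1 ^+ n by move=> n; exact: cu.
(* Summing the thresholds gives a nondecreasing sequence of indices above each of them. *)
pose phi n := (\sum_(i < n.+1) N i)%N.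
have phiN n : (N n <= phi n)%N by rewrite /phi big_ord_recr leq_addl.
have phiS n : (phi n <= phi n.+1)%N by rewrite {2}/phi big_ord_recr leq_addr.
have [n|F HF] := @Lq_fast_cvg (fun n => u (phi n)).
  by apply: ltW; apply: NP; rewrite ?(leq_trans (phiN n)).
exists F; apply/cvgrPdist_lt => e e0.
have [n hn] : exists n, 3 * (2^-1 : R) ^+ n < e.
  have := @cvg_geometric R 3 2^-1 (ltac:(by rewrite ger0_norm// invf_lt1// ltr1n)).
  move=> /cvgrPdist_lt/(_ e e0)[n _ hn]; exists n; have := hn n (leqnn _).
  by rewrite sub0r normrN ger0_norm// mulr_ge0// ltW.
exists (phi n) => // k /= nk.
rewrite -(subrK (u (phi n)) F) -addrA; apply: le_lt_trans (ler_normD _ _) _.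
have h1 := HF n; have h2 := NP n (phi n) k (phiN n) (leq_trans (phiN n) nk).
by lra.
Qed.

End riesz_fischer.

(** * Simple functions and Bochner integrals *)

Section simple_functions.
Context dsp (T : measurableType dsp) (R : realType).
Variable nu : {measure set T -> \bar R}.
Section one_space.
Variable V : normedModType R.
Implicit Types (l : seq (set T * V)) (D E : set T).

Lemma integrable_simple_cons D (Bc : set T * V) l : integrable_simple nu D (Bc :: l) <->
  [/\ measurable Bc.1, Bc.1 `<=` D & (nu Bc.1 < +oo)%E] /\ integrable_simple nu D l.
Proof.
split=> [h|[h0 h] [|i] hi]; [split|exact: h0|exact: h].
  exact: (h 0%N).
by move=> i hi; exact: (h i.+1).
Qed.

Lemma integrable_simple_cat D l1 l2 : integrable_simple nu D l1 ->
  integrable_simple nu D l2 -> integrable_simple nu D (l1 ++ l2).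
Proof.
move=> + h2; elim: l1 => [//|Bc l1 IH] /integrable_simple_cons[h h1].
by apply/integrable_simple_cons; split => //; exact: IH.
Qed.

Lemma integrable_simpleW D D' l : D' `<=` D -> integrable_simple nu D' l -> integrable_simple nu D l.
Proof.
move=> DD; elim: l => [//|Bc l IH] /integrable_simple_cons[[h1 h2 h3] h].
apply/integrable_simple_cons; split; last exact: IH.
by split => //; exact: subset_trans DD.
Qed.

Lemma simple_fun_nil x : simple_fun ([::] : seq (set T * V)) x = 0.
Proof. by rewrite /simple_fun big_nil. Qed.

Lemma simple_fun_cons (Bc : set T * V) l x :
  simple_fun (Bc :: l) x = (\1_(Bc.1) x : R) *: Bc.2 + simple_fun l x.
Proof. by rewrite /simple_fun big_cons. Qed.

Lemma simple_fun_cat l1 l2 x : simple_fun (l1 ++ l2) x = simple_fun l1 x + simple_fun l2 x.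
Proof. by rewrite /simple_fun big_cat. Qed.

Lemma simple_integral_cat l1 l2 :
  simple_integral nu (l1 ++ l2) = simple_integral nu l1 + simple_integral nu l2.
Proof. by rewrite /simple_integral big_cat. Qed.

Lemma simple_fun_out D l x : integrable_simple nu D l -> ~ D x -> simple_fun l x = 0.
Proof.
move=> + nDx; elim: l => [|Bc l IH]; first by rewrite simple_fun_nil.
move=> /integrable_simple_cons[[_ BD _] /IH h]; rewrite simple_fun_cons h addr0.
by rewrite indicE memNset ?scale0r// => /BD.
Qed.

(** A scalar substitute for strong measurability; it is stable under subtraction of simple
    functions, so all norms integrated below are measurable. *)
Definition norm_measurable D (f : T -> V) :=
  forall c : V, measurable_fun D (fun x => `|f x - c|).

Lemma norm_measurable_simple D (f : T -> V) l : measurable D -> norm_measurable D f ->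
  integrable_simple nu D l -> norm_measurable D (fun x => f x - simple_fun l x).
Proof.
move=> mD mf hl.
suff H E : measurable E -> E `<=` D -> norm_measurable E (fun x => f x - simple_fun l x).
  exact: H.
elim: l hl E => [|[B b] l IH] hl E mE ED c.
  under eq_fun do rewrite simple_fun_nil subr0.
  by apply: measurable_funS (mf c).
have [[/= mB BD _] hl'] := (integrable_simple_cons _ _ _).1 hl.
have -> : E = (E `&` B) `|` (E `\` B) by rewrite setUIDK.
apply/measurable_funU; [exact: measurableI|exact: measurableD|split].
- apply: eq_measurable_fun (IH hl' (E `&` B) _ _ (c + b)).
  + by move=> x; rewrite inE => -[_ Bx]; rewrite simple_fun_cons/= indicE mem_set// scale1r; congr `|_|;
    rewrite -!addrA -!opprD; congr (_ - _); rewrite addrA addrC addrA.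
  + exact: measurableI.
  + by move=> x [/ED].
- apply: eq_measurable_fun (IH hl' (E `\` B) _ _ c).
  + by move=> x; rewrite inE => -[_ Bx]; rewrite simple_fun_cons/= indicE memNset// scale0r add0r.
  + exact: measurableD.
  + by move=> x [/ED].
Qed.

Lemma norm_measurable_cst D (c : V) : norm_measurable D (fun=> c).
Proof. by move=> c'; exact: measurable_cst. Qed.

Lemma measurable_norm_sub_simple D (f : T -> V) l : measurable D -> norm_measurable D f ->
  integrable_simple nu D l -> measurable_fun D (fun x => `|f x - simple_fun l x|).
Proof.
move=> mD mf hl; have := norm_measurable_simple mD mf hl 0.
by under eq_fun do rewrite subr0.
Qed.

(** The sets of a list may overlap. The induction splits a set [E] along the first of them and moves
    its vector into an offset [c], so that the claim for the tail applies to both pieces. *)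
Lemma simple_integral_norm D l : measurable D -> (nu D < +oo)%E -> integrable_simple nu D l ->
  (`|simple_integral nu l|%:E <= \int[nu]_(x in D) `|simple_fun l x|%:E)%E.
Proof.
move=> mD Dfin hl.
have finE (A : set T) : measurable A -> A `<=` D -> nu A \is a fin_num.
  by move=> mA AD; rewrite ge0_fin_numE// (le_lt_trans _ Dfin)// le_measure ?inE.
suff H E (c : V) : measurable E -> E `<=` D ->
  (`|fine (nu E) *: c + \sum_(Bc <- l) fine (nu (E `&` Bc.1)) *: Bc.2|%:E <=
   \int[nu]_(x in E) `|c + simple_fun l x|%:E)%E.
  have := H D 0 mD (@subset_refl _ _); rewrite scaler0 add0r.
  under eq_integral do rewrite add0r.
  apply: le_trans; rewrite lee_fin le_eqVlt; apply/orP; left; apply/eqP; congr `|_|.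
  rewrite /simple_integral; elim: l hl {H} => [|Bc l IH] hl; first by rewrite !big_nil.
  have [[_ BD _] hl'] := (integrable_simple_cons _ _ _).1 hl.
  by rewrite !big_cons IH//; congr (_ *: _ + _); congr (fine (nu _)); rewrite setIidr.
elim: l hl E c => [|[B b] l IH] hl E c mE ED.
  rewrite big_nil addr0; under eq_integral do rewrite simple_fun_nil addr0.
  rewrite integral_cst// normrZ ger0_norm; last exact: fine_ge0.
  by rewrite EFinM fineK ?finE// muleC.
have [[/= mB BD _] hl'] := (integrable_simple_cons _ _ _).1 hl.
have mEB : measurable (E `&` B) by exact: measurableI.
have mEDB : measurable (E `\` B) by exact: measurableD.
have sEB : E `&` B `<=` D by move=> x [/ED].
have sEDB : E `\` B `<=` D by move=> x [/ED].
have nuE A : measurable A -> fine (nu (E `&` A)) = fine (nu (E `&` B `&` A)) + fine (nu ((E `\` B) `&` A)).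
  move=> mA; rewrite -fineD; last 2 first.
  - by apply: finE => [|x []]; [exact: measurableI|move=> [/ED]].
  - by apply: finE => [|x []]; [exact: measurableI|move=> [/ED]].
  congr fine; rewrite -measureU; last 3 first.
  - exact: measurableI.
  - exact: measurableI.
  - by apply/seteqP; split => x //= [[[_ Bx] _] [[_ nBx] _]].
  by rewrite -setIUl setUIDK.
have IH1 := IH hl' (E `&` B) (c + b) mEB sEB.
have IH2 := IH hl' (E `\` B) c mEDB sEDB.
have EE : E = (E `&` B) `|` (E `\` B) by rewrite setUIDK.
have mabs : measurable_fun E (fun x => `|c + simple_fun ((B, b) :: l) x|%:E).
  apply/measurable_EFinP; have := norm_measurable_simple mD (@norm_measurable_cst D 0) hl c.
  move/(measurable_funS mD ED); apply: eq_measurable_fun => x _.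
  by rewrite sub0r -opprD normrN addrC.
have -> : (\int[nu]_(x in E) `|c + simple_fun ((B, b) :: l) x|%:E =
    \int[nu]_(x in E `&` B) `|c + simple_fun ((B, b) :: l) x|%:E +
    \int[nu]_(x in E `\` B) `|c + simple_fun ((B, b) :: l) x|%:E)%E.
  rewrite {1}EE ge0_integral_setU//; first by rewrite -EE.
  by apply/disj_setPS => x [[_ Bx] [_ nBx]].
have -> : (\int[nu]_(x in E `&` B) `|c + simple_fun ((B, b) :: l) x|%:E =
    \int[nu]_(x in E `&` B) `|c + b + simple_fun l x|%:E)%E.
  apply: eq_integral => x; rewrite inE => -[_ Bx].
  by rewrite simple_fun_cons/= indicE mem_set// scale1r addrA.
have -> : (\int[nu]_(x in E `\` B) `|c + simple_fun ((B, b) :: l) x|%:E =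
    \int[nu]_(x in E `\` B) `|c + simple_fun l x|%:E)%E.
  apply: eq_integral => x; rewrite inE => -[_ Bx].
  by rewrite simple_fun_cons/= indicE memNset// scale0r add0r.
apply: le_trans (leeD IH1 IH2); rewrite -EFinD lee_fin; apply: le_trans (ler_normD _ _).
rewrite le_eqVlt; apply/orP; left; apply/eqP; congr `|_|.
rewrite big_cons/= -(setIT E) (nuE _ measurableT) !setIT.
have -> : \sum_(Bc <- l) fine (nu (E `&` Bc.1)) *: Bc.2 =
  \sum_(Bc <- l) fine (nu (E `&` B `&` Bc.1)) *: Bc.2 +
  \sum_(Bc <- l) fine (nu ((E `\` B) `&` Bc.1)) *: Bc.2.
  elim: l hl' {IH IH1 IH2 hl mabs} => [|Bc l IH] hl'; first by rewrite !big_nil addr0.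
  have [[mBc _ _] hl2] := (integrable_simple_cons _ _ _).1 hl'.
  by rewrite !big_cons IH// nuE// scalerDl addrACA.
rewrite scalerDl scalerDr -!addrA; congr (_ + _).
by rewrite [LHS]addrCA; congr (_ + _); rewrite [LHS]addrCA.
Qed.

End one_space.

Section two_spaces.
Variables V W : normedModType R.
Variable L : V -> W.
Hypotheses (L_add : forall u v, L (u + v) = L u + L v) (L_scale : forall (a : R) u, L (a *: u) = a *: L u).

Definition simple_map (l : seq (set T * V)) := [seq (Bc.1, L Bc.2) | Bc <- l].

Let L0 : L 0 = 0. Proof. by rewrite -(scale0r 0) L_scale scale0r. Qed.

Lemma integrable_simple_map D l : integrable_simple nu D l -> integrable_simple nu D (simple_map l).
Proof.
elim: l => [//|Bc l IH] /integrable_simple_cons[h1 h2].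
by apply/integrable_simple_cons; split => //; exact: IH.
Qed.

Lemma simple_fun_map l x : simple_fun (simple_map l) x = L (simple_fun l x).
Proof.
elim: l => [|Bc l IH]; first by rewrite !simple_fun_nil L0.
by rewrite /= !simple_fun_cons IH L_add L_scale.
Qed.

Lemma simple_integral_map l : simple_integral nu (simple_map l) = L (simple_integral nu l).
Proof.
rewrite /simple_integral; elim: l => [|Bc l IH]; first by rewrite !big_nil L0.
by rewrite /= !big_cons IH L_add L_scale.
Qed.

End two_spaces.
End simple_functions.

Section bochner_estimates.
Context dsp (T : measurableType dsp) (R : realType).
Variable nu : {measure set T -> \bar R}.

Lemma bochner_linear (V W : normedModType R) (L : V -> W) (c : R) D (f : T -> V) w :
  (forall u v, L (u + v) = L u + L v) -> (forall (a : R) u, L (a *: u) = a *: L u) ->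
  0 < c -> (forall u, `|L u| <= c * `|u|) -> measurable D ->
  norm_measurable D f ->
  bochner_integral nu D f w -> bochner_integral nu D (L \o f) (L w).
Proof.
move=> LD LZ c0 Lc mD mf [l [l1 l2 l3 l4]].
have LB u v : L u - L v = L (u - v) by rewrite LD -(scaleN1r v) LZ scaleN1r.
have Lcvg (u : nat -> V) v : u @ \oo --> v -> (fun k => L (u k)) @ \oo --> L v.
  move=> uv; apply/cvgrPdist_lt => e e0.
  have ec : 0 < e / c by rewrite divr_gt0.
  move/cvgrPdist_lt : uv => /(_ _ ec); apply: filterS => k h.
  by rewrite LB; apply: le_lt_trans (Lc _) _; rewrite mulrC -ltr_pdivlMr.
exists (fun k => simple_map L (l k)); split.
- by move=> k; exact: integrable_simple_map.
- apply: filterS l2 => x h Dx; under eq_fun do rewrite (simple_fun_map LD LZ).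
  by apply: Lcvg; exact: h.
- apply: (@squeeze_cvge _ _ _ _ (fun=> 0%E) _
    (fun k => c%:E * \int[nu]_(x in D) `|f x - simple_fun (l k) x|%:E)%E).
  + apply: nearW => k; apply/andP; split; first exact: integral_ge0.
    rewrite -ge0_integralZl_EFin ?(ltW c0)//; last first.
      by apply/measurable_EFinP; exact: measurable_norm_sub_simple (l1 k).
    apply: ge0_le_integral_nm => x _ //=.
    by rewrite -EFinM lee_fin (simple_fun_map LD LZ) LB.
  + exact: cvg_cst.
  + by rewrite -(mule0 c%:E); apply: cvgeZl.
- under eq_fun do rewrite (simple_integral_map _ LD LZ).
  exact: Lcvg.
Qed.

(** One estimate for three uses: L = id gives the contraction, L = 0 the bound of the norm of an
    integral, and L a propagator the comparison of integrals with different upper limits. *)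
Lemma bochner_sub_le (V W : normedModType R) (L : V -> W) (c : R) D D' (f : T -> W) (f' : T -> V)
    w w' (g : T -> \bar R) :
  (forall u v, L (u + v) = L u + L v) -> (forall (a : R) u, L (a *: u) = a *: L u) ->
  0 < c -> (forall u, `|L u| <= c * `|u|) -> measurable D -> measurable D' -> D' `<=` D ->
  (nu D < +oo)%E -> norm_measurable D f -> norm_measurable D' f' ->
  measurable_fun D g -> (forall x, D x -> 0 <= g x)%E ->
  (forall x, D' x -> (`|f x - L (f' x)|%:E <= g x)%E) ->
  (forall x, D x -> ~ D' x -> (`|f x|%:E <= g x)%E) ->
  bochner_integral nu D f w -> bochner_integral nu D' f' w' ->
  (`|w - L w'|%:E <= \int[nu]_(x in D) g x)%E.
Proof.
move=> LD LZ c0 Lc mD mD' DD Dfin mf mf' mg g0 gf1 gf2 [l [l1 l2 l3 l4]] [l' [l1' l2' l3' l4']].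
have LN u : L (- u) = - L u by rewrite -scaleN1r LZ scaleN1r.
have LB u v : L u - L v = L (u - v) by rewrite LD LN.
have ND (u v : V) : - (u + v) = - u + (- v) by rewrite opprD.
have NZ (a : R) (u : V) : - (a *: u) = a *: (- u) by rewrite scalerN.
pose q k := l k ++ simple_map (fun v => L (- v)) (l' k).
have LND u v : L (- (u + v)) = L (- u) + L (- v) by rewrite opprD LD.
have LNZ (a : R) u : L (- (a *: u)) = a *: L (- u) by rewrite -scalerN LZ.
have hq k : integrable_simple nu D (q k).
  apply: integrable_simple_cat => //; apply: integrable_simple_map.
  exact: integrable_simpleW (l1' k).
pose a k := (\int[nu]_(x in D) `|f x - simple_fun (l k) x|%:E)%E.
pose b k := (\int[nu]_(x in D') `|f' x - simple_fun (l' k) x|%:E)%E.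
have mb k := measurable_norm_sub_simple mD' mf' (l1' k).
have ma k := measurable_norm_sub_simple mD mf (l1 k).
pose Fb k x := ((fun x => `|f' x - simple_fun (l' k) x|%:E) \_ D' x)%E.
have Fb0 k x : (0 <= Fb k x)%E by rewrite /Fb patchE; case: ifP.
have mFb k : measurable_fun D (Fb k).
  apply: measurable_funS measurableT (@subsetT _ _) _.
  by apply: (measurable_restrictT _ mD').1; exact/measurable_EFinP.
have bE k : (\int[nu]_(x in D) Fb k x = b k)%E.
  rewrite /b [RHS]integral_mkcond [LHS]integral_mkcond; apply: eq_integral => x _.
  rewrite /Fb !patchE; case: ifPn => //; case: ifPn => //; rewrite inE => /DD Dx.
  by rewrite notin_setE.
have key k : (`|simple_integral nu (l k) - L (simple_integral nu (l' k))|%:E <=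
    a k + (\int[nu]_(x in D) g x + c%:E * b k))%E.
  have -> : simple_integral nu (l k) - L (simple_integral nu (l' k)) = simple_integral nu (q k).
    by rewrite simple_integral_cat (simple_integral_map _ LND LNZ) LN.
  apply: le_trans (simple_integral_norm mD Dfin (hq k)) _.
  rewrite -bE -ge0_integralZl_EFin ?(ltW c0)// -ge0_integralD//; last 2 first.
  - by move=> x _; rewrite mule_ge0// lee_fin ltW.
  - exact: emeasurable_funM.
  rewrite -ge0_integralD//; last 3 first.
  - exact/measurable_EFinP.
  - by move=> x Dx; rewrite adde_ge0 ?g0// mule_ge0// lee_fin ltW.
  - by apply: emeasurable_funD => //; exact: emeasurable_funM.
  apply: ge0_le_integral_nm => x Dx //.
  rewrite simple_fun_cat (simple_fun_map LND LNZ) LN.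
  have [D'x|nD'x] := pselect (D' x); last first.
    rewrite (simple_fun_out (l1' k) nD'x) -(scale0r (0 : V)) LZ scale0r subr0.
    rewrite /Fb patchE memNset// mule0 adde0.
    apply: (@le_trans _ _ (`|f x - simple_fun (l k) x|%:E + `|f x|%:E)%E); last first.
      by apply: leeD2l; exact: gf2.
    have := ler_normD (simple_fun (l k) x - f x) (f x).
    by rewrite subrK distrC -EFinD lee_fin.
  rewrite /Fb patchE mem_set//.
  apply: (@le_trans _ _ (`|f x - simple_fun (l k) x|%:E + (`|f x - L (f' x)|%:E +
     (c * `|f' x - simple_fun (l' k) x|)%:E))%E).
    rewrite -!EFinD lee_fin.
    rewrite (_ : _ - _ = (simple_fun (l k) x - f x) + ((f x - L (f' x)) + L (f' x - simple_fun (l' k) x))).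
      apply: le_trans (ler_normD _ _) _; rewrite distrC lerD2l.
      by apply: le_trans (ler_normD _ _) _; rewrite lerD2l.
    by rewrite -LB addrA subrKA subrKA.
  by apply: leeD2l; rewrite EFinM; apply: leeD2r; exact: gf1.
have Lcvg : (fun k => L (simple_integral nu (l' k))) @ \oo --> L w'.
  apply/cvgrPdist_lt => e e0.
  have ec : 0 < e / c by rewrite divr_gt0.
  move/cvgrPdist_lt : l4' => /(_ _ ec); apply: filterS => k h.
  by rewrite LB; apply: le_lt_trans (Lc _) _; rewrite mulrC -ltr_pdivlMr.
have lhs : (fun k => `|simple_integral nu (l k) - L (simple_integral nu (l' k))|%:E) @ \oo -->
    `|w - L w'|%:E.
  by apply: cvg_EFin; [exact: nearW|apply: cvg_norm; exact: cvgB].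
have [->|gfin] := eqVneq (\int[nu]_(x in D) g x)%E +oo%E; first by rewrite leey.
have gf : (\int[nu]_(x in D) g x)%E \is a fin_num.
  by rewrite ge0_fin_numE ?integral_ge0// lt_neqAle gfin leey.
have r1 : (fun k => c%:E * b k)%E @ \oo --> 0%E by rewrite -(mule0 c%:E); exact: cvgeZl.
have r2 : (fun k => \int[nu]_(x in D) g x + c%:E * b k)%E @ \oo --> (\int[nu]_(x in D) g x + 0)%E.
  by apply: cvgeD; [exact: fin_num_adde_defr|exact: cvg_cst|exact: r1].
have rhs : (fun k => a k + (\int[nu]_(x in D) g x + c%:E * b k))%E @ \oo -->
    (0 + (\int[nu]_(x in D) g x + 0))%E.
  by apply: cvgeD; [exact: fin_num_adde_defr|exact: l3|exact: r2].
rewrite adde0 add0e in rhs.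
rewrite -(cvg_lim (@ereal_hausdorff _) lhs) -(cvg_lim (@ereal_hausdorff _) rhs).
by apply: lee_lim; [apply/cvg_ex; eexists; exact: lhs|apply/cvg_ex; eexists; exact: rhs|exact: nearW].
Qed.

Lemma bochner_norm_le (W : normedModType R) D (f : T -> W) w (g : T -> \bar R) :
  measurable D -> (nu D < +oo)%E -> norm_measurable D f ->
  measurable_fun D g -> (forall x, D x -> (`|f x|%:E <= g x)%E) ->
  bochner_integral nu D f w -> (`|w|%:E <= \int[nu]_(x in D) g x)%E.
Proof.
move=> mD Dfin mf mg fg fw.
pose Z : W -> W := fun=> 0.
have := @bochner_sub_le W W Z 1 D D f f w w g _ _ ltr01 _ mD mD (@subset_refl _ _) Dfin mf mf mg _ _ _ fw fw.
rewrite subr0; apply => //.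
- by rewrite /Z => _ _; rewrite addr0.
- by rewrite /Z => a _; rewrite scaler0.
- by move=> u; rewrite normr0 mul1r.
- by move=> x Dx; exact: le_trans (fg x Dx).
- by move=> x Dx; rewrite subr0; exact: fg.
Qed.

End bochner_estimates.

Section bochner_existence.
Variables (R : realType) (V : normedModType R).
Notation leb := (@lebesgue_measure R).

Lemma norm_measurable_continuous (D : set R) (f : R -> V) : measurable (D : set (measurableTypeR R)) ->
  {within D, continuous f} -> norm_measurable (T := measurableTypeR R) D f.
Proof.
move=> mD /within_continuous_dist cf c.
apply: (@subspace_continuous_measurable_fun R D (fun x => `|f x - c|)) => //.
apply/within_continuous_dist => x Dx e e0; have [d d0 dP] := cf x Dx e e0.
exists d => // y Dy xy; apply: le_lt_trans (dP y Dy xy).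
apply: le_trans (ler_dist_dist _ _) _.
by rewrite opprB addrA subrK.
Qed.

Variables (t : R) (f : R -> V).
Hypotheses (t0 : 0 < t) (cf : {within `]0, t[, continuous f}).

(** Continuous induction: the set of end points up to which an approximation exists reaches beyond
    its supremum by continuity there, unless the supremum is b. *)
Lemma simple_approximation (a b e : R) : 0 < a -> a <= b -> b < t -> 0 < e ->
  exists l : seq (set (measurableTypeR R) * V), integrable_simple leb `]a, b]%classic l /\
    forall x, a < x <= b -> `|f x - simple_fun l x| <= e.
Proof.
move=> a0 ab bt e0.
pose P c := exists l : seq (set (measurableTypeR R) * V), integrable_simple leb `]a, c]%classic l /\
    forall x, a < x <= c -> `|f x - simple_fun l x| <= e.
have Pa : P a.
  by exists [::]; split => // x /andP[h1 h2]; have := lt_le_trans h1 h2; rewrite ltxx.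
have ext c c' c0 : a <= c -> c <= c' -> (forall x, c < x <= c' -> `|f x - f c0| <= e) -> P c -> P c'.
  move=> ac cc' h [l [l1 l2]]; exists ((`]c, c']%classic, f c0) :: l); split.
    apply/integrable_simple_cons; split; last first.
      apply: integrable_simpleW l1 => x /=; rewrite !in_itv/= => /andP[-> /=].
      by move/le_trans; apply.
    split => /=; first exact: measurable_itv.
      by move=> x /=; rewrite !in_itv/= => /andP[h1 ->]; rewrite (le_lt_trans ac h1).
    by rewrite lebesgue_measure_itv/=; case: ifP; rewrite ?ltry// -EFinB ltry.
  move=> x /andP[ax xc']; rewrite simple_fun_cons/= indicE.
  have [xc|cx] := leP x c.
    rewrite memNset/= ?scale0r ?add0r; first by apply: l2; rewrite ax.
    by rewrite in_itv/= ltNge xc.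
  rewrite mem_set/= ?in_itv/= ?cx// scale1r (simple_fun_out l1); last first.
    by rewrite /= in_itv/= ax/= leNgt cx.
  by rewrite addr0; apply: h; rewrite cx.
pose S := [set c | a <= c <= b /\ P c].
have Sa : S a by split => //; rewrite lexx.
have Sub : ubound S b by move=> c [/andP[]].
have hS : has_sup S by split; [exists a|exists b].
set s := sup S.
have as_ : a <= s by exact: ub_le_sup hS.2 _ Sa.
have sb : s <= b by apply: ge_sup => //; exists a.
have inD x : a <= x -> x <= b -> `]0, t[%classic x.
  by move=> h1 h2; rewrite /= in_itv/=; apply/andP; split; [exact: lt_le_trans h1|exact: le_lt_trans bt].
have /within_continuous_dist c := cf.
have [d d0 dP] := c s (inD s as_ sb) e e0.
have [u [/andP[au ub] Pu] su] := sup_adherent d0 hS.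
have us : u <= s by apply: ub_le_sup hS.2 _ _; split => //; rewrite au.
pose v := Num.min (s + d / 2) b.
have sv : s <= v by rewrite le_min sb lerDl divr_ge0// ltW.
have Pv : P v.
  apply: (ext u v s au) => //; first exact: le_trans us sv.
  move=> x /andP[ux]; rewrite le_min => /andP[xs xb].
  apply: ltW; rewrite distrC; apply: dP; first by apply: inD => //; exact: le_trans (ltW ux).
  by rewrite ltr_norml; apply/andP; split; rewrite -/s in su; lra.
have vs : v <= s.
  apply: ub_le_sup hS.2 _ _; split => //; apply/andP; split; first exact: le_trans sv.
  by rewrite ge_min lexx orbT.
suff -> : b = v by exact: Pv.
apply/eqP; rewrite eq_le; apply/andP; split; last by rewrite ge_min lexx orbT.
move: vs; rewrite ge_min => /orP[|bs]; first by lra.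
exact: le_trans bs sv.
Qed.

Hypothesis V_complete : seq_complete V.

(** The k-th simple function is within 1/(k+1) of [f] on an interval that exhausts ]0, t[ and is 0
    elsewhere. The errors tend to 0 pointwise and are dominated by g + 1, so the integrals of the
    simple functions form a Cauchy sequence. *)
Lemma bochner_exists (g : R -> R) :
  measurable_fun (`]0, t[%classic : set (measurableTypeR R)) g ->
  (forall x, 0 < x < t -> `|f x| <= g x) ->
  (\int[leb]_(x in `]0%R, t[) (g x)%:E < +oo)%E ->
  exists w, bochner_integral leb `]0, t[%classic f w.
Proof.
move=> mg fg gfin.
pose D : set (measurableTypeR R) := `]0, t[%classic.
have mD : measurable D by exact: measurable_itv.
have Dfin : (leb D < +oo)%E by rewrite lebesgue_measure_itv/=; case: ifP; rewrite ?ltry// -EFinB ltry.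
have g0 x : D x -> 0 <= g x by rewrite /D/= in_itv/= => /fg; exact: le_trans.
pose del k : R := t / k.+3%:R.
have del0 k : 0 < del k by rewrite divr_gt0.
have ab k : del k <= t - del k.
  have : del k <= t / 2 by rewrite /del ler_pM2l// lef_pV2 ?posrE// ler_nat.
  by move: (del k) => q; lra.
have bt k : t - del k < t by rewrite ltrBlDr ltrDl.
have ek k : 0 < (k.+1%:R : R)^-1 by rewrite invr_gt0.
have /choice[l lP] : forall k, exists l : seq (set (measurableTypeR R) * V),
    integrable_simple leb `]del k, t - del k]%classic l /\
    forall x, del k < x <= t - del k -> `|f x - simple_fun l x| <= k.+1%:R^-1.
  by move=> k; exact: simple_approximation.
have lD k : integrable_simple leb D (l k).
  have [h _] := lP k; apply: integrable_simpleW h => x; rewrite /D/= !in_itv/= => /andP[h1 h2].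
  by rewrite (lt_trans (del0 k) h1) (le_lt_trans h2 (bt k)).
have mf : norm_measurable D f by exact: norm_measurable_continuous.
have ptw x : D x -> (fun k => simple_fun (l k) x) @ \oo --> f x.
  rewrite /D/= in_itv/= => /andP[x0 xt]; apply/cvgrPdist_lt => e e0.
  have d0 : 0 < Num.min (Num.min x (t - x)) e.
    by rewrite !lt_min x0 subr_gt0 xt e0.
  have [n hn] := ltr_add_invr (divr_gt0 d0 (ltr_wpDl (ltW t0) ltr01)).
  exists n => // k /= nk; have [_ h] := lP k.
  move: hn; rewrite add0r ltr_pdivlMr ?ltr_wpDl ?(ltW t0)// !lt_min => /andP[/andP[h1 h2] h3].
  have kn : (k.+3%:R : R)^-1 <= n.+1%:R^-1.
    by rewrite lef_pV2 ?posrE// ler_nat !ltnS (leq_trans nk)// -addn2 leq_addr.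
  have kn1 : (k.+1%:R : R)^-1 <= n.+1%:R^-1 by rewrite lef_pV2 ?posrE// ler_nat.
  have i0 : 0 < (n.+1%:R : R)^-1 by rewrite invr_gt0.
  have dk : del k <= n.+1%:R^-1 * t by rewrite /del mulrC ler_pM2r.
  have t1 : n.+1%:R^-1 * (t + 1) = n.+1%:R^-1 * t + n.+1%:R^-1 by rewrite mulrDr mulr1.
  have t2 : 0 <= (n.+1%:R : R)^-1 * t by rewrite mulr_ge0// ltW.
  rewrite t1 in h1 h2 h3.
  apply: le_lt_trans (h x _) _; last first.
    by apply: le_lt_trans kn1 (le_lt_trans _ h3); rewrite lerDr.
  have i1 : n.+1%:R^-1 * t <= n.+1%:R^-1 * t + n.+1%:R^-1 by rewrite lerDl ltW.
  apply/andP; split; first exact: le_lt_trans dk (le_lt_trans i1 h1).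
  rewrite lerBrDr -lerBrDl; exact: le_trans dk (le_trans i1 (ltW h2)).
pose F k x := `|f x - simple_fun (l k) x|%:E.
have mF k : measurable_fun D (F k).
  by apply/measurable_EFinP; exact: measurable_norm_sub_simple (lD k).
have F0 : (fun k => \int[leb]_(x in D) F k x)%E @ \oo --> 0%E.
  have := @dominated_cvg _ _ _ leb D mD F (cst 0%E) (fun x => (g x)%:E + 1)%E mF.
  rewrite integral0; apply.
  - by move=> x Dx; apply: cvg_EFin; [exact: nearW|rewrite -(normr0 V) -(subrr (f x)); apply: cvg_norm; apply: cvgB; [exact: cvg_cst|exact: ptw]].
  - by [].
  - apply: integrableD => //; last first.
      apply/integrableP; split => //; under eq_integral do rewrite abse_EFin normr1.
      by rewrite integral_cst// mul1e.
    apply/integrableP; split; first exact/measurable_EFinP.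
    have -> : (\int[leb]_(x in D) `|(EFin \o g) x| = \int[leb]_(x in D) (g x)%:E)%E.
      by apply: eq_integral => x; rewrite inE => Dx; rewrite gee0_abs// lee_fin g0.
    exact: gfin.
  - move=> k x Dx; change ((`| `|f x - simple_fun (l k) x| |)%:E <= (g x + 1)%:E)%E.
    rewrite lee_fin normr_id.
    have [h1 h2] := lP k.
    have [xk|xk] := boolP (del k < x <= t - del k).
      apply: le_trans (h2 x xk) _; rewrite -[leLHS]add0r lerD ?g0//.
      by rewrite invf_le1// ler1n.
    rewrite (simple_fun_out h1) ?subr0; last by rewrite /= in_itv/=; exact/negP.
    by rewrite -[leLHS]addr0 lerD// fg//; move: Dx; rewrite /D/= in_itv.
have Fdist k j : (`|simple_integral leb (l k) - simple_integral leb (l j)|%:E <=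
    \int[leb]_(x in D) F k x + \int[leb]_(x in D) F j x)%E.
  have LND (u v : V) : - (u + v) = - u + - v by rewrite opprD.
  have LNZ (a : R) (u : V) : - (a *: u) = a *: - u by rewrite scalerN.
  pose q := l k ++ simple_map (fun v : V => - v) (l j).
  have hq : integrable_simple leb D q.
    by apply: integrable_simple_cat => //; exact: integrable_simple_map.
  have -> : simple_integral leb (l k) - simple_integral leb (l j) = simple_integral leb q.
    by rewrite simple_integral_cat (simple_integral_map _ LND LNZ).
  apply: le_trans (simple_integral_norm mD Dfin hq) _.
  rewrite -ge0_integralD//; [|first [exact: mF|by move=> x _; rewrite /F lee_fin]..].
  apply: ge0_le_integral_nm => x Dx //; rewrite /F -EFinD lee_fin.
  rewrite simple_fun_cat (simple_fun_map LND LNZ) [X in _ <= X + _]distrC.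
  by rewrite -(subrKA (f x)); exact: ler_normD.
have [e e0|w wP] := V_complete (u := fun k => simple_integral leb (l k)).
  have e20 : 0 < e / 2 by rewrite divr_gt0.
  have Ffin : \forall k \near \oo, (\int[leb]_(x in D) F k x < (e / 2)%:E)%E.
    move: F0 => /fine_cvgP[F1 /cvgrPdist_lt/(_ _ e20) F2].
    apply: filterS2 F1 F2 => i h1; rewrite sub0r normrN /= => h2.
    by rewrite -(fineK h1) lte_fin; exact: le_lt_trans (ler_norm _) h2.
  case: Ffin => N _ NP; exists N => i j Ni Nj.
  by rewrite -lte_fin (le_lt_trans (Fdist i j))// [e]splitr EFinD lteD// NP.
exists w; exists l; split => //.
exact: aeW.
Qed.

End bochner_existence.

Section bochner_congruence.
Context dsp (T : measurableType dsp) (R : realType) (V : normedModType R).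
Variable nu : {measure set T -> \bar R}.

Lemma eq_bochner (D : set T) (f g : T -> V) w : (forall x, D x -> f x = g x) ->
  bochner_integral nu D f w -> bochner_integral nu D g w.
Proof.
move=> fg [l [l1 l2 l3 l4]]; exists l; split => //.
  by apply: filterS l2 => x h Dx; rewrite -fg//; exact: h.
rewrite (_ : (fun k => _) = fun k => (\int[nu]_(x in D) `|f x - simple_fun (l k) x|%:E)%E)//.
by apply/funext => k; apply: eq_integral => x; rewrite inE => Dx; rewrite fg.
Qed.

Lemma bochner_set0 (f : T -> V) : bochner_integral nu set0 f 0.
Proof.
exists (fun=> [::]); split => //.
- exact: aeW.
- by under eq_fun do rewrite integral_set0; exact: cvg_cst.
- by rewrite /simple_integral big_nil; exact: cvg_cst.
Qed.

End bochner_congruence.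

(** * The fixed point problem in an abstract pair of spaces *)

Section mild_fixed_point.
Variables (R : realType) (H W : normedModType R).
Notation leb := (@lebesgue_measure R).
Variables (T : R) (D : R -> set H) (A : R -> H -> H) (U : R -> R -> H -> H).
Hypotheses (evo : evolution_family T D A U).
Variables (iota : W -> H) (c0 : R).
Hypotheses (iotaD : forall u v, iota (u + v) = iota u + iota v)
  (iotaZ : forall (b : R) u, iota (b *: u) = b *: iota u) (c0_gt0 : 0 < c0)
  (iota_le : forall u, `|iota u| <= c0 * `|u|) (iota_inj : injective iota).
(** [V] is [U] with values in the smaller space [W]; from here on [a] is the smoothing exponent,
    which is [a_exp] in the application. *)
Variables (a M : R) (V : R -> R -> H -> W).
Hypotheses (a0 : 0 < a) (a1 : a < 1) (M0 : 0 < M).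
Hypotheses (V_iota : forall t tau f, 0 <= tau -> tau < t -> t <= T -> iota (V t tau f) = U t tau f)
  (V_le : forall t tau f, 0 <= tau -> tau < t -> t <= T ->
     `|V t tau f| <= M * (t - tau) `^ (- a) * `|f|)
  (V_cont : forall t tau f (e : R), 0 <= tau -> tau < t -> t <= T -> 0 < e ->
     exists2 d, 0 < d & forall t', tau < t' -> t' <= T -> `|t - t'| < d ->
       `|V t tau f - V t' tau f| < e).
Hypothesis W_complete : seq_complete W.

Let iotaB u v : iota (u - v) = iota u - iota v.
Proof. by rewrite iotaD -(scaleN1r v) iotaZ scaleN1r. Qed.

(** [V] is specified only through [iota]; its algebra is inherited from [U] by injectivity. *)
Let VD t tau f g : 0 <= tau -> tau < t -> t <= T -> V t tau (f + g) = V t tau f + V t tau g.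
Proof.
move=> h1 h2 h3; apply: iota_inj; rewrite iotaD !V_iota//.
by have := evo_linear evo h1 (ltW h2) h3 1 f g; rewrite !scale1r.
Qed.

Let VZ t tau (b : R) f : 0 <= tau -> tau < t -> t <= T -> V t tau (b *: f) = b *: V t tau f.
Proof.
move=> h1 h2 h3; apply: iota_inj; rewrite iotaZ !V_iota//.
have U0 : U t tau 0 = 0.
  have := evo_linear evo h1 (ltW h2) h3 (-1) 0 0.
  by rewrite scaler0 addr0 scaleN1r addNr.
by have := evo_linear evo h1 (ltW h2) h3 b f 0; rewrite !addr0 U0 addr0.
Qed.

Let VB t tau f g : 0 <= tau -> tau < t -> t <= T -> V t tau (f - g) = V t tau f - V t tau g.
Proof. by move=> h1 h2 h3; rewrite VD// -(scaleN1r g) VZ// scaleN1r. Qed.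

Let V_comp t sigma tau f : 0 <= tau -> tau <= sigma -> sigma < t -> t <= T ->
  V t sigma (U sigma tau f) = V t tau f.
Proof.
move=> h1 h2 h3 h4; apply: iota_inj.
rewrite !V_iota// ?(le_lt_trans h2)// ?(le_trans h1)//.
by apply: (evo_comp evo) => //; exact: ltW.
Qed.

(** Near a time x < t the operator factors through an intermediate time sg: from sg to t it is one
    fixed bounded operator into [W], and before sg strong continuity of [U] in [H] is enough. *)
Lemma smoothed_continuous (h : R -> H) t : 0 < t -> t <= T ->
  {within `]0, t[, continuous h} -> {within `]0, t[, continuous (fun tau => V t tau (h tau))}.
Proof.
move=> t0 tT /within_continuous_dist ch; apply/within_continuous_dist => x.
rewrite /= in_itv/= => /andP[x0 xt] e e0.
pose sg := (x + t) / 2; have [xs st] : x < sg /\ sg < t by split; rewrite /sg; lra.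
have sg0 : 0 < sg by exact: lt_trans xs.
pose q := M * (t - sg) `^ (- a); have q0 : 0 < q by rewrite mulr_gt0// powR_gt0// subr_gt0.
have e2 : 0 < e / q / 2 by rewrite !divr_gt0.
have xD : `]0, t[%classic x by rewrite /= in_itv/= x0.
have [d1 d10 h1] := ch x xD _ e2.
have /within_continuous_dist cU := @evo_strongly_continuous _ _ _ _ _ _ evo (h x).
have [|d2 d20 h2] := cU (sg, x) _ _ e2.
  by split; [exact: ltW|split; [exact: ltW|rewrite (le_trans (ltW st))]].
exists (Num.min (Num.min d1 d2) (sg - x)); first by rewrite !lt_min d10 d20 subr_gt0.
move=> y; rewrite /= in_itv/= => /andP[y0 yt]; rewrite !lt_min => /andP[/andP[k1 k2] k3].
have ys : y < sg by move: k3; rewrite ltr_norml => /andP[]; lra.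
have yD : `]0, t[%classic y by rewrite /= in_itv/= y0.
rewrite -(V_comp (h x) (ltW x0) (ltW xs) st tT) -(V_comp (h y) (ltW y0) (ltW ys) st tT).
rewrite -VB ?(ltW sg0)//; apply: le_lt_trans (V_le _ (ltW sg0) st tT) _.
rewrite -/q mulrC -ltr_pdivlMr//.
have -> : U sg x (h x) - U sg y (h y) = (U sg x (h x) - U sg y (h x)) + U sg y (h x - h y).
  by rewrite (evo_sub evo _ _ (ltW y0) (ltW ys)) ?(le_trans (ltW st))// addrA subrK.
apply: le_lt_trans (ler_normD _ _) _; rewrite [ltRHS]splitr; apply: ltrD.
  apply: (h2 (sg, y)) => /=.
    by split; [exact: ltW|split; [exact: ltW|rewrite (le_trans (ltW st))]].
  by rewrite prod_normE/= subrr normr0 max_r.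
apply: le_lt_trans (evo_contraction evo _ (ltW y0) (ltW ys) (le_trans (ltW st) tT)) _.
exact: h1.
Qed.

Variables (J : W -> H) (rho : R).
Hypotheses (J0 : J 0 = 0) (rho0 : 0 < rho) (rhoa : rho < a).
Variables (Tb kappa Lam : R).
Hypotheses (Tb0 : 0 < Tb) (TbT : Tb <= T) (kappa0 : 0 < kappa) (Lam0 : 0 <= Lam).
Hypothesis J_weighted : forall tau u v, 0 < tau -> tau <= Tb ->
  `|u| <= 2 * kappa * tau `^ (- rho) -> `|v| <= 2 * kappa * tau `^ (- rho) ->
  `|J u - J v| <= Lam * tau `^ (a - 1) * `|u - v|.
(** Makes the integral operator a contraction of factor 1/4 in the weighted norm. *)
Hypothesis Lam_small : M * Lam * beta_cst a (a - rho) <= 4^-1.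

Definition admissible_path (v : R -> W) := {within `]0, Tb], continuous v} /\
  forall t, 0 < t -> t <= Tb -> `|v t| <= 2 * kappa * t `^ (- rho).

Lemma J_path_continuous v : admissible_path v -> {within `]0, Tb], continuous (J \o v)}.
Proof.
move=> [/within_continuous_dist cv bv]; apply/within_continuous_dist => x xD e e0.
have := xD; rewrite /= in_itv/= => /andP[x0 xTb].
pose d0 := x / 2; have d00 : 0 < d0 by rewrite divr_gt0.
(* the bound on the ball of radius [2 kappa (x/2)^-rho] applies at time [x/2] *)
have hb y : d0 <= y -> y <= Tb -> `|v y| <= 2 * kappa * d0 `^ (- rho).
  move=> h1 h2; have y0 := lt_le_trans d00 h1.
  apply: le_trans (bv y y0 h2) _; rewrite ler_pM2l ?mulr_gt0//.
  rewrite !powRN lef_pV2 ?posrE ?powR_gt0//.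
  by rewrite ge0_ler_powR ?nnegrE ?(ltW rho0) ?(ltW d00) ?(ltW y0).
pose q := Lam * d0 `^ (a - 1) + 1.
have q0 : 0 < q by rewrite ltr_wpDl// mulr_ge0// powR_ge0.
have [d1 d10 h1] := cv x xD (e / q) (divr_gt0 e0 q0).
exists (Num.min d1 d0); first by rewrite lt_min d10.
move=> y; rewrite /= in_itv/= lt_min => /andP[y0 yTb] /andP[k1 k2].
have dy : d0 <= y by move: k2; rewrite ltr_norml /d0 => /andP[]; lra.
have dx : d0 <= x by rewrite /d0; lra.
have dTb : d0 <= Tb by exact: le_trans xTb.
apply: le_lt_trans (J_weighted d00 dTb (hb x dx xTb) (hb y dy yTb)) _.
apply: (@le_lt_trans _ _ (q * `|v x - v y|)); first by rewrite ler_wpM2r// lerDl.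
by rewrite mulrC -ltr_pdivlMr//; apply: h1 => //; rewrite /= in_itv/= y0.
Qed.

Lemma integrand_continuous v t : admissible_path v -> 0 < t -> t <= Tb ->
  {within `]0, t[, continuous (fun tau => V t tau (J (v tau)))}.
Proof.
move=> av t0 tTb; apply: smoothed_continuous => //; first exact: le_trans TbT.
apply: continuous_subspaceW (J_path_continuous av) => x; rewrite /= !in_itv/= => /andP[-> xt].
by rewrite (le_trans (ltW xt)).
Qed.

(** The factor tau^(a-1) of the Lipschitz constant and tau^(-rho) of the weight combine into
    tau^(ga-1) with ga = a - rho > 0, integrable at 0. *)
Lemma J_path_le v1 v2 q tau : admissible_path v1 -> admissible_path v2 -> 0 <= q ->
  0 < tau -> tau <= Tb -> tau `^ rho * `|v1 tau - v2 tau| <= q ->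
  `|J (v1 tau) - J (v2 tau)| <= Lam * q * tau `^ (a - rho - 1).
Proof.
move=> [_ b1] [_ b2] q0 t0 tTb h.
apply: le_trans (J_weighted t0 tTb (b1 _ t0 tTb) (b2 _ t0 tTb)) _.
have -> : tau `^ (a - rho - 1) = tau `^ (a - 1) * tau `^ (- rho).
  by rewrite -powRD ?(gt_eqF t0) ?implybT//; congr (_ `^ _); ring.
rewrite (_ : Lam * q * _ = Lam * tau `^ (a - 1) * (tau `^ (- rho) * q)); last by ring.
apply: ler_wpM2l; first by rewrite mulr_ge0// powR_ge0.
by rewrite powRN mulrC ler_pdivlMr ?powR_gt0// mulrC.
Qed.

Lemma zero_path_admissible : admissible_path (fun=> 0).
Proof.
split; first by apply: continuous_subspaceT => x; exact: cvg_cst.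
by move=> t t0 tTb; rewrite normr0 mulr_ge0 ?powR_ge0// mulr_ge0// ltW.
Qed.

Lemma J_path_bound v tau : admissible_path v -> 0 < tau -> tau <= Tb ->
  `|J (v tau)| <= Lam * (2 * kappa) * tau `^ (a - rho - 1).
Proof.
move=> av t0 tTb; have := @J_path_le v (fun=> 0) (2 * kappa) tau av zero_path_admissible.
rewrite J0 !subr0; apply => //; first by rewrite mulr_ge0// ltW.
by have := av.2 _ t0 tTb; rewrite powRN ler_pdivlMr ?powR_gt0// mulrC.
Qed.

Let beta_kernel (t tau : R) : R := (t - tau) `^ (- a) * tau `^ (a - rho - 1).
Let kernel (q t tau : R) : R := M * Lam * q * beta_kernel t tau.

Let measurable_beta_kernel t (S : set (measurableTypeR R)) : measurable_fun S (beta_kernel t).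
Proof.
apply: (measurable_funS measurableT) => //; apply: measurable_funM.
  apply: (measurableT_comp (measurable_powR _)); exact: measurable_funB.
exact: measurable_powR.
Qed.

Let kernel_ge0 q t tau : 0 <= q -> 0 <= kernel q t tau.
Proof. by move=> q0; rewrite /kernel !mulr_ge0 ?powR_ge0// ltW. Qed.

Let measurable_kernel q t (S : set (measurableTypeR R)) : measurable_fun S (kernel q t).
Proof.
by apply: measurable_funM => //; exact: measurable_beta_kernel.
Qed.

(** The powers match: ga - a = -rho is again the power of the weight, so no smallness of t is needed
    here. *)
Let kernel_integral q t : 0 <= q -> 0 < t ->
  (\int[leb]_(tau in `]0%R, t[) (kernel q t tau)%:E <= (4^-1 * q * t `^ (- rho))%:E)%E.
Proof.
move=> q0 t0.
have -> : (\int[leb]_(tau in `]0%R, t[) (kernel q t tau)%:E =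
    \int[leb]_(tau in `]0%R, t[) ((M * Lam * q)%:E * (beta_kernel t tau)%:E))%E.
  by apply: eq_integral => tau _; rewrite EFinM.
rewrite ge0_integralZl_EFin//; last 3 first.
- by move=> tau _; rewrite lee_fin mulr_ge0// powR_ge0.
- apply/measurable_EFinP; exact: measurable_beta_kernel.
- by rewrite !mulr_ge0// ltW.
have ar0 : 0 < a - rho by rewrite subr_gt0.
have ar1 : a - rho <= 1 by rewrite lerBlDr ltW// (lt_le_trans a1)// lerDl ltW.
apply: (@le_trans _ _ ((M * Lam * q)%:E * (beta_cst a (a - rho) * t `^ (a - rho - a))%:E)%E).
  apply: lee_wpmul2l; first by rewrite lee_fin !mulr_ge0// ltW.
  exact: (integral_beta_le (ltW a0) a1 ar0 ar1 t0).
rewrite -EFinM lee_fin (_ : a - rho - a = - rho); last by ring.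
rewrite (_ : M * Lam * q * _ = M * Lam * beta_cst a (a - rho) * (q * t `^ (- rho))); last by ring.
by rewrite -[leRHS]mulrA ler_wpM2r// mulr_ge0// powR_ge0.
Qed.

Lemma path_contraction v1 v2 q t w1 w2 : admissible_path v1 -> admissible_path v2 -> 0 <= q ->
  (forall s, 0 < s -> s <= Tb -> s `^ rho * `|v1 s - v2 s| <= q) -> 0 < t -> t <= Tb ->
  bochner_integral leb `]0, t[%classic (fun tau => V t tau (J (v1 tau))) w1 ->
  bochner_integral leb `]0, t[%classic (fun tau => V t tau (J (v2 tau))) w2 ->
  t `^ rho * `|w1 - w2| <= q / 4.
Proof.
move=> av1 av2 q0 hq t0 tTb B1 B2.
have tT := le_trans tTb TbT.
pose Dt : set (measurableTypeR R) := `]0, t[%classic.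
have mD : measurable Dt by exact: measurable_itv.
have Dfin : (leb Dt < +oo)%E by rewrite lebesgue_measure_itv/=; case: ifP; rewrite ?ltry// -EFinB ltry.
have m1 : norm_measurable (T := measurableTypeR R) Dt (fun tau => V t tau (J (v1 tau))).
  by apply: norm_measurable_continuous => //; exact: integrand_continuous.
have m2 : norm_measurable (T := measurableTypeR R) Dt (fun tau => V t tau (J (v2 tau))).
  by apply: norm_measurable_continuous => //; exact: integrand_continuous.
have K : (`|w1 - w2|%:E <= \int[leb]_(tau in Dt) (kernel q t tau)%:E)%E.
  apply: (@bochner_sub_le _ _ _ leb W W idfun 1 Dt Dt _ _ _ _ _ _ _ ltr01 _ mD mD _ Dfin m1 m2 _ _ _ _ B1 B2) => //.
  - by move=> u; rewrite mul1r.
  - by apply/measurable_EFinP; exact: measurable_kernel.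
  - by move=> x _; rewrite lee_fin kernel_ge0.
  - move=> x; rewrite /Dt/= in_itv/= => /andP[x0 xt]; rewrite lee_fin.
    have xTb := le_trans (ltW xt) tTb.
    rewrite -VB ?(ltW x0)//; apply: le_trans (V_le _ (ltW x0) xt tT) _.
    apply: (@le_trans _ _ (M * (t - x) `^ (- a) * (Lam * q * x `^ (a - rho - 1)))).
      apply: ler_wpM2l; first by rewrite mulr_ge0 ?powR_ge0// ltW.
      by apply: J_path_le => //; exact: hq.
    rewrite /kernel /beta_kernel; have E (z1 z2 : R) : M * z1 * (Lam * q * z2) = M * Lam * q * (z1 * z2) by ring.
    by rewrite E.
have := le_trans K (kernel_integral q0 t0).
rewrite lee_fin powRN mulrC ler_pdivlMl ?powR_gt0//. 
by rewrite mulrC (mulrC _ q).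
Qed.

(** The value is picked by choice, with default 0; it is meaningful where [path_integralP] provides
    existence. *)
Definition path_integral (v : R -> W) (t : R) : W :=
  xget 0 [set w | bochner_integral leb `]0, t[%classic (fun tau => V t tau (J (v tau))) w].

Lemma path_integralP v t : admissible_path v -> 0 < t -> t <= Tb ->
  bochner_integral leb `]0, t[%classic (fun tau => V t tau (J (v tau))) (path_integral v t).
Proof.
move=> av t0 tTb; apply: (@xgetPex _ 0 [set w | bochner_integral leb _ _ w]).
have tT := le_trans tTb TbT.
apply: (bochner_exists t0 (integrand_continuous av t0 tTb) W_complete (g := kernel (2 * kappa) t)).
- exact: measurable_kernel.
- move=> x /andP[x0 xt].
  apply: le_trans (V_le _ (ltW x0) xt tT) _.
  apply: (@le_trans _ _ (M * (t - x) `^ (- a) * (Lam * (2 * kappa) * x `^ (a - rho - 1)))).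
    apply: ler_wpM2l; first by rewrite mulr_ge0 ?powR_ge0// ltW.
    by apply: J_path_bound => //; exact: le_trans (ltW xt) tTb.
  rewrite /kernel /beta_kernel; have E (z1 z2 q : R) : M * z1 * (Lam * q * z2) = M * Lam * q * (z1 * z2) by ring.
  by rewrite E.
- have k20 : 0 <= 2 * kappa by rewrite mulr_ge0// ltW.
  by apply: le_lt_trans (kernel_integral k20 t0) _; rewrite ltry.
Qed.

Lemma path_integral_dist v1 v2 q t : admissible_path v1 -> admissible_path v2 -> 0 <= q ->
  (forall s, 0 < s -> s <= Tb -> s `^ rho * `|v1 s - v2 s| <= q) -> 0 < t -> t <= Tb ->
  t `^ rho * `|path_integral v1 t - path_integral v2 t| <= q / 4.
Proof.
move=> av1 av2 q0 hq t0 tTb.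
by apply: (path_contraction av1 av2 q0 hq t0 tTb); exact: path_integralP.
Qed.

(** Since J 0 = 0, this compares with the zero path, at weighted distance 2 kappa; a quarter of that
    is kappa/2. *)
Lemma path_integral_le v t : admissible_path v -> 0 < t -> t <= Tb ->
  t `^ rho * `|path_integral v t| <= kappa / 2.
Proof.
move=> av t0 tTb; have tT := le_trans tTb TbT.
have k20 : 0 <= 2 * kappa by rewrite mulr_ge0// ltW.
pose Dt : set (measurableTypeR R) := `]0, t[%classic.
have mD : measurable Dt by exact: measurable_itv.
have Dfin : (leb Dt < +oo)%E by rewrite lebesgue_measure_itv/=; case: ifP; rewrite ?ltry// -EFinB ltry.
have m1 : norm_measurable (T := measurableTypeR R) Dt (fun tau => V t tau (J (v tau))).
  by apply: norm_measurable_continuous => //; exact: integrand_continuous.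
have mk : measurable_fun Dt (fun tau => (kernel (2 * kappa) t tau)%:E).
  by apply/measurable_EFinP; exact: measurable_kernel.
have K := bochner_norm_le mD Dfin m1 mk _ (path_integralP av t0 tTb).
have : (`|path_integral v t|%:E <= (4^-1 * (2 * kappa) * t `^ (- rho))%:E)%E.
  apply: le_trans (kernel_integral k20 t0); apply: K => x.
  rewrite /Dt/= in_itv/= => /andP[x0 xt]; rewrite lee_fin.
  apply: le_trans (V_le _ (ltW x0) xt tT) _.
  apply: (@le_trans _ _ (M * (t - x) `^ (- a) * (Lam * (2 * kappa) * x `^ (a - rho - 1)))).
    apply: ler_wpM2l; first by rewrite mulr_ge0 ?powR_ge0// ltW.
    by apply: J_path_bound => //; exact: le_trans (ltW xt) tTb.
  rewrite /kernel /beta_kernel; have E (z1 z2 q : R) : M * z1 * (Lam * q * z2) = M * Lam * q * (z1 * z2) by ring.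
  by rewrite E.
rewrite lee_fin powRN ler_pdivlMr ?powR_gt0// mulrC => /le_trans; apply.
by rewrite le_eqVlt; apply/orP; left; apply/eqP; field.
Qed.

(** For t near t0 the integral is, up to a small error, the integral up to a fixed time sg just
    before t0 propagated from sg to t, and such an orbit is continuous in t. The error is the
    integral over the last short piece. *)
Lemma path_integral_continuous v : admissible_path v -> {within `]0, Tb], continuous (path_integral v)}.
Proof.
move=> av; apply/within_continuous_dist => t0; rewrite /= in_itv/= => /andP[t00 t0Tb] e e0.
(* Bounds [J] along the path at all times from t0/2 on, as the exponent is negative. *)
pose B := Lam * (2 * kappa) * (t0 / 2) `^ (a - rho - 1).
have B0 : 0 <= B by rewrite mulr_ge0 ?powR_ge0// mulr_ge0// mulr_ge0// ltW.
pose Q := M * B / (1 - a).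
have a10 : 0 < 1 - a by rewrite subr_gt0.
have Q0 : 0 <= Q by rewrite divr_ge0 ?(ltW a10)// mulr_ge0// ltW.
have [et et0 etQ] : exists2 et, 0 < et & Q * (3 * et) `^ (1 - a) <= e / 4.
  exists ((e / 4 / (Q + 1)) `^ (1 - a)^-1 / 3).
    by rewrite divr_gt0// powR_gt0// !divr_gt0// ltr_wpDl.
  rewrite (_ : 3 * (_ / 3) = (e / 4 / (Q + 1)) `^ (1 - a)^-1); last by field.
  have z0 : 0 <= e / 4 / (Q + 1) by rewrite !divr_ge0 ?(ltW e0)// addr_ge0.
  rewrite -powRrM mulVf ?gt_eqF// powRr1// mulrCA ler_piMr ?divr_ge0 ?(ltW e0)//.
  by rewrite ler_pdivrMr ?mul1r ?lerDl// ltr_wpDl.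
pose eta := Num.min et (t0 / 4).
have [eta0 eta_et eta_t] : [/\ 0 < eta, eta <= et & eta <= t0 / 4].
  by split; rewrite /eta ?ge_min ?lexx ?orbT// lt_min et0 divr_gt0.
(* The open interval from sg' to t contains the closed end point sg of the last piece; its length is
   less than 3 eta when t < t0 + eta. *)
pose sg := t0 - eta; pose sg' := sg - eta.
have [sg'0 sg'sg sgt0] : [/\ t0 / 2 <= sg', sg' < sg & sg < t0].
  by rewrite /sg' /sg; split; move: eta eta0 eta_t {eta_et sg sg'} => x; lra.
have t02 : 0 < t0 / 2 by rewrite divr_gt0.
have sg0 : 0 < sg by exact: lt_trans (lt_le_trans t02 sg'0) sg'sg.
have sgTb : sg <= Tb by exact: le_trans (ltW sgt0) t0Tb.
have sgT := le_trans sgTb TbT.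
pose x0 := iota (path_integral v sg).
have near t : sg < t -> t <= Tb -> t < t0 + eta -> `|path_integral v t - V t sg x0| <= e / 4.
  move=> sgt tTb tt0; have tpos := lt_trans sg0 sgt; have tT := le_trans tTb TbT.
  pose Dt : set (measurableTypeR R) := `]0, t[%classic.
  pose Ds : set (measurableTypeR R) := `]0, sg[%classic.
  have mD : measurable Dt by exact: measurable_itv.
  have mDs : measurable Ds by exact: measurable_itv.
  have Dfin : (leb Dt < +oo)%E by rewrite lebesgue_measure_itv/=; case: ifP; rewrite ?ltry// -EFinB ltry.
  have m1 : norm_measurable (T := measurableTypeR R) Dt (fun tau => V t tau (J (v tau))).
    by apply: norm_measurable_continuous => //; exact: integrand_continuous.
  have m2 : norm_measurable (T := measurableTypeR R) Ds (fun tau => V sg tau (J (v tau))).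
    by apply: norm_measurable_continuous => //; exact: integrand_continuous.
  pose S : set (measurableTypeR R) := `]sg', t[%classic.
  have mS : measurable S by exact: measurable_itv.
  pose h x := M * B * (t - x) `^ (- a).
  have h0 x : 0 <= h x by rewrite /h mulr_ge0 ?powR_ge0// mulr_ge0// ltW.
  have mh (E : set (measurableTypeR R)) : measurable_fun E h.
    apply: (measurable_funS measurableT) => //; apply: measurable_funM => //.
    apply: (measurableT_comp (measurable_powR _)); exact: measurable_funB.
  pose g := ((EFin \o h) \_ S)%E.
  have mg : measurable_fun Dt g.
    apply: (measurable_funS measurableT) => //; apply: (measurable_restrictT _ mS).1.
    exact/measurable_EFinP.
  have g0 x : (0 <= g x)%E by rewrite /g patchE; case: ifP => // _; rewrite lee_fin.
  have cL : 0 < M * (t - sg) `^ (- a) * c0 by rewrite !mulr_gt0// powR_gt0// subr_gt0.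
  have K : (`|path_integral v t - V t sg (iota (path_integral v sg))|%:E <= \int[leb]_(tau in Dt) g tau)%E.
    apply: (@bochner_sub_le _ _ _ leb W W (fun u => V t sg (iota u)) (M * (t - sg) `^ (- a) * c0) Dt Ds
      _ _ _ _ _ _ _ cL _ mD mDs _ Dfin m1 m2 mg _ _ _ (path_integralP av tpos tTb) (path_integralP av sg0 sgTb)) => //.
    - by move=> u u'; rewrite iotaD VD// ltW.
    - by move=> b u; rewrite iotaZ VZ// ltW.
    - move=> u; apply: le_trans (V_le _ (ltW sg0) sgt tT) _.
      by rewrite -[leRHS]mulrA ler_wpM2l// mulr_ge0 ?powR_ge0// ltW.
    - move=> x; rewrite /Ds /Dt /= !in_itv/= => /andP[-> xs]; exact: lt_trans xs sgt.
    - move=> x; rewrite /Ds/= in_itv/= => /andP[xpos xs].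
      rewrite V_iota ?(ltW xpos)// V_comp ?(ltW xpos) ?(ltW xs)//.
      by rewrite subrr normr0.
    - move=> x; rewrite /Dt /Ds /= !in_itv/= => /andP[xpos xt].
      rewrite xpos /= => /negP; rewrite -leNgt => sx.
      rewrite /g patchE mem_set; last by rewrite /S /= in_itv/= xt andbT (lt_le_trans sg'sg sx).
      rewrite lee_fin; apply: le_trans (V_le _ (ltW xpos) xt tT) _.
      rewrite /h [leRHS]mulrAC; apply: ler_wpM2l; first by rewrite mulr_ge0 ?powR_ge0// ltW.
      apply: le_trans (J_path_bound av xpos (le_trans (ltW xt) tTb)) _.
      rewrite /B; apply: ler_wpM2l; first by rewrite !mulr_ge0// ltW.
      have t0x : t0 / 2 <= x by apply: le_trans sg'0 (ltW (lt_le_trans sg'sg sx)).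
      have E : a - rho - 1 = - (1 + rho - a) by ring.
      have ex : 0 <= 1 + rho - a by rewrite subr_ge0 ltW// (lt_le_trans a1)// lerDl ltW.
      rewrite E !powRN lef_pV2 ?posrE ?powR_gt0//.
      by rewrite ge0_ler_powR ?nnegrE ?(ltW t02) ?(ltW xpos).
  have st' : sg' < t by exact: lt_trans sgt.
  have gI : (\int[leb]_(tau in Dt) g tau <= (Q * (t - sg') `^ (1 - a))%:E)%E.
    have -> : (\int[leb]_(tau in Dt) g tau = \int[leb]_(tau in S) (h tau)%:E)%E.
      rewrite /g -integral_mkcondr; congr (integral _ _ _); apply/seteqP; split => x [] //=.
      rewrite /Dt /S /= !in_itv/= => /andP[sx xt]; split; rewrite ?in_itv/= ?sx ?xt//.
      by rewrite andbT (lt_trans (lt_le_trans t02 sg'0)).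
    rewrite (_ : (\int[leb]_(tau in S) (h tau)%:E = \int[leb]_(tau in S) ((M * B)%:E * ((t - tau) `^ (- a))%:E))%E); last first.
      by apply: eq_integral => x _; rewrite EFinM.
    rewrite ge0_integralZl_EFin//; last 3 first.
    - by move=> x _; rewrite lee_fin powR_ge0.
    - apply/measurable_EFinP; apply: (measurable_funS measurableT) => //.
      apply: (measurableT_comp (measurable_powR _)); exact: measurable_funB.
    - by rewrite mulr_ge0// ltW.
    apply: le_trans (lee_wpmul2l _ (integral_powR_sub_le a1 st')) _.
      by rewrite lee_fin mulr_ge0// ltW.
    by rewrite -EFinM lee_fin /Q le_eqVlt; apply/orP; left; apply/eqP; ring.
  have := le_trans K gI; rewrite lee_fin => /le_trans; apply; apply: le_trans etQ.
  apply: ler_wpM2l => //; rewrite ge0_ler_powR ?nnegrE ?(ltW a10)// ?subr_ge0 ?(ltW st')//.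
    by rewrite mulr_ge0// ltW.
  rewrite /sg' /sg; move: tt0 eta_et; move: (eta) => x; lra.
have t0T := le_trans t0Tb TbT.
have [d d0 hd] := V_cont x0 (ltW sg0) sgt0 t0T (divr_gt0 e0 (ltr0n _ 4)).
exists (Num.min d eta); first by rewrite lt_min d0.
move=> t; rewrite /= in_itv/= lt_min => /andP[tpos tTb] /andP[k1 k2].
have [sgt tt0] : sg < t /\ t < t0 + eta.
  by move: k2; rewrite ltr_norml /sg => /andP[]; move: (eta) => x h1 h2; split; lra.
have t0eta : t0 < t0 + eta by rewrite ltrDl.
have N1 := near t0 sgt0 t0Tb t0eta.
have N2 := near t sgt tTb tt0.
have N3 := hd t sgt (le_trans tTb TbT) k1.
have -> : path_integral v t0 - path_integral v t =
    (path_integral v t0 - V t0 sg x0) + ((V t0 sg x0 - V t sg x0) + (V t sg x0 - path_integral v t)).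
  by rewrite !addrA !subrK.
apply: le_lt_trans (ler_normD _ _) _.
apply: le_lt_trans (lerD N1 (ler_normD _ _)) _.
rewrite [`|V t sg x0 - _|]distrC.
move: N2 N3 e0; move: (`|_|) (`|_|) => z1 z2; lra.
Qed.

Section picard.
Variable phi : H.
Variable kappa' : R.
Hypotheses (kappa'_lt : kappa' < kappa)
  (phi_le : forall t, 0 < t -> t <= Tb -> t `^ rho * `|V t 0 phi| <= kappa').

Definition picard_map (v : R -> W) (t : R) : W := V t 0 phi + path_integral v t.

(** kappa' + kappa/2 < 2 kappa, so the iteration stays in the ball with the strict inequality
    demanded of a solution. *)
Lemma picard_map_lt v t : admissible_path v -> 0 < t -> t <= Tb ->
  t `^ rho * `|picard_map v t| < 2 * kappa.
Proof.
move=> av t0 tTb; apply: (@le_lt_trans _ _ (kappa' + kappa / 2)).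
  apply: le_trans (_ : t `^ rho * (`|V t 0 phi| + `|path_integral v t|) <= _).
    by rewrite ler_wpM2l ?powR_ge0// ler_normD.
  by rewrite mulrDr lerD ?phi_le// path_integral_le.
by move: kappa'_lt kappa0; lra.
Qed.

Lemma picard_map_admissible v : admissible_path v -> admissible_path (picard_map v).
Proof.
move=> av; split; last first.
  move=> t t0 tTb; rewrite powRN ler_pdivlMr ?powR_gt0// mulrC ltW//.
  exact: picard_map_lt.
have /within_continuous_dist c1 := path_integral_continuous av.
apply/within_continuous_dist => t tD e e0.
have := tD; rewrite /= in_itv/= => /andP[t0 tTb].
have e20 : 0 < e / 2 by rewrite divr_gt0.
have [d1 d10 h1] := c1 t tD _ e20.
have [d2 d20 h2] := V_cont phi (lexx 0) t0 (le_trans tTb TbT) e20.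
exists (Num.min d1 d2); first by rewrite lt_min d10.
move=> y yD; rewrite lt_min => /andP[k1 k2].
have := yD; rewrite /= in_itv/= => /andP[y0 yTb].
rewrite /picard_map opprD addrACA; apply: le_lt_trans (ler_normD _ _) _.
by rewrite [e]splitr ltrD ?h1 ?h2// (le_trans yTb).
Qed.

Fixpoint picard n : R -> W := if n is k.+1 then picard_map (picard k) else fun=> 0.

Lemma picard_admissible n : admissible_path (picard n).
Proof. by elim: n => [|n IH]; [exact: zero_path_admissible|exact: picard_map_admissible]. Qed.

Lemma picard_step n t : 0 < t -> t <= Tb ->
  t `^ rho * `|picard n.+1 t - picard n t| <= 2 * kappa * 4^-1 ^+ n.
Proof.
elim: n t => [|n IH] t t0 tTb.
  by rewrite subr0 expr0 mulr1 ltW//; exact: picard_map_lt zero_path_admissible t0 tTb.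
rewrite /= /picard_map opprD addrACA subrr add0r.
rewrite exprS mulrA mulrAC; apply: path_integral_dist => //.
- exact: picard_map_admissible (picard_admissible n).
- exact: picard_admissible.
- by rewrite !mulr_ge0 ?exprn_ge0// ltW.
Qed.

(** Stated as a difference so that the induction telescopes; the constant 4 exceeds the value 2/(1 -
    1/4) of the geometric sum. *)
Lemma picard_dist n k t : (n <= k)%N -> 0 < t -> t <= Tb ->
  t `^ rho * `|picard k t - picard n t| <= 4 * kappa * 4^-1 ^+ n - 4 * kappa * 4^-1 ^+ k.
Proof.
move=> nk t0 tTb; elim: k nk => [|k IH].
  by rewrite leqn0 => /eqP ->; rewrite !subrr normr0 mulr0.
rewrite leq_eqVlt => /predU1P[->|]; first by rewrite !subrr normr0 mulr0.
rewrite ltnS => /IH h; rewrite -(subrK (picard k t) (picard k.+1 t)) -addrA.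
have s := picard_step k t0 tTb; have p0 := powR_ge0 t rho.
apply: le_trans (_ : t `^ rho * (`|picard k.+1 t - picard k t| + `|picard k t - picard n t|) <= _).
  by rewrite ler_wpM2l// ler_normD.
rewrite mulrDr exprS; have k4 : 0 <= kappa * 4^-1 ^+ k by rewrite mulr_ge0 ?exprn_ge0// ltW.
move: s h k4; move: (t `^ rho * _) (t `^ rho * _) (4^-1 ^+ k) (4^-1 ^+ n) => z1 z2 z3 z4.
by lra.
Qed.

Let quarter_small (e : R) : 0 < e -> exists n, 4 * kappa * 4^-1 ^+ n < e.
Proof.
move=> e0.
have := @cvg_geometric R (4 * kappa) 4^-1 (ltac:(by rewrite ger0_norm// invf_lt1// ltr1n)).
move=> /cvgrPdist_lt/(_ e e0)[n _ hn]; exists n; have := hn n (leqnn _).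
by rewrite sub0r normrN ger0_norm// !mulr_ge0 ?exprn_ge0// ltW.
Qed.

Lemma picard_limit : exists v : R -> W, forall t, 0 < t -> t <= Tb -> forall n,
  t `^ rho * `|v t - picard n t| <= 4 * kappa * 4^-1 ^+ n.
Proof.
suff /choice[v vP] : forall t, exists w, 0 < t -> t <= Tb -> forall n,
    t `^ rho * `|w - picard n t| <= 4 * kappa * 4^-1 ^+ n by exists v.
move=> t; have [/andP[t0 tTb]|nt] := boolP (0 < t <= Tb); last first.
  by exists 0 => t0 tTb; move: nt; rewrite t0 tTb.
have p0 : 0 < t `^ rho by rewrite powR_gt0.
have q0 n : 0 <= 4 * kappa * 4^-1 ^+ n by rewrite !mulr_ge0 ?exprn_ge0// ltW.
have dist n k : (n <= k)%N -> t `^ rho * `|picard k t - picard n t| <= 4 * kappa * 4^-1 ^+ n.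
  by move=> nk; apply: le_trans (picard_dist nk t0 tTb) _; rewrite gerBl.
have [e e0|w wl] := W_complete (u := fun n => picard n t).
  have [n ne] := quarter_small (mulr_gt0 p0 (divr_gt0 e0 (ltr0n _ 2))).
  exists n => i j ni nj.
  have h1 := le_lt_trans (dist n i ni) ne; have h2 := le_lt_trans (dist n j nj) ne.
  rewrite !ltr_pM2l// in h1 h2.
  rewrite -(subrKA (picard n t)); apply: le_lt_trans (ler_normD _ _) _.
  by rewrite [e]splitr ltrD// distrC.
exists w => _ _ n; rewrite mulrC -ler_pdivlMr//.
have c : (fun k => `|picard k t - picard n t|) @ \oo --> `|w - picard n t|.
  by apply: cvg_norm; apply: cvgB => //; exact: cvg_cst.
rewrite -(cvg_lim (@Rhausdorff R) c); apply: limr_le; first by apply/cvg_ex; exists `|w - picard n t|.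
by exists n => // k /= nk; rewrite ler_pdivlMr// mulrC dist.
Qed.

(** Away from 0 the weight is bounded below, so the iterates converge uniformly on [t/2, Tb] and the
    limit is continuous. The contraction estimate then identifies the limit with its image. *)
Lemma fixed_path_exists : exists v, admissible_path v /\
  forall t, 0 < t -> t <= Tb -> v t = picard_map v t.
Proof.
have [v vP] := picard_limit.
have av : admissible_path v.
  split; last first.
    move=> t t0 tTb; rewrite powRN ler_pdivlMr ?powR_gt0//.
    apply/ler_addgt0Pl => e e0; have [n ne] := quarter_small e0.
    have h := vP t t0 tTb n; have := (picard_admissible n).2 t t0 tTb.
    rewrite powRN ler_pdivlMr ?powR_gt0// mulrC => h2.
    rewrite -(subrK (picard n t) (v t)) mulrC.
    apply: le_trans (_ : t `^ rho * (`|v t - picard n t| + `|picard n t|) <= _).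
      by rewrite ler_wpM2l ?powR_ge0// ler_normD.
    by rewrite mulrDr lerD// (le_trans h (ltW ne)).
  apply/within_continuous_dist => t tD e e0; have := tD; rewrite /= in_itv/= => /andP[t0 tTb].
  pose t2 := t / 2; have t20 : 0 < t2 by rewrite divr_gt0.
  have p0 : 0 < t2 `^ rho by rewrite powR_gt0.
  have [n ne] := quarter_small (mulr_gt0 p0 (divr_gt0 e0 (ltr0n _ 3))).
  have close y : t2 <= y -> y <= Tb -> `|v y - picard n y| < e / 3.
    move=> ty yTb; have y0 := lt_le_trans t20 ty.
    have h := le_lt_trans (vP y y0 yTb n) ne.
    rewrite -(ltr_pM2l p0); apply: le_lt_trans h; rewrite ler_wpM2r//.
    by rewrite ge0_ler_powR ?nnegrE ?(ltW rho0) ?(ltW t20) ?(ltW y0).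
  have /within_continuous_dist cn := (picard_admissible n).1.
  have [d d0 hd] := cn t tD _ (divr_gt0 e0 (ltr0n _ 3)).
  exists (Num.min d t2); first by rewrite lt_min d0.
  move=> y yD; rewrite lt_min => /andP[k1 k2]; have := yD; rewrite /= in_itv/= => /andP[y0 yTb].
  have ty : t2 <= y by move: k2; rewrite ltr_norml /t2 => /andP[]; lra.
  have tt : t2 <= t by rewrite /t2; lra.
  have N1 := close t tt tTb; have N2 := close y ty yTb; have N3 := hd y yD k1.
  have -> : v t - v y = (v t - picard n t) + ((picard n t - picard n y) + (picard n y - v y)).
    by rewrite !addrA !subrK.
  apply: le_lt_trans (ler_normD _ _) _; apply: le_lt_trans (lerD (lexx _) (ler_normD _ _)) _.
  rewrite [`|_ - v y|]distrC; move: N1 N2 N3; move: (`|_|) (`|_|) (`|_|) => z1 z2 z3; lra.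
exists v; split => // t t0 tTb.
have p0 : 0 < t `^ rho by rewrite powR_gt0.
apply/eqP; rewrite -subr_eq0 -normr_le0 -(ler_pM2l p0) mulr0.
apply/ler_addgt0Pl => e e0; rewrite addr0; have [n ne] := quarter_small (divr_gt0 e0 (ltr0n _ 2)).
have q0 : 0 <= 4 * kappa * 4^-1 ^+ n by rewrite !mulr_ge0 ?exprn_ge0// ltW.
have h1 := vP t t0 tTb n.+1.
have h2 : t `^ rho * `|picard n.+1 t - picard_map v t| <= 4 * kappa * 4^-1 ^+ n / 4.
  rewrite /= /picard_map opprD addrACA subrr add0r.
  apply: path_integral_dist => //; first exact: picard_admissible.
  by move=> y y0 yTb; rewrite distrC; exact: vP.
rewrite -(subrK (picard n.+1 t) (v t)) -addrA.
apply: le_trans (_ : t `^ rho * (`|v t - picard n.+1 t| + `|picard n.+1 t - picard_map v t|) <= _).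
  by rewrite ler_wpM2l ?powR_ge0// ler_normD.
rewrite mulrDr; move: h1 h2 ne q0; rewrite exprS.
move: (t `^ rho * _) (t `^ rho * _) (4^-1 ^+ n) => z1 z2 z3; lra.
Qed.

Definition abstract_mild_solution (u : R -> H) : Prop :=
  [/\ {within `[0, Tb], continuous u}, u 0 = phi &
   exists v : R -> W,
   [/\ forall t, 0 < t <= Tb -> iota (v t) = u t,
       {within `]0, Tb], continuous v},
       forall t, 0 < t <= Tb -> t `^ rho * `|v t| < 2 * kappa &
       forall t, 0 <= t <= Tb ->
         bochner_integral leb `]0, t[%classic
           (fun tau => U t tau (J (v tau))) (u t - U t 0 phi) /\
         exists (f : R -> W) (w : W),
         [/\ forall tau, 0 < tau < t -> iota (f tau) = U t tau (J (v tau)),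
             iota w = u t - U t 0 phi &
             bochner_integral leb `]0, t[%classic f w]]].

(** The path in [W] carries no value at 0, so [phi] is put in by hand. Continuity at 0 comes from
    |u(t) - U(t,0) phi| = O(t^(a-rho)) in [H], where the contraction property of [U] replaces the
    singular smoothing kernel. *)
Lemma abstract_mild_exists : exists u, abstract_mild_solution u.
Proof.
have [v [av vE]] := fixed_path_exists.
pose u t := if t == 0 then phi else iota (v t).
have uE t : 0 < t -> u t = iota (v t) by move=> t0; rewrite /u gt_eqF.
have iotaI t : 0 < t -> t <= Tb -> iota (path_integral v t) = u t - U t 0 phi.
  move=> t0 tTb; rewrite uE// (vE t t0 tTb) /picard_map iotaD V_iota ?(le_trans tTb)//.
  by rewrite addrAC subrr add0r.
have HB t : 0 < t -> t <= Tb -> bochner_integral leb `]0, t[%classic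
    (fun tau => U t tau (J (v tau))) (u t - U t 0 phi).
  move=> t0 tTb; rewrite -iotaI//; have tT := le_trans tTb TbT.
  have mD : measurable (`]0, t[%classic : set (measurableTypeR R)) by exact: measurable_itv.
  have m1 : norm_measurable (T := measurableTypeR R) `]0, t[%classic (fun tau => V t tau (J (v tau))).
    by apply: norm_measurable_continuous => //; exact: integrand_continuous.
  apply: eq_bochner (bochner_linear iotaD iotaZ c0_gt0 iota_le mD m1 (path_integralP av t0 tTb)).
  by move=> x; rewrite /= in_itv/= => /andP[x0 xt]; rewrite V_iota// ltW.
have ar0 : 0 < a - rho by rewrite subr_gt0.
pose B := Lam * (2 * kappa); have B0 : 0 <= B by rewrite mulr_ge0// mulr_ge0// ltW.
have Iu t : 0 < t -> t <= Tb -> `|u t - U t 0 phi| <= B * (t `^ (a - rho) / (a - rho)).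
  move=> t0 tTb; have tT := le_trans tTb TbT.
  pose Dt : set (measurableTypeR R) := `]0, t[%classic.
  have mD : measurable Dt by exact: measurable_itv.
  have Dfin : (leb Dt < +oo)%E by rewrite lebesgue_measure_itv/=; case: ifP; rewrite ?ltry// -EFinB ltry.
  have m1 : norm_measurable (T := measurableTypeR R) Dt (fun tau => U t tau (J (v tau))).
    apply: norm_measurable_continuous => //.
    have /within_continuous_dist c := integrand_continuous av t0 tTb.
    apply/within_continuous_dist => x xD e e0.
    have [dd dd0 hd] := c x xD (e / c0) (divr_gt0 e0 c0_gt0).
    exists dd => // y yD xy; have := hd y yD xy.
    move: xD yD; rewrite /Dt /= !in_itv/= => /andP[x0 xt] /andP[y0 yt].
    rewrite -!V_iota ?(ltW x0) ?(ltW y0)// -iotaB => h.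
    by apply: le_lt_trans (iota_le _) _; rewrite mulrC -ltr_pdivlMr.
  have mg : measurable_fun Dt (fun tau => (B%:E * (tau `^ (a - rho - 1))%:E)%E).
    apply: emeasurable_funM => //; apply/measurable_EFinP.
    by apply: (measurable_funS measurableT) => //; exact: measurable_powR.
  have K := bochner_norm_le mD Dfin m1 mg _ (HB t t0 tTb).
  rewrite -lee_fin; apply: le_trans (K _) _.
    move=> x; rewrite /Dt/= in_itv/= => /andP[x0 xt]; rewrite -EFinM lee_fin.
    apply: le_trans (evo_contraction evo _ (ltW x0) (ltW xt) tT) _.
    by apply: J_path_bound => //; exact: le_trans (ltW xt) tTb.
  rewrite ge0_integralZl_EFin//; last 2 first.
  - by move=> x _; rewrite lee_fin powR_ge0.
  - apply/measurable_EFinP.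
    by apply: (measurable_funS measurableT) => //; exact: measurable_powR.
  rewrite [leRHS]EFinM; apply: lee_wpmul2l; first by rewrite lee_fin.
  exact: integral_powR_le.
exists u; split; last first.
- exists v; split.
  + by move=> t /andP[t0 tTb]; rewrite uE.
  + by case: av.
  + by move=> t /andP[t0 tTb]; rewrite vE//; exact: picard_map_lt.
  (* At t = 0 the interval of integration is empty and both integrals are 0. *)
  + move=> t /andP[]; rewrite le_eqVlt => /predU1P[<- _|t0 tTb].
      have D0 : `]0, (0:R)[%classic = set0 :> set (measurableTypeR R).
        by apply/seteqP; split => x //=; rewrite in_itv/= => /andP[x0 /(lt_trans x0)]; rewrite ltxx.
      have z : u 0 - U 0 0 phi = 0.
        by rewrite (evo_id evo) ?lexx ?(le_trans (ltW Tb0))// /u eqxx subrr.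
      rewrite z D0; split; first exact: bochner_set0.
      exists (fun=> 0), 0; split; [|by rewrite -(scale0r 0) iotaZ scale0r|exact: bochner_set0].
      by move=> tau /andP[t1 /(lt_trans t1)]; rewrite ltxx.
    split; first exact: HB.
    exists (fun tau => V t tau (J (v tau))), (path_integral v t); split.
    * by move=> tau /andP[t1 t2]; rewrite V_iota ?(ltW t1)// (le_trans tTb).
    * exact: iotaI.
    * exact: path_integralP.
- by rewrite /u eqxx.
have /within_continuous_dist cv := av.1.
have /within_continuous_dist cU := @evo_within_continuous _ _ _ _ _ _ evo 0 phi (lexx 0).
apply/within_continuous_dist => t; rewrite /= in_itv/= => /andP[] + tTb e e0.
rewrite le_eqVlt => /predU1P[<-|t0].
  have [|d1 d10 h1] := cU 0 _ (e / 2) (divr_gt0 e0 (ltr0n _ 2)).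
    by rewrite /= in_itv/= lexx (le_trans (ltW Tb0)).
  pose z := e / 2 / (B + 1) * (a - rho).
  have z0 : 0 < z by rewrite mulr_gt0// !divr_gt0// ltr_wpDl.
  exists (Num.min d1 (z `^ (a - rho)^-1)); first by rewrite lt_min d10 powR_gt0.
  move=> y; rewrite /= in_itv/= => /andP[y0 yTb]; rewrite lt_min => /andP[k1 k2].
  move: y0; rewrite le_eqVlt => /predU1P[<-|y0]; first by rewrite subrr normr0.
  have h2 : `|phi - U y 0 phi| < e / 2.
    have := h1 y; rewrite (evo_id evo) ?lexx ?(le_trans (ltW Tb0))//; apply => //.
    by rewrite /= in_itv/= ltW// (le_trans yTb).
  have h3 : `|u y - U y 0 phi| < e / 2.
    apply: le_lt_trans (Iu y y0 yTb) _.
    have yz : y `^ (a - rho) < z.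
      rewrite sub0r normrN gtr0_norm// in k2.
      rewrite -[ltRHS](powRr1 (ltW z0)) -(mulVf (lt0r_neq0 ar0)) powRrM.
      by rewrite gt0_ltr_powR ?nnegrE ?powR_ge0 ?(ltW y0).
    apply: (@le_lt_trans _ _ ((B + 1) * (y `^ (a - rho) / (a - rho)))).
      by rewrite ler_wpM2r ?divr_ge0 ?powR_ge0 ?(ltW ar0)// lerDl.
    by rewrite mulrC -ltr_pdivlMr ?ltr_wpDl// ltr_pdivrMr.
  have -> : u 0 - u y = (phi - U y 0 phi) - (u y - U y 0 phi).
    by rewrite /u eqxx opprB addrA subrK.
  by apply: le_lt_trans (ler_normB _ _) _; rewrite [e]splitr ltrD.
have tD : `]0, Tb]%classic t by rewrite /= in_itv/= t0.
have [d d0 hd] := cv t tD (e / c0) (divr_gt0 e0 c0_gt0).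
exists (Num.min d t); first by rewrite lt_min d0.
move=> y; rewrite /= in_itv/= => /andP[_ yTb]; rewrite lt_min => /andP[k1 k2].
have y0 : 0 < y by move: k2; rewrite ltr_norml => /andP[]; lra.
rewrite !uE// -iotaB; apply: le_lt_trans (iota_le _) _; rewrite mulrC -ltr_pdivlMr//.
by apply: hd => //; rewrite /= in_itv/= y0.
Qed.

(** The bound required of solutions makes both of them admissible paths, at weighted distance at
    most 4 kappa, and each use of the contraction divides this by 4. Injectivity of [iota]
    identifies the integral in [W] with v(t) - V(t,0) phi. *)
Lemma abstract_mild_unique u1 u2 : abstract_mild_solution u1 -> abstract_mild_solution u2 ->
  forall t, 0 <= t <= Tb -> u1 t = u2 t.
Proof.
have main u : abstract_mild_solution u -> exists v, [/\ admissible_path v,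
    u 0 = phi, forall t, 0 < t <= Tb -> u t = iota (v t) &
    forall t, 0 < t -> t <= Tb ->
      bochner_integral leb `]0, t[%classic (fun tau => V t tau (J (v tau))) (v t - V t 0 phi)].
  move=> [_ u0 [v [vu cv vlt B]]]; exists v; split => //.
  - by split => // t t0 tTb; rewrite powRN ler_pdivlMr ?powR_gt0// mulrC ltW// vlt// t0 tTb.
  - by move=> t tb; rewrite vu.
  move=> t t0 tTb; have [|_ [f [w [fE wE]]]] := B t; first by rewrite ltW.
  have tT := le_trans tTb TbT.
  have -> : v t - V t 0 phi = w.
    by apply: iota_inj; rewrite iotaB V_iota// wE vu// t0 tTb.
  apply: eq_bochner => x; rewrite /= in_itv/= => /andP[x0 xt]; apply: iota_inj.
  by rewrite fE ?x0// V_iota// ltW.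
move=> /main[v1 [av1 u10 u1E B1]] /main[v2 [av2 u20 u2E B2]].
have step n t : 0 < t -> t <= Tb -> t `^ rho * `|v1 t - v2 t| <= 4 * kappa * 4^-1 ^+ n.
  elim: n t => [|n IH] t t0 tTb.
    have h1 := av1.2 t t0 tTb; have h2 := av2.2 t t0 tTb.
    rewrite powRN !ler_pdivlMr ?powR_gt0// in h1 h2.
    rewrite expr0 mulr1; apply: le_trans (_ : t `^ rho * (`|v1 t| + `|v2 t|) <= _).
      by rewrite ler_wpM2l ?powR_ge0// ler_normB.
    by rewrite mulrC mulrDl; lra.
  have -> : v1 t - v2 t = (v1 t - V t 0 phi) - (v2 t - V t 0 phi) by rewrite opprB addrA subrK.
  rewrite exprS mulrA mulrAC; apply: (path_contraction av1 av2 _ IH t0 tTb (B1 t t0 tTb) (B2 t t0 tTb)).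
  by rewrite !mulr_ge0 ?exprn_ge0// ltW.
move=> t /andP[]; rewrite le_eqVlt => /predU1P[<- _|t0 tTb]; first by rewrite u10 u20.
rewrite u1E ?t0 ?tTb// u2E ?t0 ?tTb//; congr iota.
have p0 : 0 < t `^ rho by rewrite powR_gt0.
apply/eqP; rewrite -subr_eq0 -normr_le0 -(ler_pM2l p0) mulr0.
apply/ler_addgt0Pl => e e0; rewrite addr0; have [n ne] := quarter_small e0.
exact: le_trans (step n t t0 tTb) (ltW ne).
Qed.

End picard.
End mild_fixed_point.

(** * Passage to the concrete spaces and choice of the constants *)

Section embedding.
Context dsp (X : measurableType dsp) (R : realType).
Variable m : {measure set X -> \bar R}.
Hypothesis m_fin : (m setT < +oo)%E.
Variables (p : R) (p1 : 1 < p).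

Let p2 : 2 <= 2 * p. Proof. by rewrite ler_peMr// ltW. Qed.

(** With s the norm of v in L^2p, y^2 <= s^2 + s^(2-2p) y^(2p) integrates to (m(X) + 1) s^2; hence c
    is the root of m(X) + 1. The negative power of s excludes v = 0. *)
Lemma L2p_embedding : exists c, 0 < c /\ forall v : L2p m p1, exists w : L2 m,
  {ae m, forall x, w x = v x} /\ `|w| <= c * `|v|.
Proof.
pose c := Num.sqrt (fine (m setT) + 1).
have mT0 : 0 <= fine (m setT) by rewrite fine_ge0.
have c0 : 0 < c by rewrite sqrtr_gt0 ltr_wpDl.
exists c; split => // v.
have [v0|vn0] := eqVneq v 0.
  exists 0; rewrite normr0 (mulr_ge0 (ltW c0))//; split => //.
  have h1 := Lq_scale 0 (0 : L2 m); have h2 := Lq_scale 0 (0 : L2p m p1).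
  rewrite !scale0r in h1 h2; rewrite v0.
  by apply: filterS2 h1 h2 => x -> ->; rewrite !mul0r.
pose s := `|v|; have s0 : 0 < s by rewrite normr_gt0.
have mv : measurable_fun setT v by exact: Lq_measurable.
have mp : measurable_fun setT (fun x => (`|v x| `^ (2 * p))%:E).
  apply/measurable_EFinP; apply: (measurableT_comp (measurable_powR _)).
  exact: measurableT_comp.
have ptw (y : R) : 0 <= y -> y ^+ 2 <= s ^+ 2 + s `^ (2 - 2 * p) * y `^ (2 * p).
  move=> y0; have [ys|/ltW sy] := leP y s.
    by rewrite -[leLHS]addr0 lerD ?mulr_ge0 ?powR_ge0// lerXn2r ?nnegrE// ltW.
  have y0' := lt_le_trans s0 sy.
  rewrite -[leLHS]add0r lerD ?sqr_ge0//.
  rewrite -powR_mulrn// -[X in y `^ X](subrK (2 * p)) powRD ?(gt_eqF y0') ?implybT//.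
  rewrite ler_wpM2r ?powR_ge0// -(opprB (2 * p)) !powRN lef_pV2 ?posrE ?powR_gt0//.
  by rewrite ge0_ler_powR ?nnegrE ?subr_ge0 ?(ltW s0).
have I2 : (\int[m]_x (`|v x| `^ 2)%:E <= ((c * s) ^+ 2)%:E)%E.
  apply: (@le_trans _ _ (\int[m]_x ((s ^+ 2)%:E + (s `^ (2 - 2 * p))%:E * (`|v x| `^ (2 * p))%:E))%E).
    apply: ge0_le_integral_nm => x _; first by rewrite lee_fin powR_ge0.
    by rewrite -EFinM -EFinD lee_fin powR_mulrn//; exact: ptw.
  rewrite ge0_integralD//; last 3 first.
  - by move=> x _; rewrite lee_fin sqr_ge0.
  - by move=> x _; rewrite mule_ge0// lee_fin powR_ge0.
  - exact: emeasurable_funM.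
  rewrite ge0_integralZl_EFin ?powR_ge0//.
  rewrite integral_cst// -(@Lq_powE _ _ _ m _ (lee1_2p p1)) -/s -(fineK (_ : m setT \is a fin_num)); last first.
    by rewrite ge0_fin_numE.
  rewrite -!EFinM -EFinD lee_fin exprMn sqr_sqrtr ?addr_ge0// -powRD; last by rewrite (gt_eqF s0) implybT.
  by rewrite subrK powR_mulrn ?(ltW s0)// mulrDl mul1r mulrC.
have [w wE] := Lq_exists (lee12 R) mv (le_lt_trans I2 (ltry _)).
have wE' : {ae m, forall x, w x = v x} by apply: filterS wE => x; exact.
exists w; split => //; apply: (Lq_norm_pow_le (p1 := lee12 R)); first by rewrite mulr_ge0// ltW.
rewrite -Lq_powE (Lq_pow_ae mv wE'); apply: le_trans I2 _; rewrite lee_fin.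
by rewrite powR_mulrn// mulr_ge0// ltW.
Qed.

End embedding.

Lemma bounded_lebesgue_fin (R : realType) (N : nat) (O : set (RN R N)) : bounded_set O ->
  measurable O -> (lebesgue_RN R N O < +oo)%E.
Proof.
move=> [M [_ HM]] mO; have h y : O y -> `|y| <= M + 1 by apply: HM; rewrite ltrDl.
apply: le_lt_trans (lebesgue_eball_fin (0 : RN R N) (N%:R * (M + 1) + 1)).
apply: le_measure; rewrite ?inE//; first exact: measurable_eball.
move=> y /h yM; rewrite /eball/=; apply: le_lt_trans (edist_le_sum _ _) _.
apply: (@le_lt_trans _ _ (\sum_(j < N) (M + 1))).
  apply: ler_sum => j _; rewrite mxE sub0r normrN; apply: le_trans yM.
  rewrite /Num.norm/= mx_normrE; exact: (le_bigmax _ (fun ij => `|y ij.1 ij.2|) (ord0, j)).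
by rewrite sumr_const card_ord -[X in X < _]mulr_natl ltrDl.
Qed.

(** The strict inequality leaves room for a bound k' < k valid on a whole right neighbourhood of 0;
    the Picard iteration works with k'. *)
Lemma limf_esup_right_lt (R : realType) (g : R -> \bar R) (k : R) :
  (limf_esup g 0^'+ < k%:E)%E ->
  exists2 k', k' < k & exists2 t1, 0 < t1 & forall t, 0 < t -> t < t1 -> (g t <= k'%:E)%E.
Proof.
rewrite limf_esupE => /ereal_inf_lt[_ [V V0 <-]] sk.
have [k' k'k sk'] : exists2 k', k' < k & (ereal_sup (g @` V) <= k'%:E)%E.
  case: (ereal_sup _) sk => [r|//|_]; first by rewrite lte_fin => rk; exists r.
  by exists (k - 1); rewrite ?leNye// ltrBlDr ltrDl.
exists k' => //; have [t1 /= t10 Vt] := V0; exists t1 => // t t0 tt1.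
apply: le_trans sk'; apply: ereal_sup_ubound; exists t => //; apply: Vt => //=.
by rewrite sub0r normrN gtr0_norm.
Qed.

(* Below time [T1] the radius [2 kappa tau^-rho] is in the range of the growth
   condition on [l]. *)
Lemma smallness_constants (R : realType) (a rho B : R) (l : R -> R) : 0 < rho -> a < 1 -> 0 < B ->
  (exists M, \forall r \near +oo, `|l r| <= M * r `^ ((1 - a) / rho)) ->
  exists kappa0, 0 < kappa0 /\ forall kappa, 0 < kappa < kappa0 ->
  exists Lam T1, [/\ 0 <= Lam, B * Lam <= 4^-1, 0 < T1 &
    forall tau, 0 < tau -> tau <= T1 ->
      l (2 * kappa * tau `^ (- rho)) <= Lam * tau `^ (a - 1)].
Proof.
move=> rho0 a1 B0 [M [r1 [_ Hr]]]; set q := (1 - a) / rho in Hr *.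
have q0 : 0 < q by rewrite divr_gt0// subr_gt0.
pose M1 := `|M| + 1; have M10 : 0 < M1 by rewrite ltr_wpDl.
have BM : 0 < B * M1 * 4 by rewrite !mulr_gt0.
(* Below this threshold B M1 (2 kappa)^q <= 1/4; it depends on the growth of [l] but not on the
   initial value. *)
exists ((B * M1 * 4)^-1 `^ q^-1 / 2); split; first by rewrite divr_gt0// powR_gt0// invr_gt0.
move=> k /andP[k0]; rewrite ltr_pdivlMr// mulrC => kk.
have k20 : 0 < 2 * k by rewrite mulr_gt0.
have kq : (2 * k) `^ q <= (B * M1 * 4)^-1.
  have := ltW kk => /(ge0_ler_powR (ltW q0)).
  by rewrite !nnegrE powR_ge0 (ltW k20) -powRrM mulVf ?gt_eqF// powRr1 ?invr_ge0 ?(ltW BM)//; apply.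
pose T1 := (k / (`|r1| + 1)) `^ rho^-1.
have r11 : 0 < `|r1| + 1 by rewrite ltr_wpDl.
(* Since rho q = 1 - a, the growth bound at radius 2 kappa tau^-rho is (2 kappa)^q tau^(a-1) times a
   constant: the growth exponent assumed of [l] produces exactly the singularity that the kernel
   tolerates. *)
exists (M1 * (2 * k) `^ q), T1; split.
- by rewrite mulr_ge0 ?powR_ge0// ltW.
- rewrite mulrA; apply: le_trans (ler_wpM2l _ kq) _; first by rewrite mulr_ge0 ?ltW.
  by rewrite invfM mulrA mulfV ?mul1r// gt_eqF// mulr_gt0.
- by rewrite powR_gt0// divr_gt0.
move=> tau tau0 tauT; have tp : 0 < tau `^ rho by rewrite powR_gt0.
have tk : tau `^ rho * (`|r1| + 1) <= k.
  have T1r : T1 `^ rho = k / (`|r1| + 1).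
    by rewrite -powRrM mulVf ?gt_eqF// powRr1// divr_ge0 ?ltW.
  rewrite -ler_pdivlMr// -T1r; apply: ge0_ler_powR => //; rewrite ?nnegrE ?powR_ge0 ?ltW//.
have big : r1 < 2 * k * tau `^ (- rho).
  rewrite powRN ltr_pdivlMr//; apply: le_lt_trans (ler_norm _) _; rewrite normrM (gtr0_norm tp).
  apply: (@lt_le_trans _ _ (tau `^ rho * (`|r1| + 1))); first by rewrite mulrC ltr_pM2l// ltrDl.
  by apply: le_trans tk _; rewrite ler_peMl ?ltW// ltr1n.
apply: le_trans (ler_norm _) _; apply: le_trans (Hr _ big) _.
rewrite powRM ?powR_ge0 ?(ltW k20)// -powRrM (_ : - rho * q = a - 1); last first.
  by rewrite /q mulrCA mulNr divff ?gt_eqF// mulrN1 opprB.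
rewrite mulrA ler_wpM2r ?powR_ge0// ler_wpM2r ?powR_ge0//.
by rewrite /M1; apply: le_trans (ler_norm _) _; rewrite lerDl.
Qed.

Section mild_transfer.
Context dsp (X : measurableType dsp) (R : realType).
Variable m : {measure set X -> \bar R}.
Variables (p : R) (p1 : 1 < p).

(** The smallness condition on the initial value uses the extended norm of an L^2 representative;
    this turns it into a bound for the corresponding element of L^2p. *)
Lemma Lnorm_scale_ae (w : L2p m p1) (g : L2 m) (c : R) : {ae m, forall x, w x = g x} ->
  ('N[m]_((2 * p)%:E)[(fun x => (c * g x)%:E)] = (`|c| * `|w|)%:E)%E.
Proof.
move=> wg; rewrite -normrZ Lq_normE.
have mcg : measurable_fun setT (fun x => c * g x).
  by apply: measurable_funM => //; exact: Lq_measurable.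
pose h : {mfun X >-> R} := HB.pack_for {mfun X >-> R} (fun x => c * g x) (isMeasurableFun.Build _ _ _ _ _ mcg).
pose h' : {mfun X >-> R} := repr (c *: w).
apply: (@ae_eq_Lnorm _ _ _ _ _ (lee1_2p p1) h h').
by have := Lq_scale c w; apply: filterS2 wg => x wgx cwx _; rewrite /h /h'/= -wgx -cwx.
Qed.

Variables (U : R -> R -> L2 m -> L2 m) (iota : L2p m p1 -> L2 m).
Hypothesis iotaE : forall v : L2p m p1, {ae m, forall x, iota v x = v x}.

Lemma embedding_eqP (v : L2p m p1) (u : L2 m) :
  iota v = u <-> (v : X -> R) = u %[ae m].
Proof.
rewrite -Lq_eqP; split => h; apply: filterS2 h (iotaE v) => x h e /h.
  by rewrite -e.
by rewrite e.
Qed.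

Lemma mild_solutionP (J : L2p m p1 -> L2 m) (rho kappa Tb : R) (phi : L2 m) u :
  mild_solution U J rho kappa phi Tb u <-> abstract_mild_solution U iota J rho Tb kappa phi u.
Proof.
have nE (v : L2p m p1) (t : R) : 0 < t -> `|t `^ rho *: v| = t `^ rho * `|v|.
  by move=> t0; rewrite normrZ ger0_norm ?powR_ge0.
split=> -[cu u0 [v [vu cv vlt B]]]; split => //; exists v; split => //.
- by move=> t tt; apply/embedding_eqP; exact: vu.
- by move=> t /andP[t0 tT]; rewrite -nE// vlt// t0.
- move=> t tt; have [B1 [f [w [fE wE B2]]]] := B t tt; split => //; exists f, w; split => //.
    by move=> tau h; apply/embedding_eqP; exact: fE.
  exact/embedding_eqP.
- by move=> t tt; apply/embedding_eqP; exact: vu.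
- by move=> t /andP[t0 tT]; rewrite nE// vlt// t0.
- move=> t tt; have [B1 [f [w [fE wE B2]]]] := B t tt; split => //; exists f, w; split => //.
    by move=> tau h; apply/embedding_eqP; exact: fE.
  exact/embedding_eqP.
Qed.

End mild_transfer.

Theorem theorem5p2 (R : realType) (N : nat)
  (Omega : set (RN R N)) (oOmega : open Omega) (eps delta : R)
  (eps_gt0 : 0 < eps) (delta_gt0 : 0 < delta)
  (Omega_bounded : bounded_set Omega)
  (Omega_eps_delta : eps_delta_domain eps delta Omega)
  (mu : {finite_measure set (RN R N) -> \bar R}) (d : R)
  (d_range : 0 < d <= N%:R)
  (boundary_d_set : d_set mu (boundary Omega) d)
  (Omega_ : nat -> set (RN R N))
  (Omega_union : Omega = \bigcup_n Omega_ n)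
  (Omega_incr : forall n, Omega_ n `<=` Omega_ n.+1)
  (Omega_bnd : forall n, bounded_set (Omega_ n))
  (Omega_lip : forall n, lipschitz_domain (Omega_ n))
  (s T : R) (s_range : 0 < s < 1) (s_range2 : N%:R - d < 2 * s < N%:R)
  (T_gt0 : 0 < T)
  (eta k1 k2 zeta1 zeta2 b0 c C : R) (eta_range : 2^-1 < eta < 1)
  (k12 : 0 < k1 < k2) (zeta12 : 0 < zeta1 < zeta2) (b0_gt0 : 0 < b0)
  (K : R -> RN R N -> RN R N -> R) (zeta : R -> RN R N -> RN R N -> R)
  (b : R -> RN R N -> R)
  (K_adm : admissible_kernel (lebesgue_RN R N) Omega T k1 k2 C eta K)
  (zeta_adm : admissible_kernel mu (boundary Omega) T zeta1 zeta2 C eta zeta)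
  (b_adm : admissible_coefficient mu (boundary Omega) T b0 c eta b)
  (D : R -> set (L2 (m_Omega oOmega mu)))
  (A : R -> L2 (m_Omega oOmega mu) -> L2 (m_Omega oOmega mu))
  (A_generator : forall t, 0 <= t <= T ->
     form_generator Omega s (energy Omega mu s d K b zeta t) (D t) (A t))
  (U : R -> R -> L2 (m_Omega oOmega mu) -> L2 (m_Omega oOmega mu))
  (U_evolution : evolution_family T D A U)
  (p : R) (p_gt1 : 1 < p)
  (J : L2p (m_Omega oOmega mu) p_gt1 -> L2 (m_Omega oOmega mu))
  (J0 : J 0 = 0) (l : R -> R)
  (J_lipschitz : forall r u v, 0 < r -> `|u| <= r -> `|v| <= r ->
     `|J u - J v| <= l r * `|u - v|)
  (a_lt1 : a_exp N s d p < 1)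
  (rho : R) (rho_range : 0 < rho < a_exp N s d p)
  (l_growth : exists M, \forall r \near +oo,
     `|l r| <= M * r `^ ((1 - a_exp N s d p) / rho)) :
  exists kappa0, 0 < kappa0 /\
  forall kappa, 0 < kappa < kappa0 ->
  forall phi : L2 (m_Omega oOmega mu),
  (limf_esup (fun t => 'N[m_Omega oOmega mu]_((2 * p)%:E)[
     (fun x => (t `^ rho * U t 0 phi x)%:E)]) 0^'+ < kappa%:E)%E ->
  exists Tb, 0 < Tb <= T /\
    (exists u, mild_solution U J rho kappa phi Tb u) /\
    (forall u1 u2, mild_solution U J rho kappa phi Tb u1 ->
       mild_solution U J rho kappa phi Tb u2 ->
       forall t, 0 <= t <= Tb -> u1 t = u2 t).
Proof.
set m := m_Omega oOmega mu.
have /andP[d0 dN] := d_range; have /andP[rho0 rhoa] := rho_range.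
have /andP[dsN sN] := s_range2; have /andP[p10 _] := k12; have /andP[z10 _] := zeta12.
have eta0 : 0 < eta by have /andP[h _] := eta_range; apply: lt_trans h; rewrite invr_gt0.
have N0 : (0 < N)%N by rewrite -(ltr_nat R); exact: lt_le_trans d0 dN.
have m_fin : (m setT < +oo)%E.
  rewrite /m m_OmegaE lte_add_pinfty//; last first.
    by rewrite -ge0_fin_numE//; exact: fin_num_measure (measurableI _ _ measurableT (measurable_boundary _)).
  by rewrite setTI; apply: bounded_lebesgue_fin => //; exact: open_measurable_RN.
have [h0 [h00 dissipative]] := form_dissipative N0 eps_gt0 delta_gt0 Omega_eps_delta boundary_d_set
  s_range dN (ltW sN) dsN T_gt0 eta0 p10 z10 b0_gt0 K_adm zeta_adm b_adm
  A_generator.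
(* Two exponents must be kept apart: [a] is the Nash exponent lambda/2, while the smoothing exponent
   (a/2)(1 - 1/p) is [a_exp]. *)
set a := lambda N s d / 2 in dissipative.
have a0 : 0 <= a.
  by rewrite /a /lambda !divr_ge0// ?mulr_ge0// ltW//; lra.
have aE : a / 2 * (1 - 1 / p) = a_exp N s d p.
  by rewrite /a /a_exp; field; rewrite gt_eqF// (lt_trans ltr01).
set ae := a_exp N s d p in a_lt1 rho_range rhoa l_growth aE *.
have ae0 := lt_trans rho0 rhoa.
have [M [M0 smoothing]] := ultracontractive T_gt0 U_evolution a0 h00 dissipative p_gt1.
(* Choice turns the smoothing estimate into one operator with values in L^2p; outside the range of
   times its value is 0. *)
have [V VP] : exists V : R -> R -> L2 m -> L2p m p_gt1, forall t tau f,
    0 <= tau -> tau < t -> t <= T -> {ae m, forall x, V t tau f x = U t tau f x} /\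
    `|V t tau f| <= M * (t - tau) `^ (- ae) * `|f|.
  have : forall z : R * R * L2 m, exists w : L2p m p_gt1,
      0 <= z.1.2 -> z.1.2 < z.1.1 -> z.1.1 <= T ->
      {ae m, forall x, w x = U z.1.1 z.1.2 z.2 x} /\
      `|w| <= M * (z.1.1 - z.1.2) `^ (- ae) * `|z.2|.
    move=> [[t tau] f] /=.
    have [[[h1 h2] h3]|nh] := pselect ((0 <= tau /\ tau < t) /\ t <= T).
      by have [w wP] := smoothing tau t f h1 h2 h3; exists w; rewrite -aE.
    by exists 0 => h1 h2 h3; exfalso; apply: nh.
  by move=> /choice[V VP]; exists (fun t tau f => V (t, tau, f)) => t tau f; exact: VP (t, tau, f).
have [c0 [c00 /choice[iota iotaP]]] := @L2p_embedding _ _ _ _ m_fin _ p_gt1.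
have iotaE v : {ae m, forall x, iota v x = v x} by have [] := iotaP v.
have iotaD (u v : L2p m p_gt1) : iota (u + v) = iota u + iota v.
  apply/Lq_eqP; have h1 := Lq_add u v; have h2 := Lq_add (iota u) (iota v).
  have h3 := iotaE u; have h4 := iotaE v; have h5 := iotaE (u + v).
  have h34 : {ae m, forall x, iota u x + iota v x = u x + v x} by apply: filterS2 h3 h4 => x -> ->.
  have h25 : {ae m, forall x, (iota u + iota v : L2 m) x = u x + v x}.
    by apply: filterS2 h2 h34 => x -> ->.
  have h15 : {ae m, forall x, iota (u + v) x = u x + v x} by apply: filterS2 h1 h5 => x <- ->.
  by apply: filterS2 h15 h25 => x -> ->.
have iotaZ (c1 : R) (u : L2p m p_gt1) : iota (c1 *: u) = c1 *: iota u.
  apply/Lq_eqP; have h1 := Lq_scale c1 u; have h2 := Lq_scale c1 (iota u).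
  have h3 := iotaE u; have h4 := iotaE (c1 *: u).
  have h14 : {ae m, forall x, iota (c1 *: u) x = c1 * u x} by apply: filterS2 h1 h4 => x <- ->.
  have h23 : {ae m, forall x, (c1 *: iota u : L2 m) x = c1 * u x}.
    by apply: filterS2 h2 h3 => x -> ->.
  by apply: filterS2 h14 h23 => x -> ->.
have iota_inj : injective iota.
  move=> u v uv; apply/Lq_eqP; have h3 := iotaE u; have h4 := iotaE v; rewrite uv in h3.
  by apply: filterS2 h3 h4 => x -> ->.
have iota_le v : `|iota v| <= c0 * `|v| by have [] := iotaP v.
have V_iota t tau f : 0 <= tau -> tau < t -> t <= T -> iota (V t tau f) = U t tau f.
  move=> h1 h2 h3; apply/(embedding_eqP iotaE); have [h _] := VP t tau f h1 h2 h3.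
  by apply: filterS h => x ->.
have V_le t tau f : 0 <= tau -> tau < t -> t <= T ->
    `|V t tau f| <= M * (t - tau) `^ (- ae) * `|f|.
  by move=> h1 h2 h3; have [] := VP t tau f h1 h2 h3.
have V_cont t tau f (e : R) : 0 <= tau -> tau < t -> t <= T -> 0 < e ->
    exists2 d, 0 < d & forall t', tau < t' -> t' <= T -> `|t - t'| < d ->
      `|V t tau f - V t' tau f| < e.
  move=> h1 h2 h3 e0.
  have [r r0 Hr] := orbit_L2p_continuous T_gt0 U_evolution a0 h00 dissipative p_gt1 f h1 h2 h3 e0.
  exists r => // t' h4 h5 tt'; apply: (Hr t') => //.
    by have [] := VP t tau f h1 h2 h3.
  by have [] := VP t' tau f h1 h4 h5.
have W_complete : seq_complete (L2p m p_gt1) by exact: Lq_complete.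
pose be := beta_cst ae (ae - rho).
have be0 : 0 < be.
  by rewrite /be /beta_cst addr_gt0// divr_gt0 ?powR_gt0 ?subr_gt0.
have [kappa0 [kappa00 Hk]] := smallness_constants rho0 a_lt1 (mulr_gt0 M0 be0) l_growth.
exists kappa0; split => // kappa kk phi limsup.
have /andP[k0 _] := kk; have k20 : 0 < 2 * kappa by rewrite mulr_gt0.
have [Lam [T1 [Lam0 Lam_small T10 l_le]]] := Hk kappa kk.
have [k' k'k [t1 t10 phi_lt]] := limf_esup_right_lt limsup.
(* [T1] brings the radii into the range of the growth condition; t1/2 keeps all times up to [Tb]
   strictly inside the neighbourhood where the orbit of [phi] is bounded by [k']. *)
pose Tb := Num.min T (Num.min T1 (t1 / 2)).
have Tb0 : 0 < Tb by rewrite !lt_min T_gt0 T10 divr_gt0.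
have TbT : Tb <= T by rewrite ge_min lexx.
have TbT1 : Tb <= T1 by rewrite !ge_min lexx !orbT.
have Tbt1 : Tb < t1.
  apply: (@le_lt_trans _ _ (t1 / 2)); first by rewrite !ge_min lexx !orbT.
  by rewrite ltr_pdivrMr// ltr_pMr// ltr1n.
have phi_le t : 0 < t -> t <= Tb -> t `^ rho * `|V t 0 phi| <= k'.
  move=> t0 tTb; have := phi_lt t t0 (le_lt_trans tTb Tbt1).
  have [h _] := VP t 0 phi (lexx _) t0 (le_trans tTb TbT).
  by rewrite (Lnorm_scale_ae _ h) lee_fin ger0_norm ?powR_ge0.
have J_weighted tau u v : 0 < tau -> tau <= Tb -> `|u| <= 2 * kappa * tau `^ (- rho) ->
    `|v| <= 2 * kappa * tau `^ (- rho) -> `|J u - J v| <= Lam * tau `^ (ae - 1) * `|u - v|.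
  move=> tau0 tauTb hu hv.
  apply: le_trans (J_lipschitz _ _ _ _ hu hv) _; first by rewrite mulr_gt0// powR_gt0.
  by rewrite ler_wpM2r// l_le// (le_trans tauTb).
have small : M * Lam * beta_cst ae (ae - rho) <= 4^-1 by rewrite mulrAC.
exists Tb; split; first by rewrite Tb0.
split.
  have [u uP] := abstract_mild_exists U_evolution iotaD iotaZ c00 iota_le iota_inj ae0 a_lt1 M0
    V_iota V_le V_cont W_complete J0 rho0 rhoa Tb0 TbT k0 Lam0 J_weighted small k'k phi_le.
  by exists u; apply/(mild_solutionP _ iotaE).
move=> u1 u2 /(mild_solutionP _ iotaE) h1 /(mild_solutionP _ iotaE) h2.
exact: (abstract_mild_unique U_evolution iotaD iotaZ iota_inj ae0 a_lt1 M0 V_iota V_le rho0 rhoa TbT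
  k0 Lam0 J_weighted small h1 h2).
Qed.
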